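(* Let $\Gamma$ be a finite, triangle-free, inseparable simplicial graph and let $X_\Gamma$ be a proper $\mathrm{CAT}(0)$ space on which $W_\Gamma$ acts geometrically. If $\Gamma$ is non-planar and $\partial X_\Gamma$ is locally connected and contains no local cut points, then $\partial X_\Gamma$ is non-planar.
   Context: $W_\Gamma$ is the right-angled Coxeter group of $\Gamma$ (generators the vertices, $s^2=1$, $st=ts$ for adjacent $s,t$). Geometric action: properly discontinuous, cocompact, by isometries. $\partial X$ is the visual boundary with the cone topology. A subgraph is separating if deleting its vertices disconnects the graph. A triangle-free graph is inseparable if it is connected and has no separating vertex, no separating edge, no cut pair (separating pair of non-adjacent vertices), and no separating vertex suspension (a separating set $\{v,s,t\}$ with $s,t$ non-adjacent neighbours of $v$). A point $p$ of a connected space $Z$ is a local cut point if some connected open neighbourhood $U$ of $p$ has $U\setminus\{p\}$ disconnected. Planar means embeddable in $S^2$. *)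

(* Defs.v *)
From Stdlib Require Import Reals List Relations.
Open Scope R_scope.

Definition finite_type (V : Type) : Prop := exists l : list V, forall v, In v l.

Definition finite_simplicial_graph {V : Type} (adj : V -> V -> Prop) : Prop :=
  finite_type V /\ (forall u v, adj u v -> adj v u) /\ (forall v, ~ adj v v).

Definition triangle_free {V : Type} (adj : V -> V -> Prop) : Prop :=
  forall a b c, ~ (adj a b /\ adj b c /\ adj c a).

Definition linked_in {V : Type} (adj : V -> V -> Prop) (P : V -> Prop) : V -> V -> Prop :=
  clos_refl_trans V (fun a b => P a /\ P b /\ adj a b).

Definition connected_in {V : Type} (adj : V -> V -> Prop) (P : V -> Prop) : Prop :=
  forall u w, P u -> P w -> linked_in adj P u w.

Definition graph_connected {V : Type} (adj : V -> V -> Prop) : Prop :=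
  connected_in adj (fun _ => True).

Definition separating {V : Type} (adj : V -> V -> Prop) (S : V -> Prop) : Prop :=
  ~ connected_in adj (fun v => ~ S v).

Definition inseparable {V : Type} (adj : V -> V -> Prop) : Prop :=
  graph_connected adj
  /\ (forall v, ~ separating adj (fun x => x = v))
  /\ (forall u v, adj u v -> ~ separating adj (fun x => x = u \/ x = v))
  /\ (forall u v, u <> v -> ~ adj u v -> ~ separating adj (fun x => x = u \/ x = v))
  /\ (forall v s t, adj v s -> adj v t -> s <> t -> ~ adj s t ->
        ~ separating adj (fun x => x = v \/ x = s \/ x = t)).

Definition pt3 : Type := (R * R * R)%type.

Definition dist3 (p q : pt3) : R :=
  let '(p1, p2, p3) := p in let '(q1, q2, q3) := q in
  sqrt ((p1 - q1) ^ 2 + (p2 - q2) ^ 2 + (p3 - q3) ^ 2).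

Definition on_S2 (p : pt3) : Prop :=
  let '(x, y, z) := p in x ^ 2 + y ^ 2 + z ^ 2 = 1.

Definition open3 (W : pt3 -> Prop) : Prop :=
  forall p, W p -> exists e, 0 < e /\ forall q, dist3 p q < e -> W q.

Definition arc_on01 (g : R -> pt3) : Prop :=
  (forall t, 0 <= t <= 1 -> forall e, 0 < e -> exists del, 0 < del /\
      forall t', 0 <= t' <= 1 -> Rabs (t - t') < del -> dist3 (g t) (g t') < e)
  /\ (forall t t', 0 <= t <= 1 -> 0 <= t' <= 1 -> g t = g t' -> t = t').

Definition planar_graph {V : Type} (adj : V -> V -> Prop) : Prop :=
  exists (pos : V -> pt3) (arc : V -> V -> R -> pt3),
    (forall v, on_S2 (pos v))
    /\ (forall u v, pos u = pos v -> u = v)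
    /\ (forall u v, adj u v ->
          arc_on01 (arc u v) /\ arc u v 0 = pos u /\ arc u v 1 = pos v
          /\ (forall t, 0 <= t <= 1 -> on_S2 (arc u v t)))
    /\ (forall u v w t, adj u v -> 0 < t < 1 -> arc u v t <> pos w)
    /\ (forall u v u' v' t t', adj u v -> adj u' v' -> 0 < t < 1 -> 0 < t' < 1 ->
          arc u v t = arc u' v' t' -> (u = u' /\ v = v') \/ (u = v' /\ v = u')).

Definition is_metric {X : Type} (d : X -> X -> R) : Prop :=
  (forall x y, 0 <= d x y) /\ (forall x y, d x y = 0 <-> x = y)
  /\ (forall x y, d x y = d y x) /\ (forall x y z, d x z <= d x y + d y z).

Definition openX {X : Type} (d : X -> X -> R) (U : X -> Prop) : Prop :=
  forall x, U x -> exists e, 0 < e /\ forall y, d x y < e -> U y.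

Definition compactX {X : Type} (d : X -> X -> R) (K : X -> Prop) : Prop :=
  forall (I : Type) (U : I -> X -> Prop), (forall i, openX d (U i)) ->
    (forall x, K x -> exists i, U i x) ->
    exists l : list I, forall x, K x -> exists i, In i l /\ U i x.

Definition proper_metric {X : Type} (d : X -> X -> R) : Prop :=
  forall x r, compactX d (fun y => d x y <= r).

Definition geod {X : Type} (d : X -> X -> R) (c : R -> X) (x y : X) : Prop :=
  c 0 = x /\ c (d x y) = y /\
  forall s t, 0 <= s <= d x y -> 0 <= t <= d x y -> d (c s) (c t) = Rabs (s - t).

Definition geodesic_space {X : Type} (d : X -> X -> R) : Prop :=
  forall x y, exists c, geod d c x y.

Definition dist2 (p q : R * R) : R :=
  sqrt ((fst p - fst q) ^ 2 + (snd p - snd q) ^ 2).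

Definition cmp_pt (P Q : R * R) (D s : R) : R * R :=
  (fst P + s / D * (fst Q - fst P), snd P + s / D * (snd Q - snd P)).

Record side (X : Type) := Side { scurve : R -> X; slen : R; sP : R * R; sQ : R * R }.
Arguments Side {X}.
Arguments scurve {X}.
Arguments slen {X}.
Arguments sP {X}.
Arguments sQ {X}.

Definition cat0_ineq {X : Type} (d : X -> X -> R) : Prop :=
  forall (x y z : X) (c1 c2 c3 : R -> X),
    geod d c1 x y -> geod d c2 y z -> geod d c3 z x ->
    forall PX PY PZ : R * R,
      dist2 PX PY = d x y -> dist2 PY PZ = d y z -> dist2 PZ PX = d z x ->
      let sides := Side c1 (d x y) PX PY :: Side c2 (d y z) PY PZ
                   :: Side c3 (d z x) PZ PX :: nil in
      forall a b s t, In a sides -> In b sides ->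
        0 <= s <= slen a -> 0 <= t <= slen b ->
        d (scurve a s) (scurve b t)
          <= dist2 (cmp_pt (sP a) (sQ a) (slen a) s) (cmp_pt (sP b) (sQ b) (slen b) t).

Definition proper_CAT0 {X : Type} (d : X -> X -> R) : Prop :=
  is_metric d /\ proper_metric d /\ geodesic_space d /\ cat0_ineq d.

(* W_Gamma = words in the vertices modulo s s = 1 and s t = t s (s,t adjacent) *)
Inductive racg_step {V : Type} (adj : V -> V -> Prop) : list V -> list V -> Prop :=
| step_cancel : forall l1 l2 s, racg_step adj (l1 ++ s :: s :: l2) (l1 ++ l2)
| step_comm : forall l1 l2 s t, adj s t ->
    racg_step adj (l1 ++ s :: t :: l2) (l1 ++ t :: s :: l2).

Definition word_eq {V : Type} (adj : V -> V -> Prop) : list V -> list V -> Prop :=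
  clos_refl_sym_trans (list V) (racg_step adj).

Definition act_word {V X : Type} (act : V -> X -> X) (w : list V) (x : X) : X :=
  fold_right (fun s y => act s y) x w.

(* An action of W_Gamma by isometries is determined by the images of the
   generators: involutive isometries, commuting for adjacent vertices. *)
Definition racg_isometric_action {V X : Type} (adj : V -> V -> Prop)
    (d : X -> X -> R) (act : V -> X -> X) : Prop :=
  (forall s x y, d (act s x) (act s y) = d x y)
  /\ (forall s x, act s (act s x) = x)
  /\ (forall s t x, adj s t -> act s (act t x) = act t (act s x)).

(* properly discontinuous (Bridson-Haefliger I.8.2): each x has a ball B(x,r)
   such that only finitely many group elements g have gB(x,r) meeting B(x,r) *)
Definition prop_discontinuous {V X : Type} (adj : V -> V -> Prop)
    (d : X -> X -> R) (act : V -> X -> X) : Prop :=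
  forall x, exists r, 0 < r /\ exists L : list (list V),
    forall w, (exists y, d x y < r /\ d x (act_word act w y) < r) ->
      exists w', In w' L /\ word_eq adj w w'.

Definition cocompact {V X : Type} (d : X -> X -> R) (act : V -> X -> X) : Prop :=
  exists K, compactX d K /\ forall x, exists w y, K y /\ act_word act w y = x.

Definition geometric_racg_action {V X : Type} (adj : V -> V -> Prop)
    (d : X -> X -> R) (act : V -> X -> X) : Prop :=
  racg_isometric_action adj d act /\ prop_discontinuous adj d act /\ cocompact d act.

(* each point of the visual boundary is represented by a unique geodesic ray
   issuing from the base point x0; we normalise rays to be x0 on (-oo,0]. *)
Definition based_ray {X : Type} (d : X -> X -> R) (x0 : X) (c : R -> X) : Prop :=
  (forall t, t <= 0 -> c t = x0)
  /\ (forall s t, 0 <= s -> 0 <= t -> d (c s) (c t) = Rabs (s - t)).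

Definition boundary {X : Type} (d : X -> X -> R) (x0 : X) : Type :=
  { c : R -> X | based_ray d x0 c }.

Definition cone_open {X : Type} (d : X -> X -> R) (x0 : X)
    (A : boundary d x0 -> Prop) : Prop :=
  forall c, A c -> exists r e, 0 < r /\ 0 < e /\
    forall c', d (proj1_sig c r) (proj1_sig c' r) < e -> A c'.

Definition connected_sub {T : Type} (opn : (T -> Prop) -> Prop) (A : T -> Prop) : Prop :=
  ~ exists U W, opn U /\ opn W /\ (forall x, A x -> U x \/ W x)
      /\ (exists x, A x /\ U x) /\ (exists x, A x /\ W x)
      /\ (forall x, A x -> U x -> W x -> False).

Definition locally_connected {T : Type} (opn : (T -> Prop) -> Prop) : Prop :=
  forall x U, opn U -> U x -> exists W, opn W /\ W x /\ (forall y, W y -> U y)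
    /\ connected_sub opn W.

Definition local_cut_point {T : Type} (opn : (T -> Prop) -> Prop) (p : T) : Prop :=
  exists U, opn U /\ U p /\ connected_sub opn U
    /\ ~ connected_sub opn (fun y => U y /\ y <> p).

Definition planar_space {T : Type} (opn : (T -> Prop) -> Prop) : Prop :=
  exists f : T -> pt3,
    (forall x, on_S2 (f x))
    /\ (forall x y, f x = f y -> x = y)
    /\ (forall W, open3 W -> opn (fun x => W (f x)))
    /\ (forall U, opn U -> exists W, open3 W /\ forall x, U x <-> W (f x)).

(* Main.v *)
(* To a set P of elements of W = W_Gamma corresponds the set of boundary points at which the orbit of P
   accumulates. Two commuting reflections have no boundary point in common on their walls, because their common
   centralizer is finite; hence, for every boundary point xi and every g in W, all orbit points near xi lie in
   a single half-space { x | s is a left descent of g^-1 x }. This makes the intersections of limit sets computable.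

   Local connectedness excludes the virtual factor separators of Mihalik and Ruane. Together with inseparability
   this shows that the sets avoiding suitable left descents are coarsely connected, so that their limit sets are
   connected.

   Suppose that the boundary embeds in the sphere. If the complement of the star of some vertex c is disconnected,
   then, for a suitable set T of neighbours of c, three families of connected limit sets, based at the elements of
   W_T, and three half-spaces at infinity of the tree-like group W_T are connected like K_{3,3}, which is impossible.
   Otherwise the limit sets C_s of { x | s is the only left descent of x } and E_st of
   { x | s and t are left descents of x }, for adjacent s and t, are connected and meet exactly as the vertices and
   edges of Gamma do. Approximating them by finite chains of points of the sphere exhibits Gamma as a minor of the
   square grid, hence as a planar graph. *)

Require Import Defs.
From Stdlib Require Import Reals List Relations Bool ZArith Lia Lra Permutation Btauto
  ClassicalEpsilon FunctionalExtensionality PropExtensionality.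
From mathcomp Require filter.
Import ListNotations.

(** * Walks in the square grid *)

(** The limit sets are compact and connected but contain no evident arcs, so plane-graph theory
    cannot be applied to them directly. A connected set is therefore used only through chains of
    points with small steps, and disjointness only through a positive distance. Such finite data
    survive stereographic projection and rounding to the grid. There planarity is combinatorial:
    contracting disjoint trees gives an embedding, and $K_{3,3}$ is excluded by counting crossings
    modulo 2, without the Jordan curve theorem.

    On the group side, two sets whose left descents share no letter, seen from a suitable base
    point, have disjoint limit sets. The freedom to move the base point separates the families that
    form $K_{3,3}$. The finiteness of the centralizer behind this comes from triangle-freeness: an
    element commuting with two adjacent generators has length at most 2. *)

Inductive dir := Rt | Lt | Up | Dn.
Definition move (p : Z * Z) (d : dir) : Z * Z :=
  let (x, y) := p in
  match d with Rt => (x + 1, y)%Z | Lt => (x - 1, y)%Z | Up => (x, y + 1)%Z | Dn => (x, y - 1)%Z end.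

Fixpoint verts (p : Z * Z) (w : list dir) : list (Z * Z) :=
  match w with [] => [p] | d :: w' => p :: verts (move p d) w' end.
Fixpoint walk_end (p : Z * Z) (w : list dir) : Z * Z :=
  match w with [] => p | d :: w' => walk_end (move p d) w' end.

Definition veq (p q : Z * Z) : bool := ((fst p =? fst q) && (snd p =? snd q))%Z.

Definition esum (F : Z * Z -> dir -> bool) : Z * Z -> list dir -> bool :=
  fix go p w := match w with [] => false | d :: w' => xorb (F p d) (go (move p d) w') end.

(* [hL v] tests whether an edge is horizontal with left end [v]; [hR], [vB], [vT] likewise for right ends, bottoms and tops. *)
Definition hL (v p : Z * Z) (d : dir) : bool :=
  match d with Rt => veq v p | Lt => veq v (move p Lt) | _ => false end.
Definition hR (v p : Z * Z) (d : dir) : bool :=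
  match d with Rt => veq v (move p Rt) | Lt => veq v p | _ => false end.
Definition vB (v p : Z * Z) (d : dir) : bool :=
  match d with Up => veq v p | Dn => veq v (move p Dn) | _ => false end.
Definition vT (v p : Z * Z) (d : dir) : bool :=
  match d with Up => veq v (move p Up) | Dn => veq v p | _ => false end.

(* Parity of the crossings of an edge with a second one translated by (eps, eps). *)
Definition cross1 (q : Z * Z) (d' : dir) (p : Z * Z) (d : dir) : bool :=
  match d with
  | Rt => vT p q d' | Lt => vT (move p Lt) q d'
  | Up => hR p q d' | Dn => hR (move p Dn) q d' end.
Definition crossings (p : Z * Z) (w : list dir) (q : Z * Z) (w' : list dir) : bool :=
  esum (fun a d => esum (fun b d' => cross1 b d' a d) q w') p w.

(** Crossing of the edge, translated by (eps, eps), with the horizontal ray from [v] to the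
    right. *)
Definition wind1 (v p : Z * Z) (d : dir) : bool :=
  match d with
  | Up => ((fst v <=? fst p) && (snd v =? snd p + 1))%Z
  | Dn => ((fst v <=? fst p) && (snd v =? snd p))%Z
  | _ => false end.
Definition winding (v p : Z * Z) (w : list dir) : bool := esum (wind1 v) p w.

Definition ray (v u : Z * Z) : bool := ((fst v <=? fst u) && (snd v =? snd u))%Z.
(** Crossing of the edge with the horizontal ray to the left from the translate of [u] by (eps,
    eps). *)
Definition ray1 (u p : Z * Z) (d : dir) : bool :=
  match d with Up => ray p u | Dn => ray (move p Dn) u | _ => false end.
Definition rays (u p : Z * Z) (w : list dir) : bool := esum (ray1 u) p w.

(** Edges leaving [v] to the right or downwards: those crossed by a short path from [v + (eps, eps)]
    to [v - (eps, eps)] around the lower right of [v]. Its companion [kap'] belongs to the path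
    around the upper left. *)
Definition kap (v p : Z * Z) (d : dir) : bool := xorb (hL v p d) (vT v p d).
Definition kap' (v p : Z * Z) (d : dir) : bool := xorb (hR v p d) (vB v p d).

Ltac zbool :=
  repeat match goal with
  | |- context [(?a =? ?b)%Z] => destruct (Z.eqb_spec a b)
  | |- context [(?a <=? ?b)%Z] => destruct (Z.leb_spec a b)
  end; simpl; try reflexivity; exfalso; lia.

(** Prolong the first edge by rays to the right and the translated second edge by rays to the left.
    The two curves go to infinity on different sides, so they cross an even number of times, and the
    rays run at different heights and do not cross each other. *)
Lemma cross1_ray (q p : Z * Z) (d' d : dir) :
  cross1 q d' p d = xorb (xorb (wind1 p q d') (wind1 (move p d) q d'))
                         (xorb (ray1 q p d) (ray1 (move q d') p d)).
Proof. destruct p as [x y], q as [a b], d, d'; cbv [cross1 vT hR hL wind1 ray1 ray veq move fst snd]; zbool. Qed.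

(** Exchanging the roles amounts to moving the second edge from its translate by (eps, eps) to that
    by (-eps, -eps). The parity changes only when an end of one edge passes over the other edge. *)
Lemma cross1_swap (p q : Z * Z) (d d' : dir) :
  xorb (cross1 q d' p d) (cross1 p d q d')
  = xorb (xorb (kap q p d) (kap (move q d') p d)) (xorb (kap' p q d') (kap' (move p d) q d')).
Proof. destruct p as [x y], q as [a b], d, d'; cbv [cross1 kap kap' vT vB hR hL veq move fst snd]; zbool. Qed.

Lemma kap_kap' (v p : Z * Z) (d : dir) : xorb (kap v p d) (kap' v p d) = xorb (veq v p) (veq v (move p d)).
Proof. destruct p as [x y], v as [a b], d; cbv [kap kap' vT vB hR hL veq move fst snd]; zbool. Qed.

Lemma esum_xor (F H : Z * Z -> dir -> bool) (p : Z * Z) (w : list dir) :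
  esum (fun a d => xorb (F a d) (H a d)) p w = xorb (esum F p w) (esum H p w).
Proof. revert p; induction w as [|d w IH]; intros p; simpl; [reflexivity|]. rewrite IH. btauto. Qed.

Lemma esum_ext (F H : Z * Z -> dir -> bool) (p : Z * Z) (w : list dir) :
  (forall a d, F a d = H a d) -> esum F p w = esum H p w.
Proof. intros E. revert p; induction w as [|d w IH]; intros p; simpl; [reflexivity|]. rewrite IH, E. reflexivity. Qed.

Lemma esum_telescope (b : Z * Z -> bool) (p : Z * Z) (w : list dir) :
  esum (fun a d => xorb (b a) (b (move a d))) p w = xorb (b p) (b (walk_end p w)).
Proof.
  revert p; induction w as [|d w IH]; intros p; simpl; [btauto|]. rewrite IH. btauto.
Qed.

Lemma esum_swap (F : Z * Z -> dir -> Z * Z -> dir -> bool) p w q w' :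
  esum (fun a d => esum (fun b d' => F a d b d') q w') p w
  = esum (fun b d' => esum (fun a d => F a d b d') p w) q w'.
Proof.
  revert p; induction w as [|d w IH]; intros p; simpl.
  - revert q; induction w' as [|d' w' IH']; intros q; simpl; [reflexivity|]. rewrite <- IH'. reflexivity.
  - rewrite IH. rewrite <- esum_xor. apply esum_ext. reflexivity.
Qed.

Lemma crossings_winding p w q w' :
  crossings p w q w' = xorb (xorb (winding p q w') (winding (walk_end p w) q w'))
                            (xorb (rays q p w) (rays (walk_end q w') p w)).
Proof.
  unfold crossings.
  rewrite (esum_ext _ (fun a d => xorb (xorb (winding a q w') (winding (move a d) q w'))
                                  (xorb (ray1 q a d) (ray1 (walk_end q w') a d)))).
  - rewrite esum_xor, esum_telescope, esum_xor. reflexivity.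
  - intros a d.
    rewrite (esum_ext _ (fun b d' => xorb (xorb (wind1 a b d') (wind1 (move a d) b d'))
                                     (xorb (ray1 b a d) (ray1 (move b d') a d)))).
    + rewrite esum_xor, esum_xor, (esum_telescope (fun b => ray1 b a d)). reflexivity.
    + intros b d'. apply cross1_ray.
Qed.

Lemma crossings_swap p w q w' :
  xorb (crossings p w q w') (crossings q w' p w)
  = xorb (xorb (esum (kap q) p w) (esum (kap (walk_end q w')) p w))
         (xorb (esum (kap' p) q w') (esum (kap' (walk_end p w)) q w')).
Proof.
  unfold crossings. rewrite (esum_swap (fun b d' a d => cross1 a d b d') q w' p w), <- esum_xor.
  rewrite (esum_ext _ (fun a d => xorb (xorb (kap q a d) (kap (walk_end q w') a d))
                          (xorb (esum (kap' a) q w') (esum (kap' (move a d)) q w')))).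
  - rewrite esum_xor, esum_xor, (esum_telescope (fun a => esum (kap' a) q w')). reflexivity.
  - intros a d. rewrite <- esum_xor.
    rewrite (esum_ext _ (fun b d' => xorb (xorb (kap b a d) (kap (move b d') a d))
                          (xorb (kap' a b d') (kap' (move a d) b d')))) by (intros; apply cross1_swap).
    rewrite esum_xor, (esum_telescope (fun b => kap b a d)), esum_xor. reflexivity.
Qed.

(** Together [kap] and [kap'] count all edge ends at [v], so this is the parity of the degree of [v]
    in the walk. *)
Lemma sum_kap_kap' v p w :
  xorb (esum (kap v) p w) (esum (kap' v) p w) = xorb (veq v p) (veq v (walk_end p w)).
Proof.
  rewrite <- esum_xor, <- (esum_telescope (veq v)). apply esum_ext. intros; apply kap_kap'.
Qed.

Lemma esum_0 (F : Z * Z -> dir -> bool) p w :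
  (forall a d, In a (verts p w) -> In (move a d) (verts p w) -> F a d = false) -> esum F p w = false.
Proof.
  revert p; induction w as [|d w IH]; intros p H; simpl; [reflexivity|].
  rewrite H, IH; [reflexivity| |left; reflexivity|right; destruct w; left; reflexivity].
  intros a d' H1 H2. apply H; right; assumption.
Qed.

Lemma veq_eq p q : veq p q = true -> p = q.
Proof. destruct p, q; unfold veq; simpl. intros H. apply andb_prop in H as [H1 H2].
  apply Z.eqb_eq in H1, H2. subst. reflexivity. Qed.
Lemma veq_refl p : veq p p = true.
Proof. unfold veq. rewrite !Z.eqb_refl. reflexivity. Qed.

Lemma kap_off v p w : ~ In v (verts p w) -> esum (kap v) p w = false /\ esum (kap' v) p w = false.
Proof.
  intros Hv; split; apply esum_0; intros a d H1 H2.
  all: assert (E1 : veq v a = false) by (destruct (veq v a) eqn:E; [apply veq_eq in E; subst; tauto | reflexivity]).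
  all: assert (E2 : veq v (move a d) = false)
    by (destruct (veq v (move a d)) eqn:E; [apply veq_eq in E; subst; tauto | reflexivity]).
  all: destruct d; cbv [kap kap' hL hR vB vT]; rewrite ?E1, ?E2; reflexivity.
Qed.

Lemma crossings_off p w q w' :
  (forall v, In v (verts p w) -> In v (verts q w') -> False) -> crossings p w q w' = false.
Proof.
  intros H. apply esum_0. intros a d Ha Ha'. apply esum_0. intros b d' Hb Hb'.
  assert (N : forall u v, In u (verts p w) -> In v (verts q w') -> veq u v = false).
  { intros u v Hu Hv. destruct (veq u v) eqn:E; [apply veq_eq in E; subst; exfalso; eauto | reflexivity]. }
  destruct d, d'; cbv [cross1 vT hR]; try reflexivity; apply N; assumption.
Qed.

Lemma verts_start p w : In p (verts p w).
Proof. destruct w; left; reflexivity. Qed.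
Lemma verts_end p w : In (walk_end p w) (verts p w).
Proof. revert p; induction w as [|d w IH]; intros p; simpl; [left; reflexivity | right; apply IH]. Qed.

Inductive tri := T0 | T1 | T2.

(* Hanani-Tutte style parity argument: only independent edges are required to be disjoint. *)
Lemma K33_not_in_grid (o q : tri -> Z * Z) (e : tri -> tri -> list dir) :
  (forall h i, walk_end (o h) (e h i) = q i) ->
  (forall h k i j v, h <> k -> i <> j ->
     In v (verts (o h) (e h i)) -> In v (verts (o k) (e k j)) -> False) -> False.
Proof.
  intros He Hd.
  pose (X := fun h i k j => crossings (o h) (e h i) (o k) (e k j)).
  assert (X0 : forall h i k j, h <> k -> i <> j -> X h i k j = false).
  { intros h i k j H1 H2. apply crossings_off. intros v. apply Hd; assumption. }
  assert (XW : forall h i k j, X h i k j = xorb (xorb (winding (o h) (o k) (e k j)) (winding (q i) (o k) (e k j)))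
                            (xorb (rays (o k) (o h) (e h i)) (rays (q j) (o h) (e h i)))).
  { intros. unfold X. rewrite crossings_winding, !He. reflexivity. }
  pose (K := fun h => esum (kap (q T0)) (o h) (e h T0)).
  pose (K' := fun h => esum (kap' (q T0)) (o h) (e h T0)).
  (* The two walks share the end [q T0]; independence removes all correction terms except those at
     this end. *)
  assert (XS : forall h k, h <> k -> xorb (X h T0 k T0) (X k T0 h T0) = xorb (K h) (K' k)).
  { intros h k Hhk. unfold X. rewrite crossings_swap, !He.
    assert (H1 : ~ In (o k) (verts (o h) (e h T0))).
    { intros Hv. apply (Hd h k T0 T1 (o k)); try assumption; [discriminate | apply verts_start]. }
    assert (H2 : ~ In (o h) (verts (o k) (e k T0))).
    { intros Hv. apply (Hd h k T1 T0 (o h)); try assumption; [discriminate | apply verts_start]. }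
    rewrite (proj1 (kap_off _ _ _ H1)), (proj2 (kap_off _ _ _ H2)). unfold K, K'. btauto. }
  (* The walk from [o T1] ends at [q T0] and does not start there, so its degree there is odd. *)
  assert (KK : xorb (K T1) (K' T1) = true).
  { unfold K, K'. rewrite sum_kap_kap', He, veq_refl.
    destruct (veq (q T0) (o T1)) eqn:E; [|reflexivity].
    apply veq_eq in E. exfalso. apply (Hd T0 T1 T0 T1 (q T0)); try discriminate.
    - rewrite <- (He T0 T0). apply verts_end.
    - rewrite E. apply verts_start. }
  pose proof (XS T0 T1 ltac:(discriminate)) as S01.
  pose proof (XS T0 T2 ltac:(discriminate)) as S02.
  pose proof (XS T1 T2 ltac:(discriminate)) as S12.
  (* The path [q T0], [o l], [q T2] crosses the cycle [q T0], [o h], [q T1], [o k] with a parity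
     given by the winding of the cycle around [q T0] and [q T2], whatever [l] is. Of these
     crossings, independence leaves only the two on the left-hand side. *)
  assert (Z : forall l h k, l <> h -> l <> k ->
     xorb (X l T0 h T0) (X l T0 k T0) =
     xorb (xorb (xorb (winding (q T2) (o h) (e h T0)) (winding (q T2) (o h) (e h T1)))
                (xorb (winding (q T2) (o k) (e k T0)) (winding (q T2) (o k) (e k T1))))
          (xorb (xorb (winding (q T0) (o h) (e h T0)) (winding (q T0) (o h) (e h T1)))
                (xorb (winding (q T0) (o k) (e k T0)) (winding (q T0) (o k) (e k T1))))).
  { intros l h k Hh Hk.
    pose proof (X0 l T2 h T0 Hh ltac:(discriminate)) as A1.
    pose proof (X0 l T2 h T1 Hh ltac:(discriminate)) as A2.
    pose proof (X0 l T2 k T0 Hk ltac:(discriminate)) as A3.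
    pose proof (X0 l T2 k T1 Hk ltac:(discriminate)) as A4.
    pose proof (X0 l T0 h T1 Hh ltac:(discriminate)) as A5.
    pose proof (X0 l T0 k T1 Hk ltac:(discriminate)) as A6.
    assert (B1 : xorb (xorb (X l T2 h T0) (X l T2 h T1)) (xorb (X l T2 k T0) (X l T2 k T1)) = false)
      by (rewrite A1, A2, A3, A4; reflexivity).
    assert (B2 : xorb (X l T0 h T0) (X l T0 k T0)
              = xorb (xorb (X l T0 h T0) (X l T0 h T1)) (xorb (X l T0 k T0) (X l T0 k T1)))
      by (rewrite A5, A6; btauto).
    rewrite B2. rewrite !XW in *. clear - B1.
    match goal with |- ?L = ?R => assert (H : xorb L R = false); [| destruct L, R; simpl in H; congruence] end.
    rewrite <- B1. btauto. }
  pose proof (Z T0 T1 T2 ltac:(discriminate) ltac:(discriminate)) as Z0.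
  pose proof (Z T1 T0 T2 ltac:(discriminate) ltac:(discriminate)) as Z1.
  pose proof (Z T2 T0 T1 ltac:(discriminate) ltac:(discriminate)) as Z2.
  (* Each centre occurs in two of the three equations, so the right-hand sides cancel. The same six
     terms, paired by [XS] instead, leave [K T1] plus [K' T1]. *)
  assert (E1 : xorb (xorb (xorb (X T0 T0 T1 T0) (X T0 T0 T2 T0)) (xorb (X T1 T0 T0 T0) (X T1 T0 T2 T0)))
                    (xorb (X T2 T0 T0 T0) (X T2 T0 T1 T0)) = false)
    by (rewrite Z0, Z1, Z2; btauto).
  assert (E2 : xorb (xorb (xorb (X T0 T0 T1 T0) (X T0 T0 T2 T0)) (xorb (X T1 T0 T0 T0) (X T1 T0 T2 T0)))
                    (xorb (X T2 T0 T0 T0) (X T2 T0 T1 T0)) = true).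
  { transitivity (xorb (xorb (xorb (X T0 T0 T1 T0) (X T1 T0 T0 T0)) (xorb (X T0 T0 T2 T0) (X T2 T0 T0 T0)))
                    (xorb (X T1 T0 T2 T0) (X T2 T0 T1 T0))); [btauto|].
    rewrite S01, S02, S12, <- KK. btauto. }
  congruence.
Qed.

Open Scope R_scope.

(** * Grid minors are planar *)

Definition ipt (p : Z * Z) : R * R := (IZR (fst p), IZR (snd p)).
Definition dvec (d : dir) : R * R :=
  match d with Rt => (1, 0) | Lt => (-1, 0) | Up => (0, 1) | Dn => (0, -1) end.
Definition edge_pt (a : Z * Z) (d : dir) (t : R) : R * R :=
  (IZR (fst a) + t * fst (dvec d), IZR (snd a) + t * snd (dvec d)).
Definition on_edge (a : Z * Z) (d : dir) (p : R * R) : Prop := exists t, 0 <= t <= 1 /\ p = edge_pt a d t.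

(** The identity on [0, 1], then back to 0 at 3/2: [u - tent u] sends [0, 1] to 0 and stretches
    [1, 3/2] over [0, 3/2]. *)
Definition tent (u : R) : R := Rmax 0 (Rmin u (3 - 2 * u)).
Definition hat (v : R) : R := Rmax 0 (1 - 2 * Rabs v).
Definition ucoord (a : Z * Z) (d : dir) (p : R * R) : R :=
  (fst p - IZR (fst a)) * fst (dvec d) + (snd p - IZR (snd a)) * snd (dvec d).
Definition vcoord (a : Z * Z) (d : dir) (p : R * R) : R :=
  (snd p - IZR (snd a)) * fst (dvec d) - (fst p - IZR (fst a)) * snd (dvec d).

(* Collapses the edge from [a] in direction [d] to [a], is injective elsewhere, and is the identity
   away from a small neighbourhood of the half-open edge not containing [a]. *)
Definition collapse (a : Z * Z) (d : dir) (p : R * R) : R * R :=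
  let h := tent (ucoord a d p) * hat (vcoord a d p) in
  (fst p - h * fst (dvec d), snd p - h * snd (dvec d)).

Ltac rminmax :=
  unfold tent, hat, Rmax, Rmin, Rabs in *;
  repeat match goal with
  | |- context [Rle_dec ?a ?b] => destruct (Rle_dec a b)
  | H : context [Rle_dec ?a ?b] |- _ => destruct (Rle_dec a b)
  | |- context [Rcase_abs ?a] => destruct (Rcase_abs a)
  | H : context [Rcase_abs ?a] |- _ => destruct (Rcase_abs a)
  end.

Lemma tent_bound u : 0 <= tent u <= 1.
Proof. rminmax; lra. Qed.
Lemma hat_bound v : 0 <= hat v <= 1.
Proof. rminmax; lra. Qed.
Lemma tent_lip u u' : Rabs (tent u - tent u') <= 2 * Rabs (u - u').
Proof. rminmax; lra. Qed.
Lemma hat_lip v v' : Rabs (hat v - hat v') <= 2 * Rabs (v - v').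
Proof. rminmax; lra. Qed.
Lemma tent_slope u u' : u <= u' -> tent u' - tent u <= u' - u.
Proof. rminmax; lra. Qed.
Lemma tent_sub_inj u u' : u - tent u = u' - tent u' -> u = u' \/ (0 <= u <= 1 /\ 0 <= u' <= 1).
Proof. intros H. rminmax; first [left; lra | right; lra]. Qed.
Lemma hat_lt1 v : v <> 0 -> hat v < 1.
Proof. intros H. rminmax; lra. Qed.
Lemma hat_0 : hat 0 = 1.
Proof. rminmax; lra. Qed.
Lemma tent_mid u : 0 <= u <= 1 -> tent u = u.
Proof. intros H. rminmax; lra. Qed.
Lemma tent_out u : u <= 0 \/ 3/2 <= u -> tent u = 0.
Proof. intros H. rminmax; lra. Qed.
Lemma hat_out v : 1/2 <= Rabs v -> hat v = 0.
Proof. unfold hat. intros H. rewrite Rmax_left; lra. Qed.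

Lemma collapse_u a d p : ucoord a d (collapse a d p) = ucoord a d p - tent (ucoord a d p) * hat (vcoord a d p).
Proof. unfold collapse. set (h := tent _ * hat _). unfold ucoord. destruct d; simpl; ring. Qed.
Lemma collapse_v a d p : vcoord a d (collapse a d p) = vcoord a d p.
Proof. unfold collapse. set (h := tent _ * hat _). unfold vcoord. destruct d; simpl; ring. Qed.
Lemma uv_inj a d p q : ucoord a d p = ucoord a d q -> vcoord a d p = vcoord a d q -> p = q.
Proof.
  unfold ucoord, vcoord. destruct p, q, d; simpl; intros H1 H2; f_equal; lra.
Qed.
Lemma edge_pt_u a d t : ucoord a d (edge_pt a d t) = t.
Proof. unfold ucoord, edge_pt. destruct d; simpl; ring. Qed.
Lemma edge_pt_v a d t : vcoord a d (edge_pt a d t) = 0.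
Proof. unfold vcoord, edge_pt. destruct d; simpl; ring. Qed.
Lemma on_edge_uv a d p : 0 <= ucoord a d p <= 1 -> vcoord a d p = 0 -> on_edge a d p.
Proof.
  intros H1 H2. exists (ucoord a d p). split; [assumption|].
  apply (uv_inj a d); rewrite ?edge_pt_u, ?edge_pt_v; auto.
Qed.
Lemma edge_pt_0 a d : edge_pt a d 0 = ipt a.
Proof. unfold edge_pt, ipt. f_equal; ring. Qed.
Lemma edge_pt_1 a d : edge_pt a d 1 = ipt (move a d).
Proof.
  unfold edge_pt, ipt. destruct a, d; simpl; rewrite ?plus_IZR, ?minus_IZR; f_equal; ring.
Qed.

Lemma collapse_edge a d p : on_edge a d p -> collapse a d p = ipt a.
Proof.
  intros [t [Ht ->]]. apply (uv_inj a d).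
  - rewrite collapse_u, edge_pt_u, edge_pt_v, hat_0, tent_mid by assumption.
    rewrite <- (edge_pt_0 a d), edge_pt_u. ring.
  - rewrite collapse_v, edge_pt_v, <- (edge_pt_0 a d), edge_pt_v. reflexivity.
Qed.

(** On each line parallel to the edge the map is [u - h * tent u]. It is strictly increasing for
    [h < 1], since [tent] has slope at most 1, and for [h = 1] it identifies only the points of
    [0, 1]. *)
Lemma collapse_inj a d p q : collapse a d p = collapse a d q -> p = q \/ (on_edge a d p /\ on_edge a d q).
Proof.
  intros H.
  assert (Hv : vcoord a d p = vcoord a d q) by (rewrite <- (collapse_v a d p), <- (collapse_v a d q), H; reflexivity).
  assert (Hu : ucoord a d p - tent (ucoord a d p) * hat (vcoord a d p)
             = ucoord a d q - tent (ucoord a d q) * hat (vcoord a d p)).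
  { rewrite <- collapse_u, H, collapse_u, Hv. reflexivity. }
  destruct (Req_dec (vcoord a d p) 0) as [H0 | H0].
  - rewrite H0, hat_0, !Rmult_1_r in Hu. destruct (tent_sub_inj _ _ Hu) as [E | [E1 E2]].
    + left. apply (uv_inj a d); assumption.
    + right; split; apply on_edge_uv; congruence.
  - left. apply (uv_inj a d); [|assumption].
    pose proof (hat_lt1 _ H0) as Hh. pose proof (hat_bound (vcoord a d p)) as [Hh0 _].
    set (h := hat _) in *. set (u := ucoord a d p) in *. set (u' := ucoord a d q) in *.
    destruct (Rtotal_order u u') as [L | [E | L]]; [|assumption|].
    + pose proof (tent_slope u u' ltac:(lra)). exfalso.
      assert ((tent u' - tent u) * h < u' - u); [|lra].
      destruct (Rle_dec (tent u' - tent u) 0); [|nra].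
      assert ((tent u' - tent u) * h <= 0) by nra. lra.
    + pose proof (tent_slope u' u ltac:(lra)). exfalso.
      assert ((tent u - tent u') * h < u - u'); [|lra].
      destruct (Rle_dec (tent u - tent u') 0); [|nra].
      assert ((tent u - tent u') * h <= 0) by nra. lra.
Qed.

Lemma collapse_id a d p :
  ucoord a d p <= 0 \/ 3/2 <= ucoord a d p \/ 1/2 <= Rabs (vcoord a d p) -> collapse a d p = p.
Proof.
  intros H. apply (uv_inj a d); [|apply collapse_v].
  rewrite collapse_u. destruct H as [H | [H | H]].
  - rewrite tent_out by auto. ring.
  - rewrite tent_out by auto. ring.
  - rewrite hat_out by auto. ring.
Qed.


(** Integer versions of [ucoord] and [vcoord], so that the position of an edge relative to [a] and
    [d] is decided by [lia]. *)
Definition lu (a : Z * Z) (d : dir) (p : Z * Z) : Z :=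
  match d with Rt => fst p - fst a | Lt => fst a - fst p | Up => snd p - snd a | Dn => snd a - snd p end%Z.
Definition lv (a : Z * Z) (d : dir) (p : Z * Z) : Z :=
  match d with Rt => snd p - snd a | Lt => snd a - snd p | Up => fst a - fst p | Dn => fst p - fst a end%Z.
Lemma ucoord_ipt a d p : ucoord a d (ipt p) = IZR (lu a d p).
Proof. unfold ucoord, lu. destruct d; simpl; rewrite minus_IZR; ring. Qed.
Lemma vcoord_ipt a d p : vcoord a d (ipt p) = IZR (lv a d p).
Proof. unfold vcoord, lv. destruct d; simpl; rewrite minus_IZR; ring. Qed.
Lemma ucoord_edge a d a' d' t :
  ucoord a d (edge_pt a' d' t) = (1 - t) * IZR (lu a d a') + t * IZR (lu a d (move a' d')).
Proof.
  rewrite <- !ucoord_ipt, <- (edge_pt_0 a' d'), <- (edge_pt_1 a' d'). unfold ucoord, edge_pt. simpl. ring.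
Qed.
Lemma vcoord_edge a d a' d' t :
  vcoord a d (edge_pt a' d' t) = (1 - t) * IZR (lv a d a') + t * IZR (lv a d (move a' d')).
Proof.
  rewrite <- !vcoord_ipt, <- (edge_pt_0 a' d'), <- (edge_pt_1 a' d'). unfold vcoord, edge_pt. simpl. ring.
Qed.
Lemma local_neq a d p : p <> move a d -> lu a d p <> 1%Z \/ lv a d p <> 0%Z.
Proof.
  intros H. destruct (Z.eq_dec (lu a d p) 1) as [E|]; [right; intros E' | left; assumption].
  apply H. destruct a, p, d; simpl in *; f_equal; lia.
Qed.
Lemma local_step a d a' d' :
  (lv a d (move a' d') = lv a d a' /\ (lu a d (move a' d') = lu a d a' + 1 \/ lu a d (move a' d') = lu a d a' - 1)
  \/ lu a d (move a' d') = lu a d a' /\ (lv a d (move a' d') = lv a d a' + 1 \/ lv a d (move a' d') = lv a d a' - 1))%Z.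
Proof. destruct a, a', d, d'; simpl; lia. Qed.
Lemma IZR_ge_abs (m : Z) : m = 0%Z \/ 1 <= Rabs (IZR m).
Proof.
  destruct (Z.eq_dec m 0) as [E|E]; [left; exact E | right].
  rewrite <- abs_IZR. apply IZR_le. lia.
Qed.

(** The collapse moves only points with 0 < u < 3/2 and |v| < 1/2 in local coordinates, and every
    grid edge entering this region is incident to [move a d]. *)
Lemma collapse_id_edge a d a' d' p :
  on_edge a' d' p -> a' <> move a d -> move a' d' <> move a d -> collapse a d p = p.
Proof.
  intros [t [Ht ->]] H1 H2. apply collapse_id.
  apply local_neq in H1, H2. rewrite ucoord_edge, vcoord_edge.
  destruct (local_step a d a' d') as [[E1 E2] | [E1 E2]]; rewrite E1 in *.
  - destruct (IZR_ge_abs (lv a d a')) as [Z0 | Z1].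
    + assert (L : (lu a d a' <= 0 /\ lu a d (move a' d') <= 0 \/ 2 <= lu a d a' /\ 2 <= lu a d (move a' d'))%Z) by lia.
      destruct L as [[L1 L2] | [L1 L2]]; apply IZR_le in L1, L2; [left | right; left]; nra.
    + right; right. replace ((1 - t) * _ + t * _) with (IZR (lv a d a')) by ring. lra.
  - destruct (Z.eq_dec (lu a d a') 1) as [Z0 | Z1].
    + right; right.
      assert (L : (lv a d a' <= -1 /\ lv a d (move a' d') <= -1 \/ 1 <= lv a d a' /\ 1 <= lv a d (move a' d'))%Z) by lia.
      destruct L as [[L1 L2] | [L1 L2]]; apply IZR_le in L1, L2; unfold Rabs; destruct (Rcase_abs _); nra.
    + assert (L : (lu a d a' <= 0 \/ 2 <= lu a d a')%Z) by lia.
      destruct L as [L1 | L1]; apply IZR_le in L1; [left | right; left];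
      replace ((1 - t) * _ + t * _) with (IZR (lu a d a')) by ring; lra.
Qed.

Lemma collapse_id_vertex a d p : p <> move a d -> collapse a d (ipt p) = ipt p.
Proof.
  intros H. apply collapse_id. apply local_neq in H. rewrite ucoord_ipt, vcoord_ipt.
  destruct (IZR_ge_abs (lv a d p)) as [Z0 | Z1]; [|right; right; lra].
  assert (L : (lu a d p <= 0 \/ 2 <= lu a d p)%Z) by lia.
  destruct L as [L | L]; apply IZR_le in L; [left | right; left]; lra.
Qed.

Lemma ipt_inj p q : ipt p = ipt q -> p = q.
Proof. destruct p, q; unfold ipt; simpl. intros H; injection H; intros H1 H2. apply eq_IZR in H1, H2. congruence. Qed.

Definition dinf (p q : R * R) : R := Rmax (Rabs (fst p - fst q)) (Rabs (snd p - snd q)).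
Definition lipschitz (f : R * R -> R * R) : Prop := exists L, 0 <= L /\ forall p q, dinf (f p) (f q) <= L * dinf p q.

Lemma dinf_ge0 p q : 0 <= dinf p q.
Proof. unfold dinf. eapply Rle_trans; [apply Rabs_pos | apply Rmax_l]. Qed.

Lemma lipschitz_comp f g : lipschitz f -> lipschitz g -> lipschitz (fun p => f (g p)).
Proof.
  intros [L [L0 HL]] [M [M0 HM]]. exists (L * M). split; [nra|]. intros p q.
  eapply Rle_trans; [apply HL|]. rewrite Rmult_assoc. apply Rmult_le_compat_l; auto.
Qed.

Lemma prod_lip A B x x' y y' : 0 <= x <= 1 -> 0 <= x' <= 1 -> 0 <= y <= 1 -> 0 <= y' <= 1 ->
  Rabs (x - x') <= A -> Rabs (y - y') <= B -> Rabs (x * y - x' * y') <= A + B.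
Proof.
  intros. replace (x * y - x' * y') with ((x - x') * y + x' * (y - y')) by ring.
  eapply Rle_trans; [apply Rabs_triang|]. rewrite !Rabs_mult.
  rewrite (Rabs_pos_eq y), (Rabs_pos_eq x') by tauto.
  pose proof (Rabs_pos (x - x')). pose proof (Rabs_pos (y - y')). nra.
Qed.

Lemma collapse_lipschitz a d : lipschitz (collapse a d).
Proof.
  exists 5. split; [lra|]. intros p q. pose proof (dinf_ge0 p q) as D0.
  assert (H1 : Rabs (fst p - fst q) <= dinf p q) by apply Rmax_l.
  assert (H2 : Rabs (snd p - snd q) <= dinf p q) by apply Rmax_r.
  assert (Hu : Rabs (ucoord a d p - ucoord a d q) <= dinf p q).
  { unfold ucoord. destruct d; simpl; [replace (_ - _) with (fst p - fst q) by ring | replace (_ - _) with (- (fst p - fst q)) by ring; rewrite Rabs_Ropp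
    | replace (_ - _) with (snd p - snd q) by ring | replace (_ - _) with (- (snd p - snd q)) by ring; rewrite Rabs_Ropp]; assumption. }
  assert (Hv : Rabs (vcoord a d p - vcoord a d q) <= dinf p q).
  { unfold vcoord. destruct d; simpl; [replace (_ - _) with (snd p - snd q) by ring | replace (_ - _) with (- (snd p - snd q)) by ring; rewrite Rabs_Ropp
    | replace (_ - _) with (- (fst p - fst q)) by ring; rewrite Rabs_Ropp | replace (_ - _) with (fst p - fst q) by ring]; assumption. }
  pose proof (tent_lip (ucoord a d p) (ucoord a d q)) as Ht.
  pose proof (hat_lip (vcoord a d p) (vcoord a d q)) as Hh.
  pose proof (prod_lip (2 * dinf p q) (2 * dinf p q) _ _ _ _ (tent_bound (ucoord a d p)) (tent_bound (ucoord a d q))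
    (hat_bound (vcoord a d p)) (hat_bound (vcoord a d q)) ltac:(lra) ltac:(lra)) as HP.
  unfold dinf at 1, collapse. simpl.
  set (h := tent (ucoord a d p) * hat (vcoord a d p)) in *.
  set (h' := tent (ucoord a d q) * hat (vcoord a d q)) in *.
  assert (E : forall x y e, Rabs (x - y) <= dinf p q -> e = 1 \/ e = -1 \/ e = 0 ->
    Rabs (x - h * e - (y - h' * e)) <= 5 * dinf p q).
  { intros x y e Hxy He. replace (x - h * e - (y - h' * e)) with ((x - y) + - (e * (h - h'))) by ring.
    eapply Rle_trans; [apply Rabs_triang|]. rewrite Rabs_Ropp, Rabs_mult.
    assert (Rabs e <= 1) by (destruct He as [-> | [-> | ->]]; unfold Rabs; destruct (Rcase_abs _); lra).
    pose proof (Rabs_pos (h - h')) as A1.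
    assert (Rabs e * Rabs (h - h') <= 1 * Rabs (h - h')) by (apply Rmult_le_compat_r; assumption). lra. }
  apply Rmax_lub; apply E; try assumption; destruct d; simpl; auto.
Qed.

(** * Contracting disjoint trees in the grid *)

Section Forest.
Variable V : Type.
Variable root : V -> Z * Z.
Hypothesis root_inj : forall s t, root s = root t -> s = t.

Definition fstep : Type := (V * (Z * Z) * dir)%type.
Inductive fvert (s : V) : list fstep -> Z * Z -> Prop :=
| fvert_root : forall l, fvert s l (root s)
| fvert_new : forall l a d, fvert s ((s, a, d) :: l) (move a d)
| fvert_old : forall l x b, fvert s l b -> fvert s (x :: l) b.
Inductive forest : list fstep -> Prop :=
| forest_nil : forest []
| forest_cons : forall l s a d, forest l -> fvert s l a -> (forall t, ~ fvert t l (move a d)) ->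
    forest ((s, a, d) :: l).
Inductive tree (s : V) : list fstep -> R * R -> Prop :=
| tree_root : forall l, tree s l (ipt (root s))
| tree_new : forall l a d p, on_edge a d p -> tree s ((s, a, d) :: l) p
| tree_old : forall l x p, tree s l p -> tree s (x :: l) p.

(** The most recent leaf is collapsed first: its vertex lies on no older tree, so all older trees
    stay fixed pointwise. *)
Fixpoint contract (l : list fstep) (p : R * R) : R * R :=
  match l with [] => p | (_, a, d) :: l' => contract l' (collapse a d p) end.

Lemma fvert_tree s l b : fvert s l b -> tree s l (ipt b).
Proof.
  induction 1; [constructor | apply tree_new; exists 1 | apply tree_old; assumption].
  split; [lra|]. rewrite edge_pt_1. reflexivity.
Qed.

Lemma tree_cases s l p : tree s l p -> forest l ->
  (exists b, fvert s l b /\ p = ipt b) \/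
  (exists a d, fvert s l a /\ fvert s l (move a d) /\ on_edge a d p).
Proof.
  induction 1 as [l | l a d p Hp | l x p Hp IH]; intros HF.
  - left; eexists; split; [apply fvert_root | reflexivity].
  - right. exists a, d. inversion HF; subst. repeat split; [apply fvert_old; assumption | apply fvert_new | assumption].
  - inversion HF; subst. destruct IH as [[b [Hb E]] | [a' [d' [H5 [H6 H7]]]]]; [assumption | |].
    + left; exists b; split; [apply fvert_old|]; assumption.
    + right; exists a', d'; repeat split; try apply fvert_old; assumption.
Qed.

Lemma collapse_tree s l a d p : forest l -> tree s l p -> (forall t, ~ fvert t l (move a d)) -> collapse a d p = p.
Proof.
  intros HF Hp Hn. destruct (tree_cases s l p Hp HF) as [[b [Hb ->]] | [a' [d' [H1 [H2 H3]]]]].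
  - apply collapse_id_vertex. intros ->. exact (Hn _ Hb).
  - apply (collapse_id_edge a d a' d'); [assumption | |]; intros E; apply (Hn s); rewrite <- E; assumption.
Qed.

Lemma tree_disjoint l : forest l -> forall s t p, tree s l p -> tree t l p -> s = t.
Proof.
  induction 1 as [|l s0 a d HF IH Ha Hn]; intros s t p Hs Ht.
  - inversion Hs; inversion Ht; subst. apply root_inj, ipt_inj. congruence.
  - assert (Old : forall s p, tree s ((s0, a, d) :: l) p -> tree s l p \/ (s = s0 /\ on_edge a d p)).
    { intros s' p' H. inversion H; subst; auto. left; constructor. }
    assert (K : forall s p, tree s l p -> on_edge a d p -> s = s0).
    { intros s' p' H1 H2. apply (IH _ _ (ipt a)); [|apply fvert_tree; assumption].
      (* A point of an older tree on the new edge is fixed by the collapse and also sent to [a];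
         hence it is [a]. *)
      rewrite <- (collapse_edge a d p' H2), (collapse_tree s' l) by assumption. assumption. }
    destruct (Old _ _ Hs) as [Hs' | [-> Hs']], (Old _ _ Ht) as [Ht' | [-> Ht']]; eauto.
    symmetry; eauto.
Qed.

(** The preimage of a tree under the collapse of a new leaf edge is that tree, enlarged by the edge
    if it contains [a]; away from the edge the collapse is injective. *)
Lemma contract_fiber l : forest l -> forall p q,
  contract l p = contract l q <-> p = q \/ exists s, tree s l p /\ tree s l q.
Proof.
  induction 1 as [|l s a d HF IH Ha Hn]; intros p q; simpl.
  - split; [auto|]. intros [E | [s [Hp Hq]]]; [assumption|]. inversion Hp; inversion Hq; subst; congruence.
  - assert (T : forall s' p, tree s' ((s, a, d) :: l) p <-> tree s' l (collapse a d p)).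
    { intros s' p'. split; intros H.
      - inversion H; subst.
        + rewrite (collapse_tree s' l) by (try assumption; constructor). constructor.
        + rewrite collapse_edge by assumption. apply fvert_tree; assumption.
        + rewrite (collapse_tree s' l) by assumption. assumption.
      - destruct (collapse_inj a d (collapse a d p') p') as [E | [E1 E2]].
        + apply (collapse_tree s' l); assumption.
        + rewrite <- E. apply tree_old; assumption.
        + rewrite (collapse_edge a d p' E2) in H.
          rewrite (tree_disjoint l HF s' s (ipt a)); [|assumption | apply fvert_tree; assumption].
          apply tree_new; assumption. }
    rewrite IH. split.
    + intros [E | [s' [H1 H2]]].
      * apply collapse_inj in E. destruct E as [E | [E1 E2]]; [left; assumption | right; exists s].
        split; apply tree_new; assumption.
      * right; exists s'; split; apply T; assumption.
    + intros [-> | [s' [H1 H2]]]; [left; reflexivity | right; exists s'; split; apply T; assumption].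
Qed.

Lemma contract_lipschitz l : lipschitz (contract l).
Proof.
  induction l as [|[[s a] d] l IH].
  - exists 1. split; [lra|]. intros p q. simpl. lra.
  - apply (lipschitz_comp (contract l)); [assumption | apply collapse_lipschitz].
Qed.

Variable walks : V -> list (list dir).
Definition region (s : V) (b : Z * Z) : Prop := b = root s \/ exists w, In w (walks s) /\ In b (verts (root s) w).
Hypothesis region_disjoint : forall s t b, region s b -> region t b -> s = t.
Variable Vl : list V.
Hypothesis Vl_all : forall v, In v Vl.

Definition within (l : list fstep) : Prop := forest l /\ forall s b, fvert s l b -> region s b.
Definition extends (l l' : list fstep) : Prop := forall s b, fvert s l b -> fvert s l' b.

(** Each vertex of the walk that is not yet in the forest is attached as a leaf to its predecessor;
    since the regions are disjoint, no other tree contains it. *)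
Lemma add_walk s w : forall l a, within l -> fvert s l a -> (forall b, In b (verts a w) -> region s b) ->
  exists l', within l' /\ extends l l' /\ forall b, In b (verts a w) -> fvert s l' b.
Proof.
  induction w as [|d w IH]; intros l a [HF HB] Ha Hw.
  - exists l. split; [split; assumption | split; [intros ? ? H; exact H|]]. intros b [<- | []]. assumption.
  - assert (Hb : region s (move a d)) by (apply Hw; right; apply verts_start).
    destruct (classic (fvert s l (move a d))) as [Hin | Hin].
    + destruct (IH l (move a d)) as [l' [H1 [H2 H3]]]; [split; assumption | assumption | intros; apply Hw; right; assumption |].
      exists l'. split; [assumption | split; [assumption|]]. intros b [<- | Hb']; auto.
    + destruct (IH ((s, a, d) :: l) (move a d)) as [l' [H1 [H2 H3]]].
      * split.
        -- constructor; try assumption. intros t Ht. pose proof (region_disjoint t s _ (HB _ _ Ht) Hb). subst; auto.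
        -- intros t b Ht. inversion Ht; subst; [left; reflexivity | assumption | apply HB; assumption].
      * apply fvert_new.
      * intros; apply Hw; right; assumption.
      * exists l'. split; [assumption | split].
        -- intros t b Ht. apply H2, fvert_old, Ht.
        -- intros b [<- | Hb']; [apply H2, fvert_old, Ha | auto].
Qed.

Lemma spanning_forest : exists l, forest l /\ forall s b, fvert s l b <-> region s b.
Proof.
  assert (A : forall s ws l, incl ws (walks s) -> within l ->
    exists l', within l' /\ extends l l' /\ forall w b, In w ws -> In b (verts (root s) w) -> fvert s l' b).
  { intros s. induction ws as [|w ws IH]; intros l Hi Hl.
    - exists l. split; [assumption | split; [intros ? ? H; exact H | intros ? ? []]].
    - destruct (IH l) as [l1 [H1 [H2 H3]]]; [intros x Hx; apply Hi; right; assumption | assumption |].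
      destruct (add_walk s w l1 (root s)) as [l2 [H4 [H5 H6]]]; [assumption | apply fvert_root | |].
      + intros b Hb. right. exists w. split; [apply Hi; left; reflexivity | assumption].
      + exists l2. split; [assumption | split].
        * intros t b Ht. apply H5, H2, Ht.
        * intros w' b [<- | Hw] Hb; [apply H6, Hb | apply H5, (H3 w'); assumption]. }
  assert (B : forall vl, exists l, within l /\ forall s b, In s vl -> region s b -> fvert s l b).
  { induction vl as [|v vl [l [H1 H2]]].
    - exists []. split; [split; [constructor|] | intros ? ? []]. intros s b Hb. inversion Hb; subst. left; reflexivity.
    - destruct (A v (walks v) l) as [l' [H3 [H4 H5]]]; [apply incl_refl | assumption |].
      exists l'. split; [assumption|]. intros s b [<- | Hs] Hb.
      + destruct Hb as [-> | [w [Hw Hb]]]; [apply fvert_root | apply (H5 w); assumption].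
      + apply H4, H2; assumption. }
  destruct (B Vl) as [l [[H1 H2] H3]]. exists l. split; [assumption|]. intros s b. split; auto.
Qed.
End Forest.

(** * Inverse stereographic projection *)

Definition inv_stereo (p : R * R) : pt3 :=
  let (x, y) := p in let m := 1 + x ^ 2 + y ^ 2 in (2 * x / m, 2 * y / m, (x ^ 2 + y ^ 2 - 1) / m).

Lemma inv_stereo_S2 p : on_S2 (inv_stereo p).
Proof.
  destruct p as [x y]; unfold inv_stereo, on_S2. assert (1 + x ^ 2 + y ^ 2 <> 0) by nra. field. assumption.
Qed.
Lemma inv_stereo_inj p q : inv_stereo p = inv_stereo q -> p = q.
Proof.
  destruct p as [x y], q as [u v]; unfold inv_stereo. intros H.
  pose proof (f_equal (fun z => fst (fst z)) H) as H1. pose proof (f_equal (fun z => snd (fst z)) H) as H2.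
  pose proof (f_equal snd H) as H3. cbv [fst snd] in H1, H2, H3. clear H.
  assert (m1 : 0 < 1 + x ^ 2 + y ^ 2) by nra. assert (m2 : 0 < 1 + u ^ 2 + v ^ 2) by nra.
  assert (E : 1 + x ^ 2 + y ^ 2 = 1 + u ^ 2 + v ^ 2).
  { assert (E : 2 / (1 + x ^ 2 + y ^ 2) = 2 / (1 + u ^ 2 + v ^ 2)).
    { replace (2 / (1 + x ^ 2 + y ^ 2)) with (1 - (x ^ 2 + y ^ 2 - 1) / (1 + x ^ 2 + y ^ 2)) by (field; lra).
      rewrite H3. field; lra. }
    transitivity (2 / (2 / (1 + x ^ 2 + y ^ 2))); [field; lra|]. rewrite E. field; lra. }
  rewrite E in H1, H2.
  f_equal.
  - transitivity (2 * x / (1 + u ^ 2 + v ^ 2) * (1 + u ^ 2 + v ^ 2) / 2); [field; lra|]. rewrite H1. field; lra.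
  - transitivity (2 * y / (1 + u ^ 2 + v ^ 2) * (1 + u ^ 2 + v ^ 2) / 2); [field; lra|]. rewrite H2. field; lra.
Qed.
Lemma inv_stereo_dist p q : dist3 (inv_stereo p) (inv_stereo q) <= 4 * dinf p q.
Proof.
  pose proof (dinf_ge0 p q) as D0.
  assert (H1 : Rabs (fst p - fst q) <= dinf p q) by apply Rmax_l.
  assert (H2 : Rabs (snd p - snd q) <= dinf p q) by apply Rmax_r.
  set (D := dinf p q) in *. clearbody D.
  destruct p as [x y], q as [u v]; simpl in *.
  assert (m1 : 1 <= 1 + x ^ 2 + y ^ 2) by nra. assert (m2 : 1 <= 1 + u ^ 2 + v ^ 2) by nra.
  rewrite <- (sqrt_Rsqr (4 * D)) by lra. apply sqrt_le_1_alt.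
  match goal with |- ?L <= _ => replace L with (4 * ((x - u) ^ 2 + (y - v) ^ 2) / ((1 + x ^ 2 + y ^ 2) * (1 + u ^ 2 + v ^ 2))) end.
  2: { field. split; apply Rgt_not_eq; nra. }
  set (A := 1 + x ^ 2 + y ^ 2) in *. set (B := 1 + u ^ 2 + v ^ 2) in *.
  assert (Hx : (x - u) ^ 2 <= D ^ 2) by (rewrite <- (pow2_abs (x - u)); apply pow_incr; split; [apply Rabs_pos | assumption]).
  assert (Hy : (y - v) ^ 2 <= D ^ 2) by (rewrite <- (pow2_abs (y - v)); apply pow_incr; split; [apply Rabs_pos | assumption]).
  assert (AB : 1 <= A * B) by nra.
  apply Rle_trans with (4 * ((x - u) ^ 2 + (y - v) ^ 2)).
  - apply (Rmult_le_reg_r (A * B)); [lra|]. unfold Rdiv. rewrite Rmult_assoc, Rinv_l by lra.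
    pose proof (pow2_ge_0 (x - u)). pose proof (pow2_ge_0 (y - v)).
    assert (Q : 0 <= (x - u) ^ 2 + (y - v) ^ 2) by lra.
    set (c := (x - u) ^ 2 + (y - v) ^ 2) in *. clearbody c. set (ab := A * B) in *. clearbody ab. nra.
  - unfold Rsqr. replace (4 * D * (4 * D)) with (16 * D ^ 2) by ring. pose proof (pow2_ge_0 D). lra.
Qed.

Lemma edge_pt_interior a d t a' d' t' : 0 < t < 1 -> 0 <= t' <= 1 -> edge_pt a d t = edge_pt a' d' t' ->
  (a' = a /\ move a' d' = move a d) \/ (a' = move a d /\ move a' d' = a).
Proof.
  intros Ht Ht' E.
  pose proof (ucoord_edge a d a' d' t') as U. pose proof (vcoord_edge a d a' d' t') as W.
  rewrite <- E, edge_pt_u in U. rewrite <- E, edge_pt_v in W.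
  assert (L : forall p q, lu a d p = lu a d q -> lv a d p = lv a d q -> p = q).
  { intros [x y] [x' y']; unfold lu, lv; destruct d; simpl; intros; f_equal; lia. }
  assert (Ma : lu a d a = 0%Z /\ lv a d a = 0%Z) by (unfold lu, lv; destruct d; lia).
  assert (Mb : lu a d (move a d) = 1%Z /\ lv a d (move a d) = 0%Z) by (unfold lu, lv; destruct a, d; simpl; lia).
  destruct (local_step a d a' d') as [[E1 E2] | [E1 E2]]; rewrite E1 in *.
  - assert (W0 : lv a d a' = 0%Z) by (apply eq_IZR; lra).
    destruct E2 as [E2 | E2]; rewrite E2, ?plus_IZR, ?minus_IZR in U.
    + assert (lu a d a' = 0)%Z.
      { apply Z.le_antisymm; [apply Zlt_succ_le, lt_IZR; simpl; lra|].
        apply Zlt_succ_le, lt_IZR. rewrite succ_IZR; lra. }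
      left; split; apply L; lia.
    + assert (lu a d a' = 1)%Z.
      { apply Z.le_antisymm; [apply Zlt_succ_le, lt_IZR; simpl; lra|].
        apply Zlt_succ_le, lt_IZR. rewrite succ_IZR; lra. }
      right; split; apply L; lia.
  - replace ((1 - t') * _ + t' * _) with (IZR (lu a d a')) in U by ring.
    exfalso. assert (0 < lu a d a' < 1)%Z; [|lia]. split; apply lt_IZR; lra.
Qed.

Section GridMinor.
Variables (V : Type) (adj : V -> V -> Prop).
Hypothesis adj_irr : forall v, ~ adj v v.
Variables (root : V -> Z * Z) (walks : V -> list (list dir)) (Vl : list V).
Hypothesis Vl_all : forall v, In v Vl.
Hypothesis region_disjoint : forall s t b, region V root walks s b -> region V root walks t b -> s = t.
Hypothesis region_adj : forall s t, adj s t -> exists a d, region V root walks s a /\ region V root walks t (move a d).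

(** Contracting a spanning forest of the regions turns every tree into a point and every connecting
    edge [g s t] into an arc. *)
Theorem grid_minor_planar : planar_graph adj.
Proof.
  assert (root_inj : forall s t, root s = root t -> s = t).
  { intros s t E. apply (region_disjoint s t (root s)); left; auto. }
  destruct (spanning_forest V root walks region_disjoint Vl Vl_all) as [l [HF HR]].
  assert (C : exists g : V -> V -> (Z * Z) * dir, forall s t, adj s t ->
     fvert V root s l (fst (g s t)) /\ fvert V root t l (move (fst (g s t)) (snd (g s t)))).
  { exists (fun s t => epsilon (inhabits ((0, 0)%Z, Rt))
       (fun ad => fvert V root s l (fst ad) /\ fvert V root t l (move (fst ad) (snd ad)))).
    intros s t Hst. apply epsilon_spec. destruct (region_adj s t Hst) as [a [d [H1 H2]]].
    exists (a, d). split; apply HR; assumption. }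
  destruct C as [g Hg].
  assert (VD : forall s t b, fvert V root s l b -> fvert V root t l b -> s = t).
  { intros s t b H1 H2. apply (region_disjoint s t b); apply HR; assumption. }
  pose (Phi := contract V l).
  pose proof (contract_fiber V root root_inj l HF) as PF. fold Phi in PF.
  (* An interior point of a connecting edge lies on no other grid edge, and the ends of this one
     belong to different trees. *)
  assert (INT : forall s t x tau, adj s t -> 0 < tau < 1 -> ~ tree V root x l (edge_pt (fst (g s t)) (snd (g s t)) tau)).
  { intros s t x tau Hst Htau Hx. destruct (Hg s t Hst) as [G1 G2].
    destruct (tree_cases V root x l _ Hx HF) as [[b [Hb E]] | [a' [d' [H1 [H2 [t' [Ht' E]]]]]]].
    - rewrite <- (edge_pt_0 b Rt) in E.
      apply (adj_irr s). destruct (edge_pt_interior _ _ _ _ _ 0 Htau (conj (Rle_refl 0) Rle_0_1) E) as [[E1 E2] | [E1 E2]].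
      +  exfalso. assert (E' : edge_pt (fst (g s t)) (snd (g s t)) tau = edge_pt (fst (g s t)) (snd (g s t)) 0)
          by (rewrite E, !edge_pt_0, E1; reflexivity).
        apply (f_equal (ucoord (fst (g s t)) (snd (g s t)))) in E'. rewrite !edge_pt_u in E'. lra.
      + exfalso. assert (E' : edge_pt (fst (g s t)) (snd (g s t)) tau = edge_pt (fst (g s t)) (snd (g s t)) 1)
          by (rewrite E, edge_pt_0, edge_pt_1, E1; reflexivity).
        apply (f_equal (ucoord (fst (g s t)) (snd (g s t)))) in E'. rewrite !edge_pt_u in E'. lra.
    - assert (Ne : s <> t) by (intros ->; exact (adj_irr _ Hst)).
      apply Ne. destruct (edge_pt_interior _ _ _ _ _ _ Htau Ht' E) as [[E1 E2] | [E1 E2]].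
      + transitivity x; [apply (VD _ _ (fst (g s t))) | apply (VD _ _ (move a' d'))]; congruence.
      + transitivity x; [apply (VD _ _ (fst (g s t))) | apply (VD _ _ a')]; congruence. }
  exists (fun s => inv_stereo (Phi (ipt (root s)))).
  exists (fun s t tau => inv_stereo (Phi (edge_pt (fst (g s t)) (snd (g s t)) tau))).
  repeat split.
  - intros; apply inv_stereo_S2.
  - intros u v E. apply inv_stereo_inj, PF in E. destruct E as [E | [s [H1 H2]]].
    + apply root_inj, ipt_inj, E.
    + transitivity s; [|symmetry]; (apply (tree_disjoint V root root_inj l HF _ _ _ (tree_root V root _ l)); assumption).
  - intros tau Htau e He. destruct (contract_lipschitz V l) as [L [L0 HL]]. fold Phi in HL.
    (* The factor 4 comes from [inv_stereo_dist] and [L] from the contraction; the 1 keeps the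
       denominator positive. *)
    exists (e / (4 * L + 1)). split; [apply Rdiv_lt_0_compat; lra|]. intros tau' Htau' Hd.
    eapply Rle_lt_trans; [apply inv_stereo_dist|].
    eapply Rle_lt_trans; [apply Rmult_le_compat_l; [lra | apply HL]|].
    assert (D : dinf (edge_pt (fst (g u v)) (snd (g u v)) tau) (edge_pt (fst (g u v)) (snd (g u v)) tau') <= Rabs (tau - tau')).
    { unfold dinf, edge_pt. simpl. apply Rmax_lub.
      - replace (_ - _) with ((tau - tau') * fst (dvec (snd (g u v)))) by ring. rewrite Rabs_mult.
        assert (Rabs (fst (dvec (snd (g u v)))) <= 1) by (destruct (snd (g u v)); simpl; unfold Rabs; destruct (Rcase_abs _); lra).
        pose proof (Rabs_pos (tau - tau')). nra.
      - replace (_ - _) with ((tau - tau') * snd (dvec (snd (g u v)))) by ring. rewrite Rabs_mult.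
        assert (Rabs (snd (dvec (snd (g u v)))) <= 1) by (destruct (snd (g u v)); simpl; unfold Rabs; destruct (Rcase_abs _); lra).
        pose proof (Rabs_pos (tau - tau')). nra. }
    pose proof (Rabs_pos (tau - tau')).
    apply Rle_lt_trans with (4 * (L * Rabs (tau - tau'))); [nra|].
    apply Rle_lt_trans with ((4 * L + 1) * Rabs (tau - tau')); [nra|].
    apply (Rmult_lt_compat_l (4 * L + 1)) in Hd; [|lra].
    replace e with ((4 * L + 1) * (e / (4 * L + 1))) by (field; lra). assumption.
  - intros tau tau' Ht Ht' E. apply inv_stereo_inj, PF in E. destruct (Hg u v H) as [G1 G2].
    destruct E as [E | [s [H1 H2]]].
    + apply (f_equal (ucoord (fst (g u v)) (snd (g u v)))) in E. rewrite !edge_pt_u in E. assumption.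
    + assert (D : forall t0, 0 <= t0 <= 1 -> tree V root s l (edge_pt (fst (g u v)) (snd (g u v)) t0) ->
          (t0 = 0 /\ s = u) \/ (t0 = 1 /\ s = v)).
      { intros t0 Ht0 Hs. destruct (Req_dec t0 0) as [-> | N0]; [left | destruct (Req_dec t0 1) as [-> | N1]; [right|]].
        - split; [reflexivity|]. rewrite edge_pt_0 in Hs.
          apply (tree_disjoint V root root_inj l HF _ _ _ Hs), fvert_tree, G1.
        - split; [reflexivity|]. rewrite edge_pt_1 in Hs.
          apply (tree_disjoint V root root_inj l HF _ _ _ Hs), fvert_tree, G2.
        - exfalso. apply (INT u v s t0 H); [lra | assumption]. }
      destruct (D _ Ht H1) as [[-> E1] | [-> E1]], (D _ Ht' H2) as [[-> E2] | [-> E2]]; try reflexivity;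
      exfalso; subst s; subst; exact (adj_irr _ H).
  - cbv beta. rewrite edge_pt_0. f_equal. apply PF. right. exists u.
    split; [apply fvert_tree, (Hg u v H) | constructor].
  - cbv beta. rewrite edge_pt_1. f_equal. apply PF. right. exists v.
    split; [apply fvert_tree, (Hg u v H) | constructor].
  - intros; apply inv_stereo_S2.
  - intros u v w tau H Ht E. apply inv_stereo_inj, PF in E. destruct E as [E | [s [H1 H2]]].
    + rewrite <- (edge_pt_0 (root w) Rt) in E.
      apply (INT u v w tau H Ht). rewrite E, edge_pt_0. constructor.
    + exact (INT u v s tau H Ht H1).
  - intros u v u' v' tau tau' H H' Ht Ht' E. apply inv_stereo_inj, PF in E.
    destruct E as [E | [s [H1 H2]]]; [|exfalso; exact (INT u v s tau H Ht H1)].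
    destruct (Hg u v H) as [G1 G2], (Hg u' v' H') as [G1' G2'].
    destruct (edge_pt_interior _ _ _ _ _ _ Ht (conj (Rlt_le _ _ (proj1 Ht')) (Rlt_le _ _ (proj2 Ht'))) E) as [[E1 E2] | [E1 E2]].
    + left. rewrite E1 in G1'. rewrite E2 in G2'. eauto.
    + right. rewrite E1 in G1'. rewrite E2 in G2'. eauto.
Qed.
End GridMinor.

(** * Finite chains on the sphere *)

Definition px (p : pt3) : R := fst (fst p).
Definition py (p : pt3) : R := snd (fst p).
Definition pz (p : pt3) : R := snd p.
Definition sqd (p q : pt3) : R := (px p - px q) ^ 2 + (py p - py q) ^ 2 + (pz p - pz q) ^ 2.

Lemma dist3_sqd p q : dist3 p q = sqrt (sqd p q).
Proof. destruct p as [[? ?] ?], q as [[? ?] ?]. reflexivity. Qed.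
Lemma sqd_ge0 p q : 0 <= sqd p q.
Proof. unfold sqd. pose proof (pow2_ge_0 (px p - px q)). pose proof (pow2_ge_0 (py p - py q)). pose proof (pow2_ge_0 (pz p - pz q)). lra. Qed.
Lemma dist3_sq p q : dist3 p q * dist3 p q = sqd p q.
Proof. rewrite dist3_sqd. apply sqrt_sqrt, sqd_ge0. Qed.
Lemma dist3_ge0 p q : 0 <= dist3 p q.
Proof. rewrite dist3_sqd. apply sqrt_pos. Qed.
Lemma dist3_le p q e : 0 <= e -> (dist3 p q <= e <-> sqd p q <= e * e).
Proof.
  intros He. rewrite <- dist3_sq. pose proof (dist3_ge0 p q). split; intros H0; [nra|].
  destruct (Rle_dec (dist3 p q) e); [assumption|nra].
Qed.
Lemma dist3_sym p q : dist3 p q = dist3 q p.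
Proof. rewrite !dist3_sqd. f_equal. unfold sqd. ring. Qed.
Lemma dist3_refl p : dist3 p p = 0.
Proof. rewrite dist3_sqd. replace (sqd p p) with 0 by (unfold sqd; ring). apply sqrt_0. Qed.

Lemma dist3_triangle p q r : dist3 p r <= dist3 p q + dist3 q r.
Proof.
  pose proof (dist3_ge0 p q) as A. pose proof (dist3_ge0 q r) as B.
  apply dist3_le; [lra|].
  pose proof (dist3_sq p q) as E1. pose proof (dist3_sq q r) as E2.
  set (a := dist3 p q) in *. set (b := dist3 q r) in *. clearbody a b.
  unfold sqd in *.
  set (x1 := px p - px q) in *. set (y1 := py p - py q) in *. set (z1 := pz p - pz q) in *.
  set (x2 := px q - px r) in *. set (y2 := py q - py r) in *. set (z2 := pz q - pz r) in *.
  replace (px p - px r) with (x1 + x2) by (unfold x1, x2; ring).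
  replace (py p - py r) with (y1 + y2) by (unfold y1, y2; ring).
  replace (pz p - pz r) with (z1 + z2) by (unfold z1, z2; ring).
  clearbody x1 y1 z1 x2 y2 z2.
  assert (C : (x1 * x2 + y1 * y2 + z1 * z2) <= a * b).
  { assert (C2 : (x1 * x2 + y1 * y2 + z1 * z2) ^ 2 <= (a * b) ^ 2).
    { replace ((a * b) ^ 2) with ((a * a) * (b * b)) by ring. rewrite E1, E2.
      pose proof (pow2_ge_0 (x1 * y2 - y1 * x2)). pose proof (pow2_ge_0 (x1 * z2 - z1 * x2)).
      pose proof (pow2_ge_0 (y1 * z2 - z1 * y2)). nra. }
    assert (0 <= a * b) by nra. nra. }
  nra.
Qed.

Lemma on_S2_eq p : on_S2 p <-> px p ^ 2 + py p ^ 2 + pz p ^ 2 = 1.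
Proof. destruct p as [[? ?] ?]. reflexivity. Qed.

Lemma quadratic_eventually a b c : a <> 0 \/ b <> 0 \/ c <> 0 ->
  exists K, forall k, K <= k -> a * k ^ 2 + b * k + c <> 0.
Proof.
  intros H. destruct (Req_dec a 0) as [Ha | Ha].
  - destruct (Req_dec b 0) as [Hb | Hb].
    + exists 0. intros k _. subst. destruct H as [H | [H | H]]; try lra.
    + exists (Rabs c / Rabs b + 1). intros k Hk. subst a.
      pose proof (Rabs_pos_lt b Hb) as Bp.
      assert (Rabs c < Rabs b * k).
      { apply (Rmult_le_compat_l (Rabs b)) in Hk; [|lra].
        replace (Rabs b * (Rabs c / Rabs b + 1)) with (Rabs c + Rabs b) in Hk by (field; lra). lra. }
      unfold Rabs in *. destruct (Rcase_abs b), (Rcase_abs c); nra.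
  - exists ((Rabs b + Rabs c) / Rabs a + 1). intros k Hk.
    pose proof (Rabs_pos_lt a Ha) as Ap. pose proof (Rabs_pos b) as Bp. pose proof (Rabs_pos c) as Cp.
    assert (H1 : Rabs b + Rabs c < Rabs a * k).
    { apply (Rmult_le_compat_l (Rabs a)) in Hk; [|lra].
      replace (Rabs a * ((Rabs b + Rabs c) / Rabs a + 1)) with (Rabs b + Rabs c + Rabs a) in Hk by (field; lra). lra. }
    assert (K1 : 1 <= k).
    { assert (0 <= (Rabs b + Rabs c) / Rabs a) by (apply Rle_mult_inv_pos; lra). lra. }
    assert (H2 : Rabs b * k + Rabs c * k < Rabs a * k ^ 2) by nra.
    intros E.
    assert (E' : Rabs a * k ^ 2 <= Rabs b * k + Rabs c).
    { rewrite <- (Rabs_pos_eq k) at 2 by lra. rewrite <- (Rabs_pos_eq (k ^ 2)) by nra.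
      rewrite <- !Rabs_mult. replace (a * k ^ 2) with (- (b * k + c)) by lra. rewrite Rabs_Ropp. apply Rabs_triang. }
    nra.
Qed.

(* [rot k] is the orthogonal map taking the point with parameter [k] of the latitude [z = 4/5] to the north pole. *)
Definition rot (k : R) (p : pt3) : pt3 :=
  let al := 3/5 * ((1 - k ^ 2) / (1 + k ^ 2)) in let be := 3/5 * (2 * k / (1 + k ^ 2)) in
  (5/3 * (al * py p - be * px p), - 4/3 * (al * px p + be * py p) + 3/5 * pz p, al * px p + be * py p + 4/5 * pz p).

Lemma rot_circle k : (3/5 * ((1 - k ^ 2) / (1 + k ^ 2))) ^ 2 + (3/5 * (2 * k / (1 + k ^ 2))) ^ 2 = 9/25.
Proof. assert (1 + k ^ 2 <> 0) by nra. field. assumption. Qed.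

Lemma rot_sqd k p q : sqd (rot k p) (rot k q) = sqd p q.
Proof.
  pose proof (rot_circle k) as E. unfold rot.
  set (al := 3/5 * _) in *. set (be := 3/5 * (2 * k / _)) in *. clearbody al be.
  unfold sqd, px, py, pz. simpl fst. simpl snd.
  set (x := fst (fst p) - fst (fst q)). set (y := snd (fst p) - snd (fst q)). set (z := snd p - snd q).
  transitivity ((25/9) * (al ^ 2 + be ^ 2) * (x ^ 2 + y ^ 2) + z ^ 2); [unfold x, y, z; field | rewrite E; field].
Qed.
Lemma rot_S2 k p : on_S2 p -> on_S2 (rot k p).
Proof.
  rewrite !on_S2_eq. intros H. pose proof (rot_sqd k p (0, 0, 0)) as E.
  unfold sqd in E. replace (rot k (0, 0, 0)) with ((0, 0, 0) : pt3) in E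
    by (unfold rot, px, py, pz; simpl; f_equal; [f_equal|]; ring).
  unfold px, py, pz in *. simpl fst in *. simpl snd in *. rewrite !Rminus_0_r in E. lra.
Qed.

Definition dot_rot (k : R) (n : pt3) : R := pz (rot k n).
Definition cross3 (p q : pt3) : pt3 :=
  (py p * pz q - pz p * py q, pz p * px q - px p * pz q, px p * py q - py p * px q).

(** Rotations commute with the cross product, and the left-hand side is the vertical coordinate of
    the cross product of the images. *)
Lemma rot_det k p q : px (rot k p) * py (rot k q) - py (rot k p) * px (rot k q) = dot_rot k (cross3 p q).
Proof.
  pose proof (rot_circle k) as E. unfold dot_rot, rot, cross3.
  set (al := 3/5 * _) in *. set (be := 3/5 * (2 * k / _)) in *. clearbody al be.
  unfold px, py, pz. simpl fst. simpl snd.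
  set (a := fst (fst p)). set (b := snd (fst p)). set (c := snd p).
  set (a' := fst (fst q)). set (b' := snd (fst q)). set (c' := snd q).
  transitivity (al * (b * c' - c * b') + be * (c * a' - a * c') + 20/9 * (al ^ 2 + be ^ 2) * (a * b' - b * a'));
    [field | rewrite E; field].
Qed.

(** After multiplication by [5 * (1 + k ^ 2)] this is a quadratic polynomial in [k]. It does not
    vanish identically because the latitude 4/5 is not a great circle and so lies in no plane
    through the origin. *)
Lemma dot_rot_eventually n : px n <> 0 \/ py n <> 0 \/ pz n <> 0 -> exists K, forall k, K <= k -> dot_rot k n <> 0.
Proof.
  intros H.
  destruct (quadratic_eventually (-3 * px n + 4 * pz n) (6 * py n) (3 * px n + 4 * pz n)) as [K HK].
  { destruct (Req_dec (-3 * px n + 4 * pz n) 0), (Req_dec (3 * px n + 4 * pz n) 0); auto.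
    right; left. destruct H as [H | [H | H]]; lra. }
  exists K. intros k Hk E. apply (HK k Hk).
  change (3/5 * ((1 - k ^ 2) / (1 + k ^ 2)) * px n + 3/5 * (2 * k / (1 + k ^ 2)) * py n + 4/5 * pz n = 0) in E.
  assert (P : 1 + k ^ 2 <> 0) by nra.
  transitivity (5 * (1 + k ^ 2) * 0); [|ring]. rewrite <- E. field. assumption.
Qed.

Lemma generic_rot (l : list pt3) : (forall n, In n l -> px n <> 0 \/ py n <> 0 \/ pz n <> 0) ->
  exists k, forall n, In n l -> dot_rot k n <> 0.
Proof.
  intros H. assert (E : exists K, forall k, K <= k -> forall n, In n l -> dot_rot k n <> 0).
  { induction l as [|n l IH]; [exists 0; intros ? ? ? [] |].
    destruct IH as [K1 H1]; [intros; apply H; right; assumption|].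
    destruct (dot_rot_eventually n) as [K2 H2]; [apply H; left; reflexivity|].
    exists (Rmax K1 K2). intros k Hk m [<- | Hm].
    - apply H2. eapply Rle_trans; [apply Rmax_r | exact Hk].
    - apply H1; [eapply Rle_trans; [apply Rmax_l | exact Hk] | assumption]. }
  destruct E as [K HK]. exists K. apply HK. lra.
Qed.

Definition stereo (p : pt3) : R * R := (px p / (1 - pz p), py p / (1 - pz p)).
Definition sq2 (a b : R * R) : R := (fst a - fst b) ^ 2 + (snd a - snd b) ^ 2.

Lemma stereo_sqd p q : on_S2 p -> on_S2 q -> pz p < 1 -> pz q < 1 ->
  sq2 (stereo p) (stereo q) = sqd p q / ((1 - pz p) * (1 - pz q)).
Proof.
  rewrite !on_S2_eq. intros Hp Hq H1 H2. unfold sq2, stereo, sqd; simpl fst; simpl snd.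
  set (a := px p) in *. set (b := py p) in *. set (c := pz p) in *.
  set (a' := px q) in *. set (b' := py q) in *. set (c' := pz q) in *. clearbody a b c a' b' c'.
  transitivity (((a ^ 2 + b ^ 2) * (1 - c') ^ 2 + (a' ^ 2 + b' ^ 2) * (1 - c) ^ 2
     - 2 * (a * a' + b * b') * (1 - c) * (1 - c')) / ((1 - c) ^ 2 * (1 - c') ^ 2)); [field; lra|].
  replace (a ^ 2 + b ^ 2) with (1 - c ^ 2) by lra. replace (a' ^ 2 + b' ^ 2) with (1 - c' ^ 2) by lra.
  replace ((a - a') ^ 2 + (b - b') ^ 2 + (c - c') ^ 2) with (2 - 2 * (a * a' + b * b' + c * c')).
  - field; lra.
  - transitivity ((a ^ 2 + b ^ 2 + c ^ 2) + (a' ^ 2 + b' ^ 2 + c' ^ 2) - 2 * (a * a' + b * b' + c * c')); [lra | ring].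
Qed.

(** Separation must be inherited by the plane: points that are apart on the sphere stay apart after
    projection. *)
Lemma stereo_expanding p q : on_S2 p -> on_S2 q -> pz p < 1 -> pz q < 1 -> sqd p q <= 4 * sq2 (stereo p) (stereo q).
Proof.
  intros Hp Hq H1 H2. rewrite stereo_sqd by assumption. pose proof (sqd_ge0 p q) as D.
  rewrite on_S2_eq in Hp, Hq.
  pose proof (pow2_ge_0 (px p)). pose proof (pow2_ge_0 (py p)). pose proof (pow2_ge_0 (px q)). pose proof (pow2_ge_0 (py q)).
  assert (0 < (1 - pz p) * (1 - pz q)) by nra.
  assert (A1 : -1 <= pz p) by nra. assert (A2 : -1 <= pz q) by nra.
  assert ((1 - pz p) * (1 - pz q) <= 4) by nra.
  apply (Rmult_le_reg_r ((1 - pz p) * (1 - pz q))); [assumption|].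
  replace (4 * (sqd p q / ((1 - pz p) * (1 - pz q))) * ((1 - pz p) * (1 - pz q))) with (4 * sqd p q) by (field; lra).
  nra.
Qed.

Lemma rot_dot k p q : px (rot k p) * px (rot k q) + py (rot k p) * py (rot k q) + pz (rot k p) * pz (rot k q)
  = px p * px q + py p * py q + pz p * pz q.
Proof.
  pose proof (rot_circle k) as E. unfold rot.
  set (al := 3/5 * _) in *. set (be := 3/5 * (2 * k / _)) in *. clearbody al be.
  unfold px, py, pz. simpl fst. simpl snd.
  set (x := fst (fst p)). set (y := snd (fst p)). set (z := snd p).
  set (x' := fst (fst q)). set (y' := snd (fst q)). set (z' := snd q).
  transitivity ((25/9) * (al ^ 2 + be ^ 2) * (x * x' + y * y') + z * z'); [field | rewrite E; field].
Qed.

Definition lerp (P Q : pt3) (t : R) : pt3 :=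
  ((1 - t) * px P + t * px Q, (1 - t) * py P + t * py Q, (1 - t) * pz P + t * pz Q).
Definition nsq (p : pt3) : R := px p ^ 2 + py p ^ 2 + pz p ^ 2.
Definition normalize (p : pt3) : pt3 := (px p / sqrt (nsq p), py p / sqrt (nsq p), pz p / sqrt (nsq p)).
Definition chord (P Q : pt3) (t : R) : pt3 := normalize (lerp P Q t).

Lemma nsq_normalize p : 0 < nsq p -> nsq (normalize p) = 1.
Proof.
  intros H. unfold normalize, nsq at 1, px, py, pz. simpl fst. simpl snd. fold (px p) (py p) (pz p).
  pose proof (sqrt_lt_R0 _ H) as S. pose proof (sqrt_sqrt _ (Rlt_le _ _ H)) as E.
  transitivity (nsq p / (sqrt (nsq p) * sqrt (nsq p))).
  - unfold nsq at 4. field. lra.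
  - rewrite E. field. lra.
Qed.

Lemma nsq_lerp P Q t : nsq P = 1 -> nsq Q = 1 -> nsq (lerp P Q t) = 1 - t * (1 - t) * sqd P Q.
Proof.
  intros HP HQ. unfold lerp, nsq, sqd, px, py, pz in *. simpl fst. simpl snd.
  set (a := fst (fst P)) in *. set (b := snd (fst P)) in *. set (c := snd P) in *.
  set (a' := fst (fst Q)) in *. set (b' := snd (fst Q)) in *. set (c' := snd Q) in *.
  transitivity ((1 - t) * (a ^ 2 + b ^ 2 + c ^ 2) + t * (a' ^ 2 + b' ^ 2 + c' ^ 2)
    - t * (1 - t) * ((a - a') ^ 2 + (b - b') ^ 2 + (c - c') ^ 2)); [ring | rewrite HP, HQ; ring].
Qed.

(** With the norms [m] and [n], the left-hand side is exactly [(sqd p q - (m - n) ^ 2) / (m * n)],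
    and [m * n] is at least 81/100. *)
Lemma sqd_normalize p q : 9/10 <= nsq p -> 9/10 <= nsq q -> sqd (normalize p) (normalize q) <= 2 * sqd p q.
Proof.
  intros Hp Hq. pose proof (sqd_ge0 p q) as D.
  pose proof (sqrt_lt_R0 (nsq p) ltac:(lra)) as S1. pose proof (sqrt_sqrt (nsq p) ltac:(lra)) as E1.
  pose proof (sqrt_lt_R0 (nsq q) ltac:(lra)) as S2. pose proof (sqrt_sqrt (nsq q) ltac:(lra)) as E2.
  set (m := sqrt (nsq p)) in *. set (n := sqrt (nsq q)) in *.
  assert (E : sqd (normalize p) (normalize q) = (sqd p q - (m - n) ^ 2) / (m * n)).
  { assert (Dp : px p * px q + py p * py q + pz p * pz q = (m * m + n * n - sqd p q) / 2).
    { rewrite E1, E2. unfold nsq, sqd. field. }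
    transitivity (nsq p / (m * m) + nsq q / (n * n) - 2 * (px p * px q + py p * py q + pz p * pz q) / (m * n)).
    - unfold normalize. fold m n. unfold sqd, nsq, px, py, pz. simpl fst. simpl snd. field. split; lra.
    - rewrite Dp, <- E1, <- E2. field. split; lra. }
  rewrite E. clearbody m n.
  assert (9/10 <= m) by nra. assert (9/10 <= n) by nra.
  assert (MN : 81/100 <= m * n) by nra.
  apply (Rmult_le_reg_r (m * n)); [lra|]. unfold Rdiv. rewrite Rmult_assoc, Rinv_l, Rmult_1_r by lra.
  pose proof (pow2_ge_0 (m - n)). set (s := sqd p q) in *. clearbody s. nra.
Qed.

Lemma chord_S2 P Q t : nsq P = 1 -> nsq Q = 1 -> sqd P Q <= 1/100 -> 0 <= t <= 1 ->
  9/10 <= nsq (lerp P Q t) /\ nsq (chord P Q t) = 1.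
Proof.
  intros HP HQ HD Ht. pose proof (sqd_ge0 P Q) as D.
  assert (A : 9/10 <= nsq (lerp P Q t)).
  { rewrite nsq_lerp by assumption. assert (0 <= t * (1 - t) <= 1) by nra.
    set (s := sqd P Q) in *. clearbody s. nra. }
  split; [assumption|]. apply nsq_normalize. lra.
Qed.

Lemma sqd_lerp P Q s t : sqd (lerp P Q s) (lerp P Q t) = (s - t) ^ 2 * sqd P Q.
Proof. unfold lerp, sqd, px, py, pz. simpl. ring. Qed.

Lemma chord_sqd P Q s t : nsq P = 1 -> nsq Q = 1 -> sqd P Q <= 1/100 -> 0 <= s <= 1 -> 0 <= t <= 1 ->
  sqd (chord P Q s) (chord P Q t) <= 2 * ((s - t) ^ 2 * sqd P Q).
Proof.
  intros HP HQ HD Hs Ht. rewrite <- sqd_lerp. apply sqd_normalize; apply chord_S2; assumption.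
Qed.

Lemma normalize_unit p : nsq p = 1 -> normalize p = p.
Proof.
  intros H. unfold normalize. rewrite H, sqrt_1. destruct p as [[a b] c]. unfold px, py, pz. simpl.
  f_equal; [f_equal|]; field.
Qed.
Lemma chord_0 P Q : nsq P = 1 -> chord P Q 0 = P.
Proof.
  intros H. unfold chord. replace (lerp P Q 0) with P; [apply normalize_unit, H|].
  unfold lerp, px, py, pz. destruct P as [[a b] c]. simpl. f_equal; [f_equal|]; ring.
Qed.
Lemma chord_1 P Q : nsq Q = 1 -> chord P Q 1 = Q.
Proof.
  intros H. unfold chord. replace (lerp P Q 1) with Q; [apply normalize_unit, H|].
  unfold lerp, px, py, pz. destruct Q as [[a b] c]. simpl. f_equal; [f_equal|]; ring.
Qed.

(* If the vertical projections of [P] and [Q] are linearly independent, the arc misses the north pole. *)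
Lemma chord_pole P Q t : nsq P = 1 -> nsq Q = 1 -> sqd P Q <= 1/100 -> 0 <= t <= 1 ->
  pz (chord P Q t) <= 1 - 50 * (px P * py Q - py P * px Q) ^ 2.
Proof.
  intros HP HQ HD Ht. destruct (chord_S2 P Q t HP HQ HD Ht) as [A B].
  pose proof (sqrt_lt_R0 (nsq (lerp P Q t)) ltac:(lra)) as S1.
  pose proof (sqrt_sqrt (nsq (lerp P Q t)) ltac:(lra)) as E1.
  assert (N1 : nsq (lerp P Q t) <= 1).
  { rewrite nsq_lerp by assumption. pose proof (sqd_ge0 P Q). assert (0 <= t * (1 - t)) by nra.
    set (s := sqd P Q) in *. clearbody s. nra. }
  set (M := lerp P Q t) in *.
  (* Since [M] lies on the segment, the determinant of [P] and [Q] is also that of [M] and [Q - P].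
     Cauchy-Schwarz with squared length at most 1/100 for [Q - P] gives the factor 100. *)
  assert (K : 100 * (px P * py Q - py P * px Q) ^ 2 <= px M ^ 2 + py M ^ 2).
  { replace (px P * py Q - py P * px Q) with (px M * (py Q - py P) - py M * (px Q - px P))
      by (unfold M, lerp, px, py; simpl; ring).
    set (u := py Q - py P). set (v := px Q - px P).
    assert (u ^ 2 + v ^ 2 <= 1/100).
    { unfold sqd in HD. pose proof (pow2_ge_0 (pz P - pz Q)). unfold u, v.
      replace (_ + _) with ((px P - px Q) ^ 2 + (py P - py Q) ^ 2) by ring. lra. }
    clearbody u v. set (x := px M). set (y := py M). clearbody x y.
    assert ((x * u - y * v) ^ 2 <= (x ^ 2 + y ^ 2) * (u ^ 2 + v ^ 2)) by (pose proof (pow2_ge_0 (x * v + y * u)); nra).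
    pose proof (pow2_ge_0 x). pose proof (pow2_ge_0 y). nra. }
  set (m := sqrt (nsq M)) in *.
  assert (Z : px (chord P Q t) ^ 2 + py (chord P Q t) ^ 2 >= px M ^ 2 + py M ^ 2).
  { change (px (chord P Q t)) with (px M / m). change (py (chord P Q t)) with (py M / m).
    replace ((px M / m) ^ 2 + (py M / m) ^ 2) with ((px M ^ 2 + py M ^ 2) / (m * m)) by (field; lra).
    rewrite E1. apply Rle_ge. apply (Rmult_le_reg_r (nsq M)); [lra|].
    unfold Rdiv. rewrite Rmult_assoc, Rinv_l by lra.
    pose proof (pow2_ge_0 (px M)). pose proof (pow2_ge_0 (py M)). nra. }
  unfold nsq in B. set (z := pz (chord P Q t)) in *. set (w := px P * py Q - py P * px Q) in *.
  set (xx := px (chord P Q t) ^ 2) in *. set (yy := py (chord P Q t) ^ 2) in *.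
  clearbody z w xx yy. pose proof (pow2_ge_0 w).
  assert (z ^ 2 <= 1 - 100 * w ^ 2) by lra. nra.
Qed.

Lemma chord_stereo P Q s t : nsq P = 1 -> nsq Q = 1 -> sqd P Q <= 1/100 -> 0 <= s <= 1 -> 0 <= t <= 1 ->
  let w := px P * py Q - py P * px Q in w <> 0 ->
  sq2 (stereo (chord P Q s)) (stereo (chord P Q t)) <= ((s - t) / w ^ 2) ^ 2.
Proof.
  intros HP HQ HD Hs Ht w Hw.
  pose proof (chord_pole P Q s HP HQ HD Hs) as K1. pose proof (chord_pole P Q t HP HQ HD Ht) as K2. fold w in K1, K2.
  pose proof (chord_sqd P Q s t HP HQ HD Hs Ht) as K3.
  assert (W : 0 < w ^ 2) by (pose proof (pow2_ge_0 w); assert (w ^ 2 <> 0) by (apply pow_nonzero; assumption); lra).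
  rewrite stereo_sqd; [| apply on_S2_eq; apply chord_S2; assumption | apply on_S2_eq; apply chord_S2; assumption | lra | lra].
  set (a := 1 - pz (chord P Q s)) in *. set (b := 1 - pz (chord P Q t)) in *.
  assert (Ha : w ^ 2 <= a) by (unfold a; lra). assert (Hb : w ^ 2 <= b) by (unfold b; lra).
  set (S := sqd (chord P Q s) (chord P Q t)) in *. clearbody a b S. set (W2 := w ^ 2) in *. clearbody W2.
  assert (S <= (s - t) ^ 2) by (pose proof (pow2_ge_0 (s - t)); set (r := (s - t) ^ 2) in *; set (q := sqd P Q) in *; clearbody r q; nra).
  assert (AB : W2 * W2 <= a * b) by nra.
  replace (((s - t) / W2) ^ 2) with ((s - t) ^ 2 / (W2 * W2)) by (field; lra).
  apply (Rmult_le_reg_r (a * b)); [nra|]. unfold Rdiv at 1. rewrite Rmult_assoc, Rinv_l by nra.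
  apply (Rmult_le_reg_r (W2 * W2)); [nra|].
  replace ((s - t) ^ 2 / (W2 * W2) * (a * b) * (W2 * W2)) with ((s - t) ^ 2 * (a * b)) by (field; lra).
  pose proof (pow2_ge_0 (s - t)). set (r := (s - t) ^ 2) in *. clearbody r. set (ab := a * b) in *. clearbody ab.
  assert (0 <= W2 * W2) by nra. set (ww := W2 * W2) in *. clearbody ww. nra.
Qed.

Definition rnd (lam : R) (p : pt3) : Z * Z :=
  (Int_part (lam * fst (stereo p)), Int_part (lam * snd (stereo p))).
(** The tolerance 2 is 1 for rounding and 1 for the short walk between two rounded points. *)
Definition nearv (lam : R) (p : pt3) (v : Z * Z) : Prop :=
  Rabs (IZR (fst v) - lam * fst (stereo p)) <= 2 /\ Rabs (IZR (snd v) - lam * snd (stereo p)) <= 2.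

Lemma walk_end_app p w w' : walk_end p (w ++ w') = walk_end (walk_end p w) w'.
Proof. revert p; induction w as [|d w IH]; intros p; simpl; [reflexivity | apply IH]. Qed.
Lemma verts_app p w w' v : In v (verts p (w ++ w')) -> In v (verts p w) \/ In v (verts (walk_end p w) w').
Proof.
  revert p; induction w as [|d w IH]; intros p; simpl; [auto|]. intros [H | H]; [auto|].
  destruct (IH _ H); auto.
Qed.

Lemma walk_between p q : (Z.abs (fst p - fst q) <= 1 -> Z.abs (snd p - snd q) <= 1 ->
  exists w, walk_end p w = q /\ forall v, In v (verts p w) -> Z.abs (fst v - fst p) <= 1 /\ Z.abs (snd v - snd p) <= 1)%Z.
Proof.
  destruct p as [x y], q as [a b]; simpl. intros H1 H2.
  assert (C : exists w1, walk_end (x, y) w1 = (a, y) /\ (w1 = [] \/ exists d, w1 = [d])).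
  { assert (a = x \/ a = x + 1 \/ a = x - 1)%Z as [-> | [-> | ->]] by lia.
    - exists []; auto. - exists [Rt]; eauto. - exists [Lt]; eauto. }
  assert (D : exists w1, walk_end (a, y) w1 = (a, b) /\ (w1 = [] \/ exists d, w1 = [d])).
  { assert (b = y \/ b = y + 1 \/ b = y - 1)%Z as [-> | [-> | ->]] by lia.
    - exists []; auto. - exists [Up]; eauto. - exists [Dn]; eauto. }
  destruct C as [w1 [E1 F1]], D as [w2 [E2 F2]].
  exists (w1 ++ w2). split; [rewrite walk_end_app, E1; exact E2|].
  intros v Hv. apply verts_app in Hv. rewrite E1 in Hv.
  destruct F1 as [-> | [d1 ->]], F2 as [-> | [d2 ->]]; simpl in *; rewrite ?E1, ?E2 in Hv;
  repeat match goal with H : _ \/ _ |- _ => destruct H | H : False |- _ => destruct H end; subst; simpl; lia.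
Qed.

Lemma Int_part_near x : Rabs (IZR (Int_part x) - x) <= 1.
Proof. destruct (base_Int_part x) as [H1 H2]. unfold Rabs; destruct (Rcase_abs _); lra. Qed.
Lemma Int_part_close x y : Rabs (x - y) <= 1 -> (Z.abs (Int_part x - Int_part y) <= 1)%Z.
Proof.
  intros H. destruct (base_Int_part x) as [H1 H2], (base_Int_part y) as [H3 H4].
  assert (A : IZR (Int_part x) < IZR (Int_part y + 2)) by (rewrite plus_IZR; unfold Rabs in H; destruct (Rcase_abs _); lra).
  assert (B : IZR (Int_part y) < IZR (Int_part x + 2)) by (rewrite plus_IZR; unfold Rabs in H; destruct (Rcase_abs _); lra).
  apply lt_IZR in A, B. lia.
Qed.

Lemma rnd_walk lam p q : 0 < lam -> lam ^ 2 * sq2 (stereo p) (stereo q) <= 1 ->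
  exists w, walk_end (rnd lam p) w = rnd lam q /\ forall v, In v (verts (rnd lam p) w) -> nearv lam p v.
Proof.
  intros Hl H. unfold sq2 in H.
  set (a := fst (stereo p)) in *. set (b := snd (stereo p)) in *. set (a' := fst (stereo q)) in *. set (b' := snd (stereo q)) in *.
  assert (A : Rabs (lam * a - lam * a') <= 1).
  { pose proof (pow2_ge_0 (lam * (b - b'))).
    assert ((lam * a - lam * a') ^ 2 <= 1) by (replace ((lam * a - lam * a') ^ 2) with (lam ^ 2 * ((a - a') ^ 2 + (b - b') ^ 2) - (lam * (b - b')) ^ 2) by ring; lra).
    unfold Rabs; destruct (Rcase_abs _); nra. }
  assert (B : Rabs (lam * b - lam * b') <= 1).
  { pose proof (pow2_ge_0 (lam * (a - a'))).
    assert ((lam * b - lam * b') ^ 2 <= 1) by (replace ((lam * b - lam * b') ^ 2) with (lam ^ 2 * ((a - a') ^ 2 + (b - b') ^ 2) - (lam * (a - a')) ^ 2) by ring; lra).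
    unfold Rabs; destruct (Rcase_abs _); nra. }
  destruct (walk_between (rnd lam p) (rnd lam q)) as [w [E W]]; [apply Int_part_close, A | apply Int_part_close, B |].
  exists w. split; [assumption|]. intros v Hv. destruct (W v Hv) as [V1 V2]. unfold rnd in V1, V2. simpl in V1, V2.
  apply IZR_le in V1, V2. rewrite abs_IZR, minus_IZR in V1, V2.
  pose proof (Int_part_near (lam * fst (stereo p))) as N1. pose proof (Int_part_near (lam * snd (stereo p))) as N2.
  assert (T : forall x y z, Rabs (x - y) <= 1 -> Rabs (y - z) <= 1 -> Rabs (x - z) <= 2).
  { intros x y z Hx Hy. replace (x - z) with ((x - y) + (y - z)) by ring.
    eapply Rle_trans; [apply Rabs_triang | lra]. }
  split; eapply T; eassumption.
Qed.

Definition pole_free (P Q : pt3) : Prop := P = Q \/ px P * py Q - py P * px Q <> 0.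

Lemma chord_walk lam P Q : 0 < lam -> nsq P = 1 -> nsq Q = 1 -> pz P < 1 -> sqd P Q <= 1/100 -> pole_free P Q ->
  exists w, walk_end (rnd lam P) w = rnd lam Q /\ forall v, In v (verts (rnd lam P) w) ->
    exists X, nsq X = 1 /\ pz X < 1 /\ sqd P X <= 4 * sqd P Q /\ nearv lam X v.
Proof.
  intros Hl HP HQ HzP HD [<- | Hw].
  - exists []. split; [reflexivity|]. intros v [<- | []]. exists P.
    pose proof (sqd_ge0 P P). repeat split; try assumption; try lra.
    + eapply Rle_trans; [apply Int_part_near | lra].
    + eapply Rle_trans; [apply Int_part_near | lra].
  - set (w0 := px P * py Q - py P * px Q) in *.
    assert (W : 0 < w0 ^ 2) by (pose proof (pow2_ge_0 w0); assert (w0 ^ 2 <> 0) by (apply pow_nonzero; assumption); lra).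
    (* By [chord_stereo] the scaled projected arc has speed at most [lam / w0 ^ 2], so each of [K]
       equal steps moves it by at most 1. *)
    destruct (INR_unbounded (lam / w0 ^ 2)) as [K HK].
    assert (K0 : 0 < INR K) by (eapply Rlt_trans; [apply (Rdiv_lt_0_compat lam (w0 ^ 2)); assumption | exact HK]).
    assert (T : forall j, (j <= K)%nat -> 0 <= INR j / INR K <= 1).
    { intros j Hj. apply le_INR in Hj. pose proof (pos_INR j). split.
      - apply Rle_mult_inv_pos; assumption.
      - apply (Rmult_le_reg_r (INR K)); [assumption|]. unfold Rdiv. rewrite Rmult_assoc, Rinv_l; lra. }
    assert (Z : forall t, 0 <= t <= 1 -> nsq (chord P Q t) = 1 /\ pz (chord P Q t) < 1 /\ sqd P (chord P Q t) <= 4 * sqd P Q).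
    { intros t Ht. split; [apply chord_S2; assumption | split].
      - pose proof (chord_pole P Q t HP HQ HD Ht) as C. fold w0 in C. lra.
      - pose proof (chord_sqd P Q 0 t HP HQ HD ltac:(lra) Ht) as C. rewrite chord_0 in C by assumption.
        pose proof (sqd_ge0 P Q). set (q := sqd P Q) in *. set (q' := sqd P (chord P Q t)) in *. clearbody q q'.
        assert ((0 - t) ^ 2 <= 1) by nra. nra. }
    assert (S : forall j, (j <= K)%nat -> exists w, walk_end (rnd lam P) w = rnd lam (chord P Q (INR j / INR K)) /\
       forall v, In v (verts (rnd lam P) w) -> exists t, 0 <= t <= 1 /\ nearv lam (chord P Q t) v).
    { induction j as [|j IH]; intros Hj.
      - exists []. replace (INR 0 / INR K) with 0 by (simpl; field; lra). rewrite chord_0 by assumption.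
        split; [reflexivity|]. intros v [<- | []]. exists 0. rewrite chord_0 by assumption. split; [lra|].
        split; (eapply Rle_trans; [apply Int_part_near | lra]).
      - destruct IH as [w [E1 E2]]; [lia|].
        destruct (rnd_walk lam (chord P Q (INR j / INR K)) (chord P Q (INR (S j) / INR K)) Hl) as [w' [E3 E4]].
        + pose proof (chord_stereo P Q (INR j / INR K) (INR (S j) / INR K) HP HQ HD (T j ltac:(lia)) (T (S j) Hj)) as C.
          cbv zeta in C. fold w0 in C. specialize (C Hw).
          replace (INR j / INR K - INR (S j) / INR K) with (- (1 / INR K)) in C by (rewrite S_INR; field; lra).
          assert (B : lam ^ 2 * (- (1 / INR K) / w0 ^ 2) ^ 2 <= 1).
          { replace (lam ^ 2 * (- (1 / INR K) / w0 ^ 2) ^ 2) with ((lam / w0 ^ 2 / INR K) ^ 2) by (field; split; first [assumption | apply Rgt_not_eq; lra]).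
            assert (0 < lam / w0 ^ 2) by (apply Rdiv_lt_0_compat; assumption).
            assert (0 <= lam / w0 ^ 2 / INR K <= 1).
            { split; [apply Rle_mult_inv_pos; lra|]. apply (Rmult_le_reg_r (INR K)); [assumption|].
              unfold Rdiv at 1. rewrite Rmult_assoc, Rinv_l; lra. }
            nra. }
          assert (0 <= lam ^ 2) by apply pow2_ge_0. nra.
        + exists (w ++ w'). rewrite walk_end_app, E1. split; [assumption|].
          intros v Hv. apply verts_app in Hv. rewrite E1 in Hv. destruct Hv as [Hv | Hv]; [auto|].
          exists (INR j / INR K). split; [apply T; lia | auto]. }
    destruct (S K (le_n K)) as [w [E1 E2]]. replace (INR K / INR K) with 1 in E1 by (field; lra).
    rewrite chord_1 in E1 by assumption. exists w. split; [assumption|]. intros v Hv.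
    destruct (E2 v Hv) as [t [Ht Hn]]. exists (chord P Q t). destruct (Z t Ht) as [Z1 [Z2 Z3]]. auto.
Qed.

Fixpoint chain (del : R) (p : pt3) (l : list pt3) : Prop :=
  on_S2 p /\ match l with [] => True | q :: l' => dist3 p q <= del /\ chain del q l' end.
Definition perp (p : pt3) : pt3 :=
  if excluded_middle_informative (px p = 0 /\ py p = 0) then (1, 0, 0) else (py p, - px p, 0).
(** Vectors that must not be orthogonal to the new pole: [perp p] keeps the pole away from [p], and
    [cross3 p q] keeps it off the great circle through [p] and [q]. *)
Fixpoint normals (p : pt3) (l : list pt3) : list pt3 :=
  perp p ::
  match l with [] => [] | q :: l' => cross3 p q :: normals q l' end.

Lemma perp_neq0 p : px (perp p) <> 0 \/ py (perp p) <> 0 \/ pz (perp p) <> 0.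
Proof.
  unfold perp. destruct (excluded_middle_informative _) as [[F1 F2] | E]; unfold px, py, pz in *; simpl; [left; lra|].
  destruct (Req_dec (snd (fst p)) 0); [right; left; intros E'; apply E; split; lra | left; assumption].
Qed.

Lemma sq_cross p q : nsq p = 1 -> nsq q = 1 ->
  px (cross3 p q) ^ 2 + py (cross3 p q) ^ 2 + pz (cross3 p q) ^ 2 = sqd p q * (1 - sqd p q / 4).
Proof.
  intros Hp Hq.
  assert (E : px p * px q + py p * py q + pz p * pz q = 1 - sqd p q / 2).
  { transitivity ((nsq p + nsq q - sqd p q) / 2); [unfold nsq, sqd; field | rewrite Hp, Hq; field]. }
  transitivity (nsq p * nsq q - (px p * px q + py p * py q + pz p * pz q) ^ 2).
  - unfold nsq, cross3, px, py, pz. simpl. ring.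
  - rewrite E, Hp, Hq. field.
Qed.

Lemma sqd_0 p q : sqd p q = 0 -> p = q.
Proof.
  unfold sqd. destruct p as [[a b] c], q as [[a' b'] c']. unfold px, py, pz; simpl fst; simpl snd. intros H.
  pose proof (pow2_ge_0 (a - a')). pose proof (pow2_ge_0 (b - b')). pose proof (pow2_ge_0 (c - c')).
  assert (a = a') by nra. assert (b = b') by nra. assert (c = c') by nra. subst. reflexivity.
Qed.

Lemma rot_pole k p : on_S2 p -> dot_rot k (perp p) <> 0 ->
  pz (rot k p) < 1.
Proof.
  intros Hp. set (n := perp p).
  assert (Hn : px n * px p + py n * py p + pz n * pz p = 0).
  { unfold n, perp. destruct (excluded_middle_informative _) as [[E1 E2] | _]; unfold px, py, pz in *; simpl.
    - rewrite E1. ring. - ring. }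
  intros H. pose proof (rot_S2 k p Hp) as S. rewrite on_S2_eq in S.
  destruct (Rlt_le_dec (pz (rot k p)) 1) as [L | L]; [assumption|]. exfalso.
  pose proof (pow2_ge_0 (px (rot k p))). pose proof (pow2_ge_0 (py (rot k p))).
  assert (E1 : px (rot k p) = 0) by nra. assert (E2 : py (rot k p) = 0) by nra.
  assert (E3 : pz (rot k p) <> 0) by lra.
  pose proof (rot_dot k n p) as D. rewrite Hn, E1, E2 in D.
  apply E3. unfold dot_rot in H. apply (Rmult_eq_reg_l (pz (rot k n))); [lra | assumption].
Qed.

Lemma last_cons (A : Type) (l : list A) (p q : A) : last (q :: l) p = last l q.
Proof. revert q; induction l as [|a l IH]; intros q; [reflexivity|]. simpl in *. destruct l; [reflexivity | apply (IH q)]. Qed.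

Lemma chain_hd_S2 del p l : chain del p l -> on_S2 p.
Proof. destruct l; simpl; tauto. Qed.

Lemma chain_walk (k lam del : R) : 0 < lam -> 0 < del <= 1/10 -> forall l p, chain del p l ->
  (forall n, In n (normals p l) -> (px n <> 0 \/ py n <> 0 \/ pz n <> 0) -> dot_rot k n <> 0) ->
  exists w, walk_end (rnd lam (rot k p)) w = rnd lam (rot k (last l p)) /\
    forall v, In v (verts (rnd lam (rot k p)) w) ->
    exists X q, In q (p :: l) /\ nsq X = 1 /\ pz X < 1 /\ dist3 (rot k q) X <= 2 * del /\ nearv lam X v.
Proof.
  intros Hl Hd. induction l as [|q l IH]; intros p HC HN.
  - assert (Hp : on_S2 p) by (eapply chain_hd_S2; exact HC).
    assert (HzP : pz (rot k p) < 1).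
    { apply rot_pole; [assumption|]. apply HN; [left; reflexivity|].
      apply perp_neq0. }
    exists []. split; [reflexivity|]. intros v [<- | []]. exists (rot k p), p.
    split; [left; reflexivity|]. split; [apply on_S2_eq, rot_S2, Hp|]. split; [assumption|].
    split; [rewrite dist3_refl; lra|]. split; (eapply Rle_trans; [apply Int_part_near | lra]).
  - destruct HC as [Hp [Hpq HC]]. pose proof (chain_hd_S2 _ _ _ HC) as Hq.
    destruct (IH q HC) as [w' [E1 E2]]; [intros n Hn; apply HN; right; right; assumption|].
    assert (HzP : pz (rot k p) < 1).
    { apply rot_pole; [assumption|]. apply HN; [left; reflexivity|].
      apply perp_neq0. }
    assert (NP : nsq (rot k p) = 1) by (apply on_S2_eq, rot_S2, Hp).
    assert (NQ : nsq (rot k q) = 1) by (apply on_S2_eq, rot_S2, Hq).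
    assert (D : sqd p q <= del * del) by (apply dist3_le; [lra | assumption]).
    destruct (chord_walk lam (rot k p) (rot k q)) as [w [E3 E4]]; try assumption.
    + rewrite rot_sqd. nra.
    (* A vanishing cross product means equal or antipodal points, and short steps exclude the
       latter. *)
    + destruct (classic (px (cross3 p q) <> 0 \/ py (cross3 p q) <> 0 \/ pz (cross3 p q) <> 0)) as [C | C].
      * right. rewrite rot_det. apply HN; [right; left; reflexivity | assumption].
      * left. f_equal. apply sqd_0. apply on_S2_eq in Hp, Hq. pose proof (sq_cross p q Hp Hq) as SC.
        assert (C1 : px (cross3 p q) = 0) by tauto || (apply NNPP; tauto).
        assert (C2 : py (cross3 p q) = 0) by (apply NNPP; tauto).
        assert (C3 : pz (cross3 p q) = 0) by (apply NNPP; tauto).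
        rewrite C1, C2, C3 in SC. pose proof (sqd_ge0 p q). set (s := sqd p q) in *. clearbody s.
        assert (del * del <= 1/100) by nra.
        destruct (Req_dec s 0) as [|N]; [assumption | exfalso]. assert (0 < s) by lra.
        assert (0 < s * (1 - s / 4)) by (apply Rmult_lt_0_compat; lra). lra.
    + exists (w ++ w'). rewrite walk_end_app, E3. split; [rewrite E1, last_cons; reflexivity|].
      intros v Hv. apply verts_app in Hv. rewrite E3 in Hv. destruct Hv as [Hv | Hv].
      * destruct (E4 v Hv) as [X [X1 [X2 [X3 X4]]]]. exists X, p. split; [left; reflexivity|].
        repeat split; try assumption; try apply X4. apply dist3_le; [lra|]. rewrite rot_sqd in X3.
        replace (2 * del * (2 * del)) with (4 * (del * del)) by ring. lra.
      * destruct (E2 v Hv) as [X [q' [X1 X2]]]. exists X, q'. split; [right; exact X1 | exact X2].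
Qed.

Lemma rot_dist k p q : dist3 (rot k p) (rot k q) = dist3 p q.
Proof. rewrite !dist3_sqd, rot_sqd. reflexivity. Qed.

(** One rotation, generic for the finitely many normals of all chains, and one scale serve all
    chains, so that chains with a common endpoint yield walks with a common endpoint. *)
Lemma sphere_chains_to_grid (I : Type) (Il : list I) (hd : I -> pt3) (tl : I -> list pt3) (del : I -> R) :
  (forall i, In i Il) -> (forall i, 0 < del i <= 1/10) -> (forall i, chain (del i) (hd i) (tl i)) ->
  exists (phi : pt3 -> Z * Z) (w : I -> list dir),
    (forall i, walk_end (phi (hd i)) (w i) = phi (last (tl i) (hd i))) /\
    (forall i j, (forall p q, In p (hd i :: tl i) -> In q (hd j :: tl j) -> 4 * (del i + del j) <= dist3 p q) ->
       forall v, In v (verts (phi (hd i)) (w i)) -> In v (verts (phi (hd j)) (w j)) -> False).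
Proof.
  intros HI Hd HC.
  pose (ns := flat_map (fun i => normals (hd i) (tl i)) Il).
  pose (nz := fun n => px n <> 0 \/ py n <> 0 \/ pz n <> 0).
  pose (dec := fun n => if excluded_middle_informative (nz n) then true else false).
  destruct (generic_rot (filter dec ns)) as [k Hk].
  { intros n Hn. apply filter_In in Hn as [_ Hn]. unfold dec in Hn.
    destruct (excluded_middle_informative (nz n)); [assumption | discriminate]. }
  assert (Hk' : forall i n, In n (normals (hd i) (tl i)) -> nz n -> dot_rot k n <> 0).
  { intros i n Hn Hz. apply Hk, filter_In. split.
    - apply in_flat_map. exists i; auto.
    - unfold dec. destruct (excluded_middle_informative (nz n)); tauto. }
  assert (M : exists mu, 0 < mu /\ forall i, mu <= del i).
  { assert (M : forall l : list I, exists mu, 0 < mu /\ forall i, In i l -> mu <= del i).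
    { induction l as [|i l [mu [M1 M2]]]; [exists 1; split; [lra | intros ? []]|].
      exists (Rmin mu (del i)). destruct (Hd i). split; [apply Rmin_glb_lt; assumption|].
      intros j [<- | Hj]; [apply Rmin_r | eapply Rle_trans; [apply Rmin_l | auto]]. }
    destruct (M Il) as [mu [M1 M2]]. exists mu. split; auto. }
  destruct M as [mu [M1 M2]].
  (* Points at distance at least [4 * mu] project to distance at least [2 * mu], hence 20 after
     scaling, whereas walks through a common grid point allow only 4 in each coordinate. *)
  pose (lam := 10 / mu). assert (L : 0 < lam) by (apply Rdiv_lt_0_compat; lra).
  pose (phi := fun p => rnd lam (rot k p)).
  assert (W : forall i, exists w, walk_end (phi (hd i)) w = phi (last (tl i) (hd i)) /\
     forall v, In v (verts (phi (hd i)) w) -> exists X q, In q (hd i :: tl i) /\ nsq X = 1 /\ pz X < 1 /\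
       dist3 (rot k q) X <= 2 * del i /\ nearv lam X v).
  { intros i. apply (chain_walk k lam (del i)); auto. intros n. apply Hk'. }
  assert (W' : exists w : I -> list dir, forall i, walk_end (phi (hd i)) (w i) = phi (last (tl i) (hd i)) /\
     forall v, In v (verts (phi (hd i)) (w i)) -> exists X q, In q (hd i :: tl i) /\ nsq X = 1 /\ pz X < 1 /\
       dist3 (rot k q) X <= 2 * del i /\ nearv lam X v).
  { exists (fun i => proj1_sig (constructive_indefinite_description _ (W i))).
    intros i. exact (proj2_sig (constructive_indefinite_description _ (W i))). }
  destruct W' as [w Hw]. exists phi, w. split; [intros i; apply Hw|].
  intros i j Hij v Hi Hj. destruct (Hw i) as [_ H1], (Hw j) as [_ H2].
    destruct (H1 v Hi) as [X [p [Xp [X1 [X2 [X3 [X4 X5]]]]]]].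
    destruct (H2 v Hj) as [Y [q [Yq [Y1 [Y2 [Y3 [Y4 Y5]]]]]]].
    pose proof (Hij p q Xp Yq) as D. rewrite <- (rot_dist k) in D.
    assert (D2 : 4 * mu <= dist3 X Y).
    { pose proof (dist3_triangle (rot k p) X (rot k q)). pose proof (dist3_triangle X Y (rot k q)).
      rewrite (dist3_sym Y (rot k q)) in *. pose proof (M2 i). pose proof (M2 j). lra. }
    assert (D3 : 16 * mu ^ 2 <= sqd X Y).
    { rewrite <- dist3_sq. nra. }
    assert (D4 : 4 * mu ^ 2 <= sq2 (stereo X) (stereo Y)).
    { apply on_S2_eq in X1, Y1. pose proof (stereo_expanding X Y X1 Y1 X2 Y2). lra. }
    assert (D5 : 400 <= lam ^ 2 * sq2 (stereo X) (stereo Y)).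
    { assert (E : lam * mu = 10) by (unfold lam; field; lra).
      assert (lam ^ 2 * (4 * mu ^ 2) = 400) by (replace (lam ^ 2 * (4 * mu ^ 2)) with (4 * (lam * mu) ^ 2) by ring; rewrite E; ring).
      assert (0 <= lam ^ 2) by apply pow2_ge_0. nra. }
    unfold sq2 in D5. set (a := fst (stereo X)) in *. set (b := snd (stereo X)) in *.
    set (a' := fst (stereo Y)) in *. set (b' := snd (stereo Y)) in *.
    assert (A : Rabs (lam * a - lam * a') <= 4).
    { replace (lam * a - lam * a') with (- (IZR (fst v) - lam * a) + (IZR (fst v) - lam * a')) by ring.
      eapply Rle_trans; [apply Rabs_triang|]. rewrite Rabs_Ropp. lra. }
    assert (B : Rabs (lam * b - lam * b') <= 4).
    { replace (lam * b - lam * b') with (- (IZR (snd v) - lam * b) + (IZR (snd v) - lam * b')) by ring.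
      eapply Rle_trans; [apply Rabs_triang|]. rewrite Rabs_Ropp. lra. }
    assert (A2 : (lam * a - lam * a') ^ 2 <= 16) by (rewrite <- pow2_abs; pose proof (Rabs_pos (lam * a - lam * a')); nra).
    assert (B2 : (lam * b - lam * b') ^ 2 <= 16) by (rewrite <- pow2_abs; pose proof (Rabs_pos (lam * b - lam * b')); nra).
    replace (lam ^ 2 * ((a - a') ^ 2 + (b - b') ^ 2)) with ((lam * a - lam * a') ^ 2 + (lam * b - lam * b') ^ 2) in D5 by ring.
    lra.
Qed.

Lemma K33_not_in_sphere (o q : tri -> pt3) (l : tri -> tri -> list pt3) (del : R) :
  0 < del <= 1/10 -> (forall h i, chain del (o h) (l h i)) -> (forall h i, last (l h i) (o h) = q i) ->
  (forall h k i j a b, h <> k -> i <> j -> In a (o h :: l h i) -> In b (o k :: l k j) -> 8 * del <= dist3 a b) -> False.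
Proof.
  intros Hd HC HL HA.
  destruct (sphere_chains_to_grid (tri * tri) (list_prod [T0; T1; T2] [T0; T1; T2])
    (fun x => o (fst x)) (fun x => l (fst x) (snd x)) (fun _ => del)) as [phi [w [H1 H2]]].
  - intros [h i]. apply in_prod; [destruct h | destruct i]; simpl; auto.
  - intros _; assumption.
  - intros [h i]; apply HC.
  - apply (K33_not_in_grid (fun h => phi (o h)) (fun i => phi (q i)) (fun h i => w (h, i))).
    + intros h i. pose proof (H1 (h, i)) as E. simpl in E. rewrite HL in E. exact E.
    + intros h k i j v Hhk Hij. apply (H2 (h, i) (k, j)). simpl. intros a b Ha Hb.
      replace (4 * (del + del)) with (8 * del) by ring. apply (HA h k i j); assumption.
Qed.

Close Scope R_scope.

(** * Right-angled Coxeter groups *)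

Section Coxeter.
Context {V : Type} (adj : V -> V -> Prop).

(** Elements are the equivalence classes themselves, so that equality in the group is Leibniz
    equality. *)
Definition racg : Type := { P : list V -> Prop | exists w, P = word_eq adj w }.
Definition cls (w : list V) : racg := exist _ (word_eq adj w) (ex_intro _ w eq_refl).

Lemma cls_eq w w' : cls w = cls w' <-> word_eq adj w w'.
Proof.
  split.
  - intros H. apply (f_equal (@proj1_sig _ _)) in H. simpl in H. rewrite H. apply rst_refl.
  - intros H. apply eq_sig_hprop; [intros; apply proof_irrelevance|]. simpl.
    apply functional_extensionality. intros x. apply propositional_extensionality. split; intros K.
    + eapply rst_trans; [apply rst_sym; exact H | exact K].
    + eapply rst_trans; [exact H | exact K].
Qed.
Lemma cls_surj (g : racg) : exists w, cls w = g.
Proof. destruct g as [P [w ->]]. exists w. reflexivity. Qed.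
Definition rep (g : racg) : list V := epsilon (inhabits []) (fun w => cls w = g).
Lemma cls_rep g : cls (rep g) = g.
Proof. unfold rep. exact (epsilon_spec (inhabits []) (fun w => cls w = g) (cls_surj g)). Qed.

Lemma word_eq_inv {A : Type} (f : list V -> A) :
  (forall w w', racg_step adj w w' -> f w = f w') -> forall w w', word_eq adj w w' -> f w = f w'.
Proof. intros H w w'. induction 1; auto. congruence. Qed.
Lemma word_eq_map (f : list V -> list V) :
  (forall w w', racg_step adj w w' -> word_eq adj (f w) (f w')) ->
  forall w w', word_eq adj w w' -> word_eq adj (f w) (f w').
Proof.
  intros H w w'. induction 1; auto; [apply rst_refl | apply rst_sym; assumption | eapply rst_trans; eassumption].
Qed.
Lemma word_eq_app_l u w w' : word_eq adj w w' -> word_eq adj (u ++ w) (u ++ w').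
Proof.
  apply (word_eq_map (fun w => u ++ w)). intros x y [l1 l2 s | l1 l2 s t Hst]; rewrite !app_assoc;
  apply rst_step; constructor; assumption.
Qed.
Lemma word_eq_app_r u w w' : word_eq adj w w' -> word_eq adj (w ++ u) (w' ++ u).
Proof.
  apply (word_eq_map (fun w => w ++ u)). intros x y [l1 l2 s | l1 l2 s t Hst]; rewrite <- !app_assoc; simpl;
  apply rst_step; constructor; assumption.
Qed.

Definition mul (g h : racg) : racg := cls (rep g ++ rep h).
Definition inv (g : racg) : racg := cls (rev (rep g)).
Definition one : racg := cls [].
Definition gen (s : V) : racg := cls [s].
Local Infix "*" := mul.

Lemma cls_app w w' : cls (w ++ w') = cls w * cls w'.
Proof.
  unfold mul. apply cls_eq. eapply rst_trans.
  - apply word_eq_app_l. apply cls_eq. symmetry. apply (cls_rep (cls w')).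
  - apply word_eq_app_r. apply cls_eq. symmetry. apply (cls_rep (cls w)).
Qed.
Lemma cls_cons v w : cls (v :: w) = gen v * cls w.
Proof. apply (cls_app [v]). Qed.
Lemma mulA g h k : g * (h * k) = g * h * k.
Proof.
  rewrite <- (cls_rep g), <- (cls_rep h), <- (cls_rep k). rewrite <- !cls_app, app_assoc. reflexivity.
Qed.
Lemma mul1g g : one * g = g.
Proof. rewrite <- (cls_rep g). unfold one. rewrite <- cls_app. reflexivity. Qed.
Lemma mulg1 g : g * one = g.
Proof. rewrite <- (cls_rep g). unfold one. rewrite <- cls_app, app_nil_r. reflexivity. Qed.
Lemma cls_rev_app w : cls (rev w) * cls w = one.
Proof.
  rewrite <- cls_app. apply cls_eq. induction w as [|v w IH]; [apply rst_refl|].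
  simpl. rewrite <- app_assoc. simpl. eapply rst_trans; [apply rst_step, step_cancel | exact IH].
Qed.
Lemma mulVg g : inv g * g = one.
Proof. unfold inv. rewrite <- (cls_rep g) at 2. apply cls_rev_app. Qed.
Lemma mulgV g : g * inv g = one.
Proof.
  unfold inv. rewrite <- (cls_rep g) at 1. rewrite <- (rev_involutive (rep g)) at 1. apply cls_rev_app.
Qed.
Lemma mulKg g h : inv g * (g * h) = h.
Proof. rewrite mulA, mulVg, mul1g. reflexivity. Qed.
Lemma mulKVg g h : g * (inv g * h) = h.
Proof. rewrite mulA, mulgV, mul1g. reflexivity. Qed.
Lemma mulgK g h : h * g * inv g = h.
Proof. rewrite <- mulA, mulgV, mulg1. reflexivity. Qed.
Lemma mulgKV g h : h * inv g * g = h.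
Proof. rewrite <- mulA, mulVg, mulg1. reflexivity. Qed.
Lemma mulIg g h k : h * g = k * g -> h = k.
Proof. intros H. rewrite <- (mulgK g h), H, mulgK. reflexivity. Qed.
Lemma mulgI g h k : g * h = g * k -> h = k.
Proof. intros H. rewrite <- (mulKg g h), H, mulKg. reflexivity. Qed.
Lemma inv_uniq g h : g * h = one -> h = inv g.
Proof. intros H. apply (mulgI g). rewrite H, mulgV. reflexivity. Qed.
Lemma invK g : inv (inv g) = g.
Proof. symmetry. apply inv_uniq, mulVg. Qed.
Lemma invM g h : inv (g * h) = inv h * inv g.
Proof. symmetry. apply inv_uniq. rewrite mulA, mulgK, mulgV. reflexivity. Qed.
Lemma inv1 : inv one = one.
Proof. symmetry. apply inv_uniq, mul1g. Qed.
Lemma gen2 s : gen s * gen s = one.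
Proof. unfold gen, one. rewrite <- cls_app. apply cls_eq, rst_step. apply (step_cancel adj [] [] s). Qed.
Lemma genK s g : gen s * (gen s * g) = g.
Proof. rewrite mulA, gen2, mul1g. reflexivity. Qed.
Lemma mulgenK s g : g * gen s * gen s = g.
Proof. rewrite <- mulA, gen2, mulg1. reflexivity. Qed.
Lemma inv_gen s : inv (gen s) = gen s.
Proof. symmetry. apply inv_uniq, gen2. Qed.
Lemma gen_comm s t : adj s t -> gen s * gen t = gen t * gen s.
Proof. intros H. unfold gen. rewrite <- !cls_app. apply cls_eq, rst_step. apply (step_comm adj [] []), H. Qed.
Lemma gen_commA s t g : adj s t -> gen s * (gen t * g) = gen t * (gen s * g).
Proof. intros H. rewrite !mulA, (gen_comm s t H). reflexivity. Qed.

Definition beq {A : Type} (x y : A) : bool := if excluded_middle_informative (x = y) then true else false.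
Lemma beq_true {A : Type} (x y : A) : beq x y = true <-> x = y.
Proof. unfold beq. destruct (excluded_middle_informative _); split; congruence. Qed.
Lemma beq_refl {A : Type} (x : A) : beq x x = true.
Proof. apply beq_true. reflexivity. Qed.
Lemma beq_iff {A B : Type} (x y : A) (a b : B) : (x = y <-> a = b) -> beq x y = beq a b.
Proof. intros H. unfold beq. repeat destruct (excluded_middle_informative _); tauto. Qed.

(** Counting one letter modulo 2 is a homomorphism on the group; it shows that distinct generators
    are not conjugate. *)
Fixpoint letter_parity_w (s : V) (w : list V) : bool :=
  match w with [] => false | v :: w' => xorb (beq s v) (letter_parity_w s w') end.
Lemma letter_parity_app s w w' : letter_parity_w s (w ++ w') = xorb (letter_parity_w s w) (letter_parity_w s w').
Proof. induction w as [|v w IH]; simpl; [btauto|]. rewrite IH. btauto. Qed.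
Definition letter_parity s g := letter_parity_w s (rep g).
Lemma letter_parity_cls s w : letter_parity s (cls w) = letter_parity_w s w.
Proof.
  apply (word_eq_inv (letter_parity_w s)); [|apply cls_eq, cls_rep].
  intros x y [l1 l2 u | l1 l2 u v Huv]; rewrite !letter_parity_app; simpl; btauto.
Qed.
Lemma letter_parity_mul s g h : letter_parity s (g * h) = xorb (letter_parity s g) (letter_parity s h).
Proof. unfold mul. rewrite letter_parity_cls. apply letter_parity_app. Qed.
Lemma letter_parity_gen s v : letter_parity s (gen v) = beq s v.
Proof. unfold gen. rewrite letter_parity_cls. simpl. btauto. Qed.
Lemma gen_inj s t : gen s = gen t -> s = t.
Proof. intros H. apply beq_true. rewrite <- letter_parity_gen, <- H, letter_parity_gen. apply beq_refl. Qed.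

Lemma conj_genK s r : gen s * (gen s * r * gen s) * gen s = r.
Proof. rewrite !mulA, gen2, mul1g, mulgenK. reflexivity. Qed.
Lemma conj_gen_iff s r x : gen s * r * gen s = x <-> r = gen s * x * gen s.
Proof. split; [intros <-; symmetry | intros ->]; apply conj_genK. Qed.
Lemma conj_gen_comm s u r : adj s u -> gen u * (gen s * r * gen s) * gen u = gen s * (gen u * r * gen u) * gen s.
Proof.
  intros H. rewrite !mulA, (gen_comm s u H), <- !mulA, (gen_comm s u H). reflexivity.
Qed.

(* Parity of the number of times the gallery [w] from the identity crosses the wall of [t]. *)
Fixpoint cross_w (w : list V) (t : racg) : bool :=
  match w with [] => false | v :: w' => xorb (beq t (gen v)) (cross_w w' (gen v * t * gen v)) end.
Lemma cross_app w w' t : cross_w (w ++ w') t = xorb (cross_w w t) (cross_w w' (inv (cls w) * t * cls w)).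
Proof.
  revert t; induction w as [|v w IH]; intros t; simpl.
  - change (cls []) with one. rewrite inv1, mul1g, mulg1. btauto.
  - rewrite IH, cls_cons, invM, inv_gen, !mulA. btauto.
Qed.
Definition wcross (g t : racg) : bool := cross_w (rep g) t.
Lemma wcross_cls w t : wcross (cls w) t = cross_w w t.
Proof.
  revert t. assert (H : forall w w', word_eq adj w w' -> (fun t => cross_w w t) = (fun t => cross_w w' t)).
  { apply (word_eq_inv (fun w t => cross_w w t)). intros x y H. apply functional_extensionality. intros t.
    destruct H as [l1 l2 s | l1 l2 s u Hsu]; rewrite !cross_app; f_equal; simpl;
    set (r := inv (cls l1) * t * cls l1).
    - rewrite (beq_iff (gen s * r * gen s) (gen s) r (gen s)), conj_genK; [btauto|].
      rewrite conj_gen_iff, gen2, mul1g. tauto.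
    - rewrite (beq_iff (gen s * r * gen s) (gen u) r (gen u)), (beq_iff (gen u * r * gen u) (gen s) r (gen s)).
      + rewrite (conj_gen_comm s u r Hsu). btauto.
      + rewrite conj_gen_iff, <- (gen_comm s u Hsu), mulgenK. tauto.
      + rewrite conj_gen_iff, (gen_comm s u Hsu), mulgenK. tauto. }
  intros t. change (wcross (cls w) t) with ((fun t => cross_w (rep (cls w)) t) t).
  rewrite (H (rep (cls w)) w); [reflexivity | apply cls_eq, cls_rep].
Qed.

Lemma wcross_mul g h t : wcross (g * h) t = xorb (wcross g t) (wcross h (inv g * t * g)).
Proof.
  rewrite <- (cls_rep g), <- (cls_rep h), <- cls_app, !wcross_cls. apply cross_app.
Qed.
Lemma wcross_gen v t : wcross (gen v) t = beq t (gen v).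
Proof. unfold gen. rewrite wcross_cls. simpl. apply xorb_false_r. Qed.
Lemma wcross_one t : wcross one t = false.
Proof. unfold one. rewrite wcross_cls. reflexivity. Qed.

(** The exchange condition, read at the first crossing of the wall of [t]: the reflection swaps the
    two chambers on either side. *)
Lemma cross_exchange w t : cross_w w t = true ->
  exists w1 v w2, w = w1 ++ v :: w2 /\ t * cls w1 = cls (w1 ++ [v]).
Proof.
  revert t; induction w as [|v w IH]; intros t; simpl; [discriminate|].
  destruct (beq t (gen v)) eqn:E.
  - intros _. apply (proj1 (beq_true _ _)) in E. exists [], v, w. split; [reflexivity|]. simpl.
    change (cls []) with one. rewrite mulg1, E. reflexivity.
  - rewrite xorb_false_l. intros H. destruct (IH _ H) as [w1 [u [w2 [-> E2]]]].
    exists (v :: w1), u, w2. split; [reflexivity|]. simpl. rewrite !cls_cons.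
    apply (mulgI (gen v)). rewrite genK, <- E2, !mulA. reflexivity.
Qed.

(* [s] is a left descent of [g]: the wall of [s] separates the identity from [g]. *)
Definition desc (s : V) (g : racg) : bool := wcross g (gen s).

Lemma desc_one s : desc s one = false.
Proof. apply wcross_one. Qed.
Lemma desc_flip s g : desc s (gen s * g) = negb (desc s g).
Proof.
  unfold desc. rewrite wcross_mul, wcross_gen, beq_refl, inv_gen, gen2, mul1g. reflexivity.
Qed.
Lemma desc_comm s t g : adj s t -> s <> t -> desc s (gen t * g) = desc s g.
Proof.
  intros H N. unfold desc. rewrite wcross_mul, wcross_gen, inv_gen, <- (gen_comm s t H), mulgenK.
  destruct (beq (gen s) (gen t)) eqn:E; [|reflexivity]. apply (proj1 (beq_true _ _)), gen_inj in E. contradiction.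
Qed.
Lemma desc_cross s g v : desc s (g * gen v) = xorb (desc s g) (beq (gen s * g) (g * gen v)).
Proof.
  unfold desc. rewrite wcross_mul, wcross_gen. f_equal. apply beq_iff. split; intros H.
  - rewrite <- H, !mulA, mulgV, mul1g. reflexivity.
  - rewrite <- mulA, H, mulA, mulVg, mul1g. reflexivity.
Qed.
Lemma desc_change s g v : desc s (g * gen v) <> desc s g -> gen s * g = g * gen v.
Proof.
  rewrite desc_cross. intros H. apply beq_true. destruct (beq _ _); [reflexivity|].
  exfalso. apply H. btauto.
Qed.
Lemma wall_letter s g v : gen s * g = g * gen v -> v = s.
Proof.
  intros H. apply (f_equal (letter_parity s)) in H. rewrite !letter_parity_mul, !letter_parity_gen, beq_refl in H.
  symmetry. apply beq_true. destruct (letter_parity s g), (beq s v); simpl in *; congruence.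
Qed.

Definition is_len (g : racg) (n : nat) : Prop :=
  (exists w, cls w = g /\ length w = n) /\ forall w, cls w = g -> n <= length w.
Definition len (g : racg) : nat := epsilon (inhabits 0) (is_len g).
Lemma len_spec g : is_len g (len g).
Proof.
  unfold len. apply (epsilon_spec (inhabits 0) (is_len g)).
  destruct (dec_inh_nat_subset_has_unique_least_element (fun n => exists w, cls w = g /\ length w = n)) as [n [[H1 H2] _]].
  - intros n. apply classic.
  - exists (length (rep g)), (rep g). split; [apply cls_rep | reflexivity].
  - exists n. split; [assumption|]. intros w Hw. apply H2. exists w; auto.
Qed.
Lemma len_word g : exists w, cls w = g /\ length w = len g.
Proof. apply len_spec. Qed.
Lemma len_le w : len (cls w) <= length w.
Proof. apply len_spec. reflexivity. Qed.
Lemma len_mul g h : len (g * h) <= len g + len h.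
Proof.
  destruct (len_word g) as [w [E1 L1]], (len_word h) as [w' [E2 L2]].
  rewrite <- E1, <- E2, <- cls_app at 1. rewrite <- L1, <- L2, <- length_app. apply len_le.
Qed.
Lemma len_gen s : len (gen s) <= 1.
Proof. apply (len_le [s]). Qed.
Lemma len_one : len one = 0.
Proof. pose proof (len_le []). simpl in H. unfold one. lia. Qed.
Lemma len_0 g : len g = 0 -> g = one.
Proof. intros H. destruct (len_word g) as [w [E L]]. rewrite H in L. destruct w; [symmetry; exact E | discriminate]. Qed.
Lemma len_inv g : len (inv g) = len g.
Proof.
  assert (H : forall g, len (inv g) <= len g).
  { intros h. destruct (len_word h) as [w [E L]]. rewrite <- L, <- length_rev. rewrite <- E.
    replace (inv (cls w)) with (cls (rev w)); [apply len_le|]. apply (mulIg (cls w)). rewrite cls_rev_app, mulVg. reflexivity. }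
  apply Nat.le_antisymm; [apply H|]. rewrite <- (invK g) at 1. apply H.
Qed.

Lemma wcross_len g t : wcross g t = true -> len (t * g) < len g.
Proof.
  intros H. destruct (len_word g) as [w [E L]]. rewrite <- E in H. rewrite wcross_cls in H.
  destruct (cross_exchange _ _ H) as [w1 [v [w2 [Ew E2]]]].
  assert (E3 : t * g = cls (w1 ++ w2)).
  { rewrite <- E, Ew, cls_app, cls_cons, mulA, E2, !cls_app. fold (gen v). rewrite mulA, mulgenK. reflexivity. }
  rewrite E3, <- L, Ew. eapply Nat.le_lt_trans; [apply len_le|]. rewrite !length_app. simpl. lia.
Qed.
Lemma desc_len s g : desc s g = true -> len (gen s * g) < len g.
Proof. apply wcross_len. Qed.
Lemma desc_len' s g : desc s g = false -> len g < len (gen s * g).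
Proof. intros H. rewrite <- (genK s g) at 1. apply desc_len. rewrite desc_flip, H. reflexivity. Qed.
Lemma len_gen_mul s g : len (gen s * g) <= S (len g).
Proof. pose proof (len_mul (gen s) g). pose proof (len_gen s). lia. Qed.
Lemma desc_len_eq s g : desc s g = true -> len g = S (len (gen s * g)).
Proof.
  intros H. pose proof (desc_len s g H). pose proof (len_gen_mul s (gen s * g)) as K. rewrite genK in K. lia.
Qed.
Lemma desc_len_eq' s g : desc s g = false -> len (gen s * g) = S (len g).
Proof. intros H. pose proof (desc_len' s g H). pose proof (len_gen_mul s g). lia. Qed.
Lemma exists_desc g : g <> one -> exists s, desc s g = true.
Proof.
  intros H. destruct (len_word g) as [[|s w] [E L]]; [symmetry in E; contradiction|].
  exists s. destruct (desc s g) eqn:D; [reflexivity|]. exfalso.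
  pose proof (desc_len_eq' s g D) as K. rewrite <- E, cls_cons, genK in K. pose proof (len_le w). simpl in L.
  rewrite <- cls_cons, E in K. lia.
Qed.

Definition right_desc (v : V) (g : racg) : bool := desc v (inv g).
Local Notation rdesc := right_desc.
Lemma rdesc_len_eq v g : rdesc v g = true -> len g = S (len (g * gen v)).
Proof.
  unfold rdesc. intros H. apply desc_len_eq in H. rewrite len_inv in H. rewrite H. f_equal.
  rewrite <- (len_inv (g * gen v)), invM, inv_gen. reflexivity.
Qed.
Lemma rdesc_len_eq' v g : rdesc v g = false -> len (g * gen v) = S (len g).
Proof.
  unfold rdesc. intros H. apply desc_len_eq' in H. rewrite len_inv in H. rewrite <- H.
  rewrite <- (len_inv (g * gen v)), invM, inv_gen. reflexivity.
Qed.

Hypothesis adj_irr : forall v, ~ adj v v.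
Hypothesis adj_sym : forall u v, adj u v -> adj v u.

(* The action of W_Gamma on the integers through the infinite dihedral group generated by two non-adjacent
   generators: chambers of the real line are numbered by integers, and [s], [t] are the walls of chamber 0. *)
Definition dih1 (s t v : V) (k : Z) : Z :=
  if excluded_middle_informative (v = s) then (-1 - k)%Z
  else if excluded_middle_informative (v = t) then (1 - k)%Z else k.
Definition dih_w (s t : V) (w : list V) (k : Z) : Z := fold_right (dih1 s t) k w.
Lemma dih1_s s t k : dih1 s t s k = (-1 - k)%Z.
Proof. unfold dih1. destruct (excluded_middle_informative _); congruence. Qed.
Lemma dih1_t s t k : s <> t -> dih1 s t t k = (1 - k)%Z.
Proof. intros N. unfold dih1. repeat destruct (excluded_middle_informative _); congruence. Qed.
Lemma dih_cls s t w w' k : s <> t -> ~ adj s t -> cls w = cls w' -> dih_w s t w k = dih_w s t w' k.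
Proof.
  intros N Ha H. apply cls_eq in H. revert H. apply (word_eq_inv (fun w => dih_w s t w k)).
  intros x y [l1 l2 u | l1 l2 u v Huv]; unfold dih_w; rewrite !fold_right_app; f_equal; simpl; unfold dih1;
  repeat destruct (excluded_middle_informative _); subst; try lia; exfalso; eauto.
Qed.

Fixpoint alt (s t : V) (n : nat) : list V := match n with 0 => [] | S n => s :: alt t s n end.
Lemma alt_dih s t n : s <> t -> forall w1 v w2, alt s t n = w1 ++ v :: w2 ->
  (dih_w s t w1 0 = - Z.of_nat (length w1))%Z /\ (dih_w s t (w1 ++ [v]) 0 = - Z.of_nat (length w1) - 1)%Z.
Proof.
  intros N.
  assert (A : forall m, (dih_w s t (alt s t m) 0 = - Z.of_nat m)%Z /\ (dih_w s t (alt t s m) 0 = Z.of_nat m)%Z).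
  { induction m as [|m [I1 I2]]; [split; reflexivity|]. simpl alt. unfold dih_w in *. simpl fold_right.
    rewrite I1, I2, dih1_s, dih1_t by assumption. lia. }
  assert (P : forall m s' t' w1 w2, alt s' t' m = w1 ++ w2 -> w1 = alt s' t' (length w1)).
  { induction m as [|m IH]; intros s' t' w1 w2 H; simpl in H.
    - destruct w1; [reflexivity | discriminate].
    - destruct w1 as [|x w1]; [reflexivity|]. simpl in *. injection H; intros H' ->. f_equal. eapply IH; eassumption. }
  intros w1 v w2 H. split.
  - rewrite (P _ _ _ _ _ H). rewrite (proj1 (A _)), <- (P _ _ _ _ _ H). reflexivity.
  - change (v :: w2) with ([v] ++ w2) in H. rewrite app_assoc in H. rewrite (P _ _ _ _ _ H), (proj1 (A _)).
    rewrite length_app. simpl. lia.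
Qed.

(** By exchange, left multiplication by [t] would take some chamber [-m] of the line to [-m - 1],
    but the reflection [t] takes it to [m + 1]. *)
Lemma alt_not_desc s t n : s <> t -> ~ adj s t -> desc t (cls (alt s t n)) = false.
Proof.
  intros N Ha. destruct (desc t (cls (alt s t n))) eqn:D; [exfalso | reflexivity].
  unfold desc in D. rewrite wcross_cls in D. destruct (cross_exchange _ _ D) as [w1 [v [w2 [E1 E2]]]].
  destruct (alt_dih s t n N w1 v w2 E1) as [A1 A2].
  rewrite <- cls_cons in E2. pose proof (dih_cls s t _ _ 0%Z N Ha E2) as A3.
  rewrite A2 in A3. unfold dih_w in A3, A1. simpl in A3. rewrite A1, dih1_t in A3 by assumption. lia.
Qed.

Definition dihedral (s t : V) (z : racg) : Prop := exists n, z = cls (alt s t n) \/ z = cls (alt t s n).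
Lemma dihedral_mul s t z : dihedral s t z -> dihedral s t (gen s * z) /\ dihedral s t (gen t * z).
Proof.
  assert (B : forall a b n, gen a * cls (alt a b n) = cls (alt b a (pred n)) \/ n = 0).
  { intros a b [|n]; [right; reflexivity | left]. simpl. rewrite cls_cons, genK. reflexivity. }
  intros [n [-> | ->]]; split.
  - destruct (B s t n) as [-> | ->]; [exists (pred n); auto | exists 1; left; simpl; rewrite cls_cons; reflexivity].
  - exists (S n). right. simpl. rewrite cls_cons. reflexivity.
  - exists (S n). left. simpl. rewrite cls_cons. reflexivity.
  - destruct (B t s n) as [-> | ->]; [exists (pred n); auto | exists 1; right; simpl; rewrite cls_cons; reflexivity].
Qed.

(** Otherwise write [g = z * y] with [z] in the infinite dihedral group of [s] and [t] and [y] as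
    short as possible. By minimality [s] and [t] are descents of [g] only if they are descents of
    [z], and an alternating word has at most one of them. *)
Lemma desc_adj s t g : desc s g = true -> desc t g = true -> s = t \/ adj s t.
Proof.
  intros Hs Ht. apply NNPP. intros C. assert (N : s <> t) by tauto. assert (Ha : ~ adj s t) by tauto. clear C.
  assert (M : exists z y, dihedral s t z /\ g = z * y /\
     forall z' y', dihedral s t z' -> g = z' * y' -> len y <= len y').
  { destruct (dec_inh_nat_subset_has_unique_least_element
       (fun n => exists z y, dihedral s t z /\ g = z * y /\ len y = n)) as [n [[[z [y [H1 [H2 H3]]]] H4] _]].
    - intros n. apply classic.
    - exists (len g), one, g. split; [exists 0; left; reflexivity | split; [symmetry; apply mul1g | reflexivity]].
    - exists z, y. split; [assumption | split; [assumption|]]. intros z' y' D E. rewrite H3. apply H4. eauto. }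
  destruct M as [z [y [Dz [E M]]]].
  assert (K' : forall r, r = s \/ r = t -> desc r g = desc r z).
  { intros r Hr. unfold desc. rewrite E, wcross_mul.
    destruct (wcross y (inv z * gen r * z)) eqn:W; [exfalso | btauto]. apply wcross_len in W.
    assert (len y <= len (inv z * gen r * z * y)); [|lia].
    apply (M (gen r * z)).
    - destruct Hr as [-> | ->]; apply dihedral_mul; assumption.
    - rewrite E, !mulA, !mulgK. destruct Hr as [-> | ->]; rewrite gen2, mul1g; reflexivity. }
  rewrite (K' s) in Hs by auto. rewrite (K' t) in Ht by auto.
  destruct Dz as [n [-> | ->]].
  - rewrite alt_not_desc in Ht by assumption. discriminate.
  - rewrite alt_not_desc in Hs; [discriminate | auto | intros H; apply Ha, adj_sym, H].
Qed.
End Coxeter.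

(** * Centralizers and coarse connectedness over a triangle-free graph *)

Section CoxeterGraph.
Context {V : Type} (adj : V -> V -> Prop).
Hypothesis adj_irr : forall v, ~ adj v v.
Hypothesis adj_sym : forall u v, adj u v -> adj v u.
Hypothesis tri_free : triangle_free adj.
Local Notation racg := (racg adj).
Local Notation gen := (gen adj).
Local Notation cls := (cls adj).
Local Notation one := (one adj).
Local Infix "*" := (mul adj).
Local Notation inv := (inv adj).
Local Notation desc := (desc adj).
Local Notation rdesc := (right_desc adj).
Local Notation len := (len adj).

Lemma adj_neq s t : adj s t -> s <> t.
Proof. intros H ->. exact (adj_irr _ H). Qed.
Lemma no_triangle a b c : adj a b -> adj b c -> adj a c -> False.
Proof. intros H1 H2 H3. apply (tri_free a b c). auto. Qed.

Lemma desc_comm' s t g : adj s t -> desc s (gen t * g) = desc s g.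
Proof. intros H. apply desc_comm; [assumption | apply adj_neq, H]. Qed.
Lemma desc_excl s t g : s <> t -> ~ adj s t -> desc s g = true -> desc t g = true -> False.
Proof. intros N H H1 H2. destruct (desc_adj adj adj_sym s t g H1 H2); contradiction. Qed.

(** The step from [g] to [g * gen s] crosses the wall of [s] and no other, so [u] and [s] are both
    descents of [g * gen s]. *)
Lemma wall_desc s g u : gen s * g = g * gen s -> desc s g = false -> desc u g = true -> adj u s.
Proof.
  intros C Hs Hu. assert (N : u <> s) by (intros ->; congruence).
  destruct (desc u (g * gen s)) eqn:D.
  - rewrite <- C in D. assert (D' : desc s (gen s * g) = true) by (rewrite desc_flip, Hs; reflexivity).
    destruct (desc_adj adj adj_sym u s _ D D'); [contradiction | assumption].
  - exfalso. apply N. assert (E : gen u * g = g * gen s) by (apply desc_change; congruence).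
    symmetry. apply (wall_letter adj u g s). assumption.
Qed.

Lemma comm_inv s g : gen s * g = g * gen s -> gen s * inv g = inv g * gen s.
Proof.
  intros C. apply (mulgI adj g). rewrite !mulA, <- C, mulgK, mulgV, mul1g. reflexivity.
Qed.
Lemma desc_inv s g : gen s * g = g * gen s -> desc s (inv g) = desc s g.
Proof.
  intros C. pose proof (desc_one adj s) as H. rewrite <- (mulVg adj g) in H. unfold desc in *.
  rewrite wcross_mul, invK, <- C, mulgK in H. destruct (wcross adj (inv g) (gen s)), (wcross adj g (gen s)); simpl in H; congruence.
Qed.
Lemma wall_rdesc s g u : gen s * g = g * gen s -> desc s g = false -> rdesc u g = true -> adj u s.
Proof. intros C Hs. apply (wall_desc s (inv g)); [apply comm_inv, C | rewrite desc_inv; assumption]. Qed.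

Lemma wall_cross s g v : desc s g = false -> desc s (g * gen v) = true -> v = s /\ gen s * g = g * gen s.
Proof.
  intros H1 H2. assert (E : gen s * g = g * gen v) by (apply desc_change; congruence).
  pose proof (wall_letter adj s g v E) as ->. auto.
Qed.

Lemma comm_mul s g h : gen s * g = g * gen s -> gen s * h = h * gen s -> gen s * (g * h) = g * h * gen s.
Proof. intros H1 H2. rewrite mulA, H1, <- mulA, H2, mulA. reflexivity. Qed.

(** Once [s] and [t] are removed from the left, any further descent would be adjacent to both and
    complete a triangle. *)
Lemma central_len s t h : adj s t -> gen s * h = h * gen s -> gen t * h = h * gen t -> len h <= 2.
Proof.
  intros Hst.
  assert (K0 : forall h, gen s * h = h * gen s -> gen t * h = h * gen t -> desc s h = false -> desc t h = false -> h = one).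
  { intros h' Cs Ct Ds Dt. apply NNPP. intros N. destruct (exists_desc adj _ N) as [u Hu].
    exact (no_triangle u s t (wall_desc s h' u Cs Ds Hu) Hst (wall_desc t h' u Ct Dt Hu)). }
  assert (Cst : forall u, (u = s \/ u = t) -> gen s * gen u = gen u * gen s /\ gen t * gen u = gen u * gen t).
  { intros u [-> | ->]; split; try reflexivity; apply gen_comm; auto. }
  assert (K1 : forall h, gen s * h = h * gen s -> gen t * h = h * gen t -> desc s h = false -> len h <= 1).
  { intros h' Cs Ct Ds. destruct (desc t h') eqn:Dt.
    - assert (E : gen t * h' = one).
      { apply K0; try (apply comm_mul; [apply (Cst t); auto | assumption]).
        - rewrite desc_comm' by assumption. assumption.
        - rewrite desc_flip, Dt. reflexivity. }
      rewrite <- (genK adj t h'), E, mulg1. apply len_gen.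
    - rewrite (K0 h') by assumption. rewrite len_one. auto. }
  intros Cs Ct. destruct (desc s h) eqn:Ds.
  - assert (L : len (gen s * h) <= 1).
    { apply K1; try (apply comm_mul; [apply (Cst s); auto | assumption]). rewrite desc_flip, Ds. reflexivity. }
    pose proof (desc_len_eq adj s h Ds). lia.
  - pose proof (K1 h Cs Ct Ds). lia.
Qed.

Definition avoiding (S : V -> Prop) (g : racg) : Prop := forall t, S t -> desc t g = false.
Definition far_step (P : racg -> Prop) (n : nat) (a b : racg) : Prop :=
  P a /\ P b /\ n <= len a /\ n <= len b /\ exists v, b = a * gen v.
(** Connectedness at infinity of the subgraph of the Cayley graph spanned by [P]; [limit_connected]
    turns it into connectedness of the limit set. *)
Definition coarsely_connected (P : racg -> Prop) : Prop :=
  forall n, exists m, forall x y, P x -> P y -> m <= len x -> m <= len y -> clos_refl_trans _ (far_step P n) x y.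

Lemma rdesc_comm u w g : adj w u -> rdesc w (g * gen u) = rdesc w g.
Proof. intros H. unfold right_desc. rewrite invM, inv_gen. apply desc_comm', H. Qed.
Lemma desc_shrink t g v : rdesc v g = true -> desc t g = false -> desc t (g * gen v) = false.
Proof.
  intros Hv Ht. destruct (desc t (g * gen v)) eqn:D; [exfalso | reflexivity].
  destruct (wall_cross t g v Ht D) as [-> E].
  pose proof (rdesc_len_eq adj t g Hv) as L. rewrite <- E in L. pose proof (desc_len' adj t g Ht). lia.
Qed.

Section Avoiding.
Variable S : V -> Prop.
(** For [x] avoiding [S], these are the letters [v] such that [x * gen v] is longer than [x] and
    still avoids [S]. *)
Definition free_dirs (x : racg) (v : V) : Prop := rdesc v x = false /\ ~ (S v /\ gen v * x = x * gen v).
Hypothesis free_dirs_connected : forall x, avoiding S x -> connected_in adj (free_dirs x).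

Lemma free_dir_avoiding x v : avoiding S x -> free_dirs x v -> avoiding S (x * gen v).
Proof.
  intros Hx [_ Hv] t Ht. destruct (desc t (x * gen v)) eqn:D; [exfalso | reflexivity].
  destruct (wall_cross t x v (Hx t Ht) D) as [-> E]. apply Hv. auto.
Qed.
Lemma avoiding_free_dir x v : avoiding S (x * gen v) -> rdesc v x = false -> avoiding S x -> free_dirs x v.
Proof.
  intros H Hv Hx. split; [assumption|]. intros [Sv E]. pose proof (H v Sv) as D. rewrite <- E, desc_flip, (Hx v Sv) in D. discriminate.
Qed.

(** The path runs around the commuting square at [x] through its three other corners, all of them
    longer than [x]. *)
Lemma free_dirs_step n x u w : n = len x -> avoiding S x -> free_dirs x u -> free_dirs x w -> adj u w ->
  clos_refl_trans _ (far_step (avoiding S) (Datatypes.S n)) (x * gen u) (x * gen w).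
Proof.
  intros -> Hx Hu Hw Huw.
  pose proof (rdesc_len_eq' adj u x (proj1 Hu)) as Lu. pose proof (rdesc_len_eq' adj w x (proj1 Hw)) as Lw.
  assert (E : x * gen u * gen w = x * gen w * gen u) by (rewrite <- !mulA, (gen_comm adj u w Huw); reflexivity).
  assert (L : len (x * gen u * gen w) = Datatypes.S (Datatypes.S (len x))).
  { rewrite (rdesc_len_eq' adj), Lu; [reflexivity|]. rewrite rdesc_comm by (apply adj_sym, Huw). apply Hw. }
  assert (A : avoiding S (x * gen u * gen w)).
  { intros t Ht. destruct (desc t (x * gen u * gen w)) eqn:D; [exfalso | reflexivity].
    destruct (wall_cross t _ w (free_dir_avoiding x u Hx Hu t Ht) D) as [-> C].
    apply Hw. split; [assumption|]. apply (mulIg adj (gen u)).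
    rewrite <- (mulA adj (gen t)), C, <- !mulA, (gen_comm adj u t Huw). reflexivity. }
  apply rt_trans with (x * gen u * gen w); apply rt_step.
  - repeat split; [apply free_dir_avoiding; assumption | assumption | lia | lia | exists w; reflexivity].
  - repeat split; [assumption | apply free_dir_avoiding; assumption | lia | lia | exists u].
    rewrite E, mulgenK. reflexivity.
Qed.

Lemma free_dirs_path n x u w : n = len x -> avoiding S x -> free_dirs x u -> free_dirs x w ->
  clos_refl_trans _ (far_step (avoiding S) (Datatypes.S n)) (x * gen u) (x * gen w).
Proof.
  intros Hn Hx Hu Hw. pose proof (free_dirs_connected x Hx u w Hu Hw) as L. unfold linked_in in L.
  clear Hu Hw. induction L as [a b [Ha [Hb Hab]] | a | a b c _ IH1 _ IH2].
  - apply free_dirs_step; assumption.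
  - apply rt_refl.
  - eapply rt_trans; eassumption.
Qed.

(** A path at level [n] is pushed to level [n + 1]. Next to a visit to an element of length exactly
    [n] the path uses free directions, and these can be joined around that element. *)
Lemma avoiding_level n : forall x y, avoiding S x -> avoiding S y -> n <= len x -> n <= len y ->
  clos_refl_trans _ (far_step (avoiding S) n) x y.
Proof.
  induction n as [|n IH].
  (* Removing right descents creates no left descents, so every element is joined to [one] inside
     the set. *)
  - assert (R : forall k x, len x <= k -> avoiding S x ->
      clos_refl_trans _ (far_step (avoiding S) 0) x one /\ clos_refl_trans _ (far_step (avoiding S) 0) one x).
    { induction k as [|k IHk]; intros x Hk Hx.
      - assert (x = one) as -> by (apply len_0; lia). split; apply rt_refl.
      - destruct (classic (x = one)) as [-> | N]; [split; apply rt_refl|].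
        destruct (exists_desc adj (inv x)) as [v Hv].
        { intros E. apply N. rewrite <- (invK adj x), E, inv1. reflexivity. }
        assert (Hxv : avoiding S (x * gen v)) by (intros t Ht; apply desc_shrink; auto).
        pose proof (rdesc_len_eq adj v x Hv) as L.
        destruct (IHk (x * gen v)) as [I1 I2]; [lia | assumption |]. split.
        + eapply rt_trans; [apply rt_step | exact I1]. repeat split; try assumption; try lia. exists v; reflexivity.
        + eapply rt_trans; [exact I2 | apply rt_step]. repeat split; try assumption; try lia. exists v. rewrite mulgenK. reflexivity. }
    intros x y Hx Hy _ _. eapply rt_trans; [apply (R (len x)); auto | apply (R (len y)); auto].
  (* The second clause describes the middle of a detour: the visit to [a] of length [n] is replaced
     by an arbitrary free neighbour [a * gen u]. *)
  - assert (K : forall a y, clos_refl_trans_1n _ (far_step (avoiding S) n) a y -> avoiding S a -> avoiding S y -> Datatypes.S n <= len y ->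
       (Datatypes.S n <= len a -> clos_refl_trans _ (far_step (avoiding S) (Datatypes.S n)) a y) /\
       (len a = n -> forall u, free_dirs a u -> clos_refl_trans _ (far_step (avoiding S) (Datatypes.S n)) (a * gen u) y)).
    { intros a y. induction 1 as [y | a b y Hab Hby IHp]; intros Ha Hy Ly.
      - split; [intros; apply rt_refl | intros; lia].
      - destruct Hab as [_ [Hb [La [Lb [v Ev]]]]]. destruct (IHp Hb Hy Ly) as [I1 I2].
        assert (Eb : a = b * gen v) by (rewrite Ev, mulgenK; reflexivity). split.
        + intros La'. destruct (Nat.eq_dec (len b) n) as [E | N].
          * rewrite Eb. apply I2; [assumption|]. apply avoiding_free_dir; [rewrite <- Eb; assumption | | assumption].
            destruct (rdesc v b) eqn:D; [|reflexivity]. apply rdesc_len_eq in D. rewrite <- Eb in D. lia.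
          * eapply rt_trans; [apply rt_step | apply I1; lia]. repeat split; try assumption; try lia. exists v; assumption.
        + intros E u Hu.
          assert (Fv : free_dirs a v).
          { apply avoiding_free_dir; [rewrite <- Ev; assumption | | assumption].
            destruct (rdesc v a) eqn:D; [|reflexivity]. apply rdesc_len_eq in D. rewrite <- Ev in D. lia. }
          eapply rt_trans; [apply (free_dirs_path n a u v); auto |]. rewrite <- Ev. apply I1.
          pose proof (rdesc_len_eq' adj v a (proj1 Fv)) as L. rewrite <- Ev in L. lia. }
    intros x y Hx Hy Lx Ly. apply K; try assumption. apply clos_rt_rt1n_iff, IH; try assumption; lia.
Qed.

Lemma avoiding_coarsely_connected : coarsely_connected (avoiding S).
Proof. intros n. exists n. intros. apply avoiding_level; assumption. Qed.
End Avoiding.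

Definition translate (g : racg) (P : racg -> Prop) (x : racg) : Prop := P (inv g * x).
Lemma translate_mul g P x : translate g P (g * x) <-> P x.
Proof. unfold translate. rewrite mulKg. tauto. Qed.
Lemma len_translate g x : len x <= len g + len (g * x) /\ len (g * x) <= len g + len x.
Proof.
  split; [|apply len_mul]. rewrite <- (mulKg adj g x) at 1. rewrite <- (len_inv adj g). apply len_mul.
Qed.
Lemma coarsely_connected_translate g P : coarsely_connected P -> coarsely_connected (translate g P).
Proof.
  intros H n. destruct (H (n + len g)) as [m Hm]. exists (m + len g). intros x y Hx Hy Lx Ly.
  rewrite <- (mulKVg adj g x), <- (mulKVg adj g y) in *.
  set (x' := inv g * x) in *. set (y' := inv g * y) in *. clearbody x' y'.
  rewrite translate_mul in Hx, Hy. pose proof (len_translate g x'). pose proof (len_translate g y').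
  assert (R : clos_refl_trans _ (far_step P (n + len g)) x' y') by (apply Hm; try assumption; lia).
  clear - R. induction R as [a b [Ha [Hb [La [Lb [v ->]]]]] | a | a b c _ I1 _ I2].
  - apply rt_step. repeat split; rewrite ?translate_mul; try assumption.
    + pose proof (len_translate g a). lia.
    + pose proof (len_translate g (a * gen v)). lia.
    + exists v. rewrite mulA. reflexivity.
  - apply rt_refl.
  - eapply rt_trans; eassumption.
Qed.

Lemma desc_support (u : V) (w : list V) : desc u (cls w) = true -> In u w.
Proof.
  unfold desc. rewrite wcross_cls. intros H. destruct (cross_exchange adj _ _ H) as [w1 [v [w2 [-> E]]]].
  rewrite cls_app in E. fold (gen v) in E. apply wall_letter in E. subst. apply in_app_iff. right; left; reflexivity.
Qed.
Lemma alt_letters (a b : V) n u : In u (alt a b n) -> u = a \/ u = b.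
Proof. revert a b; induction n as [|n IH]; intros a b; simpl; [tauto|]. intros [H | H]; [auto|]. destruct (IH _ _ H); auto. Qed.
Lemma alt_desc (a b : V) n u : a <> b -> ~ adj a b -> desc u (cls (alt a b (S n))) = true <-> u = a.
Proof.
  intros N H. split.
  - intros D. destruct (alt_letters _ _ _ _ (desc_support _ _ D)) as [-> | ->]; [reflexivity|].
    rewrite (alt_not_desc adj adj_sym a b) in D by assumption. discriminate.
  - intros ->. simpl. rewrite cls_cons, desc_flip, (alt_not_desc adj adj_sym b a); [reflexivity | auto | auto].
Qed.
Lemma alt_len (a b : V) n : a <> b -> ~ adj a b -> len (cls (alt a b n)) = n.
Proof.
  revert a b; induction n as [|n IH]; intros a b N H; [apply len_one|]. simpl. rewrite cls_cons.
  rewrite desc_len_eq', IH; auto. apply alt_not_desc; auto.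
Qed.
Lemma comm_word t (w : list V) : (forall u, In u w -> adj t u) -> gen t * cls w = cls w * gen t.
Proof.
  induction w as [|v w IH]; intros H.
  - change (cls []) with one. rewrite mulg1, mul1g. reflexivity.
  - rewrite cls_cons. apply comm_mul; [apply gen_comm, H; left; reflexivity | apply IH; intros; apply H; right; assumption].
Qed.
Lemma desc_comm_word t (w : list V) g : (forall u, In u w -> adj t u) -> desc t (cls w * g) = desc t g.
Proof.
  induction w as [|v w IH]; intros H.
  - change (cls []) with one. rewrite mul1g. reflexivity.
  - rewrite cls_cons, <- mulA, desc_comm' by (apply H; left; reflexivity). apply IH. intros; apply H; right; assumption.
Qed.
End CoxeterGraph.

(** * The boundary of a CAT(0) space *)

(** A non-principal ultrafilter replaces the repeated extraction of subsequences. *)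
Record ultra (U : (nat -> Prop) -> Prop) : Prop := {
  ultra_mono : forall P Q : nat -> Prop, (forall n, P n -> Q n) -> U P -> U Q;
  ultra_and : forall P Q, U P -> U Q -> U (fun n => P n /\ Q n);
  ultra_ne : forall P, U P -> exists n, P n;
  ultra_ge : forall N, U (fun n => N <= n);
  ultra_em : forall P, U P \/ U (fun n => ~ P n) }.

Lemma ultra_exists : exists U, ultra U.
Proof.
pose (F := fun A : nat -> Prop => exists N, forall n, N <= n -> A n).
assert (FF : filter.ProperFilter F).
{ constructor.
  - intros [N HN]. exact (HN N (Nat.le_refl N)).
  - constructor.
    + exists 0. intros n _. exact I.
    + intros P Q [N HN] [M HM]. exists (N + M). intros n Hn. split; [apply HN | apply HM]; lia.
    + intros P Q HPQ [N HN]. exists N. intros n Hn. apply HPQ, HN, Hn. }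
destruct (filter.ultraFilterLemma FF) as [U [[UP Umax] HFU]].
pose proof (@filter.filter_filter _ _ UP) as UF.
assert (Umono : forall P Q : nat -> Prop, (forall n, P n -> Q n) -> U P -> U Q).
{ intros P Q H HP. exact (@filter.filterS _ _ UF P Q H HP). }
assert (Uand : forall P Q, U P -> U Q -> U (fun n => P n /\ Q n)).
{ intros P Q HP HQ. exact (@filter.filterI _ _ UF P Q HP HQ). }
assert (Une : forall P, U P -> exists n, P n).
{ intros P HP. apply NNPP. intros Hn. apply (@filter.filter_not_empty _ _ UP).
  apply (Umono P); auto. intros n Pn. exfalso. apply Hn. exists n. exact Pn. }
exists U. split; auto.
- intros N. apply HFU. exists N. auto.
- intros P. destruct (classic (U (fun n => ~ P n))) as [H | H]; [right; exact H | left].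
  (* The filter generated by [U] and [P]; maximality of [U] puts [P] into [U]. *)
  pose (G := fun A : nat -> Prop => exists B, U B /\ forall n, B n -> P n -> A n).
  assert (GP : filter.ProperFilter G).
  { constructor.
    - intros [B [UB HB]]. exact (H (Umono B _ (fun n Bn Pn => HB n Bn Pn) UB)).
    - constructor.
      + exists (fun _ => True). split; [exact (@filter.filterT _ _ UF) | intros; exact I].
      + intros A1 A2 [B1 [U1 H1]] [B2 [U2 H2]]. exists (fun n => B1 n /\ B2 n).
        split; [apply Uand; auto | intros n [b1 b2] p; split; [exact (H1 n b1 p) | exact (H2 n b2 p)]].
      + intros A1 A2 HA [B [UB HB]]. exists B. split; [exact UB |]. intros n ? ?. apply HA, HB; assumption. }
  assert (HUG : classical_sets.subset U G).
  { intros A UA. exists A. split; auto. }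
  rewrite <- (Umax G GP HUG).
  exists (fun _ => True). split; [exact (@filter.filterT _ _ UF) | auto].
Qed.

(** The pigeonhole principle along the ultrafilter. *)
Lemma ultra_list (U : (nat -> Prop) -> Prop) (HU : ultra U) (A : Type) (l : list A) (Q : A -> nat -> Prop) :
  (forall n, exists a, In a l /\ Q a n) -> exists a, In a l /\ U (Q a).
Proof.
intros H. apply NNPP. intros Hn.
assert (K : forall l', incl l' l -> U (fun n => forall a, In a l' -> ~ Q a n)).
{ induction l' as [|a l' IH]; intros Hi.
  - apply (ultra_mono U HU (fun n => 0 <= n)); [intros n _ a [] | apply (ultra_ge U HU)].
  - destruct (ultra_em U HU (Q a)) as [Ha | Ha].
    + exfalso. apply Hn. exists a. split; auto. apply Hi. left; auto.
    + apply (ultra_mono U HU (fun n => ~ Q a n /\ forall b, In b l' -> ~ Q b n)).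
      * intros n [H1 H2] b [<- | Hb]; auto.
      * apply (ultra_and U HU); auto. apply IH. intros b Hb. apply Hi. right; auto. }
destruct (ultra_ne U HU _ (K l (incl_refl l))) as [n Hl].
destruct (H n) as [a [Ha Qa]]. exact (Hl a Ha Qa).
Qed.

Open Scope R_scope.

Section Cat0.
Context {X : Type} (d : X -> X -> R).
Hypothesis d_metric : is_metric d.
Hypothesis d_proper : proper_metric d.
Hypothesis d_geod : geodesic_space d.
Hypothesis d_cat0 : cat0_ineq d.

Lemma d_ge0 x y : 0 <= d x y. Proof. apply d_metric. Qed.
Lemma d_refl x : d x x = 0. Proof. apply d_metric. reflexivity. Qed.
Lemma d_eq x y : d x y = 0 -> x = y. Proof. apply d_metric. Qed.
Lemma d_sym x y : d x y = d y x. Proof. apply d_metric. Qed.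
Lemma d_tri x y z : d x z <= d x y + d y z. Proof. apply d_metric. Qed.

Lemma geod_dist c x y t : geod d c x y -> 0 <= t <= d x y -> d x (c t) = t.
Proof.
  intros [H0 [H1 H]] Ht. rewrite <- H0, H by lra. unfold Rabs; destruct (Rcase_abs _); lra.
Qed.
Lemma geod_prefix c x y t : geod d c x y -> 0 <= t <= d x y -> geod d c x (c t).
Proof.
  intros G Ht. pose proof (geod_dist c x y t G Ht) as E. destruct G as [H0 [H1 H]].
  split; [assumption|]. rewrite E. split; [reflexivity|]. intros; apply H; lra.
Qed.
Lemma geod_rev c x y : geod d c x y -> geod d (fun t => c (d x y - t)) y x.
Proof.
  intros [H0 [H1 H]]. split; [rewrite Rminus_0_r; assumption|]. rewrite (d_sym y x). split.
  - rewrite Rminus_diag. assumption.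
  - intros s t Hs Ht. rewrite H by lra. replace (d x y - s - (d x y - t)) with (t - s) by ring. apply Rabs_minus_sym.
Qed.

(** In the comparison triangle with angle theta at [b], the squared distance at radius [rho] is 2
    rho^2 (1 - cos theta), while the opposite side satisfies e^2 >= 2 a g (1 - cos theta) >= 2 r^2
    (1 - cos theta). *)
Lemma geodesics_close b p z c c' r rho :
  geod d c b p -> geod d c' b z -> 0 < r -> r <= d b p -> r <= d b z -> 0 <= rho <= r ->
  d (c rho) (c' rho) <= rho / r * d p z.
Proof.
  intros Gc Gc' Hr Hp Hz Hrho. destruct (d_geod p z) as [c2 G2].
  pose proof (geod_rev _ _ _ Gc') as G3.
  set (a := d b p) in *. set (g := d b z) in *. set (e := d p z) in *.
  assert (He : 0 <= e) by apply d_ge0.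
  assert (T1 : e <= a + g) by (unfold e, a, g; rewrite (d_sym b p); apply d_tri).
  assert (T2 : a <= g + e) by (unfold e, a, g; rewrite (d_sym p z); apply d_tri).
  assert (T3 : g <= a + e) by apply d_tri.
  (* The law of cosines with [b] at the origin and [p] at [(a, 0)]: the third vertex is [(u, v)],
     and [u / g] is the cosine of the angle. *)
  set (u := (a * a + g * g - e * e) / (2 * a)).
  assert (Hu : 2 * a * u = a * a + g * g - e * e) by (unfold u; field; lra).
  assert (Hug : u <= g) by (apply (Rmult_le_reg_l (2 * a)); nra).
  assert (Hu2 : u * u <= g * g).
  { assert (- g <= u) by (apply (Rmult_le_reg_l (2 * a)); nra). nra. }
  set (v := sqrt (g * g - u * u)).
  assert (Hv : v * v = g * g - u * u) by (apply sqrt_sqrt; lra).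
  assert (D1 : dist2 (0, 0) (a, 0) = a).
  { unfold dist2; simpl fst; simpl snd. replace ((0 - a) ^ 2 + (0 - 0) ^ 2) with (a * a) by ring. apply sqrt_square. lra. }
  assert (D2 : dist2 (a, 0) (u, v) = e).
  { unfold dist2; simpl fst; simpl snd. replace ((a - u) ^ 2 + (0 - v) ^ 2) with (e * e); [apply sqrt_square; lra|].
    replace ((a - u) ^ 2 + (0 - v) ^ 2) with (a * a - 2 * a * u + u * u + v * v) by ring. rewrite Hv. lra. }
  assert (D3 : dist2 (u, v) (0, 0) = d z b).
  { rewrite (d_sym z b). fold g. unfold dist2; simpl fst; simpl snd.
    replace ((u - 0) ^ 2 + (v - 0) ^ 2) with (u * u + v * v) by ring. rewrite Hv.
    replace (u * u + (g * g - u * u)) with (g * g) by ring. apply sqrt_square. lra. }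
  pose proof (d_cat0 b p z c c2 _ Gc G2 G3 (0, 0) (a, 0) (u, v) D1 D2 D3
    (Side c a (0, 0) (a, 0)) (Side (fun t => c' (g - t)) (d z b) (u, v) (0, 0)) rho (g - rho)) as K.
  assert (Egb : d z b = g) by apply d_sym.
  simpl in K. specialize (K ltac:(left; reflexivity) ltac:(right; right; left; reflexivity)).
  rewrite Egb in K. specialize (K ltac:(lra) ltac:(lra)).
  replace (g - (g - rho)) with rho in K by ring. eapply Rle_trans; [exact K|].
  unfold dist2, cmp_pt; simpl fst; simpl snd.
  assert (B : 0 <= rho / r * e) by (apply Rmult_le_pos; [apply Rle_mult_inv_pos; lra | assumption]).
  rewrite <- (sqrt_square _ B). apply sqrt_le_1_alt.
  match goal with |- ?L <= _ => replace L with (2 * rho * rho * (g - u) / g) end.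
  - assert (E1 : 2 * a * (g - u) <= e * e).
    { pose proof (pow2_ge_0 (a - g)) as Q.
      replace (2 * a * (g - u)) with (e * e - (a - g) ^ 2); [lra|].
      replace (2 * a * (g - u)) with (2 * a * g - 2 * a * u) by ring. rewrite Hu. ring. }
    assert (G0 : 0 <= g - u) by lra.
    replace (rho / r * e * (rho / r * e)) with (rho * rho * ((e * e) / (r * r))) by (field; lra).
    replace (2 * rho * rho * (g - u) / g) with (rho * rho * (2 * (g - u) / g)) by (field; lra).
    apply Rmult_le_compat_l; [nra|].
    apply (Rmult_le_reg_r g); [lra|]. unfold Rdiv at 1. rewrite Rmult_assoc, Rinv_l by lra.
    apply (Rmult_le_reg_r (r * r)); [nra|].
    replace (e * e / (r * r) * g * (r * r)) with (e * e * g) by (field; lra).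
    assert (RR : r * r <= a * g) by (apply Rmult_le_compat; lra).
    apply Rle_trans with (2 * (g - u) * (a * g)).
    + rewrite Rmult_1_r. apply Rmult_le_compat_l; lra.
    + replace (2 * (g - u) * (a * g)) with (2 * a * (g - u) * g) by ring. apply Rmult_le_compat_r; lra.
  - transitivity (rho * rho * (1 - 2 * (u / g)) + rho * rho * ((u * u + v * v) / (g * g))).
    + rewrite Hv. field. lra.
    + field. split; lra.
Qed.

Variable U : (nat -> Prop) -> Prop.
Hypothesis HU : ultra U.

Definition ulim (u : nat -> X) (p : X) : Prop := forall e, 0 < e -> U (fun n => d (u n) p < e).

Lemma U_and P Q : U P -> U Q -> U (fun n => P n /\ Q n).
Proof. apply (ultra_and U HU). Qed.
Lemma U_mono P Q : (forall n, P n -> Q n) -> U P -> U Q.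
Proof. apply (ultra_mono U HU). Qed.
Lemma U_all (P : nat -> Prop) : (forall n, P n) -> U P.
Proof. intros H. apply (U_mono (fun n => (0 <= n)%nat)); [auto | apply (ultra_ge U HU)]. Qed.
Lemma U_ge (x : R) : U (fun n => x <= INR n).
Proof.
  destruct (INR_unbounded x) as [N HN]. apply (U_mono (fun n => (N <= n)%nat)); [|apply (ultra_ge U HU)].
  intros n Hn. apply le_INR in Hn. lra.
Qed.

Lemma bounded_ulim x r u : U (fun n => d x (u n) <= r) -> exists p, ulim u p.
Proof.
  intros B. apply NNPP. intros N.
  assert (E : forall p, exists e, 0 < e /\ U (fun n => ~ d (u n) p < e)).
  { intros p. apply NNPP. intros K. apply N. exists p. intros e He.
    destruct (ultra_em U HU (fun n => d (u n) p < e)) as [H | H]; [assumption|]. exfalso. eauto. }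
  pose (ef := fun p => proj1_sig (constructive_indefinite_description _ (E p))).
  assert (Hef : forall p, 0 < ef p /\ U (fun n => ~ d (u n) p < ef p))
    by (intros p; exact (proj2_sig (constructive_indefinite_description _ (E p)))).
  destruct (d_proper x r X (fun p y => d p y < ef p)) as [l Hl].
  - intros p y H. exists (ef p - d p y). split; [lra|]. intros z Hz. pose proof (d_tri p y z). lra.
  - intros y _. exists y. rewrite d_refl. apply Hef.
  - assert (K : forall l', U (fun n => forall p, In p l' -> ~ d (u n) p < ef p)).
    { induction l' as [|p l' IH]; [apply U_all; intros n p []|].
      apply (U_mono (fun n => ~ d (u n) p < ef p /\ forall q, In q l' -> ~ d (u n) q < ef q)).
      - intros n [H1 H2] q [<- | Hq]; auto.
      - apply U_and; [apply Hef | exact IH]. }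
    destruct (ultra_ne U HU _ (U_and _ _ (K l) B)) as [n [H1 H2]].
    destruct (Hl (u n) H2) as [p [Hp H3]]. apply (H1 p Hp). rewrite d_sym. exact H3.
Qed.

Lemma ulim_le u v p q k : ulim u p -> ulim v q -> U (fun n => d (u n) (v n) <= k) -> d p q <= k.
Proof.
  intros Hp Hq Hk. apply le_epsilon. intros e He.
  destruct (ultra_ne U HU _ (U_and _ _ Hk (U_and _ _ (Hp (e / 2) ltac:(lra)) (Hq (e / 2) ltac:(lra))))) as [n [H0 [H1 H2]]].
  pose proof (d_tri p (u n) q). pose proof (d_tri (u n) (v n) q). rewrite (d_sym p (u n)) in *. lra.
Qed.
Lemma ulim_ge u v p q k : ulim u p -> ulim v q -> U (fun n => k <= d (u n) (v n)) -> k <= d p q.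
Proof.
  intros Hp Hq Hk. apply le_epsilon. intros e He.
  destruct (ultra_ne U HU _ (U_and _ _ Hk (U_and _ _ (Hp (e / 2) ltac:(lra)) (Hq (e / 2) ltac:(lra))))) as [n [H0 [H1 H2]]].
  pose proof (d_tri (u n) p (v n)). pose proof (d_tri p q (v n)). rewrite (d_sym q (v n)) in *. lra.
Qed.

Variable x0 : X.
Local Notation boundary := (boundary d x0).
Definition rlim (xs : nat -> boundary) (xi : boundary) : Prop :=
  forall t, 0 <= t -> ulim (fun n => proj1_sig (xs n) t) (proj1_sig xi t).

(** The curves are required to be geodesic only up to each [T] and for almost all [n], so that
    segments to points going to infinity are allowed. *)
Lemma limit_ray (c : nat -> R -> X) :
  (forall T, 0 <= T -> U (fun n => c n 0 = x0 /\ forall s t, 0 <= s <= T -> 0 <= t <= T -> d (c n s) (c n t) = Rabs (s - t))) ->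
  exists xi : boundary, forall t, 0 <= t -> ulim (fun n => c n t) (proj1_sig xi t).
Proof.
  intros H.
  assert (L : forall t, 0 <= t -> exists p, ulim (fun n => c n t) p).
  { intros t Ht. apply (bounded_ulim x0 t).
    refine (U_mono _ _ _ (H t Ht)). intros n [H0 H1]. rewrite <- H0, H1 by lra.
    unfold Rabs; destruct (Rcase_abs _); lra. }
  pose (xi := fun t => if Rle_dec t 0 then x0 else epsilon (inhabits x0) (ulim (fun n => c n t))).
  assert (X1 : forall t, 0 <= t -> ulim (fun n => c n t) (xi t)).
  { intros t Ht. unfold xi. destruct (Rle_dec t 0).
    - assert (t = 0) as -> by lra. intros e He. refine (U_mono _ _ _ (H 0 (Rle_refl 0))). intros n [H0 _].
      rewrite H0, d_refl. assumption.
    - apply (epsilon_spec (inhabits x0) (ulim (fun n => c n t))), L, Ht. }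
  assert (BR : based_ray d x0 xi).
  { split.
    - intros t Ht. unfold xi. destruct (Rle_dec t 0); [reflexivity | contradiction].
    - intros s t Hs Ht.
      assert (E : U (fun n => d (c n s) (c n t) = Rabs (s - t))).
      { refine (U_mono _ _ _ (H (Rmax s t) _)).
        - intros n [_ H1]. apply H1; split; try assumption; [apply Rmax_l | apply Rmax_r].
        - eapply Rle_trans; [exact Hs | apply Rmax_l]. }
      apply Rle_antisym.
      + apply (ulim_le _ _ _ _ _ (X1 s Hs) (X1 t Ht)). refine (U_mono _ _ _ E). intros n ->. lra.
      + apply (ulim_ge _ _ _ _ _ (X1 s Hs) (X1 t Ht)). refine (U_mono _ _ _ E). intros n ->. lra. }
  exists (exist _ xi BR). exact X1.
Qed.

Lemma ray_dist (xi : boundary) t : 0 <= t -> d x0 (proj1_sig xi t) = t.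
Proof.
  intros Ht. destruct xi as [c [H1 H2]]. simpl. rewrite <- (H1 0) by lra. rewrite H2 by lra.
  unfold Rabs; destruct (Rcase_abs _); lra.
Qed.
Lemma ray_geod (xi : boundary) t : 0 <= t -> geod d (proj1_sig xi) x0 (proj1_sig xi t).
Proof.
  intros Ht. pose proof (ray_dist xi t Ht) as E. unfold geod. rewrite E. destruct xi as [c [H1 H2]]. simpl.
  split; [apply H1; lra | split; [reflexivity|]]. intros; apply H2; lra.
Qed.
Lemma boundary_compact (xs : nat -> boundary) : exists xi, rlim xs xi.
Proof.
  apply (limit_ray (fun n => proj1_sig (xs n))). intros T HT. apply U_all. intros n.
  destruct (xs n) as [c [H1 H2]]. simpl. split; [apply H1; lra|]. intros; apply H2; lra.
Qed.
Lemma rlim_open xs xi O : rlim xs xi -> cone_open d x0 O -> O xi -> U (fun n => O (xs n)).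
Proof.
  intros H HO Hxi. destruct (HO xi Hxi) as [r [e [Hr [He K]]]].
  refine (U_mono _ _ _ (H r (Rlt_le _ _ Hr) e He)). intros n Hn. apply K. rewrite d_sym. exact Hn.
Qed.

Definition geo (p : X) : R -> X := epsilon (inhabits (fun _ => x0)) (fun c => geod d c x0 p).
Lemma geo_spec p : geod d (geo p) x0 p.
Proof. apply (epsilon_spec (inhabits (fun _ => x0)) (fun c => geod d c x0 p)), d_geod. Qed.
Lemma geo_uniq c p t : geod d c x0 p -> 0 <= t <= d x0 p -> c t = geo p t.
Proof.
  intros G Ht. apply d_eq. apply Rle_antisym; [|apply d_ge0].
  destruct (Req_dec (d x0 p) 0) as [E | N].
  - assert (t = 0) as -> by lra. destruct G as [G0 _], (geo_spec p) as [G1 _]. rewrite G0, G1, d_refl. lra.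
  - pose proof (geodesics_close x0 p p c (geo p) (d x0 p) t G (geo_spec p) ltac:(lra) ltac:(lra) ltac:(lra) Ht) as K.
    rewrite d_refl, Rmult_0_r in K. exact K.
Qed.

(** The trace on the space of a basic neighbourhood of [xi] in its compactification by the visual
    boundary. *)
Definition near (xi : boundary) (r e : R) (p : X) : Prop := r <= d x0 p /\ d (geo p r) (proj1_sig xi r) < e.

(** Beyond radius [r0] a displacement by [D] shrinks to [r / r0 * D <= e / 2] at radius [r]; taking
    [p] beyond [r0 + D] keeps [z] beyond [r0]. *)
Lemma near_shift xi r e D : 0 <= r -> 0 < e -> 0 <= D ->
  exists r' e', r <= r' /\ 0 < e' /\ e' <= e /\ forall p z, near xi r' e' p -> d p z <= D -> near xi r e z.
Proof.
  intros Hr He HD. set (r0 := r + 1 + 2 * r * D / e).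
  assert (Q : 0 <= 2 * r * D / e) by (apply Rle_mult_inv_pos; [apply Rmult_le_pos; lra | assumption]).
  exists (r0 + D), (e / 2). repeat split; try (unfold r0; lra).
  - destruct H as [H1 _]. pose proof (d_tri x0 z p). rewrite (d_sym z p) in *. unfold r0 in *. lra.
  - destruct H as [H1 H2].
    assert (Hz : r0 <= d x0 z) by (pose proof (d_tri x0 z p); rewrite (d_sym z p) in *; lra).
    pose proof (geodesics_close x0 p z (geo p) (geo z) r0 r (geo_spec p) (geo_spec z)
      ltac:(unfold r0; lra) ltac:(lra) Hz ltac:(unfold r0; lra)) as K1.
    assert (K2 : r / r0 * d p z <= e / 2).
    { apply Rle_trans with (r / r0 * D).
      - apply Rmult_le_compat_l; [apply Rle_mult_inv_pos; unfold r0; lra | assumption].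
      - apply (Rmult_le_reg_r r0); [unfold r0; lra|].
        replace (r / r0 * D * r0) with (r * D) by (field; unfold r0; lra).
        assert (E : e / 2 * (2 * r * D / e) = r * D) by (field; lra).
        unfold r0. assert (0 <= e / 2 * (r + 1)) by (apply Rmult_le_pos; lra). lra. }
    assert (R1 : 0 < r0 + D) by (unfold r0; lra).
    assert (G1 : d x0 (geo p (r0 + D)) = r0 + D) by (apply (geod_dist _ _ p); [apply geo_spec | lra]).
    assert (G2 : d x0 (proj1_sig xi (r0 + D)) = r0 + D) by (apply ray_dist; lra).
    pose proof (geodesics_close x0 (geo p (r0 + D)) (proj1_sig xi (r0 + D)) (geo p) (proj1_sig xi) (r0 + D) r
      (geod_prefix _ _ _ (r0 + D) (geo_spec p) ltac:(lra)) (ray_geod xi (r0 + D) ltac:(lra)) R1 ltac:(lra) ltac:(lra) ltac:(unfold r0; lra)) as K3.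
    assert (K4 : r / (r0 + D) * d (geo p (r0 + D)) (proj1_sig xi (r0 + D)) < e / 2).
    { eapply Rle_lt_trans; [|exact H2].
      rewrite <- (Rmult_1_l (d (geo p (r0 + D)) (proj1_sig xi (r0 + D)))) at 2.
      apply Rmult_le_compat_r; [apply d_ge0|]. apply (Rmult_le_reg_r (r0 + D)); [assumption|].
      unfold Rdiv. rewrite Rmult_assoc, Rinv_l by lra. unfold r0; lra. }
    pose proof (d_tri (geo z r) (geo p r) (proj1_sig xi r)) as T. rewrite (d_sym (geo z r) (geo p r)) in T. lra.
Qed.
Lemma near_mono xi r e r' p : 0 <= r -> r < r' -> near xi r' e p -> near xi r e p.
Proof.
  intros Hr Hr' [H1 H2]. split; [lra|].
  assert (G1 : d x0 (geo p r') = r') by (apply (geod_dist _ _ p); [apply geo_spec | lra]).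
  assert (G2 : d x0 (proj1_sig xi r') = r') by (apply ray_dist; lra).
  pose proof (geodesics_close x0 (geo p r') (proj1_sig xi r') (geo p) (proj1_sig xi) r' r
      (geod_prefix _ _ _ r' (geo_spec p) ltac:(lra)) (ray_geod xi r' ltac:(lra)) ltac:(lra) ltac:(lra) ltac:(lra) ltac:(lra)) as K3.
  eapply Rle_lt_trans; [exact K3|]. eapply Rle_lt_trans; [|exact H2].
  rewrite <- (Rmult_1_l (d (geo p r') (proj1_sig xi r'))) at 2.
  apply Rmult_le_compat_r; [apply d_ge0|]. apply (Rmult_le_reg_r r'); [lra|].
  unfold Rdiv. rewrite Rmult_assoc, Rinv_l by lra. lra.
Qed.
Lemma near_both xi r1 e1 r2 e2 : 0 <= r1 -> 0 <= r2 -> 0 < e1 -> 0 < e2 ->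
  exists r e, 0 <= r /\ 0 < e /\ forall p, near xi r e p -> near xi r1 e1 p /\ near xi r2 e2 p.
Proof.
  intros H1 H2 H3 H4. exists (Rmax r1 r2 + 1), (Rmin e1 e2).
  pose proof (Rmax_l r1 r2). pose proof (Rmax_r r1 r2). split; [lra|]. split; [apply Rmin_glb_lt; assumption|].
  intros p Hp. split.
  - apply (near_mono xi r1 e1 (Rmax r1 r2 + 1)); [assumption | lra |]. destruct Hp. split; [assumption|].
    pose proof (Rmin_l e1 e2). lra.
  - apply (near_mono xi r2 e2 (Rmax r1 r2 + 1)); [assumption | lra |]. destruct Hp. split; [assumption|].
    pose proof (Rmin_r e1 e2). lra.
Qed.
Lemma near_geo xi r e p t : 0 <= r -> near xi r e p -> r <= t <= d x0 p -> near xi r e (geo p t).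
Proof.
  intros Hr [H1 H2] Ht.
  assert (G1 : d x0 (geo p t) = t) by (apply (geod_dist _ _ p); [apply geo_spec | lra]).
  split; [lra|]. rewrite <- (geo_uniq (geo p) (geo p t) r); [assumption | | lra].
  apply (geod_prefix _ _ p); [apply geo_spec | lra].
Qed.

Lemma points_limit (z : nat -> X) : (forall T, U (fun n => T <= d x0 (z n))) ->
  exists xi : boundary, forall r e, 0 <= r -> 0 < e -> U (fun n => near xi r e (z n)).
Proof.
  intros H. destruct (limit_ray (fun n => geo (z n))) as [xi Hxi].
  - intros T HT. refine (U_mono _ _ _ (H T)). intros n Hn. destruct (geo_spec (z n)) as [G0 [G1 G2]].
    split; [assumption|]. intros; apply G2; lra.
  - exists xi. intros r e Hr He. refine (U_mono _ _ _ (U_and _ _ (H r) (Hxi r Hr e He))).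
    intros n [H1 H2]. split; assumption.
Qed.
End Cat0.

(** * Limit sets of subsets of the group *)

Record geometric_setting {V X : Type} (adj : V -> V -> Prop) (d : X -> X -> R) (act : V -> X -> X)
    (U : (nat -> Prop) -> Prop) : Prop := {
  gs_finite : finite_type V;
  gs_irr : forall v, ~ adj v v;
  gs_sym : forall u v, adj u v -> adj v u;
  gs_tri : triangle_free adj;
  gs_metric : is_metric d;
  gs_proper : proper_metric d;
  gs_geod : geodesic_space d;
  gs_cat0 : cat0_ineq d;
  gs_iso : racg_isometric_action adj d act;
  gs_disc : prop_discontinuous adj d act;
  gs_cocompact : cocompact d act;
  gs_ultra : ultra U }.

Section Action.
Context {V X : Type} (adj : V -> V -> Prop) (d : X -> X -> R) (act : V -> X -> X) (U : (nat -> Prop) -> Prop).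
Hypothesis GS : geometric_setting adj d act U.
Variable x0 : X.
Local Notation racg := (racg adj).
Local Notation gen := (gen adj).
Local Notation cls := (cls adj).
Local Notation one := (one adj).
Local Notation "x ** y" := (mul adj x y) (at level 40, left associativity).
Local Notation inv := (inv adj).
Local Notation desc := (desc adj).
Local Notation len := (len adj).
Local Notation bd := (boundary d x0).

Local Notation met := (gs_metric _ _ _ _ GS).
Local Notation geods := (gs_geod _ _ _ _ GS).
Local Notation cat0 := (gs_cat0 _ _ _ _ GS).
Local Notation ult := (gs_ultra _ _ _ _ GS).
Local Notation sym := (gs_sym _ _ _ _ GS).
Local Notation irr := (gs_irr _ _ _ _ GS).
Local Notation dtri := (d_tri d met).
Local Notation dsym := (d_sym d met).
Local Notation Umono := (U_mono U ult).
Local Notation Uand := (U_and U ult).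

Definition gact (g : racg) (x : X) : X := act_word act (rep adj g) x.

Lemma act_word_eq w w' x : word_eq adj w w' -> act_word act w x = act_word act w' x.
Proof.
  apply (word_eq_inv adj (fun w => act_word act w x)). destruct (gs_iso _ _ _ _ GS) as [_ [I2 I3]].
  intros ? ? [l1 l2 s | l1 l2 s t Hst]; unfold act_word; rewrite !fold_right_app; simpl.
  - rewrite I2. reflexivity.
  - rewrite I3 by assumption. reflexivity.
Qed.
Lemma gact_cls w x : gact (cls w) x = act_word act w x.
Proof. apply act_word_eq, (cls_eq adj), cls_rep. Qed.
Lemma gact_mul g h x : gact (g ** h) x = gact g (gact h x).
Proof.
  unfold mul. rewrite gact_cls. unfold gact, act_word. rewrite fold_right_app. reflexivity.
Qed.
Lemma act_word_iso w x y : d (act_word act w x) (act_word act w y) = d x y.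
Proof.
  induction w as [|s w IH]; [reflexivity|]. simpl. rewrite (proj1 (gs_iso _ _ _ _ GS)). exact IH.
Qed.
Lemma gact_iso g x y : d (gact g x) (gact g y) = d x y.
Proof. apply act_word_iso. Qed.
Lemma gact_one x : gact one x = x.
Proof. apply (gact_cls []). Qed.

Definition orbit_pt (g : racg) : X := gact g x0.
Local Notation pt := orbit_pt.
Lemma pt_mul_dist g h h' : d (pt (g ** h)) (pt (g ** h')) = d (pt h) (pt h').
Proof. unfold pt. rewrite !gact_mul. apply gact_iso. Qed.
Lemma pt_step g h : d (pt g) (pt (g ** h)) = d x0 (pt h).
Proof.
  rewrite <- (mulg1 adj g) at 1. rewrite pt_mul_dist. unfold pt at 1. rewrite gact_one. reflexivity.
Qed.

Lemma finite_bound {A : Type} (f : A -> R) (l : list A) : exists M, 0 <= M /\ forall a, In a l -> f a <= M.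
Proof.
  induction l as [|a l [M [HM H]]]; [exists 0; split; [lra | intros ? []]|].
  exists (Rmax M (f a)). pose proof (Rmax_l M (f a)). pose proof (Rmax_r M (f a)). split; [lra|].
  intros b [<- | Hb]; [assumption|]. specialize (H b Hb). lra.
Qed.

Lemma orbit_lipschitz : exists L, 0 <= L /\ forall g, d x0 (pt g) <= L * INR (len g).
Proof.
  destruct (gs_finite _ _ _ _ GS) as [lV HlV].
  destruct (finite_bound (fun s => d x0 (act s x0)) lV) as [L [HL H]]. exists L. split; [assumption|].
  intros g. destruct (len_word adj g) as [w [<- <-]]. unfold pt. rewrite gact_cls.
  induction w as [|s w IH]; [simpl; rewrite (d_refl d met); lra|].
  change (act_word act (s :: w) x0) with (act s (act_word act w x0)).
  pose proof (dtri x0 (act s x0) (act s (act_word act w x0))) as T.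
  rewrite (proj1 (gs_iso _ _ _ _ GS)) in T. specialize (H s (HlV s)).
  change (length (s :: w)) with (S (length w)). rewrite S_INR. lra.
Qed.

Lemma orbit_dense : exists D, 0 <= D /\ forall x, exists g, d (pt g) x <= D.
Proof.
  destruct (gs_cocompact _ _ _ _ GS) as [K [HK HX]].
  destruct (HK nat (fun n y => d x0 y < INR n)) as [l Hl].
  - intros n x Hx. exists (INR n - d x0 x). split; [lra|]. intros y Hy. pose proof (dtri x0 x y). lra.
  - intros x _. destruct (INR_unbounded (d x0 x)) as [n Hn]. exists n. lra.
  - destruct (finite_bound INR l) as [D [HD H]]. exists D. split; [assumption|].
    intros x. destruct (HX x) as [w [y [Hy <-]]]. exists (cls w). unfold pt. rewrite gact_cls, act_word_iso.
    destruct (Hl y Hy) as [n [Hn H1]]. specialize (H n Hn). lra.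
Qed.

(** Otherwise orbit points of ever longer elements cluster at some [z]. The products
    [g n ** inv (g m)] then move a point near [z] to a point near [z], so they lie in a finite set
    and the length of [g n] stays bounded. *)
Lemma orbit_proper C : exists n, forall g, d x0 (pt g) <= C -> (len g <= n)%nat.
Proof.
  apply NNPP. intros N.
  assert (S : forall n, exists g, d x0 (pt g) <= C /\ (n < len g)%nat).
  { intros n. apply NNPP. intros K. apply N. exists n. intros g Hg.
    apply Nat.le_ngt. intros L. apply K. exists g. auto. }
  pose (g := fun n => proj1_sig (constructive_indefinite_description _ (S n))).
  assert (Hg : forall n, d x0 (pt (g n)) <= C /\ (n < len (g n))%nat)
    by (intros n; exact (proj2_sig (constructive_indefinite_description _ (S n)))).
  destruct (bounded_ulim d met (gs_proper _ _ _ _ GS) U ult x0 C (fun n => pt (g n))) as [z Hz].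
  { apply (U_all U ult). intros n. apply Hg. }
  destruct (gs_disc _ _ _ _ GS z) as [r [Hr [L HL]]].
  pose proof (Hz r Hr) as H1. destruct (ultra_ne U ult _ H1) as [m Hm].
  destruct (ultra_ne U ult _ (Uand _ _ H1 (ultra_ge U ult (list_max (map (@length V) L) + len (g m))%nat))) as [n [Hn1 Hn2]].
  destruct (HL (rep adj (g n ** inv (g m)))) as [w' [Hw E]].
  { exists (pt (g m)). rewrite dsym. split; [exact Hm|].
    change (d z (gact (g n ** inv (g m)) (gact (g m) x0)) < r). rewrite <- gact_mul, (mulgKV adj), dsym. exact Hn1. }
  apply (cls_eq adj) in E. rewrite cls_rep in E.
  assert (Lw : (length w' <= list_max (map (@length V) L))%nat).
  { pose proof (proj1 (list_max_le (map (@length V) L) _) (le_n _)) as F. rewrite Forall_forall in F.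
    apply F, in_map, Hw. }
  pose proof (len_le adj w') as L1. pose proof (len_mul adj (cls w') (g m)) as L2.
  rewrite <- E, (mulgKV adj) in L2. rewrite <- E in L1. destruct (Hg n). lia.
Qed.

Lemma finite_ball n : exists l : list racg, forall g, (len g <= n)%nat -> In g l.
Proof.
  destruct (gs_finite _ _ _ _ GS) as [lV HlV].
  assert (W : exists l : list (list V), forall w, (length w <= n)%nat -> In w l).
  { induction n as [|k [l Hl]].
    - exists [[]]. intros [|] H; simpl in *; [auto | lia].
    - exists ([] :: flat_map (fun v => map (cons v) l) lV). intros [|v w] H; [left; reflexivity | right].
      apply in_flat_map. exists v. split; [apply HlV | apply in_map, Hl]. simpl in H. lia. }
  destruct W as [l Hl]. exists (map cls l). intros g Hg. destruct (len_word adj g) as [w [<- Hw]].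
  apply in_map, Hl. lia.
Qed.

Definition gnear (xi : bd) (r e : R) (g : racg) : Prop := near d x0 xi r e (pt g).
Definition limit (P : racg -> Prop) (xi : bd) : Prop :=
  forall r e, 0 <= r -> 0 < e -> exists g, P g /\ gnear xi r e g.
Definition eventually_at (xi : bd) (P : racg -> Prop) : Prop :=
  exists r e, 0 <= r /\ 0 < e /\ forall g, gnear xi r e g -> P g.

Lemma gnear_shift xi r e N : 0 <= r -> 0 < e -> exists r' e', 0 <= r' /\ 0 < e' /\
  forall g h, gnear xi r' e' g -> (len h <= N)%nat -> gnear xi r e (g ** h).
Proof.
  intros Hr He. destruct orbit_lipschitz as [L [HL H]].
  assert (B : 0 <= L * INR N) by (apply Rmult_le_pos; [assumption | apply pos_INR]).
  destruct (near_shift d met geods cat0 x0 xi r e _ Hr He B) as [r' [e' [H1 [H2 [_ H3]]]]].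
  exists r', e'. split; [lra | split; [assumption|]]. intros g h Hg Hh. apply (H3 _ _ Hg). rewrite pt_step.
  eapply Rle_trans; [apply H|]. apply Rmult_le_compat_l; [assumption | apply le_INR, Hh].
Qed.

Lemma limit_eventually P Q xi : limit P xi -> eventually_at xi Q -> limit (fun g => P g /\ Q g) xi.
Proof.
  intros HP [r [e [Hr [He HQ]]]] r1 e1 Hr1 He1.
  destruct (near_both d met geods cat0 x0 xi r e r1 e1 Hr Hr1 He He1) as [r2 [e2 [Hr2 [He2 H]]]].
  destruct (HP r2 e2 Hr2 He2) as [g [Pg Ng]]. destruct (H _ Ng). exists g. split; [split; [|apply HQ]|]; assumption.
Qed.
Lemma limit_witness P xi : limit P xi -> exists g, P g.
Proof. intros H. destruct (H 0 1) as [g [Hg _]]; [lra | lra | exists g; exact Hg]. Qed.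
Lemma limit_meets P Q xi : limit P xi -> eventually_at xi Q -> exists g, P g /\ Q g.
Proof. intros HP HQ. apply (limit_witness _ xi), limit_eventually; assumption. Qed.
Lemma limit_mono P Q xi : (forall g, P g -> Q g) -> limit P xi -> limit Q xi.
Proof. intros H HP r e Hr He. destruct (HP r e Hr He) as [g [Hg N]]. exists g. auto. Qed.
Lemma not_limit P xi : ~ limit P xi -> eventually_at xi (fun g => ~ P g).
Proof.
  intros H. apply NNPP. intros K. apply H. intros r e Hr He. apply NNPP. intros N. apply K.
  exists r, e. split; [assumption | split; [assumption|]]. intros g Hg Pg. apply N. exists g. auto.
Qed.
Lemma eventually_and xi P Q : eventually_at xi P -> eventually_at xi Q -> eventually_at xi (fun g => P g /\ Q g).
Proof.
  intros [r [e [Hr [He HP]]]] [r1 [e1 [Hr1 [He1 HQ]]]].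
  destruct (near_both d met geods cat0 x0 xi r e r1 e1 Hr Hr1 He He1) as [r2 [e2 [Hr2 [He2 H]]]].
  exists r2, e2. split; [assumption | split; [assumption|]]. intros g Ng. destruct (H _ Ng). auto.
Qed.
Lemma eventually_mono xi (P Q : racg -> Prop) : (forall g, P g -> Q g) -> eventually_at xi P -> eventually_at xi Q.
Proof. intros H [r [e [Hr [He HP]]]]. exists r, e. auto. Qed.
Lemma eventually_all xi (Q : V -> racg -> Prop) :
  (forall v, eventually_at xi (Q v)) -> eventually_at xi (fun g => forall v, Q v g).
Proof.
  intros H. destruct (gs_finite _ _ _ _ GS) as [lV HlV].
  assert (K : forall l, eventually_at xi (fun g => forall v, In v l -> Q v g)).
  { induction l as [|v l IH]; [exists 0, 1; repeat split; try lra; intros ? ? ? []|].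
    refine (eventually_mono _ _ _ _ (eventually_and _ _ _ (H v) IH)). intros g [H1 H2] u [<- | Hu]; auto. }
  refine (eventually_mono _ _ _ _ (K lV)). auto.
Qed.
Lemma eventually_long xi n : eventually_at xi (fun g => (n <= len g)%nat).
Proof.
  destruct orbit_lipschitz as [L [HL H]].
  exists (L * INR n + 1), 1. pose proof (Rmult_le_pos _ _ HL (pos_INR n)). repeat split; try lra.
  intros g [N _]. apply Nat.le_ngt. intros K. specialize (H g).
  assert (INR (len g) <= INR n) by (apply le_INR; lia).
  assert (L * INR (len g) <= L * INR n) by (apply Rmult_le_compat_l; assumption). lra.
Qed.

Lemma limit_shift P Q xi N : limit P xi -> (forall g, P g -> exists h, (len h <= N)%nat /\ Q (g ** h)) -> limit Q xi.
Proof.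
  intros HP H r e Hr He. destruct (gnear_shift xi r e N Hr He) as [r' [e' [Hr' [He' K]]]].
  destruct (HP r' e' Hr' He') as [g [Pg Ng]]. destruct (H g Pg) as [h [Hh Qh]]. exists (g ** h). auto.
Qed.
Lemma limit_gen P Q xi : limit P xi -> (forall g, P g -> exists v, Q (g ** gen v)) -> limit Q xi.
Proof.
  intros HP H. apply (limit_shift P Q xi 1 HP). intros g Pg. destruct (H g Pg) as [v Hv].
  exists (gen v). split; [apply len_gen | exact Hv].
Qed.
Lemma limit_or P Q xi : limit (fun g => P g \/ Q g) xi -> limit P xi \/ limit Q xi.
Proof.
  intros H. apply NNPP. intros N. apply not_or_and in N. destruct N as [N1 N2].
  destruct (limit_meets _ _ xi H (eventually_and _ _ _ (not_limit _ _ N1) (not_limit _ _ N2))) as [g [[|] [? ?]]]; auto.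
Qed.
Lemma limit_all xi : limit (fun _ => True) xi.
Proof.
  destruct orbit_dense as [D [HD H]]. intros r e Hr He.
  destruct (near_shift d met geods cat0 x0 xi r e D Hr He HD) as [r' [e' [H1 [H2 [_ H3]]]]].
  destruct (H (proj1_sig xi r')) as [g Hg]. exists g. split; [exact I|].
  apply (H3 (proj1_sig xi r')); [|rewrite dsym; exact Hg].
  assert (E : d x0 (proj1_sig xi r') = r') by (apply ray_dist; lra).
  split; [lra|]. rewrite <- (geo_uniq d met geods cat0 x0 (proj1_sig xi)); [rewrite (d_refl d met); assumption | apply ray_geod; lra | lra].
Qed.

Lemma limit_closed P : cone_open d x0 (fun xi => ~ limit P xi).
Proof.
  intros xi H. destruct (not_limit _ _ H) as [r [e [Hr [He K]]]]. exists (r + 1), (e / 2). repeat split; try lra.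
  intros xi' Hd L. destruct (L (r + 1) (e / 2)) as [g [Pg [N1 N2]]]; [lra | lra |]. apply (K g); [|exact Pg].
  apply (near_mono d met geods cat0 x0 xi r e (r + 1)); [lra | lra |]. split; [exact N1|].
  pose proof (dtri (geo d x0 (pt g) (r + 1)) (proj1_sig xi' (r + 1)) (proj1_sig xi (r + 1))).
  rewrite (dsym (proj1_sig xi (r + 1))) in Hd. lra.
Qed.
Lemma limit_rlim P xs xi : (forall n, limit P (xs n)) -> rlim d U x0 xs xi -> limit P xi.
Proof.
  intros H Hr. apply NNPP. intros N.
  destruct (ultra_ne U ult _ (rlim_open d met U ult x0 xs xi _ Hr (limit_closed P) N)) as [n Hn]. exact (Hn (H n)).
Qed.

Lemma orbit_cluster (g : nat -> racg) : (forall n, (n <= len (g n))%nat) ->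
  exists xi : bd, forall Q, eventually_at xi Q -> U (fun n => Q (g n)).
Proof.
  intros Hg. destruct (points_limit d met (gs_proper _ _ _ _ GS) geods U ult x0 (fun n => pt (g n))) as [xi Hxi].
  - intros T. destruct (orbit_proper T) as [m Hm]. refine (Umono _ _ _ (ultra_ge U ult (S m))).
    intros n Hn. destruct (Rle_or_lt T (d x0 (pt (g n)))) as [|K]; [assumption|].
    specialize (Hm (g n) (Rlt_le _ _ K)). specialize (Hg n). lia.
  - exists xi. intros Q [r [e [Hr [He HQ]]]]. refine (Umono _ _ _ (Hxi r e Hr He)). intros n. apply HQ.
Qed.
Lemma limit_nonempty P : (forall n, exists g, P g /\ (n <= len g)%nat) -> exists xi, limit P xi.
Proof.
  intros H.
  pose (g := fun n => proj1_sig (constructive_indefinite_description _ (H n))).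
  assert (Hg : forall n, P (g n) /\ (n <= len (g n))%nat)
    by (intros n; exact (proj2_sig (constructive_indefinite_description _ (H n)))).
  destruct (orbit_cluster g) as [xi Hxi]; [intros n; apply Hg|]. exists xi. apply NNPP. intros N.
  destruct (ultra_ne U ult _ (Hxi _ (not_limit _ _ N))) as [n Hn]. apply Hn, Hg.
Qed.

(** Follow the geodesic to [a] back to radius [r'], change to the geodesic to [b] and go out again.
    Orbit points near this route are joined by words of bounded length, which stay near [xi]. *)
Lemma near_orbit_path xi r e : 0 <= r -> 0 < e -> exists r' e', 0 <= r' /\ 0 < e' /\
  forall a b, gnear xi r' e' a -> gnear xi r' e' b ->
    clos_refl_trans _ (fun a b => gnear xi r e a /\ gnear xi r e b /\ exists v, b = a ** gen v) a b.
Proof.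
  intros Hr He. set (rt := clos_refl_trans _ _).
  destruct orbit_lipschitz as [L [HL Lip]]. destruct orbit_dense as [D [HD Dense]].
  (* Consecutive points of the route are at most [1 + 2 * e] apart, by unit steps along a geodesic
     or by the change at radius [r']; each is within [D] of the orbit. *)
  destruct (orbit_proper (2 * D + 1 + 2 * e)) as [N HN].
  assert (HLN : 0 <= L * INR N) by (apply Rmult_le_pos; [assumption | apply pos_INR]).
  destruct (near_shift d met geods cat0 x0 xi r e (D + L * INR N) Hr He ltac:(lra)) as [r' [e' [H1 [H2 [H3 H4]]]]].
  assert (Close : forall z z' g g', near d x0 xi r' e' z -> d z z' <= 1 + 2 * e ->
    d (pt g) z <= D -> d (pt g') z' <= D -> rt g g').
  { intros z z' g g' Hz Hzz Hg Hg'.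
    assert (B : (len (inv g ** g') <= N)%nat).
    { apply HN. rewrite <- (pt_step g), (mulKVg adj). pose proof (dtri (pt g) z (pt g')).
      pose proof (dtri z z' (pt g')). rewrite (dsym z' (pt g')) in *. lra. }
    rewrite <- (mulKVg adj g g'). destruct (len_word adj (inv g ** g')) as [w [Ew Lw]]. rewrite <- Ew.
    assert (K : forall w2 w1, (length (w1 ++ w2) <= N)%nat -> rt (g ** cls w1) (g ** cls (w1 ++ w2))).
    { assert (NN : forall w1, (length w1 <= N)%nat -> gnear xi r e (g ** cls w1)).
      { intros w1 Hw1. apply (H4 z); [assumption|]. pose proof (dtri z (pt g) (pt (g ** cls w1))) as T.
        rewrite pt_step, (dsym z (pt g)) in T. pose proof (Lip (cls w1)) as T2.
        assert (L * INR (len (cls w1)) <= L * INR N).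
        { apply Rmult_le_compat_l; [assumption|]. apply le_INR. pose proof (len_le adj w1). lia. }
        lra. }
      induction w2 as [|v w2 IH]; intros w1 Hw.
      - rewrite app_nil_r. apply rt_refl.
      - rewrite length_app in Hw. simpl in Hw.
        assert (E1 : w1 ++ v :: w2 = (w1 ++ [v]) ++ w2) by (rewrite <- app_assoc; reflexivity).
        apply rt_trans with (g ** cls (w1 ++ [v])).
        + apply rt_step. split; [apply NN; lia|]. split; [apply NN; rewrite length_app; simpl; lia|].
          exists v. rewrite cls_app, (mulA adj). reflexivity.
        + rewrite E1. apply IH. rewrite !length_app. simpl. lia. }
    specialize (K w []). simpl in K. change (cls []) with one in K. rewrite (mulg1 adj) in K. apply K. lia. }
  assert (Along : forall p, near d x0 xi r' e' p -> forall k t t' g g', r' <= t -> t <= t' <= t + INR k -> t' <= d x0 p ->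
    d (pt g) (geo d x0 p t) <= D -> d (pt g') (geo d x0 p t') <= D -> rt g g' /\ rt g' g).
  { intros p Hp. destruct (geo_spec d geods x0 p) as [_ [_ Gp]].
    assert (Nt : forall t, r' <= t <= d x0 p -> near d x0 xi r' e' (geo d x0 p t)).
    { intros t Ht. apply (near_geo d met geods cat0); [lra | assumption | assumption]. }
    induction k as [|k IH]; intros t t' g g' Ht Htt Ht' Hg Hg'.
    - assert (E : t' = t) by (simpl in Htt; lra). subst t'. split; apply (Close (geo d x0 p t) (geo d x0 p t)); try assumption;
      try (apply Nt; lra); rewrite (d_refl d met); lra.
    - rewrite S_INR in Htt. destruct (Rle_or_lt t' (t + 1)) as [C | C].
      + assert (B : d (geo d x0 p t) (geo d x0 p t') <= 1 + 2 * e).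
        { rewrite Gp by lra. unfold Rabs; destruct (Rcase_abs _); lra. }
        split; [apply (Close (geo d x0 p t) (geo d x0 p t')) | apply (Close (geo d x0 p t') (geo d x0 p t))]; try assumption; try (apply Nt; lra).
        rewrite dsym. exact B.
      + destruct (Dense (geo d x0 p (t + 1))) as [g1 Hg1].
        destruct (IH (t + 1) t' g1 g' ltac:(lra) ltac:(lra) Ht' Hg1 Hg') as [A1 A2].
        assert (B : d (geo d x0 p t) (geo d x0 p (t + 1)) <= 1 + 2 * e).
        { rewrite Gp by lra. unfold Rabs; destruct (Rcase_abs _); lra. }
        split.
        * apply rt_trans with g1; [|assumption]. apply (Close (geo d x0 p t) (geo d x0 p (t + 1))); try assumption. apply Nt; lra.
        * apply rt_trans with g1; [assumption|]. apply (Close (geo d x0 p (t + 1)) (geo d x0 p t)); try assumption; [apply Nt; lra|].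
          rewrite dsym. exact B. }
  exists r', e'. split; [lra | split; [assumption|]]. intros a b Ha Hb.
  assert (End : forall a, gnear xi r' e' a -> exists g, d (pt g) (geo d x0 (pt a) r') <= D /\ rt g a /\ rt a g).
  { intros c Hc. destruct (Dense (geo d x0 (pt c) r')) as [g Hg]. exists g. split; [assumption|].
    destruct (INR_unbounded (d x0 (pt c))) as [k Hk]. pose proof (proj1 Hc) as Lc.
    apply (Along (pt c) Hc k r' (d x0 (pt c)) g c); try lra; try assumption.
    destruct (geo_spec d geods x0 (pt c)) as [_ [-> _]]. rewrite (d_refl d met). assumption. }
  destruct (End a Ha) as [ga [A1 [A2 A3]]]. destruct (End b Hb) as [gb [B1 [B2 B3]]].
  apply rt_trans with ga; [assumption|]. apply rt_trans with gb; [|assumption].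
  apply (Close (geo d x0 (pt a) r') (geo d x0 (pt b) r')); try assumption.
  - apply (near_geo d met geods cat0); [lra | assumption | destruct Ha; lra].
  - destruct Ha as [_ Ha], Hb as [_ Hb]. rewrite dsym in Hb. pose proof (dtri (geo d x0 (pt a) r') (proj1_sig xi r') (geo d x0 (pt b) r')). lra.
Qed.

(** The path of [near_orbit_path] from an element of [P] to one outside leaves [P] at some step. *)
Lemma crossing P xi : limit P xi -> limit (fun g => ~ P g) xi ->
  limit (fun g => P g /\ exists v, ~ P (g ** gen v)) xi.
Proof.
  intros H1 H2 r e Hr He. destruct (near_orbit_path xi r e Hr He) as [r' [e' [Hr' [He' K]]]].
  destruct (H1 r' e' Hr' He') as [a [Pa Na]]. destruct (H2 r' e' Hr' He') as [b [Pb Nb]].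
  specialize (K a b Na Nb). clear Na Nb H1 H2. apply clos_rt_rt1n in K.
  induction K as [a | a b c [N1 [N2 [v ->]]] _ IH]; [contradiction|].
  destruct (classic (P (a ** gen v))) as [Q | Q]; [apply IH; assumption|]. exists a. split; [split; [assumption | exists v; assumption] | assumption].
Qed.
End Action.

(** * Walls at infinity and connectedness of limit sets *)

Section Walls.
Context {V X : Type} (adj : V -> V -> Prop) (d : X -> X -> R) (act : V -> X -> X) (U : (nat -> Prop) -> Prop).
Hypothesis GS : geometric_setting adj d act U.
Variable x0 : X.
Local Notation racg := (racg adj).
Local Notation gen := (gen adj).
Local Notation one := (one adj).
Local Notation "x ** y" := (mul adj x y) (at level 40, left associativity).
Local Notation inv := (inv adj).
Local Notation desc := (desc adj).
Local Notation len := (len adj).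
Local Notation bd := (boundary d x0).
Local Notation met := (gs_metric _ _ _ _ GS).
Local Notation geods := (gs_geod _ _ _ _ GS).
Local Notation cat0 := (gs_cat0 _ _ _ _ GS).
Local Notation ult := (gs_ultra _ _ _ _ GS).
Local Notation sym := (gs_sym _ _ _ _ GS).
Local Notation irr := (gs_irr _ _ _ _ GS).
Local Notation dtri := (d_tri d met).
Local Notation dsym := (d_sym d met).
Local Notation limit := (limit adj d act x0).
Local Notation eventually_at := (eventually_at adj d act x0).
Local Notation pt := (orbit_pt adj act x0).
Local Notation gact := (gact adj act).
Local Notation geo := (geo d x0).

(** Seen from [phi p], the geodesics to [phi x0] and to [x0] stay within [K]; seen from [x0], those
    to [p] and to [phi p] stay within [A]. The lengths [T] and [T'] differ by at most [K], which
    costs a second [K]. *)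
Lemma geod_displacement (phi : X -> X) p A t : (forall x y, d (phi x) (phi y) = d x y) ->
  d p (phi p) <= A -> d x0 (phi x0) <= t -> t <= d x0 p - d x0 (phi x0) ->  0 < t ->
  d (phi (geo p t)) (geo p t) <= 2 * d x0 (phi x0) + A.
Proof.
  intros Hphi HA. set (K := d x0 (phi x0)). set (T := d x0 p). set (T' := d x0 (phi p)). intros H1 H2 Ht.
  assert (K0 : 0 <= K) by apply (d_ge0 d met).
  assert (E : d (phi x0) (phi p) = T) by apply Hphi.
  assert (B1 : T <= K + T'). { rewrite <- E. pose proof (dtri (phi x0) x0 (phi p)). rewrite (dsym (phi x0) x0) in *. exact H. }
  assert (B2 : T' <= K + T). { rewrite <- E. apply dtri. }
  assert (G1 : geod d (fun s => phi (geo p (T - s))) (phi p) (phi x0)).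
  { pose proof (geod_rev d met _ _ _ (geo_spec d geods x0 p)) as [A0 [A1 A2]]. unfold geod.
    rewrite Hphi. fold T in A0, A1, A2. split; [congruence|]. split; [congruence|]. intros; rewrite Hphi. apply A2; assumption. }
  pose proof (geod_rev d met _ _ _ (geo_spec d geods x0 (phi p))) as G2. fold T' in G2.
  assert (Rp : 0 < Rmin T T') by (apply Rmin_glb_lt; lra).
  pose proof (Rmin_l T T') as Rl. pose proof (Rmin_r T T') as Rr.
  assert (Scale : forall rho k, 0 <= rho <= Rmin T T' -> 0 <= k -> rho / Rmin T T' * k <= k).
  { intros rho k Hrho Hk. rewrite <- (Rmult_1_l k) at 2. apply Rmult_le_compat_r; [assumption|].
    apply (Rmult_le_reg_r (Rmin T T')); [assumption|]. unfold Rdiv. rewrite Rmult_assoc, Rinv_l by lra. lra. }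
  assert (Hr1 : 0 <= T - t <= Rmin T T') by (split; [lra | apply Rmin_glb; lra]).
  assert (Hr2 : 0 <= t <= Rmin T T') by (split; [lra | apply Rmin_glb; lra]).
  pose proof (geodesics_close d met geods cat0 (phi p) (phi x0) x0 _ _ (Rmin T T') (T - t) G1 G2 Rp
    ltac:(rewrite dsym, E; assumption) ltac:(rewrite dsym; assumption) Hr1) as C1.
  pose proof (geodesics_close d met geods cat0 x0 p (phi p) _ _ (Rmin T T') t (geo_spec d geods x0 p) (geo_spec d geods x0 (phi p)) Rp Rl Rr Hr2) as C2.
  cbv beta in C1. replace (T - (T - t)) with t in C1 by ring. rewrite (dsym (phi x0) x0) in C1. fold K in C1.
  pose proof (Scale _ K Hr1 K0) as S1. pose proof (Scale _ (d p (phi p)) Hr2 (d_ge0 d met _ _)) as S2.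
  assert (C3 : d (geo (phi p) (T' - (T - t))) (geo (phi p) t) <= K).
  { destruct (geo_spec d geods x0 (phi p)) as [_ [_ G]]. fold T' in G. rewrite G by lra.
    unfold Rabs; destruct (Rcase_abs _); lra. }
  pose proof (dtri (phi (geo p t)) (geo (phi p) (T' - (T - t))) (geo p t)).
  pose proof (dtri (geo (phi p) (T' - (T - t))) (geo (phi p) t) (geo p t)). rewrite (dsym (geo (phi p) t) (geo p t)) in *. lra.
Qed.

(** The point [xi] is adherent to both sides of the wall of the reflection [g ** gen s ** inv g]. *)
Definition on_wall (g : racg) (s : V) (xi : bd) : Prop :=
  limit (fun x => desc s (inv g ** x) = true) xi /\ limit (fun x => ~ desc s (inv g ** x) = true) xi.

Lemma on_wall_crossing g s xi : on_wall g s xi -> limit (fun x => desc s (inv g ** x) = true /\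
  gen s ** (inv g ** x) = inv g ** x ** gen s) xi.
Proof.
  intros [H1 H2]. refine (limit_mono _ _ _ _ _ _ _ _ (crossing _ _ _ _ GS _ _ _ H1 H2)).
  intros x [Hx [v Hv]]. split; [assumption|]. rewrite (mulA adj) in Hv.
  assert (E : gen s ** (inv g ** x) = inv g ** x ** gen v).
  { apply desc_change. rewrite Hx. exact Hv. }
  pose proof (wall_letter adj _ _ _ E). subst. exact E.
Qed.

(** The reflection moves orbit points next to its wall by a bounded distance, hence also the
    geodesics to them, and such points accumulate at [xi]. *)
Lemma wall_displacement g s xi : on_wall g s xi ->
  exists C t0, forall t, t0 <= t -> d (gact (g ** gen s ** inv g) (proj1_sig xi t)) (proj1_sig xi t) <= C.
Proof.
  intros W. set (rho := g ** gen s ** inv g). set (phi := gact rho). set (K := d x0 (phi x0)).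
  destruct (orbit_lipschitz _ _ _ _ GS x0) as [L [HL Lip]].
  assert (K0 : 0 <= K) by apply (d_ge0 d met).
  exists (2 * K + L + 2), (K + 1). intros t Ht.
  destruct (on_wall_crossing _ _ _ W (t + K + 1) 1 ltac:(lra) ltac:(lra)) as [x [[_ E] N]].
  pose proof (near_mono d met geods cat0 x0 xi t 1 (t + K + 1) (pt x) ltac:(lra) ltac:(lra) N) as [_ N2].
  destruct N as [N1 _].
  assert (A : d (pt x) (phi (pt x)) <= L).
  { unfold phi, orbit_pt. rewrite <- (gact_mul _ _ _ _ GS).
    assert (E2 : rho ** x = x ** gen s).
    { unfold rho. rewrite <- !(mulA adj), E, !(mulA adj), (mulgV adj), (mul1g adj). reflexivity. }
    rewrite E2. fold (pt x). fold (pt (x ** gen s)). rewrite (pt_step _ _ _ _ GS).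
    eapply Rle_trans; [apply Lip|]. pose proof (le_INR _ _ (len_gen adj s)) as G. simpl in G.
    rewrite <- (Rmult_1_r L) at 2. apply Rmult_le_compat_l; assumption. }
  pose proof (geod_displacement phi (pt x) L t (gact_iso _ _ _ _ GS rho) A ltac:(change (K <= t); lra) ltac:(change (t <= d x0 (pt x) - K); lra) ltac:(lra)) as D.
  fold K in D. set (a := geo (pt x) t) in *. set (b := proj1_sig xi t) in *.
  pose proof (gact_iso _ _ _ _ GS rho b a) as I. fold phi in I.
  pose proof (dtri (phi b) (phi a) b). pose proof (dtri (phi a) a b). rewrite (dsym b a) in *. unfold phi in *. lra.
Qed.

Lemma conj_commute (s h k : racg) : inv h ** s ** h = inv k ** s ** k -> (h ** inv k) ** s = s ** (h ** inv k).
Proof.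
  intros E. apply (mulIg adj k). rewrite <- !(mulA adj). rewrite (mulVg adj), (mulg1 adj).
  apply (mulgI adj (inv h)). rewrite !(mulA adj), (mulVg adj), (mul1g adj). symmetry. exact E.
Qed.

(** Both reflections move the ray a bounded distance, so their conjugates by elements [h n] along
    the ray lie in a finite set. When the conjugates agree for [n] far beyond [m], the element
    [h n ** inv (h m)], conjugated into the base point [g], commutes with [s] and [t], and
    [central_len] bounds the length of [h n]. *)
Lemma walls_not_adjacent g s t xi : adj s t -> on_wall g s xi -> on_wall g t xi -> False.
Proof.
  intros Hst Ws Wt.
  destruct (wall_displacement _ _ _ Ws) as [C1 [t1 H1]]. destruct (wall_displacement _ _ _ Wt) as [C2 [t2 H2]].
  destruct (orbit_dense _ _ _ _ GS x0) as [D [HD Dense]].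
  set (T := Rmax 0 (Rmax t1 t2)).
  assert (HT : 0 <= T /\ t1 <= T /\ t2 <= T).
  { unfold T. pose proof (Rmax_l 0 (Rmax t1 t2)). pose proof (Rmax_r 0 (Rmax t1 t2)).
    pose proof (Rmax_l t1 t2). pose proof (Rmax_r t1 t2). lra. }
  destruct (choice (fun n h => d (pt h) (proj1_sig xi (T + INR n)) <= D)) as [h Hh]; [intros n; apply Dense|].
  destruct (orbit_proper _ _ _ _ GS x0 (Rmax C1 C2 + 2 * D)) as [N HN].
  destruct (finite_ball _ _ _ _ GS N) as [l Hl].
  assert (B : forall u n, d (gact (g ** gen u ** inv g) (proj1_sig xi (T + INR n))) (proj1_sig xi (T + INR n)) <= Rmax C1 C2 ->
    In (inv (h n) ** (g ** gen u ** inv g) ** h n) l).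
  { intros u n Hu. apply Hl, HN. set (rho := g ** gen u ** inv g) in *.
    rewrite <- (pt_step _ _ _ _ GS _ (h n)), <- !(mulA adj), (mulKVg adj).
    unfold orbit_pt at 2. rewrite (gact_mul _ _ _ _ GS). fold (pt (h n)). specialize (Hh n). set (b := proj1_sig xi (T + INR n)) in *.
    pose proof (gact_iso _ _ _ _ GS rho b (pt (h n))) as I.
    pose proof (dtri (pt (h n)) b (gact rho (pt (h n)))). pose proof (dtri b (gact rho b) (gact rho (pt (h n)))).
    rewrite (dsym b (gact rho b)), (dsym b (pt (h n))) in *. lra. }
  pose proof (Rmax_l C1 C2). pose proof (Rmax_r C1 C2).
  destruct (ultra_list U ult _ (list_prod l l) (fun p n => inv (h n) ** (g ** gen s ** inv g) ** h n = fst p /\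
     inv (h n) ** (g ** gen t ** inv g) ** h n = snd p)) as [[a b] [_ Hab]].
  { intros n. pose proof (pos_INR n). exists (inv (h n) ** (g ** gen s ** inv g) ** h n, inv (h n) ** (g ** gen t ** inv g) ** h n). simpl. split; [|auto].
    apply in_prod; apply B.
    - specialize (H1 (T + INR n) ltac:(lra)). lra.
    - specialize (H2 (T + INR n) ltac:(lra)). lra. }
  destruct (ultra_ne U ult _ Hab) as [m [Am Bm]]. simpl in Am, Bm.
  destruct (orbit_lipschitz _ _ _ _ GS x0) as [L [HL Lip]].
  set (M := (2 + (len g + len g) + len (h m))%nat).
  destruct (ultra_ne U ult _ (U_and U ult _ _ Hab (U_ge U ult (L * INR M + D + 1)))) as [n [[An Bn] Hn]]. simpl in An, Bn.
  assert (Q : forall u, inv (h n) ** (g ** gen u ** inv g) ** h n = inv (h m) ** (g ** gen u ** inv g) ** h m ->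
    gen u ** (inv g ** (h n ** inv (h m)) ** g) = inv g ** (h n ** inv (h m)) ** g ** gen u).
  { intros u E. pose proof (conj_commute _ _ _ E) as C.
    apply (mulgI adj g). apply (mulIg adj (inv g)).
    set (k := h n ** inv (h m)) in *. rewrite !(mulA adj) in C. rewrite !(mulA adj). rewrite !(mulgV adj), !(mul1g adj), (mulgK adj).
    symmetry. exact C. }
  pose proof (central_len adj irr sym (gs_tri _ _ _ _ GS) s t (inv g ** (h n ** inv (h m)) ** g) Hst
    (Q s (eq_trans An (eq_sym Am))) (Q t (eq_trans Bn (eq_sym Bm)))) as CL.
  assert (LN : (len (h n) <= M)%nat).
  { assert (E : h n = g ** (inv g ** (h n ** inv (h m)) ** g) ** inv g ** h m).
    { rewrite !(mulA adj), (mulgV adj), (mul1g adj), (mulgK adj), (mulgKV adj). reflexivity. }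
    rewrite E. unfold M.
    pose proof (len_mul adj (g ** (inv g ** (h n ** inv (h m)) ** g) ** inv g) (h m)).
    pose proof (len_mul adj (g ** (inv g ** (h n ** inv (h m)) ** g)) (inv g)).
    pose proof (len_mul adj g (inv g ** (h n ** inv (h m)) ** g)). rewrite (len_inv adj) in *. lia. }
  pose proof (Lip (h n)) as L1. pose proof (pos_INR n).
  assert (L2 : d x0 (proj1_sig xi (T + INR n)) = T + INR n) by (apply ray_dist; lra).
  specialize (Hh n). pose proof (dtri x0 (pt (h n)) (proj1_sig xi (T + INR n))).
  assert (L * INR (len (h n)) <= L * INR M) by (apply Rmult_le_compat_l; [assumption | apply le_INR, LN]). lra.
Qed.

(* The half-spaces based at [g] whose closure is a neighbourhood of [xi]: the walls through [xi] are pairwise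
   non-adjacent, so crossing one of them next to [xi] would leave an element with no descent available. *)
Lemma halfspace_at g xi : exists w, eventually_at xi (fun x => desc w (inv g ** x) = true).
Proof.
  apply NNPP. intros N.
  assert (F : forall w, limit (fun x => ~ desc w (inv g ** x) = true) xi).
  { intros w. apply NNPP. intros K. apply N. exists w.
    refine (eventually_mono _ _ _ _ _ _ _ _ (not_limit _ _ _ _ _ _ K)). intros x; apply NNPP. }
  assert (E : eventually_at xi (fun x => forall w, ~ on_wall g w xi -> desc w (inv g ** x) = false)).
  { apply (eventually_all _ _ _ _ GS). intros w. destruct (classic (on_wall g w xi)) as [W | W].
    - exists 0, 1. split; [lra | split; [lra|]]. intros x _ K. contradiction.
    - refine (eventually_mono _ _ _ _ _ _ _ _ (not_limit _ _ _ _ _ _ (fun L => W (conj L (F w))))).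
      intros x Hx _. apply not_true_is_false, Hx. }
  pose proof (eventually_and _ _ _ _ GS _ _ _ _ E (eventually_long _ _ _ _ GS x0 xi (2 + len g))) as E2.
  assert (NZ : forall x k, (2 + len g <= len x)%nat -> (len k <= 1)%nat -> inv g ** x ** k <> one).
  { intros x k Hx Hk Z. assert (EX : x = g ** inv k).
    { apply (mulgI adj (inv g)). rewrite (mulKg adj). apply (mulIg adj k). rewrite (mulVg adj).
      exact Z. }
    rewrite EX in Hx. pose proof (len_mul adj g (inv k)). rewrite (len_inv adj) in *. lia. }
  assert (W : exists s, on_wall g s xi).
  { destruct (limit_meets _ _ _ _ GS _ _ _ _ (limit_all _ _ _ _ GS x0 xi) E2) as [x [_ [H1 H2]]].
    pose proof (NZ x one H2 ltac:(rewrite len_one; lia)) as Z. rewrite (mulg1 adj) in Z.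
    destruct (exists_desc adj _ Z) as [s Hs]. exists s. apply NNPP. intros K. rewrite (H1 s K) in Hs. discriminate. }
  destruct W as [s Ws].
  (* Next to the wall of [s], on the base side, every descent [u] is adjacent to [s], and by [H1]
     its wall passes through [xi] as well. *)
  assert (L : limit (fun x => desc s (inv g ** x) = false /\ gen s ** (inv g ** x) = inv g ** x ** gen s) xi).
  { apply (limit_gen _ _ _ _ GS _ _ _ _ (on_wall_crossing _ _ _ Ws)). intros x [Hx Cx]. exists s.
    rewrite (mulA adj), <- Cx, (genK adj). split; [rewrite desc_flip, Hx; reflexivity|].
    rewrite Cx, (mulgenK adj). reflexivity. }
  destruct (limit_meets _ _ _ _ GS _ _ _ _ L E2) as [x [[Ds Cs] [H1 H2]]].
  pose proof (NZ x one H2 ltac:(rewrite len_one; lia)) as Z. rewrite (mulg1 adj) in Z.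
  destruct (exists_desc adj _ Z) as [u Hu].
  pose proof (wall_desc adj sym s _ u Cs Ds Hu) as A. apply (walls_not_adjacent g u s xi A); [|assumption].
  apply NNPP. intros K. rewrite (H1 u K) in Hu. discriminate.
Qed.

(* Moving the base point across the wall of [c] avoids the half-space of [c] itself. *)
Lemma halfspace_avoiding c g xi : exists g' w, (g' = g \/ g' = g ** gen c) /\ w <> c /\
  eventually_at xi (fun x => desc w (inv g' ** x) = true).
Proof.
  destruct (halfspace_at g xi) as [w Hw]. destruct (classic (w = c)) as [-> | N]; [|exists g, w; auto].
  destruct (halfspace_at (g ** gen c) xi) as [w Hw']. exists (g ** gen c), w. split; [auto | split; [|assumption]].
  intros ->. destruct (limit_meets _ _ _ _ GS _ _ _ _ (limit_all _ _ _ _ GS x0 xi) (eventually_and _ _ _ _ GS _ _ _ _ Hw Hw')) as [x [_ [H1 H2]]].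
  rewrite (invM adj), (inv_gen adj), <- (mulA adj), desc_flip, H1 in H2. discriminate.
Qed.

(** If the limit set splits, compactness keeps the two pieces 4 apart at some radius [m]. Far
    elements of [P] are labelled by the piece approached within 1 at radius [m]; a step moves the
    geodesic there by at most 1, and 1 + 1 + 1 < 4, so labels are constant along far paths. *)
Lemma limit_connected P : coarsely_connected adj P -> connected_sub (cone_open d x0) (limit P).
Proof.
  intros CC [A [B [OA [OB [Cov [[xa [La HA]] [[xb [Lb HB]] Dis]]]]]]].
  pose (K := fun i : bool => fun xi => limit P xi /\ if i then A xi else B xi).
  assert (Sep : exists m, 0 < m /\ forall xi eta, K true xi -> K false eta -> 4 <= d (proj1_sig xi m) (proj1_sig eta m)).
  { apply NNPP. intros N.
    assert (S : forall n : nat, exists p, K true (fst p) /\ K false (snd p) /\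
      d (proj1_sig (fst p) (INR n + 1)) (proj1_sig (snd p) (INR n + 1)) < 4).
    { intros n. apply NNPP. intros H. apply N. exists (INR n + 1). pose proof (pos_INR n). split; [lra|].
      intros xi eta H1 H2. apply Rnot_lt_le. intros H3. apply H. exists (xi, eta). auto. }
    destruct (choice _ S) as [p Hp]. clear S.
    destruct (boundary_compact d met (gs_proper _ _ _ _ GS) U ult x0 (fun n => fst (p n))) as [xi Hxi].
    assert (Heta : rlim d U x0 (fun n => snd (p n)) xi).
    { intros t Ht e He. refine (U_mono U ult _ _ _ (U_and U ult _ _ (Hxi t Ht (e / 2) ltac:(lra)) (U_ge U ult (t + 8 * t / e)))).
      intros n [H1 H2]. assert (Q : 0 <= 8 * t / e) by (apply Rle_mult_inv_pos; [lra | assumption]).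
      destruct (Hp n) as [_ [_ H3]]. set (m := INR n + 1) in *.
      pose proof (ray_dist d x0 (fst (p n)) m ltac:(unfold m; lra)) as E1.
      pose proof (ray_dist d x0 (snd (p n)) m ltac:(unfold m; lra)) as E2.
      pose proof (geodesics_close d met geods cat0 x0 _ _ _ _ m t (ray_geod d x0 (fst (p n)) m ltac:(unfold m; lra))
        (ray_geod d x0 (snd (p n)) m ltac:(unfold m; lra)) ltac:(unfold m; lra) ltac:(lra) ltac:(lra) ltac:(unfold m; lra)) as C.
      assert (B4 : t / m * d (proj1_sig (fst (p n)) m) (proj1_sig (snd (p n)) m) <= e / 2).
      { apply Rle_trans with (t / m * 4).
        - apply Rmult_le_compat_l; [apply Rle_mult_inv_pos; unfold m; lra | lra].
        - apply (Rmult_le_reg_r m); [unfold m; lra|]. replace (t / m * 4 * m) with (4 * t) by (field; unfold m; lra).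
          assert (E : e / 2 * (8 * t / e) = 4 * t) by (field; lra).
          assert (8 * t / e <= m) by (unfold m; lra). assert (e / 2 * (8 * t / e) <= e / 2 * m) by (apply Rmult_le_compat_l; lra). lra. }
      pose proof (dtri (proj1_sig (snd (p n)) t) (proj1_sig (fst (p n)) t) (proj1_sig xi t)) as T3.
      rewrite (dsym (proj1_sig (snd (p n)) t) (proj1_sig (fst (p n)) t)) in T3. lra. }
    assert (Lxi : limit P xi) by (apply (limit_rlim _ _ _ _ GS _ _ (fun n => fst (p n))); [intros n; apply Hp | assumption]).
    destruct (Cov xi Lxi) as [H | H].
    - destruct (ultra_ne U ult _ (rlim_open d met U ult x0 _ _ _ Heta OA H)) as [n Hn].
      destruct (Hp n) as [_ [[L1 L2] _]]. exact (Dis _ L1 Hn L2).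
    - destruct (ultra_ne U ult _ (rlim_open d met U ult x0 _ _ _ Hxi OB H)) as [n Hn].
      destruct (Hp n) as [[L1 L2] _]. exact (Dis _ L1 L2 Hn). }
  destruct Sep as [m [Hm Sep]].
  pose (lab := fun i g => exists xi, K i xi /\ d (geo (pt g) m) (proj1_sig xi m) < 1).
  assert (Lab : exists n, forall g, P g -> (n <= len g)%nat -> lab true g \/ lab false g).
  { apply NNPP. intros N.
    assert (S : forall n, exists g, (P g /\ ~ (lab true g \/ lab false g)) /\ (n <= len g)%nat).
    { intros n. apply NNPP. intros H. apply N. exists n. intros g H1 H2. apply NNPP. intros H3. apply H. exists g. auto. }
    destruct (limit_nonempty _ _ _ _ GS x0 _ S) as [xi Hxi].
    destruct (Hxi m 1 ltac:(lra) ltac:(lra)) as [g [[Pg Ng] [_ Hg]]]. apply Ng.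
    assert (Lxi : limit P xi) by (refine (limit_mono _ _ _ _ _ _ _ _ Hxi); tauto).
    destruct (Cov xi Lxi); [left | right]; exists xi; split; auto; split; auto. }
  destruct Lab as [n0 Lab].
  destruct (orbit_lipschitz _ _ _ _ GS x0) as [L [HL Lip]].
  (* From this radius on, a step of length at most [L] shrinks to at most 1 at radius [m]. *)
  destruct (orbit_proper _ _ _ _ GS x0 (m * (L + 1) + m)) as [n1 Far].
  assert (Step : forall i a b, far_step adj P (n0 + S n1) a b -> lab i a -> lab i b).
  { intros i a b [Pa [Pb [Ha [Hb [v ->]]]]] [xi [Kx Dx]].
    assert (Ra : m * (L + 1) + m <= d x0 (pt a)).
    { apply Rnot_lt_le. intros H. specialize (Far a (Rlt_le _ _ H)). lia. }
    assert (Rb : m * (L + 1) + m <= d x0 (pt (a ** gen v))).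
    { apply Rnot_lt_le. intros H. specialize (Far _ (Rlt_le _ _ H)). lia. }
    assert (Q : 0 <= m * (L + 1)) by (apply Rmult_le_pos; lra).
    set (r := m * (L + 1) + m) in *.
    pose proof (geodesics_close d met geods cat0 x0 _ _ _ _ r m (geo_spec d geods x0 (pt a)) (geo_spec d geods x0 (pt (a ** gen v)))
      ltac:(unfold r; lra) Ra Rb ltac:(unfold r; lra)) as C.
    assert (DL : d (pt a) (pt (a ** gen v)) <= L).
    { rewrite (pt_step _ _ _ _ GS). eapply Rle_trans; [apply Lip|]. pose proof (le_INR _ _ (len_gen adj v)) as G. simpl in G.
      rewrite <- (Rmult_1_r L) at 2. apply Rmult_le_compat_l; assumption. }
    assert (C1 : m / r * d (pt a) (pt (a ** gen v)) <= 1).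
    { apply (Rmult_le_reg_r r); [unfold r; lra|].
      replace (m / r * d (pt a) (pt (a ** gen v)) * r) with (m * d (pt a) (pt (a ** gen v))) by (field; unfold r; lra).
      assert (m * d (pt a) (pt (a ** gen v)) <= m * L) by (apply Rmult_le_compat_l; lra). unfold r; lra. }
    pose proof (dtri (geo (pt (a ** gen v)) m) (geo (pt a) m) (proj1_sig xi m)) as T1.
    rewrite (dsym (geo (pt (a ** gen v)) m) (geo (pt a) m)) in T1.
    destruct (Lab (a ** gen v) Pb ltac:(lia)) as [B1 | B1].
    - destruct i; [exact B1|]. exfalso. destruct B1 as [eta [Ke De]]. pose proof (Sep eta xi Ke Kx) as S4.
      pose proof (dtri (proj1_sig eta m) (geo (pt (a ** gen v)) m) (proj1_sig xi m)) as T4.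
      rewrite (dsym (proj1_sig eta m) (geo (pt (a ** gen v)) m)) in T4. lra.
    - destruct i; [|exact B1]. exfalso. destruct B1 as [eta [Ke De]]. pose proof (Sep xi eta Kx Ke) as S4.
      pose proof (dtri (proj1_sig xi m) (geo (pt (a ** gen v)) m) (proj1_sig eta m)) as T4.
      rewrite (dsym (proj1_sig xi m) (geo (pt (a ** gen v)) m)) in T4. lra. }
  destruct (CC (n0 + S n1)%nat) as [k Hk].
  assert (Get : forall xi, limit P xi -> exists g, P g /\ (k <= len g)%nat /\ d (geo (pt g) m) (proj1_sig xi m) < 1).
  { intros xi Lx. destruct (limit_eventually _ _ _ _ GS _ _ _ _ Lx (eventually_long _ _ _ _ GS x0 xi k) m 1 ltac:(lra) ltac:(lra)) as [g [[H1 H2] [_ H3]]].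
    exists g. auto. }
  destruct (Get xa La) as [a [Pa [Ha Da]]]. destruct (Get xb Lb) as [b [Pb [Hb Db]]].
  assert (Path : forall a b, clos_refl_trans _ (far_step adj P (n0 + S n1)) a b -> lab true a -> lab true b).
  { intros a' b' Hab. induction Hab; eauto. }
  destruct (Path a b (Hk a b Pa Pb Ha Hb)) as [xi [Kx Dx]]; [exists xa; split; [split; assumption | assumption]|].
  pose proof (Sep xi xb Kx (conj Lb HB)) as S4.
  pose proof (dtri (proj1_sig xi m) (geo (pt b) m) (proj1_sig xb m)) as T4.
  rewrite (dsym (proj1_sig xi m) (geo (pt b) m)) in T4. lra.
Qed.
End Walls.

Close Scope R_scope.

(** * Virtual factor separators *)

Section Links.
Context {V : Type} (adj : V -> V -> Prop).
Hypothesis adj_sym : forall u v, adj u v -> adj v u.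
Lemma linked_sym P u v : linked_in adj P u v -> linked_in adj P v u.
Proof.
  induction 1 as [u v [Hu [Hv H]] | u | u v w _ IH1 _ IH2]; [apply rt_step; auto | apply rt_refl | eapply rt_trans; eassumption].
Qed.
Lemma linked_in_set P u v : linked_in adj P u v -> P u -> P v.
Proof. induction 1 as [u v [Hu [Hv H]] | u | u v w _ IH1 _ IH2]; auto. Qed.
Lemma linked_mono (P Q : V -> Prop) u v : (forall x, P x -> Q x) -> linked_in adj P u v -> linked_in adj Q u v.
Proof.
  intros H. induction 1 as [u v [Hu [Hv K]] | u | u v w _ IH1 _ IH2]; [apply rt_step; auto | apply rt_refl | eapply rt_trans; eassumption].
Qed.
Lemma connected_in_ext (P Q : V -> Prop) : (forall x, P x <-> Q x) -> connected_in adj P -> connected_in adj Q.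
Proof. intros H C u v Hu Hv. apply (linked_mono P); [intros; apply H; assumption|]. apply C; apply H; assumption. Qed.
End Links.

Section Factor.
Context {V X : Type} (adj : V -> V -> Prop) (d : X -> X -> R) (act : V -> X -> X) (U : (nat -> Prop) -> Prop).
Hypothesis GS : geometric_setting adj d act U.
Variable x0 : X.
Hypothesis LC : locally_connected (cone_open d x0).
Local Notation racg := (racg adj).
Local Notation gen := (gen adj).
Local Notation cls := (cls adj).
Local Notation one := (one adj).
Local Notation "x ** y" := (mul adj x y) (at level 40, left associativity).
Local Notation inv := (inv adj).
Local Notation desc := (desc adj).
Local Notation len := (len adj).
Local Notation bd := (boundary d x0).
Local Notation sym := (gs_sym _ _ _ _ GS).
Local Notation irr := (gs_irr _ _ _ _ GS).
Local Notation limit := (limit adj d act x0).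

Definition parabolic (D : V -> Prop) (g : racg) : Prop := exists w, (forall u, In u w -> D u) /\ cls w = g.
Lemma parabolic_one D : parabolic D one.
Proof. exists []. split; [intros ? [] | reflexivity]. Qed.
Lemma parabolic_snoc D p u : parabolic D p -> D u -> parabolic D (p ** gen u).
Proof.
  intros [w [Hw <-]] Du. exists (w ++ [u]). split; [|apply cls_app].
  intros v Hv. apply in_app_iff in Hv. destruct Hv as [Hv | [<- | []]]; auto.
Qed.
Lemma parabolic_desc D p u : parabolic D p -> desc u p = true -> D u.
Proof. intros [w [Hw <-]] H. apply Hw, (desc_support adj u w H). Qed.

Variables (a c : V) (D R : V -> Prop).
Hypothesis ac : a <> c.
Hypothesis nac : ~ adj a c.
Hypothesis Da : forall u, D u -> adj a u.
Hypothesis Dc : forall u, D u -> adj c u.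
Hypothesis R_closed : forall r u, R r -> adj r u -> R u \/ u = a \/ D u.
Hypothesis R_out : forall u, R u -> u <> a /\ u <> c /\ ~ D u.

(** Powers of the translation [c a] in the infinite dihedral group of [a] and [c]; they commute with
    all letters of [D]. *)
Fixpoint dih_rot (n : nat) : racg := match n with O => one | S n => gen c ** (gen a ** dih_rot n) end.
Lemma rot_add n m : dih_rot (n + m) = dih_rot n ** dih_rot m.
Proof. induction n as [|n IH]; simpl; [rewrite mul1g; reflexivity|]. rewrite IH, !(mulA adj). reflexivity. Qed.
Lemma rot_comm n t : D t -> gen t ** dih_rot n = dih_rot n ** gen t.
Proof.
  intros Ht. induction n as [|n IH]; simpl; [rewrite mul1g, mulg1; reflexivity|].
  apply comm_mul; [apply gen_comm, sym, Dc, Ht|]. apply comm_mul; [apply gen_comm, sym, Da, Ht | exact IH].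
Qed.
Lemma rot_comm_parabolic n p : parabolic D p -> dih_rot n ** p = p ** dih_rot n.
Proof.
  intros [w [Hw <-]]. induction w as [|t w IH].
  - change (cls []) with one. rewrite mul1g, mulg1. reflexivity.
  - rewrite cls_cons, (mulA adj), <- rot_comm by (apply Hw; left; reflexivity).
    rewrite <- !(mulA adj), IH by (intros; apply Hw; right; assumption). reflexivity.
Qed.
Lemma rot_desc n t y : D t -> desc t (dih_rot n ** y) = desc t y.
Proof.
  intros Ht. induction n as [|n IH]; simpl; [rewrite mul1g; reflexivity|].
  rewrite <- !(mulA adj), !(desc_comm' adj irr); [exact IH | apply sym, Da, Ht | apply sym, Dc, Ht].
Qed.
Lemma desc_false_flip s t z : s <> t -> ~ adj s t -> desc s z = false -> desc t (gen s ** z) = false.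
Proof.
  intros N A H. destruct (desc t (gen s ** z)) eqn:E; [exfalso | reflexivity].
  apply (desc_excl adj sym s t (gen s ** z) N A); [rewrite desc_flip, H; reflexivity | exact E].
Qed.
Lemma desc_true_other s t z : s <> t -> ~ adj s t -> desc s z = true -> desc t z = false.
Proof.
  intros N A H. destruct (desc t z) eqn:E; [exfalso | reflexivity]. exact (desc_excl adj sym s t z N A H E).
Qed.
(** Ping-pong: along the alternating product [a] and [c] are descents in turn and never together. *)
Lemma rot_desc_c n z : desc c (gen a ** z) = false -> desc c (dih_rot (S n) ** z) = true.
Proof.
  intros H. induction n as [|n IH].
  - simpl. rewrite <- !(mulA adj), mul1g, desc_flip, H. reflexivity.
  - change (dih_rot (S (S n))) with (gen c ** (gen a ** dih_rot (S n))).
    rewrite <- !(mulA adj), desc_flip, desc_false_flip; auto.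
    apply (desc_true_other c a); [congruence | intros A; apply nac, sym, A | exact IH].
Qed.

Definition root_set (y : racg) : Prop := y <> one /\ forall u, desc u y = true -> R u.
(** The prefixes [p] and [p ** gen a] run through the subgroup generated by [D] and [a]; the set
    collects what continues from there in the direction of [R]. *)
Definition factor_set (x : racg) : Prop := exists p y, parabolic D p /\ root_set y /\ (x = p ** y \/ x = p ** (gen a ** y)).

Lemma root_set_a y : root_set y -> desc c y = false /\ desc c (gen a ** y) = false.
Proof.
  intros [_ H]. split.
  - apply not_true_is_false. intros E. destruct (R_out _ (H _ E)) as [_ [N _]]. congruence.
  - apply desc_false_flip; auto. apply not_true_is_false. intros E. destruct (R_out _ (H _ E)) as [N _]. congruence.
Qed.
Lemma desc_c_parabolic p z : parabolic D p -> desc c (p ** z) = desc c z.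
Proof. intros [w [Hw <-]]. apply (desc_comm_word adj irr). auto. Qed.
Lemma factor_desc k x : factor_set x -> desc c x = false /\ desc c (dih_rot (S k) ** x) = true.
Proof.
  intros [p [y [Hp [Hy Hx]]]]. destruct (root_set_a y Hy) as [H1 H2].
  assert (K : forall z, desc c z = false -> desc c (gen a ** z) = false -> desc c (p ** z) = false /\ desc c (dih_rot (S k) ** (p ** z)) = true).
  { intros z Z1 Z2. rewrite desc_c_parabolic by assumption. split; [assumption|].
    rewrite (mulA adj), rot_comm_parabolic, <- (mulA adj), desc_c_parabolic by assumption. apply rot_desc_c, Z2. }
  destruct Hx as [-> | ->]; apply K; auto. rewrite (genK adj). assumption.
Qed.
(** A new descent [u] of [y ** gen v] outside [R] must be [v] itself and commute with [y], so it is
    adjacent to a letter of [R]. Then it is [a] or lies in [D] and can be moved into the prefix; the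
    only exit is through [y ** gen v = one]. *)
Lemma factor_exit x v : factor_set x -> factor_set (x ** gen v) \/ parabolic D (x ** gen v) \/ parabolic D (x ** gen v ** gen a).
Proof.
  intros [p [y [Hp [[Hy1 Hy] Hx]]]].
  destruct (classic (y ** gen v = one)) as [E | N].
  { right. destruct Hx as [-> | ->]; rewrite <- !(mulA adj), E.
    - left. rewrite mulg1. assumption.
    - right. rewrite (mulA adj y), E, mul1g, gen2, mulg1. assumption. }
  left. destruct (classic (forall u, desc u (y ** gen v) = true -> R u)) as [H | H].
  { exists p, (y ** gen v). split; [assumption|]. split; [split; assumption|].
    destruct Hx as [-> | ->]; rewrite <- !(mulA adj); auto. }
  apply not_all_ex_not in H. destruct H as [u H]. apply imply_to_and in H. destruct H as [Du NR].
  assert (Dy : desc u y = false) by (apply not_true_is_false; auto).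
  destruct (wall_cross adj u y v Dy Du) as [-> C].
  destruct (exists_desc adj _ Hy1) as [r Hr]. pose proof (wall_desc adj sym u y r C Dy Hr) as A.
  destruct (R_closed r u (Hy r Hr) A) as [K | [-> | K]]; [contradiction | |].
  - exists p, y. split; [assumption|]. split; [split; assumption|].
    destruct Hx as [-> | ->]; rewrite <- !(mulA adj), <- C; [auto|]. rewrite (genK adj). auto.
  - exists (p ** gen u), y. split; [apply parabolic_snoc; assumption|]. split; [split; assumption|].
    destruct Hx as [-> | ->]; rewrite <- !(mulA adj), <- C; [auto|]. right. f_equal. apply gen_commA, Da, K.
Qed.

(** At an exit the translate is within bounded distance of the parabolic subgroup itself, because
    the rotation commutes with it. *)
Lemma factor_frontier n xi : limit (translate adj (dih_rot n) factor_set) xi ->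
  limit (fun x => ~ translate adj (dih_rot n) factor_set x) xi -> limit (parabolic D) xi.
Proof.
  intros H1 H2. refine (limit_shift _ _ _ _ GS _ _ _ _ (2 + len (dih_rot n)) (crossing _ _ _ _ GS _ _ _ H1 H2) _).
  unfold translate. intros x [Hx [v Hv]]. rewrite (mulA adj) in Hv.
  destruct (factor_exit _ v Hx) as [K | [K | K]]; [contradiction | |].
  - exists (gen v ** inv (dih_rot n)). split.
    + pose proof (len_mul adj (gen v) (inv (dih_rot n))). pose proof (len_gen adj v). rewrite (len_inv adj) in *. lia.
    + rewrite <- (mulKVg adj (dih_rot n) (x ** (gen v ** inv (dih_rot n)))), !(mulA adj).
      rewrite <- (mulA adj (dih_rot n)), <- (mulA adj (dih_rot n)), rot_comm_parabolic by (rewrite ?(mulA adj); exact K).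
      rewrite mulgK. exact K.
  - exists (gen v ** gen a ** inv (dih_rot n)). split.
    + pose proof (len_mul adj (gen v ** gen a) (inv (dih_rot n))). pose proof (len_mul adj (gen v) (gen a)).
      pose proof (len_gen adj v). pose proof (len_gen adj a). rewrite (len_inv adj) in *. lia.
    + rewrite <- (mulKVg adj (dih_rot n) (x ** (gen v ** gen a ** inv (dih_rot n)))), !(mulA adj).
      rewrite <- (mulA adj (dih_rot n)), <- (mulA adj (dih_rot n)), <- (mulA adj (dih_rot n)), rot_comm_parabolic by (rewrite ?(mulA adj); exact K).
      rewrite mulgK. exact K.
Qed.

Definition rotated_root_set (n : nat) (x : racg) : Prop := root_set (inv (dih_rot n) ** x).
Lemma rotated_root_factor n x : rotated_root_set n x -> translate adj (dih_rot n) factor_set x.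
Proof.
  intros H. exists one, (inv (dih_rot n) ** x). split; [apply parabolic_one|]. split; [exact H | left; symmetry; apply mul1g].
Qed.
(** Near [xi] one letter is a descent of all orbit points. On the parabolic subgroup it lies in [D];
    rotations do not affect descents in [D], so on the rotated sets it would have to lie in [R]. *)
Lemma rotated_root_not_parabolic xi : limit (fun x => exists n, rotated_root_set n x) xi -> ~ limit (parabolic D) xi.
Proof.
  intros H1 H2. destruct (halfspace_at _ _ _ _ GS x0 one xi) as [w Hw].
  destruct (limit_meets _ _ _ _ GS _ _ _ _ H2 Hw) as [p [Hp Wp]]. rewrite inv1, mul1g in Wp.
  pose proof (parabolic_desc _ _ _ Hp Wp) as Dw.
  destruct (limit_meets _ _ _ _ GS _ _ _ _ H1 Hw) as [x [[n [_ Hx]] Wx]]. rewrite inv1, mul1g in Wx.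
  rewrite <- (mulKVg adj (dih_rot n) x), rot_desc in Wx by assumption. destruct (R_out _ (Hx _ Wx)) as [_ [_ N]]. contradiction.
Qed.
Lemma rotated_root_nonempty r n : R r -> exists xi, limit (rotated_root_set n) xi.
Proof.
  intros Rr. apply (limit_nonempty _ _ _ _ GS). intros m.
  assert (N : r <> c) by (apply R_out, Rr).
  assert (A : ~ adj r c).
  { intros A. destruct (R_closed r c Rr A) as [K | [K | K]].
    - destruct (R_out _ K) as [_ [Q _]]. congruence.
    - congruence.
    - exact (irr _ (Dc _ K)). }
  set (y := cls (alt r c (S (m + len (dih_rot n))))).
  assert (L : len y = S (m + len (dih_rot n))) by (apply alt_len; try assumption; exact sym).
  exists (dih_rot n ** y). split.
  - unfold rotated_root_set. rewrite mulKg. split.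
    + intros E. rewrite E, len_one in L. discriminate.
    + intros u Hu. apply (alt_desc adj sym) in Hu; [subst; assumption | assumption | assumption].
  - destruct (len_translate adj (dih_rot n) y). lia.
Qed.

(* The translates of [factor_set] by the rotations are disjoint and, away from the limit set of the parabolic
   subgroup of [D], have clopen limit sets; these accumulate at a point where the boundary is not locally connected. *)
Lemma no_factor_separator r : R r -> False.
Proof.
  intros Rr.
  destruct (choice (fun n xi => limit (rotated_root_set n) xi)) as [z Hz]; [intros n; exact (rotated_root_nonempty r n Rr)|].
  destruct (boundary_compact d (gs_metric _ _ _ _ GS) (gs_proper _ _ _ _ GS) U (gs_ultra _ _ _ _ GS) x0 z) as [xi Hxi].
  assert (Lxi : limit (fun x => exists n, rotated_root_set n x) xi).
  { apply (limit_rlim _ _ _ _ GS _ _ z); [|assumption]. intros n. apply (limit_mono _ _ _ _ (rotated_root_set n)); [eauto | apply Hz]. }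
  destruct (LC xi (fun xi => ~ limit (parabolic D) xi)) as [W [OW [Wxi [WO CW]]]].
  { apply (limit_closed _ _ _ _ GS). }
  { apply rotated_root_not_parabolic, Lxi. }
  pose proof (rlim_open d (gs_metric _ _ _ _ GS) U (gs_ultra _ _ _ _ GS) x0 z xi W Hxi OW Wxi) as HU.
  (* Some [z n] and [z m] with [n < m] lie in the connected set [W]; the limit set of the translate
     by [dih_rot n] contains the first and not the second. *)
  destruct (ultra_ne U (gs_ultra _ _ _ _ GS) _ HU) as [n Hn].
  destruct (ultra_ne U (gs_ultra _ _ _ _ GS) _ (U_and U (gs_ultra _ _ _ _ GS) _ _ HU (ultra_ge U (gs_ultra _ _ _ _ GS) (S n)))) as [m [Hm Lm]].
  set (M := translate adj (dih_rot n) factor_set).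
  apply CW. exists (fun xi => ~ limit (fun x => ~ M x) xi), (fun xi => ~ limit M xi).
  split; [apply (limit_closed _ _ _ _ GS)|]. split; [apply (limit_closed _ _ _ _ GS)|]. split.
  { intros eta Heta. apply NNPP. intros N. apply not_or_and in N. destruct N as [N1 N2].
    apply (WO eta Heta), (factor_frontier n); apply NNPP; assumption. }
  split; [|split].
  - exists (z n). split; [assumption|]. intros K. apply (WO _ Hn), (factor_frontier n); [|assumption].
    apply (limit_mono _ _ _ _ (rotated_root_set n)); [apply rotated_root_factor | apply Hz].
  - exists (z m). split; [assumption|]. intros K. apply (WO _ Hm), (factor_frontier n); [assumption|].
    apply (limit_mono _ _ _ _ (rotated_root_set m)); [|apply Hz]. intros x Hx Mx.
    apply rotated_root_factor in Hx. unfold M, translate in *.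
    (* Seen from the translate with index [n], the later one has [c] as a descent, while the factor
       set has not. *)
    replace m with (n + S (m - S n))%nat in Hx by lia. rewrite rot_add, invM, <- (mulA adj) in Hx.
    destruct (factor_desc (m - S n) _ Hx) as [_ F1]. destruct (factor_desc 0 _ Mx) as [F2 _].
    rewrite mulKVg in F1. congruence.
  - intros eta _ N1 N2. destruct (limit_or _ _ _ _ GS x0 M (fun x => ~ M x) eta) as [K | K]; auto.
    apply (limit_mono _ _ _ _ (fun _ => True)); [intros; apply classic | apply (limit_all _ _ _ _ GS)].
Qed.
End Factor.

(** A component of the complement that misses [c] would serve as [R] in the preceding section. *)
Lemma no_virtual_factor_separator {V X : Type} (adj : V -> V -> Prop) (d : X -> X -> R) (act : V -> X -> X)
    (U : (nat -> Prop) -> Prop) (GS : geometric_setting adj d act U) (x0 : X)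
    (LC : locally_connected (cone_open d x0)) (a c : V) (D : V -> Prop) :
  a <> c -> ~ adj a c -> (forall u, D u -> adj a u) -> (forall u, D u -> adj c u) ->
  connected_in adj (fun v => v <> a /\ ~ D v).
Proof.
  intros ac nac Da Dc. set (P := fun v => v <> a /\ ~ D v).
  assert (Pc : P c) by (split; [congruence | intros K; exact (gs_irr _ _ _ _ GS _ (Dc _ K))]).
  assert (K : forall u, P u -> linked_in adj P u c).
  { intros u Pu. apply NNPP. intros N.
    apply (no_factor_separator adj d act U GS x0 LC a c D (linked_in adj P u) ac nac Da Dc) with u; [| | apply rt_refl].
    - intros r v Hr Hrv. apply NNPP. intros K. apply not_or_and in K. destruct K as [K1 K2]. apply not_or_and in K2.
      apply K1. eapply rt_trans; [exact Hr | apply rt_step]. split; [exact (linked_in_set adj P u r Hr Pu) | split; [exact K2 | exact Hrv]].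
    - intros v Hv. destruct (linked_in_set adj P u v Hv Pu) as [P1 P2]. split; [assumption|]. split; [congruence | assumption]. }
  intros u w Pu Pw. eapply rt_trans; [apply K, Pu | apply linked_sym; [apply (gs_sym _ _ _ _ GS) | apply K, Pw]].
Qed.

(** * Limit sets that inseparability makes connected *)

Section Instances.
Context {V X : Type} (adj : V -> V -> Prop) (d : X -> X -> R) (act : V -> X -> X) (U : (nat -> Prop) -> Prop).
Hypothesis GS : geometric_setting adj d act U.
Variable x0 : X.
Hypothesis LC : locally_connected (cone_open d x0).
Hypothesis insep : inseparable adj.
Local Notation racg := (racg adj).
Local Notation gen := (gen adj).
Local Notation one := (one adj).
Local Notation "x ** y" := (mul adj x y) (at level 40, left associativity).
Local Notation inv := (inv adj).
Local Notation desc := (desc adj).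
Local Notation rdesc := (right_desc adj).
Local Notation sym := (gs_sym _ _ _ _ GS).
Local Notation irr := (gs_irr _ _ _ _ GS).
Local Notation tri := (gs_tri _ _ _ _ GS).
Local Notation limit := (limit adj d act x0).
Local Notation connected := (connected_sub (cone_open d x0)).

Lemma minus_vertex u : connected_in adj (fun v => v <> u).
Proof. apply NNPP. exact (proj1 (proj2 insep) u). Qed.
Lemma minus_edge u v : adj u v -> connected_in adj (fun w => ~ (w = u \/ w = v)).
Proof. intros H. apply NNPP. exact (proj1 (proj2 (proj2 insep)) u v H). Qed.

(** Only elements with a single right descent [r] need the second hypothesis. With two of them, [r]
    and [r'], the free directions are all vertices off the edge they form, since a commuting letter
    of [S] would complete a triangle. *)
Lemma avoiding_connected (S : V -> Prop) :
  connected_in adj (fun v => ~ S v) ->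
  (forall x r, x <> one -> avoiding adj S x -> (forall v, S v -> gen v ** x = x ** gen v -> adj v r) ->
    connected_in adj (fun v => v <> r /\ ~ (S v /\ gen v ** x = x ** gen v))) ->
  coarsely_connected adj (avoiding adj S).
Proof.
  intros C1 C2. apply (avoiding_coarsely_connected adj irr sym). intros x Hx.
  destruct (classic (x = one)) as [-> | N].
  - apply (connected_in_ext adj (fun v => ~ S v)); [|exact C1]. intros v. unfold free_dirs, right_desc.
    rewrite inv1, desc_one, mulg1, mul1g. tauto.
  - assert (Ni : inv x <> one) by (intros E; apply N; rewrite <- (invK adj x), E; apply inv1).
    destruct (exists_desc adj _ Ni) as [r Hr]. change (rdesc r x = true) in Hr.
    assert (W : forall v u, S v -> gen v ** x = x ** gen v -> rdesc u x = true -> adj u v).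
    { intros v u Sv Cv Hu. apply (wall_rdesc adj sym v x u Cv (Hx v Sv) Hu). }
    destruct (classic (exists r', r' <> r /\ rdesc r' x = true)) as [[r' [Nr Hr']] | NR].
    + assert (A : adj r r') by (destruct (desc_adj adj sym r r' (inv x) Hr Hr'); [congruence | assumption]).
      apply (connected_in_ext adj (fun v => ~ (v = r \/ v = r'))); [|apply minus_edge, A].
      intros v. split.
      * intros K. split.
        -- apply not_true_is_false. intros D. apply not_or_and in K. destruct K as [K1 K2].
           destruct (desc_adj adj sym v r (inv x) D Hr) as [|A1]; [contradiction|].
           destruct (desc_adj adj sym v r' (inv x) D Hr') as [|A2]; [contradiction|].
           apply (no_triangle adj sym tri v r r'); auto.
        -- intros [Sv Cv]. apply (no_triangle adj sym tri r r' v); auto.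
      * intros [D _] [-> | ->]; congruence.
    + apply (connected_in_ext adj (fun v => v <> r /\ ~ (S v /\ gen v ** x = x ** gen v))).
      * intros v. unfold free_dirs. split; intros [H1 H2]; split; auto.
        -- apply not_true_is_false. intros D. apply NR. eauto.
        -- intros ->. congruence.
      * apply C2; [assumption | assumption|]. intros v Sv Cv. apply sym, W; assumption.
Qed.

Lemma avoiding_one_connected s : coarsely_connected adj (avoiding adj (fun v => v = s)).
Proof.
  apply avoiding_connected; [apply minus_vertex|]. intros x r _ _ H.
  destruct (classic (gen s ** x = x ** gen s)) as [C | C].
  - apply (connected_in_ext adj (fun w => ~ (w = r \/ w = s))); [|apply minus_edge, sym, H; auto].
    intros v. split; [intros K; split; [tauto|]; intros [-> _]; tauto|]. intros [K1 K2] [E | ->]; tauto.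
  - apply (connected_in_ext adj (fun v => v <> r)); [|apply minus_vertex].
    intros v. split; [intros K; split; [assumption|]; intros [-> K2]; tauto | tauto].
Qed.

Lemma avoiding_edge_connected s t : adj s t -> coarsely_connected adj (avoiding adj (fun v => v = s \/ v = t)).
Proof.
  intros A. apply avoiding_connected; [apply minus_edge, A|]. intros x r _ _ H.
  assert (One : forall u w, adj u w -> (forall v, v = u \/ v = w -> gen v ** x = x ** gen v -> adj v r) -> gen u ** x = x ** gen u ->
    connected_in adj (fun v => v <> r /\ ~ ((v = u \/ v = w) /\ gen v ** x = x ** gen v))).
  { intros u w B K C. apply (connected_in_ext adj (fun w => ~ (w = r \/ w = u))); [|apply minus_edge, sym, K; auto].
    intros v. split.
    - intros K1. split; [tauto|]. intros [[-> | ->] K2]; [tauto|].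
      apply (no_triangle adj sym tri u w r); [exact B | apply K; auto | apply K; auto].
    - intros [K1 K2] [E | ->]; tauto. }
  destruct (classic (gen s ** x = x ** gen s)) as [C | C]; [apply One; assumption|].
  destruct (classic (gen t ** x = x ** gen t)) as [C' | C'].
  - apply (connected_in_ext adj (fun v => v <> r /\ ~ ((v = t \/ v = s) /\ gen v ** x = x ** gen v))); [tauto|].
    apply One; [apply sym, A | | assumption]. intros v Hv. apply H. tauto.
  - apply (connected_in_ext adj (fun v => v <> r)); [|apply minus_vertex].
    intros v. split; [intros K; split; [assumption|]; intros [[-> | ->] K2]; tauto | tauto].
Qed.

(** The commuting letters outside [A] are adjacent to a left descent [u] in [A], hence to [c], and
    also to the right descent [r]. They are thus common neighbours of [r] and [c], or of [c] and [u]
    if [r = c], and cannot be a virtual factor separator together with [r]; if [r] is adjacent to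
    [c] there are none. *)
Lemma avoiding_part_connected c (A : V -> Prop) : connected_in adj A ->
  (forall u, A u -> u <> c /\ ~ adj c u) -> (forall u v, A u -> adj u v -> A v \/ adj c v) ->
  coarsely_connected adj (avoiding adj (fun v => ~ A v)).
Proof.
  intros CA Ac AN. apply avoiding_connected.
  { apply (connected_in_ext adj A); [|assumption]. intros v. split; [tauto | apply NNPP]. }
  intros x r N Hx H. destruct (exists_desc adj x N) as [u Hu].
  assert (Au : A u) by (apply NNPP; intros K; rewrite (Hx u K) in Hu; discriminate).
  set (D := fun v => ~ A v /\ gen v ** x = x ** gen v). change (connected_in adj (fun v => v <> r /\ ~ D v)).
  assert (Du : forall v, D v -> adj u v) by (intros v [Nv Cv]; exact (wall_desc adj sym v x u Cv (Hx v Nv) Hu)).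
  assert (Dc : forall v, D v -> adj c v) by (intros v Hv; destruct (AN u v Au (Du v Hv)) as [K | K]; [destruct (proj1 Hv K) | exact K]).
  assert (Dr : forall v, D v -> adj r v) by (intros v [Nv Cv]; apply sym, H; assumption).
  destruct (Ac u Au) as [Nuc Nacu].
  destruct (classic (r = c)) as [-> | Nrc].
  - apply (no_virtual_factor_separator adj d act U GS x0 LC c u); auto.
  - destruct (classic (adj r c)) as [Arc | Narc].
    + apply (connected_in_ext adj (fun v => v <> r)); [|apply minus_vertex]. intros v. split; [|tauto].
      intros K. split; [assumption|]. intros Hv. apply (no_triangle adj sym tri r c v); auto.
    + apply (no_virtual_factor_separator adj d act U GS x0 LC r c); auto.
Qed.

Lemma pred_ext {A : Type} (P Q : A -> Prop) : (forall x, P x <-> Q x) -> P = Q.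
Proof. intros H. apply functional_extensionality. intros x. apply propositional_extensionality, H. Qed.

(** Translation by the reflection turns a required descent into a forbidden one; the same is done
    below with both letters of an edge. *)
Lemma limit_halfspace_connected g s : connected (limit (fun x => desc s (inv g ** x) = true)).
Proof.
  rewrite (pred_ext _ (translate adj (g ** gen s) (avoiding adj (fun v => v = s)))).
  - apply (limit_connected _ _ _ _ GS), coarsely_connected_translate, avoiding_one_connected.
  - intros x. unfold translate, avoiding. rewrite invM, inv_gen, <- (mulA adj). split.
    + intros H t ->. rewrite desc_flip, H. reflexivity.
    + intros H. specialize (H s eq_refl). rewrite desc_flip in H. destruct (desc s (inv g ** x)); [reflexivity | discriminate].
Qed.
Lemma limit_edge_connected s t : adj s t -> connected (limit (fun x => desc s x = true /\ desc t x = true)).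
Proof.
  intros A. rewrite (pred_ext _ (translate adj (gen s ** gen t) (avoiding adj (fun v => v = s \/ v = t)))).
  - apply (limit_connected _ _ _ _ GS), coarsely_connected_translate, avoiding_edge_connected, A.
  - intros x. unfold translate, avoiding. rewrite invM, !inv_gen, <- (mulA adj).
    assert (E1 : desc t (gen t ** (gen s ** x)) = negb (desc t x)) by (rewrite desc_flip, (desc_comm' adj irr) by (apply sym, A); reflexivity).
    assert (E2 : desc s (gen t ** (gen s ** x)) = negb (desc s x)) by (rewrite (desc_comm' adj irr), desc_flip by exact A; reflexivity).
    split.
    + intros [H1 H2] v [-> | ->]; [rewrite E2, H1 | rewrite E1, H2]; reflexivity.
    + intros H. pose proof (H s ltac:(auto)) as K1. pose proof (H t ltac:(auto)) as K2. rewrite E2 in K1. rewrite E1 in K2.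
      destruct (desc s x), (desc t x); try discriminate; auto.
Qed.
Lemma limit_part_connected g c (A : V -> Prop) : connected_in adj A ->
  (forall u, A u -> u <> c /\ ~ adj c u) -> (forall u v, A u -> adj u v -> A v \/ adj c v) ->
  connected (limit (fun x => forall u, desc u (inv g ** x) = true -> A u)).
Proof.
  intros H1 H2 H3. rewrite (pred_ext _ (translate adj g (avoiding adj (fun v => ~ A v)))).
  - apply (limit_connected _ _ _ _ GS), coarsely_connected_translate, (avoiding_part_connected c); assumption.
  - intros x. unfold translate, avoiding. split.
    + intros H t Nt. apply not_true_is_false. auto.
    + intros H u Hu. apply NNPP. intros N. rewrite (H u N) in Hu. discriminate.
Qed.
(** Multiplication by [gen s] exchanges the elements whose only descent is [s] with those whose
    descents all lie outside the star of [s]. *)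
Lemma limit_vertex_connected s : connected_in adj (fun v => v <> s /\ ~ adj s v) ->
  connected (limit (fun x => forall u, desc u x = true <-> u = s)).
Proof.
  intros C. rewrite (pred_ext _ (fun x => forall u, desc u (inv (gen s) ** x) = true -> u <> s /\ ~ adj s u)).
  - apply (limit_part_connected (gen s) s); [assumption | auto |]. intros u v [H1 H2] A.
    destruct (classic (adj s v)) as [K | K]; [auto | left; split; [|assumption]]. intros ->. apply H2, sym, A.
  - intros x. rewrite inv_gen. split.
    + intros H u Hu. assert (Ds : desc s x = true) by (apply H; reflexivity). split.
      * intros ->. rewrite desc_flip, Ds in Hu. discriminate.
      * intros A. rewrite (desc_comm' adj irr) in Hu by (apply sym, A). apply H in Hu. subst. exact (irr _ A).
    + intros H. assert (Ds : desc s x = true).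
      { apply not_false_is_true. intros D. destruct (H s); [|congruence]. rewrite desc_flip, D. reflexivity. }
      intros u. split; [|intros ->; assumption]. intros Du. destruct (desc_adj adj sym u s x Du Ds) as [|A]; [assumption|].
      destruct (H u) as [_ K]; [rewrite (desc_comm' adj irr) by assumption; exact Du|]. destruct K. apply sym, A.
Qed.
End Instances.

(** * Disconnected star complements *)

(** For pairwise non-adjacent letters these are the reduced words, as the letters generate a free
    product of groups of order 2. *)
Fixpoint stutter_free {V : Type} (w : list V) : Prop :=
  match w with a :: w' => match w' with b :: _ => a <> b | [] => True end /\ stutter_free w' | [] => True end.

Section Words.
Context {V : Type} (adj : V -> V -> Prop).
Hypothesis adj_irr : forall v, ~ adj v v.
Hypothesis adj_sym : forall u v, adj u v -> adj v u.
Local Notation racg := (racg adj).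
Local Notation gen := (gen adj).
Local Notation cls := (cls adj).
Local Notation one := (one adj).
Local Notation "x ** y" := (mul adj x y) (at level 40, left associativity).
Local Notation inv := (inv adj).
Local Notation desc := (desc adj).

Lemma stutter_free_app (w1 w2 : list V) x : stutter_free (w1 ++ [x]) -> stutter_free (x :: w2) -> stutter_free (w1 ++ x :: w2).
Proof.
  induction w1 as [|a w1 IH]; intros H1 H2; [exact H2|]. destruct H1 as [H0 H1].
  split; [|apply IH; assumption]. destruct w1; exact H0.
Qed.
Lemma stutter_free_prefix (w1 w2 : list V) : stutter_free (w1 ++ w2) -> stutter_free w1.
Proof. induction w1 as [|a w1 IH]; [intros; exact I|]. intros [H0 H1]. split; [|auto]. destruct w1; [exact I | exact H0]. Qed.
Lemma stutter_free_rev (w : list V) : stutter_free w -> stutter_free (rev w).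
Proof.
  induction w as [|a w IH]; [intros; exact I|]. intros [H0 H1]. destruct w as [|b w]; [simpl; auto|].
  specialize (IH H1). simpl rev in *. rewrite <- app_assoc. apply (stutter_free_app (rev w)); [exact IH | simpl; auto].
Qed.
Lemma stutter_free_NoDup (w : list V) : NoDup w -> stutter_free w.
Proof.
  induction 1 as [|a w N _ IH]; [exact I|]. split; [|exact IH]. destruct w as [|b w]; [exact I|].
  intros ->. apply N. left. reflexivity.
Qed.
Lemma stutter_free_double u (l : list V) : NoDup (u :: l) -> l <> [] -> stutter_free ((u :: l) ++ u :: l).
Proof.
  intros N L. pose proof (stutter_free_NoDup _ N) as F. destruct (exists_last L) as [l' [b ->]].
  replace ((u :: l' ++ [b]) ++ u :: l' ++ [b]) with ((u :: l') ++ b :: (u :: l' ++ [b])) by (simpl; rewrite <- app_assoc; reflexivity).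
  apply (stutter_free_app (u :: l')); [exact F|]. split; [|exact F].
  intros ->. inversion N as [|? ? N1 _]. apply N1, in_app_iff. right. left. reflexivity.
Qed.
Lemma stutter_cases (w : list V) : stutter_free w \/ exists l1 a l2, w = l1 ++ a :: a :: l2.
Proof.
  induction w as [|a w [IH | [l1 [b [l2 ->]]]]]; [left; exact I | | right; exists (a :: l1), b, l2; reflexivity].
  destruct w as [|b w]; [left; simpl; auto|]. destruct (classic (a = b)) as [-> | N].
  - right. exists [], b, w. reflexivity.
  - left. split; assumption.
Qed.
Lemma cls_cancel (l1 l2 : list V) a : cls (l1 ++ a :: a :: l2) = cls (l1 ++ l2).
Proof. rewrite !cls_app, !cls_cons, genK. reflexivity. Qed.
Lemma inv_cls (w : list V) : inv (cls w) = cls (rev w).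
Proof. symmetry. apply inv_uniq. rewrite <- (rev_involutive w) at 1. apply cls_rev_app. Qed.

Lemma parabolic_mul (D : V -> Prop) p q : parabolic adj D p -> parabolic adj D q -> parabolic adj D (p ** q).
Proof.
  intros [w [Hw <-]] [w' [Hw' <-]]. exists (w ++ w'). split; [|apply cls_app].
  intros u Hu. apply in_app_iff in Hu. destruct Hu; auto.
Qed.
Lemma parabolic_inv (D : V -> Prop) p : parabolic adj D p -> parabolic adj D (inv p).
Proof. intros [w [Hw <-]]. exists (rev w). split; [|symmetry; apply inv_cls]. intros u Hu. apply Hw, in_rev, Hu. Qed.
Lemma parabolic_cls (D : V -> Prop) w : (forall u, In u w -> D u) -> parabolic adj D (cls w).
Proof. intros H. exists w. auto. Qed.

Variable T : V -> Prop.
Hypothesis T_indep : forall t t', T t -> T t' -> ~ adj t t'.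

(** Two different letters of [T] are never descents of the same element, so the property of being a
    descent passes from each letter of the word to the one before it. *)
Lemma strip_first t z b : (forall v, In v (t :: z) -> T v) -> stutter_free (t :: z) -> desc (last z t) b = false ->
  desc t (cls (t :: z) ** b) = true.
Proof.
  revert t. induction z as [|s z IH]; intros t HT HS Hb.
  - change (cls [t]) with (gen t). rewrite desc_flip. simpl in Hb. rewrite Hb. reflexivity.
  - rewrite cls_cons, <- (mulA adj), desc_flip.
    destruct HS as [N HS]. rewrite last_cons in Hb.
    assert (K : desc s (cls (s :: z) ** b) = true) by (apply IH; [intros; apply HT; right; assumption | exact HS | exact Hb]).
    destruct (desc t (cls (s :: z) ** b)) eqn:E; [exfalso | reflexivity].
    apply (desc_excl adj adj_sym t s _ N) in K; [assumption | | exact E].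
    apply T_indep; apply HT; simpl; auto.
Qed.
(** Such a [w] is adjacent to the first letter, so it remains a descent when that letter is removed,
    and the argument repeats. *)
Lemma strip_other w t z b : (forall v, In v (t :: z) -> T v) -> stutter_free (t :: z) -> desc (last z t) b = false ->
  w <> t -> desc w (cls (t :: z) ** b) = true -> (forall v, In v (t :: z) -> adj w v) /\ desc w b = true.
Proof.
  revert t. induction z as [|s z IH]; intros t HT HS Hb N Hw.
  all: pose proof (strip_first t _ b HT HS Hb) as Ht.
  all: destruct (desc_adj adj adj_sym w t _ Hw Ht) as [|A]; [contradiction|].
  all: rewrite cls_cons, <- (mulA adj), (desc_comm' adj adj_irr) in Hw by exact A.
  - change (cls []) with one in Hw. rewrite mul1g in Hw. split; [|exact Hw]. intros v [<- | []]. exact A.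
  - rewrite last_cons in Hb. destruct HS as [N1 HS].
    destruct (IH s) as [I1 I2]; [intros; apply HT; right; assumption | exact HS | exact Hb | | exact Hw |].
    + intros ->. apply (T_indep t s); [apply HT; simpl; auto | apply HT; simpl; auto | apply adj_sym, A].
    + split; [|exact I2]. intros v [<- | Hv]; auto.
Qed.

(** Final letters of [w] that are descents of [y] are absorbed into [y]; they are adjacent to [r],
    so [r] stays a descent. *)
Lemma absorb_suffix r y (w : list V) : ~ T r -> (forall v, In v w -> T v) -> stutter_free w -> desc r y = true ->
  exists h y', cls w ** y = cls h ** y' /\ desc r y' = true /\ (exists h', w = h ++ h') /\
    match h with [] => True | t :: z => desc (last z t) y' = false end.
Proof.
  revert y. induction w as [|t w IH] using rev_ind; intros y Nr HT HS Hy; [exists [], y; repeat split; auto; exists []; reflexivity|].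
  destruct (desc t y) eqn:E.
  - destruct (IH (gen t ** y)) as [h [y' [E1 [E2 [[h' E3] E4]]]]].
    + exact Nr.
    + intros v Hv. apply HT, in_app_iff. auto.
    + apply stutter_free_prefix in HS. exact HS.
    + rewrite (desc_comm' adj adj_irr); [exact Hy|]. destruct (desc_adj adj adj_sym r t y Hy E) as [-> | A]; [|exact A].
      destruct Nr. apply HT, in_app_iff. right; left; reflexivity.
    + exists h, y'. split; [rewrite <- E1, cls_app, (mulA adj); reflexivity|]. split; [exact E2|]. split; [|exact E4].
      exists (h' ++ [t]). rewrite app_assoc, <- E3. reflexivity.
  - exists (w ++ [t]), y. split; [reflexivity | split; [exact Hy|]]. split; [exists []; symmetry; apply app_nil_r|].
    destruct w as [|s w]; simpl; [exact E|]. rewrite last_last. exact E.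
Qed.
End Words.

Open Scope R_scope.

(** * Chains and separation in the embedded boundary *)

Section Chains.
Context {X : Type} (d : X -> X -> R).
Hypothesis d_metric : is_metric d.
Hypothesis d_proper : proper_metric d.
Variable U : (nat -> Prop) -> Prop.
Hypothesis HU : ultra U.
Variable x0 : X.
Local Notation bd := (boundary d x0).
Variable f : bd -> pt3.
Hypothesis f_S2 : forall x, on_S2 (f x).
Hypothesis f_inj : forall x y, f x = f y -> x = y.
Hypothesis f_cont : forall W, open3 W -> cone_open d x0 (fun x => W (f x)).

Definition reach (K : bd -> Prop) (del : R) : bd -> bd -> Prop :=
  clos_refl_trans _ (fun x y => K x /\ K y /\ dist3 (f x) (f y) <= del).

Lemma reach_mono (K K' : bd -> Prop) del p q : (forall x, K x -> K' x) -> reach K del p q -> reach K' del p q.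
Proof.
  intros H. unfold reach. induction 1 as [x y [H1 [H2 H3]] | x | x y z _ IH1 _ IH2];
  [apply rt_step; auto | apply rt_refl | eapply rt_trans; eassumption].
Qed.

(** Otherwise the points of [K] reachable from [p] and the remaining ones have open neighbourhoods
    that are disjoint in [K]. *)
Lemma connected_reach (K : bd -> Prop) del p q : connected_sub (cone_open d x0) K -> 0 < del -> K p -> K q -> reach K del p q.
Proof.
  intros C Hdel Kp Kq. apply NNPP. intros N. apply C.
  assert (Op : forall S : bd -> Prop, open3 (fun z => exists y, S y /\ dist3 z (f y) < del)).
  { intros S z [y [Sy Hy]]. exists (del - dist3 z (f y)). split; [lra|]. intros z' Hz. exists y. split; [assumption|].
    pose proof (dist3_triangle z' z (f y)). rewrite (dist3_sym z' z) in *. lra. }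
  exists (fun x => exists y, (K y /\ reach K del p y) /\ dist3 (f x) (f y) < del),
         (fun x => exists y, (K y /\ ~ reach K del p y) /\ dist3 (f x) (f y) < del).
  split; [apply (f_cont _ (Op (fun y => K y /\ reach K del p y)))|].
  split; [apply (f_cont _ (Op (fun y => K y /\ ~ reach K del p y)))|].
  assert (Z : forall x, dist3 (f x) (f x) < del) by (intros x; rewrite dist3_refl; assumption).
  split; [|split; [|split]].
  - intros x Kx. destruct (classic (reach K del p x)); [left | right]; exists x; auto.
  - exists p. split; [assumption|]. exists p. split; [split; [assumption | apply rt_refl] | apply Z].
  - exists q. split; [assumption|]. exists q. auto.
  - intros x Kx [y [[Ky Ry] Dy]] [y' [[Ky' Ny] Dy']]. apply Ny.
    apply rt_trans with y; [assumption|]. apply rt_trans with x; apply rt_step.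
    + split; [assumption | split; [assumption|]]. rewrite dist3_sym. lra.
    + split; [assumption | split; [assumption|]]. lra.
Qed.

Lemma last_map {A B : Type} (h : A -> B) (l : list A) p : last (map h l) (h p) = h (last l p).
Proof. revert p; induction l as [|a l IH]; intros p; [reflexivity|]. simpl map. rewrite !last_cons. apply IH. Qed.

Lemma reach_chain (K : bd -> Prop) del p q : reach K del p q -> K p ->
  exists l : list bd, chain del (f p) (map f l) /\ last l p = q /\ forall x, In x (p :: l) -> K x.
Proof.
  intros H. apply clos_rt_rt1n in H. induction H as [p | p y q [Kp [Ky D]] _ IH]; intros Hp.
  - exists []. simpl. split; [auto | split; [reflexivity|]]. intros x [<- | []]; assumption.
  - destruct (IH Ky) as [l [H1 [H2 H3]]]. exists (y :: l). split; [simpl; auto|]. split; [rewrite last_cons; assumption|].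
    intros x [<- | Hx]; auto.
Qed.

Definition rclosed (K : bd -> Prop) : Prop := forall xs xi, (forall n, K (xs n)) -> rlim d U x0 xs xi -> K xi.

Lemma rlim_f xs xi e : rlim d U x0 xs xi -> 0 < e -> U (fun n => dist3 (f (xs n)) (f xi) < e).
Proof.
  intros H He. apply (rlim_open d d_metric U HU x0 xs xi (fun x => dist3 (f x) (f xi) < e) H).
  - apply (f_cont (fun z => dist3 z (f xi) < e)). intros z Hz. exists (e - dist3 z (f xi)). split; [lra|]. intros z' Hz'.
    pose proof (dist3_triangle z' z (f xi)). rewrite (dist3_sym z' z) in *. lra.
  - rewrite dist3_refl. assumption.
Qed.

Lemma separation (K K' : bd -> Prop) : rclosed K -> rclosed K' -> (forall x, K x -> K' x -> False) ->
  exists eta, 0 < eta /\ forall x y, K x -> K' y -> eta <= dist3 (f x) (f y).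
Proof.
  intros C C' D. apply NNPP. intros N.
  assert (S : forall n : nat, exists p, K (fst p) /\ K' (snd p) /\ dist3 (f (fst p)) (f (snd p)) < / (INR n + 1)).
  { intros n. apply NNPP. intros H. apply N. exists (/ (INR n + 1)). pose proof (pos_INR n).
    split; [apply Rinv_0_lt_compat; lra|]. intros x y Hx Hy. apply Rnot_lt_le. intros L. apply H. exists (x, y). auto. }
  destruct (choice _ S) as [p Hp]. clear S.
  destruct (boundary_compact d d_metric d_proper U HU x0 (fun n => fst (p n))) as [xi Hxi].
  destruct (boundary_compact d d_metric d_proper U HU x0 (fun n => snd (p n))) as [eta Heta].
  assert (E : xi = eta).
  { apply f_inj. apply NNPP. intros Ne.
    assert (Pos : 0 < dist3 (f xi) (f eta)).
    { destruct (Rle_lt_or_eq_dec _ _ (dist3_ge0 (f xi) (f eta))) as [L | L]; [assumption | exfalso].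
      apply Ne. pose proof (dist3_sq (f xi) (f eta)) as Q. rewrite <- L in Q. unfold sqd in Q.
      assert (Q' : (px (f xi) - px (f eta)) ^ 2 + (py (f xi) - py (f eta)) ^ 2 + (pz (f xi) - pz (f eta)) ^ 2 = 0) by lra.
      destruct (f xi) as [[a b] c], (f eta) as [[a' b'] c']. unfold px, py, pz in Q'. simpl fst in Q'. simpl snd in Q'.
      pose proof (pow2_ge_0 (a - a')). pose proof (pow2_ge_0 (b - b')). pose proof (pow2_ge_0 (c - c')).
      assert (Z : forall u v : R, (u - v) ^ 2 = 0 -> u = v).
      { intros u v Huv. apply Rminus_diag_uniq, Rsqr_0_uniq. rewrite <- Huv. unfold Rsqr. ring. }
      f_equal; [f_equal|]; apply Z; lra. }
    set (e := dist3 (f xi) (f eta)) in *.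
    destruct (ultra_ne U HU _ (U_and U HU _ _ (rlim_f _ _ (e / 3) Hxi ltac:(lra)) (U_and U HU _ _ (rlim_f _ _ (e / 3) Heta ltac:(lra)) (U_ge U HU (3 / e))))) as [n [H1 [H2 H3]]].
    destruct (Hp n) as [_ [_ H4]].
    assert (H5 : / (INR n + 1) <= e / 3).
    { apply (Rmult_le_reg_r (INR n + 1)); [pose proof (pos_INR n); lra|]. rewrite Rinv_l by (pose proof (pos_INR n); lra).
      assert (e / 3 * (3 / e) = 1) by (field; lra). assert (e / 3 * (3 / e) <= e / 3 * (INR n)) by (apply Rmult_le_compat_l; lra). lra. }
    pose proof (dist3_triangle (f xi) (f (fst (p n))) (f eta)) as T1.
    pose proof (dist3_triangle (f (fst (p n))) (f (snd (p n))) (f eta)).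
    rewrite (dist3_sym (f (fst (p n))) (f xi)) in *. fold e in T1. lra. }
  apply (D xi).
  - apply (C (fun n => fst (p n))); [intros n; apply Hp | assumption].
  - rewrite E. apply (C' (fun n => snd (p n))); [intros n; apply Hp | assumption].
Qed.

Lemma rclosed_away (K L : bd -> Prop) r : rclosed K -> rclosed (fun x => K x /\ forall y, L y -> r <= dist3 (f x) (f y)).
Proof.
  intros C xs xi H Hr. split; [apply (C xs); [intros n; apply H | assumption]|]. intros y Ly. apply le_epsilon. intros e He.
  destruct (ultra_ne U HU _ (rlim_f xs xi e Hr He)) as [n Hn]. destruct (H n) as [_ H1]. specialize (H1 y Ly).
  pose proof (dist3_triangle (f (xs n)) (f xi) (f y)). lra.
Qed.
End Chains.

Lemma common_positive {I : Type} (l : list I) (Q : I -> R -> Prop) :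
  (forall i, exists eta, 0 < eta /\ Q i eta) -> (forall i a b, 0 < a <= b -> Q i b -> Q i a) ->
  exists eta, 0 < eta /\ forall i, In i l -> Q i eta.
Proof.
  intros H M. induction l as [|i l [e [He IH]]]; [exists 1; split; [lra | intros ? []]|].
  destruct (H i) as [e' [He' Hi]]. exists (Rmin e e').
  pose proof (Rmin_l e e'). pose proof (Rmin_r e e'). assert (0 < Rmin e e') by (apply Rmin_glb_lt; assumption).
  split; [assumption|]. intros j [<- | Hj]; [apply (M i _ e'); auto | apply (M j _ e); auto].
Qed.

Section LimitTools.
Context {V X : Type} (adj : V -> V -> Prop) (d : X -> X -> R) (act : V -> X -> X) (U : (nat -> Prop) -> Prop).
Hypothesis GS : geometric_setting adj d act U.
Variable x0 : X.
Local Notation racg := (racg adj).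
Local Notation gen := (gen adj).
Local Notation cls := (cls adj).
Local Notation "x ** y" := (mul adj x y) (at level 40, left associativity).
Local Notation inv := (inv adj).
Local Notation desc := (desc adj).
Local Notation limit := (limit adj d act x0).

Lemma limit_ex {I : Type} (l : list I) (P : I -> racg -> Prop) xi :
  limit (fun x => exists i, In i l /\ P i x) xi -> exists i, In i l /\ limit (P i) xi.
Proof.
  induction l as [|i l IH]; intros H.
  - destruct (limit_witness _ _ _ _ _ _ H) as [x [i [[] _]]].
  - destruct (limit_or _ _ _ _ GS x0 (P i) (fun x => exists i, In i l /\ P i x) xi) as [K | K].
    + refine (limit_mono _ _ _ _ _ _ _ _ H). intros x [j [[<- | Hj] Pj]]; eauto.
    + exists i. split; [left; reflexivity | exact K].
    + destruct (IH K) as [j [Hj Lj]]. exists j. split; [right; assumption | assumption].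
Qed.

Lemma alternating_limit (g : racg) a b : a <> b -> ~ adj a b -> exists xi, limit (fun x => exists m, x = g ** cls (alt a b (S m))) xi.
Proof.
  intros N A. apply (limit_nonempty _ _ _ _ GS). intros n.
  exists (g ** cls (alt a b (S (n + len adj g)))). split; [eexists; reflexivity|].
  destruct (len_translate adj g (cls (alt a b (S (n + len adj g))))) as [L _].
  rewrite (alt_len adj (gs_sym _ _ _ _ GS)) in L by assumption. lia.
Qed.
(** The limit of alternating words in [s] and [a], which are not adjacent by triangle-freeness.
    Since [t] commutes with both letters, appending it adds [t] as a left descent and does not
    change the limit. *)
Lemma vertex_edge_limit (g : racg) s t a : adj s t -> adj t a -> a <> s -> exists xi,
  limit (fun x => forall u, desc u (inv g ** x) = true <-> u = s) xi /\
  limit (fun x => desc s (inv g ** x) = true /\ desc t (inv g ** x) = true) xi.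
Proof.
  intros Hst Hta N.
  assert (Nsa : ~ adj s a) by (intros K; exact (no_triangle adj (gs_sym _ _ _ _ GS) (gs_tri _ _ _ _ GS) s t a Hst Hta K)).
  destruct (alternating_limit g s a (fun E => N (eq_sym E)) Nsa) as [xi L]. exists xi.
  assert (D : forall m u, desc u (cls (alt s a (S m))) = true <-> u = s)
    by (intros; apply (alt_desc adj (gs_sym _ _ _ _ GS)); auto).
  split.
  - refine (limit_mono _ _ _ _ _ _ _ _ L). intros x [m ->]. rewrite mulKg. apply D.
  - apply (limit_gen _ _ _ _ GS _ _ _ _ L). intros x [m ->]. exists t. rewrite <- (mulA adj), mulKg, <- comm_word.
    + split.
      * rewrite (desc_comm' adj (gs_irr _ _ _ _ GS)) by exact Hst. apply D. reflexivity.
      * rewrite desc_flip. destruct (desc t (cls (alt s a (S m)))) eqn:E; [|reflexivity].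
        apply D in E. subst. destruct (gs_irr _ _ _ _ GS _ Hst).
    + intros u Hu. apply alt_letters in Hu. destruct Hu as [-> | ->]; [apply (gs_sym _ _ _ _ GS)|]; assumption.
Qed.
End LimitTools.

Lemma last_in {A : Type} (z : list A) t : In (last z t) (t :: z).
Proof. revert t; induction z as [|a z IH]; intros t; [left; reflexivity|]. rewrite last_cons. right. apply IH. Qed.
Definition prefixes {A : Type} (w : list A) : list (list A) := map (fun n => firstn n w) (seq 0 (S (length w))).
Lemma in_prefixes {A : Type} (w : list A) n : (n <= length w)%nat -> In (firstn n w) (prefixes w).
Proof. intros H. apply (in_map (fun n => firstn n w)), in_seq. lia. Qed.
Lemma prefixes_spec {A : Type} (h w : list A) : In h (prefixes w) -> exists h', w = h ++ h'.
Proof. intros H. apply in_map_iff in H. destruct H as [n [<- _]]. exists (skipn n w). symmetry. apply firstn_skipn. Qed.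
Lemma firstn_snoc {A : Type} (w : list A) n : (n < length w)%nat -> exists t, In t w /\ firstn (S n) w = firstn n w ++ [t].
Proof.
  revert w. induction n as [|n IH]; intros [|a w] H; simpl in H; try lia.
  - exists a. split; [left; reflexivity | reflexivity].
  - destruct (IH w ltac:(lia)) as [t [Ht E]]. exists t. split; [right; exact Ht|]. simpl in *. rewrite E. reflexivity.
Qed.

(** * A copy of $K_{3,3}$ in the boundary *)

Section BadStar.
Context {V X : Type} (adj : V -> V -> Prop) (d : X -> X -> R) (act : V -> X -> X) (U : (nat -> Prop) -> Prop).
Hypothesis GS : geometric_setting adj d act U.
Variable x0 : X.
Hypothesis LC : locally_connected (cone_open d x0).
Hypothesis insep : inseparable adj.
Local Notation racg := (racg adj).
Local Notation gen := (gen adj).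
Local Notation cls := (cls adj).
Local Notation one := (one adj).
Local Notation "x ** y" := (mul adj x y) (at level 40, left associativity).
Local Notation inv := (inv adj).
Local Notation desc := (desc adj).
Local Notation bd := (boundary d x0).
Local Notation sym := (gs_sym _ _ _ _ GS).
Local Notation irr := (gs_irr _ _ _ _ GS).
Local Notation tri_free := (gs_tri _ _ _ _ GS).
Local Notation limit := (limit adj d act x0).
Local Notation eventually_at := (eventually_at adj d act x0).

(* [A] is a component of the complement of the star of [c], [R] a further piece that meets neither [A] nor its
   neighbours, and [T] consists of the neighbours of [c] adjacent to both; [W_T] commutes with [c]. *)
Variables (c : V) (A R T : V -> Prop).
Hypothesis A_conn : connected_in adj A.
Hypothesis A_c : forall v, A v -> v <> c /\ ~ adj c v.
Hypothesis A_nbr : forall v w, A v -> adj v w -> A w \/ adj c w.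
Hypothesis R_conn : connected_in adj R.
Hypothesis R_c : forall r, R r -> r <> c.
Hypothesis AR : forall a r, A a -> R r -> a <> r /\ ~ adj a r.
Hypothesis T_c : forall t, T t -> adj c t.
Hypothesis T_A : forall t, T t -> exists a, A a /\ adj a t.
Hypothesis T_R : forall t, T t -> exists r, R r /\ adj r t.
Hypothesis RT : forall r, R r -> ~ T r.
Hypothesis T_escape : forall v, v <> c -> exists t, T t /\ ~ adj t v.
Hypothesis R_ne : exists r, R r.
Hypothesis two_nbrs : forall s t, adj s t -> exists a, a <> s /\ adj t a.

Lemma T_indep t t' : T t -> T t' -> ~ adj t t'.
Proof. intros H H' K. apply (no_triangle adj sym tri_free c t t'); auto. Qed.
Lemma AT v : A v -> ~ T v.
Proof. intros H K. destruct (A_c v H). auto. Qed.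
Lemma R_escape r : R r -> exists t, T t /\ r <> t /\ ~ adj r t.
Proof.
  intros Hr. destruct (T_escape r (R_c r Hr)) as [t [Ht N]]. exists t. split; [assumption|]. split.
  - intros ->. exact (RT _ Hr Ht).
  - intros K. apply N, sym, K.
Qed.
Lemma A_no_desc_c v y : A v -> desc v y = true -> desc c y = false.
Proof.
  intros Hv H. destruct (A_c v Hv) as [N1 N2]. destruct (desc c y) eqn:E; [exfalso | reflexivity].
  apply (desc_excl adj sym c v y); auto.
Qed.

Definition covers (w : list V) : Prop := forall t, T t -> In t w.
Definition T_word (w : list V) : Prop := (forall v, In v w -> T v) /\ stutter_free w.

(** By [strip_other] a second descent is adjacent to every letter of the word, hence to all of [T],
    which [T_escape] allows only for [c]. *)
Lemma strip_covering w t z b : T_word (t :: z) -> covers (t :: z) -> desc (last z t) b = false ->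
  w <> c -> desc w (cls (t :: z) ** b) = true -> w = t.
Proof.
  intros [H1 H2] C Hb N Hw. apply NNPP. intros Nt.
  destruct (strip_other adj irr sym T T_indep w t z b H1 H2 Hb Nt Hw) as [K _].
  destruct (T_escape w N) as [t' [Ht' K']]. apply K', sym, K, C, Ht'.
Qed.

(* The half-space at the end of the reduced word [t :: z], based at [g]. *)
Definition pin (g : racg) (t : V) (z : list V) (x : racg) : Prop := desc (last z t) (inv (g ** cls (t :: z)) ** x) = false.

Lemma pin_decompose g t z x : x = g ** (cls (t :: z) ** (inv (g ** cls (t :: z)) ** x)).
Proof. rewrite (mulA adj), mulKVg. reflexivity. Qed.
Lemma comm_c w : (forall v, In v w -> T v) -> gen c ** cls w = cls w ** gen c.
Proof. intros H. apply comm_word. auto. Qed.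
Lemma desc_T_c t y : T t -> desc t (gen c ** y) = desc t y.
Proof. intros H. apply (desc_comm' adj irr), sym, T_c, H. Qed.

(** The half-space near [xi] is identified by [strip_covering], which does not exclude the letter
    [c]. Moving the base point across the wall of [c] removes this case, and [c] commutes with the
    whole word. *)
Lemma pin_first g t z xi : T_word (t :: z) -> covers (t :: z) -> limit (pin g t z) xi ->
  eventually_at xi (fun x => desc t (inv g ** x) = true).
Proof.
  intros W C L. destruct (halfspace_avoiding _ _ _ _ GS x0 c g xi) as [g' [w [Hg [N E]]]].
  assert (Tl : T (last z t)) by (apply (proj1 W), last_in).
  assert (Tt : T t) by (apply (proj1 W); left; reflexivity).
  destruct (limit_meets _ _ _ _ GS _ _ _ _ L E) as [x [Px Hx]]. unfold pin in Px.
  rewrite (pin_decompose g t z x) in Hx. set (b := inv (g ** cls (t :: z)) ** x) in *.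
  destruct Hg as [-> | ->].
  - rewrite mulKg in Hx. assert (w = t) as -> by (apply (strip_covering w t z b); assumption). exact E.
  - rewrite invM, inv_gen, <- (mulA adj), mulKg, (mulA adj), comm_c, <- (mulA adj) in Hx by apply W.
    assert (w = t) as ->.
    { apply (strip_covering w t z (gen c ** b)); try assumption. rewrite desc_T_c; assumption. }
    refine (eventually_mono _ _ _ _ _ _ _ _ E). intros y. rewrite invM, inv_gen, <- (mulA adj), desc_T_c by assumption. auto.
Qed.

Definition part (g : racg) (x : racg) : Prop := forall v, desc v (inv g ** x) = true -> A v.
Definition half (g : racg) (r : V) (x : racg) : Prop := desc r (inv g ** x) = true.
(** The first two hubs are copies of one set on the two sides of the wall of [c]; the third collects
    the half-spaces in the direction of [R]. *)
Definition hub (k : tri) (h : list V) (x : racg) : Prop :=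
  match k with
  | T0 => part (cls h) x
  | T1 => part (gen c ** cls h) x
  | T2 => exists r, R r /\ half (cls h) r x
  end.

Lemma halfspace_in_part g xi : limit (part g) xi -> exists w, A w /\ eventually_at xi (half g w).
Proof.
  intros L. destruct (halfspace_at _ _ _ _ GS x0 g xi) as [w Hw].
  destruct (limit_meets _ _ _ _ GS _ _ _ _ L Hw) as [x [Px Hx]]. exists w. split; [apply Px, Hx | exact Hw].
Qed.

(** For [a] in [A] adjacent to [t], the letters [a] and [c] commute with [t], so alternating words
    in [a] and [c] lead to a common limit point. *)
Lemma part_limit_step g t : T t -> exists xi, limit (part g) xi /\ limit (part (g ** gen t)) xi.
Proof.
  intros Ht. destruct (T_A t Ht) as [a [Aa Hat]]. destruct (A_c a Aa) as [Nac Nadj].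
  assert (N : ~ adj a c) by (intros K; apply Nadj, sym, K).
  destruct (alternating_limit _ _ _ _ GS x0 g a c Nac N) as [xi L]. exists xi. split.
  - refine (limit_mono _ _ _ _ _ _ _ _ L). intros x [m ->] v. rewrite mulKg. intros Hv.
    apply (alt_desc adj sym) in Hv; [subst; assumption | assumption | assumption].
  - apply (limit_gen _ _ _ _ GS _ _ _ _ L). intros x [m ->]. exists t. intros v.
    rewrite invM, inv_gen, <- !(mulA adj), mulKg, <- comm_word.
    + rewrite genK. intros Hv. apply (alt_desc adj sym) in Hv; [subst; assumption | assumption | assumption].
    + intros u Hu. apply alt_letters in Hu. destruct Hu as [-> | ->]; apply sym; auto.
Qed.
Lemma half_limit g r : R r -> exists t, T t /\ exists xi, limit (fun x => half g r x /\ forall v, desc v (inv g ** x) = true -> v = r) xi.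
Proof.
  intros Hr. destruct (R_escape r Hr) as [t [Ht [N1 N2]]]. exists t. split; [assumption|].
  destruct (alternating_limit _ _ _ _ GS x0 g r t N1 N2) as [xi L]. exists xi.
  refine (limit_mono _ _ _ _ _ _ _ _ L). intros x [m ->]. unfold half. rewrite mulKg. split; [|intros v Hv]; apply (alt_desc adj sym r t m); auto.
Qed.

Lemma hub_step k h t : T t -> exists xi, limit (hub k h) xi /\ limit (hub k (h ++ [t])) xi.
Proof.
  intros Ht. destruct k; unfold hub; rewrite cls_app; fold (gen t).
  - apply part_limit_step, Ht.
  - rewrite (mulA adj). apply part_limit_step, Ht.
  - destruct (T_R t Ht) as [r [Rr Hrt]]. destruct (half_limit (cls h) r Rr) as [_ [_ [xi L]]]. exists xi. split.
    + refine (limit_mono _ _ _ _ _ _ _ _ L). intros x [Hx _]. eauto.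
    + refine (limit_mono _ _ _ _ _ _ _ _ L). intros x [Hx _]. exists r. split; [assumption|]. unfold half in *.
      rewrite invM, inv_gen, <- (mulA adj), (desc_comm' adj irr); assumption.
Qed.

Lemma hub_pin k t z : T_word (t :: z) -> exists xi, limit (hub k (t :: z)) xi /\ limit (pin one t z) xi.
Proof.
  intros [W1 W2]. assert (Tl : T (last z t)) by (apply W1, last_in). assert (Tt : T t) by (apply W1; left; reflexivity).
  destruct k.
  - destruct (part_limit_step (cls (t :: z)) t Tt) as [xi [L _]]. exists xi. split; [exact L|].
    refine (limit_mono _ _ _ _ _ _ _ _ L). intros x Hx. unfold pin. rewrite mul1g.
    apply not_true_is_false. intros D. exact (AT _ (Hx _ D) Tl).
  - destruct (part_limit_step (gen c ** cls (t :: z)) t Tt) as [xi [L _]]. exists xi. split; [exact L|].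
    refine (limit_mono _ _ _ _ _ _ _ _ L). intros x Hx. unfold pin. rewrite mul1g.
    apply not_true_is_false. intros D. apply (AT (last z t)); [|exact Tl]. apply Hx.
    rewrite comm_c, invM, inv_gen, <- (mulA adj), desc_T_c by assumption. exact D.
  - destruct R_ne as [r Rr]. destruct (half_limit (cls (t :: z)) r Rr) as [_ [_ [xi L]]]. exists xi. split.
    + refine (limit_mono _ _ _ _ _ _ _ _ L). intros x [Hx _]. exists r. auto.
    + refine (limit_mono _ _ _ _ _ _ _ _ L). intros x [_ Hx]. unfold pin. rewrite mul1g.
      apply not_true_is_false. intros D. rewrite (Hx _ D) in Tl. exact (RT _ Rr Tl).
Qed.

(** Cancel repeated letters of [z] and absorb those that commute with [r]. By [strip_other] the
    descent [w] would survive to an element that also has the descent [r], contradicting [AR]. *)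
Lemma no_A_descent (z : list V) y r w : (forall v, In v z -> T v) -> R r -> desc r y = true -> A w -> desc w (cls z ** y) = false.
Proof.
  remember (length z) as n eqn:En. revert z y En. induction n as [n IH] using (well_founded_induction lt_wf). intros z y -> HT Hr Hy Hw.
  assert (Nr : ~ T r) by (apply RT, Hr).
  assert (Base : forall y', desc r y' = true -> desc w y' = false).
  { intros y' H. apply not_true_is_false. intros D. destruct (AR w r Hw Hr) as [N1 N2].
    exact (desc_excl adj sym w r y' N1 N2 D H). }
  destruct (stutter_cases z) as [S | [l1 [a [l2 ->]]]].
  - destruct (absorb_suffix adj irr sym T r y z Nr HT S Hy) as [h [y' [E1 [E2 [[h' E3] E4]]]]]. rewrite E1.
    destruct h as [|t h]; [change (cls []) with one; rewrite mul1g; apply Base, E2|].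
    apply not_true_is_false. intros D.
    destruct (strip_other adj irr sym T T_indep w t h y') as [_ K]; [| | exact E4 | | exact D |].
    + intros v Hv. apply HT. rewrite E3. apply in_app_iff. auto.
    + rewrite E3 in S. exact (stutter_free_prefix _ _ S).
    + intros ->. apply (AT t Hw), HT. rewrite E3. left. reflexivity.
    + rewrite (Base y' E2) in K. discriminate.
  - rewrite cls_cancel. apply (IH (length (l1 ++ l2))); try assumption; [rewrite !length_app; simpl; lia | reflexivity|].
    intros v Hv. apply HT. rewrite in_app_iff in *. simpl. tauto.
Qed.

(** Near a limit point of one of the first two hubs, some letter of [A] is a descent seen from its
    base point. This is impossible on the other hub: by the wall of [c], or by [no_A_descent] for
    the half-spaces. *)
Lemma hubs_disjoint_aux k k' h h' xi : (forall v, In v h -> T v) -> (forall v, In v h' -> T v) ->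
  limit (hub k h) xi -> limit (hub k' h') xi ->
  match k, k' with T0, T1 | T0, T2 | T1, T2 => False | _, _ => True end.
Proof.
  intros Hh Hh' L L'.
  assert (Q : parabolic adj T (inv (cls h) ** cls h')).
  { apply parabolic_mul; [apply parabolic_inv|]; apply parabolic_cls; assumption. }
  destruct Q as [p [Hp Ep]].
  destruct k, k'; try exact I; unfold hub in L, L'.
  - destruct (halfspace_in_part _ _ L) as [w [Aw E]]. destruct (limit_meets _ _ _ _ GS _ _ _ _ L' E) as [x [Px Hx]].
    unfold half in Hx. set (y := inv (gen c ** cls h') ** x) in *.
    assert (Ex : inv (cls h) ** x = gen c ** (cls p ** y)).
    { rewrite Ep. unfold y. rewrite invM, inv_gen, !(mulA adj). rewrite <- (mulA adj (gen c) (inv (cls h))).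
      rewrite <- (mulA adj _ (inv (cls h) ** cls h')), <- (mulA adj (inv (cls h))), mulgV, mulg1.
      rewrite inv_cls, comm_c by (intros v Hv; apply Hh, in_rev, Hv). rewrite mulgenK. reflexivity. }
    rewrite Ex in Hx. pose proof (A_no_desc_c w _ Aw Hx) as D. rewrite desc_flip in D.
    rewrite (desc_comm_word adj irr) in D by auto. destruct (desc c y) eqn:Dc; [|discriminate].
    destruct (A_c c (Px c Dc)) as [K _]. congruence.
  - destruct (halfspace_in_part _ _ L) as [w [Aw E]]. destruct (limit_meets _ _ _ _ GS _ _ _ _ L' E) as [x [[r [Rr Px]] Hx]].
    unfold half in *. assert (Ex : inv (cls h) ** x = cls p ** (inv (cls h') ** x)).
    { rewrite Ep, <- (mulA adj), mulKVg. reflexivity. }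
    rewrite Ex, (no_A_descent p _ r w Hp Rr Px Aw) in Hx. discriminate.
  - destruct (halfspace_in_part _ _ L) as [w [Aw E]]. destruct (limit_meets _ _ _ _ GS _ _ _ _ L' E) as [x [[r [Rr Px]] Hx]].
    unfold half in *. set (y := inv (cls h') ** x) in *.
    assert (Ex : inv (gen c ** cls h) ** x = gen c ** (cls p ** y)).
    { rewrite Ep, comm_c, invM, inv_gen by assumption. unfold y. rewrite <- !(mulA adj), mulKVg. reflexivity. }
    rewrite Ex in Hx. destruct (desc c y) eqn:Dc.
    + assert (Dr : desc r (gen c ** y) = true).
      { rewrite (desc_comm' adj irr); [assumption|]. destruct (desc_adj adj sym r c y Px Dc) as [K | K]; [|assumption].
        destruct (R_c r Rr K). }
      rewrite (mulA adj), comm_c, <- (mulA adj), (no_A_descent p _ r w Hp Rr Dr Aw) in Hx by exact Hp. discriminate.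
    + pose proof (A_no_desc_c w _ Aw Hx) as D. rewrite desc_flip, (desc_comm_word adj irr), Dc in D by auto. discriminate.
Qed.
Lemma hubs_disjoint k k' h h' xi : k <> k' -> (forall v, In v h -> T v) -> (forall v, In v h' -> T v) ->
  limit (hub k h) xi -> limit (hub k' h') xi -> False.
Proof.
  intros N H H' L L'. pose proof (hubs_disjoint_aux k k' h h' xi H H' L L') as K.
  pose proof (hubs_disjoint_aux k' k h' h xi H' H L' L) as K'. destruct k, k'; try contradiction; congruence.
Qed.

Lemma pins_disjoint t z t' z' xi : T_word (t :: z) -> covers (t :: z) -> T_word (t' :: z') -> covers (t' :: z') -> t <> t' ->
  limit (pin one t z) xi -> limit (pin one t' z') xi -> False.
Proof.
  intros W C W' C' N L L'. pose proof (pin_first _ _ _ _ W C L) as E. pose proof (pin_first _ _ _ _ W' C' L') as E'.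
  destruct (limit_meets _ _ _ _ GS _ _ _ _ (limit_all _ _ _ _ GS x0 xi) (eventually_and _ _ _ _ GS _ _ _ _ E E')) as [x [_ [H1 H2]]].
  apply (desc_excl adj sym t t' (inv one ** x) N); [|assumption|assumption].
  apply T_indep; [apply W | apply W']; left; reflexivity.
Qed.

(* Peeling the letters of [z1] off the pin, each of them has to commute with [r]. *)
Lemma half_meets_pin z1 : forall g r t z xi, R r -> T_word (z1 ++ t :: z) -> covers (t :: z) ->
  limit (half g r) xi -> limit (fun x => desc (last z t) (inv (g ** cls (z1 ++ t :: z)) ** x) = false) xi ->
  forall v, In v z1 -> adj r v.
Proof.
  induction z1 as [|s z1 IH]; intros g r t z xi Rr W C L LP v Hv; [destruct Hv|].
  assert (Cs : covers (s :: z1 ++ t :: z)) by (intros t' Ht'; right; apply in_app_iff; right; apply C, Ht').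
  assert (El : last (z1 ++ t :: z) s = last z t).
  { clear. revert s. induction z1 as [|a z1 IH]; intros s; [apply last_cons|]. simpl app. rewrite last_cons. apply IH. }
  assert (Es : eventually_at xi (fun x => desc s (inv g ** x) = true)).
  { apply (pin_first g s (z1 ++ t :: z)); [exact W | exact Cs|]. unfold pin. rewrite El. exact LP. }
  destruct (limit_meets _ _ _ _ GS _ _ _ _ L Es) as [x [Hx Sx]].
  assert (Ts : T s) by (apply (proj1 W); left; reflexivity).
  assert (Ars : adj r s).
  { destruct (desc_adj adj sym r s _ Hx Sx) as [-> | K]; [destruct (RT _ Rr Ts) | exact K]. }
  destruct Hv as [<- | Hv]; [exact Ars|].
  apply (IH (g ** gen s) r t z xi Rr); try assumption.
  - destruct W as [W1 W2]. split; [intros; apply W1; right; assumption | apply W2].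
  - refine (limit_mono _ _ _ _ _ _ _ _ L). intros y Hy. unfold half in *.
    rewrite invM, inv_gen, <- (mulA adj), (desc_comm' adj irr); assumption.
  - rewrite <- (mulA adj), <- cls_cons. exact LP.
Qed.

Lemma half_prefix h r x : T_word h -> R r -> half (cls h) r x ->
  desc r x = true \/ match h with [] => False | u :: _ => desc u x = true end.
Proof.
  intros [W1 W2] Rr Hx. unfold half in Hx. rewrite <- (mulKVg adj (cls h) x). set (y := inv (cls h) ** x) in *. clearbody y. clear x.
  destruct (absorb_suffix adj irr sym T r y h (RT r Rr) W1 W2 Hx) as [h0 [y' [E1 [E2 [[h' E3] E4]]]]]. rewrite E1.
  destruct h0 as [|t h0]; [left; change (cls []) with one; rewrite mul1g; exact E2|].
  right. rewrite E3. simpl. apply (strip_first adj sym T T_indep); [| | exact E4].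
  - intros v Hv. apply W1. rewrite E3. apply in_app_iff. auto.
  - rewrite E3 in W2. exact (stutter_free_prefix _ _ W2).
Qed.

Lemma finite_exists_limit (P : V -> racg -> Prop) xi : limit (fun x => exists v, P v x) xi -> exists v, limit (P v) xi.
Proof.
  intros L. destruct (gs_finite _ _ _ _ GS) as [lV HlV]. destruct (limit_ex _ _ _ _ GS x0 lV P xi) as [v [_ H]]; [|eauto].
  refine (limit_mono _ _ _ _ _ _ _ _ L). intros x [v Hv]. eauto.
Qed.

(** As [u <> t], the way back along [h] followed by the word of the pin is still reduced, so from
    the base point [cls h] the only possible descent other than [c] lies in [T] and not in [A]. For
    the third hub, peeling off the first copy of [t :: l] would make [r] adjacent to all of [T]; the
    second copy keeps the remaining word covering, which is why the word is doubled. *)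
Lemma hub_misses_pin k h h' u w t l xi :
  u <> t -> u :: w = h ++ h' -> T_word (u :: w) -> T_word ((t :: l) ++ t :: l) -> covers (t :: l) ->
  limit (hub k h) xi -> limit (pin one t (l ++ t :: l)) xi -> False.
Proof.
  intros N Eh W W' C L LP.
  assert (C2 : covers (t :: l ++ t :: l)) by (intros v Hv; destruct (C v Hv) as [H | H]; [left; exact H | right; apply in_app_iff; auto]).
  assert (Wh : T_word h).
  { destruct W as [W1 W2]. rewrite Eh in W1, W2. split; [intros; apply W1, in_app_iff; auto | exact (stutter_free_prefix _ _ W2)]. }
  set (z := l ++ t :: l) in *. change ((t :: l) ++ t :: l) with (t :: z) in W'.
  assert (Tl : T (last z t)) by (apply (proj1 W'), last_in).
  assert (W3 : T_word (rev h ++ t :: z)).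
  { destruct Wh as [H1 H2], W' as [H3 H4]. split.
    - intros v Hv. apply in_app_iff in Hv. destruct Hv as [Hv | Hv]; [apply H1, in_rev, Hv | apply H3, Hv].
    - destruct h as [|u' h]; [exact H4|]. simpl in Eh. injection Eh as <- _. simpl. rewrite <- app_assoc. simpl.
      apply stutter_free_app; [apply (stutter_free_rev _ H2) | split; assumption]. }
  assert (Base : forall w b, A w -> desc (last z t) b = false -> desc w (inv (cls h) ** (cls (t :: z) ** b)) = true -> False).
  { intros v b Av Hb Hv. rewrite inv_cls, (mulA adj), <- cls_app in Hv.
    destruct (rev h ++ t :: z) as [|s y] eqn:E; [destruct (rev h); discriminate|].
    assert (v = s).
    { apply (strip_covering v s y b); [exact W3 | | | apply A_c, Av | exact Hv].
      - intros t' Ht'. rewrite <- E. apply in_app_iff. right. apply C2, Ht'.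
      - replace (last y s) with (last z t); [exact Hb|].
        assert (El : last (s :: y) s = last (t :: z) s).
        { rewrite <- E. clear. induction (rev h) as [|a q IH]; [reflexivity|]. simpl app. rewrite <- IH.
          destruct (q ++ t :: z) eqn:Q; [destruct q; discriminate|]. reflexivity. }
        rewrite !last_cons in El. symmetry. exact El. }
    subst v. apply (AT s Av), (proj1 W3). left. reflexivity. }
  pose proof (pin_first one t z xi W' C2 LP) as E1.
  destruct k; unfold hub in L.
  - destruct (halfspace_in_part _ _ L) as [v [Av E]]. destruct (limit_meets _ _ _ _ GS _ _ _ _ LP E) as [x [Px Hx]].
    unfold half, pin in *. rewrite mul1g in Px. set (b := inv (cls (t :: z)) ** x) in *.
    apply (Base v b Av Px). unfold b. rewrite mulKVg. exact Hx.
  - destruct (halfspace_in_part _ _ L) as [v [Av E]]. destruct (limit_meets _ _ _ _ GS _ _ _ _ LP E) as [x [Px Hx]].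
    unfold half, pin in *. rewrite mul1g in Px. set (b := inv (cls (t :: z)) ** x) in *.
    apply (Base v (gen c ** b) Av); [rewrite desc_T_c; assumption|].
    rewrite (mulA adj (cls (t :: z))), <- comm_c by apply W'. rewrite <- (mulA adj). unfold b. rewrite mulKVg.
    rewrite invM, inv_gen, <- (mulA adj) in Hx. exact Hx.
  - destruct (finite_exists_limit _ _ L) as [r Lr].
    assert (Rr : R r) by (destruct (limit_witness _ _ _ _ _ _ Lr) as [x [K _]]; exact K).
    assert (L2 : limit (fun x => desc r x = true \/ desc u x = true) xi).
    { refine (limit_mono _ _ _ _ _ _ _ _ Lr). intros x [_ Hx]. destruct (half_prefix h r x Wh Rr Hx) as [K | K]; [auto|].
      destruct h as [|u' h]; [destruct K|]. injection Eh as <- _. auto. }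
    destruct (limit_or _ _ _ _ GS _ _ _ _ L2) as [L3 | L3].
    + assert (K : forall v, In v (t :: l) -> adj r v).
      { apply (half_meets_pin (t :: l) one r t l xi Rr W' C).
        - unfold half. refine (limit_mono _ _ _ _ _ _ _ _ L3). intros x. rewrite inv1, mul1g. auto.
        - refine (limit_mono _ _ _ _ _ _ _ _ LP). intros x Hx. unfold pin in Hx. change ((t :: l) ++ t :: l) with (t :: z).
          replace (last l t) with (last z t); [exact Hx|]. unfold z. clear.
          assert (Q : forall (l' : list V) s, last (l' ++ t :: l) s = last l t).
          { induction l' as [|a l' IH]; intros s; [apply last_cons|]. simpl app. rewrite last_cons. apply IH. }
          apply Q. }
      destruct (R_escape r Rr) as [t' [Ht' [_ K']]]. apply K', K, C, Ht'.
    + destruct (limit_meets _ _ _ _ GS _ _ _ _ L3 E1) as [x [H1 H2]]. rewrite inv1, mul1g in H2.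
      apply (desc_excl adj sym u t x N); [|assumption|assumption].
      apply T_indep; [apply (proj1 W) | apply (proj1 W')]; left; reflexivity.
Qed.

Variable f : bd -> pt3.
Hypothesis f_S2 : forall x, on_S2 (f x).
Hypothesis f_inj : forall x y, f x = f y -> x = y.
Hypothesis f_cont : forall W, open3 W -> cone_open d x0 (fun x => W (f x)).
Variables (u : tri -> V) (l : tri -> list V).
Hypothesis u_inj : forall i j, u i = u j -> i = j.
Hypothesis l_ne : forall i, l i <> [].
Hypothesis l_nodup : forall i, NoDup (u i :: l i).
Hypothesis l_T : forall i v, In v (u i :: l i) <-> T v.
Local Notation met := (gs_metric _ _ _ _ GS).
Local Notation ult := (gs_ultra _ _ _ _ GS).
Local Notation reach := (reach d x0 f).

Definition tail (i : tri) : list V := l i ++ u i :: l i.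
(** An edge of $K_{3,3}$: the base point of the hub moves along the prefixes of the word, and the
    last hub meets the pin. *)
Definition hub_pin_set (k i : tri) (x : racg) : Prop :=
  (exists h, In h (prefixes (u i :: tail i)) /\ hub k h x) \/ pin one (u i) (tail i) x.

Lemma tail_word i : T_word (u i :: tail i).
Proof.
  split.
  - intros v Hv. apply (l_T i). unfold tail in Hv. simpl in *. rewrite in_app_iff in Hv. simpl in Hv. tauto.
  - apply (stutter_free_double (u i) (l i)); auto.
Qed.

(** The third hub is a union of half-spaces; those of adjacent letters of [R] have a common limit
    point, and [R] is connected. *)
Lemma hub_reach k h del p q : 0 < del -> limit (hub k h) p -> limit (hub k h) q -> reach (limit (hub k h)) del p q.
Proof.
  intros Hd Hp Hq. destruct k.
  - apply connected_reach; try assumption. apply (limit_part_connected adj d act U GS x0 LC insep (cls h) c A); assumption.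
  - apply connected_reach; try assumption. apply (limit_part_connected adj d act U GS x0 LC insep (gen c ** cls h) c A); assumption.
  - assert (Conn : forall r p q, R r -> limit (half (cls h) r) p -> limit (half (cls h) r) q -> reach (limit (hub T2 h)) del p q).
    { intros r p' q' Rr Lp Lq. apply (reach_mono d x0 f (limit (half (cls h) r))).
      - intros x. apply limit_mono. intros y Hy. exists r. auto.
      - apply connected_reach; try assumption. apply (limit_halfspace_connected adj d act U GS x0 insep). }
    destruct (finite_exists_limit _ _ Hp) as [r Lr]. destruct (finite_exists_limit _ _ Hq) as [r' Lr'].
    destruct (limit_witness _ _ _ _ _ _ Lr) as [_ [Rr _]]. destruct (limit_witness _ _ _ _ _ _ Lr') as [_ [Rr' _]].
    assert (Hp' : limit (half (cls h) r) p) by (refine (limit_mono _ _ _ _ _ _ _ _ Lr); tauto).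
    assert (Hq' : limit (half (cls h) r') q) by (refine (limit_mono _ _ _ _ _ _ _ _ Lr'); tauto).
    pose proof (R_conn r r' Rr Rr') as P. apply clos_rt_rt1n in P. clear Lr Lr' Hp. revert p Hp'.
    induction P as [r | r r1 r' [_ [Rr1 Hrr]] _ IH]; intros p Hp'; [apply (Conn r); assumption|].
    destruct (two_nbrs r r1 Hrr) as [a [Na Ha]].
    destruct (vertex_edge_limit _ _ _ _ GS x0 (cls h) r r1 a Hrr Ha Na) as [m [_ Lm]].
    apply rt_trans with m.
    + apply (Conn r); [assumption | assumption|]. refine (limit_mono _ _ _ _ _ _ _ _ Lm). unfold half. tauto.
    + apply IH; try assumption. refine (limit_mono _ _ _ _ _ _ _ _ Lm). unfold half. tauto.
Qed.

Lemma pin_connected t z : connected_sub (cone_open d x0) (limit (pin one t z)).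
Proof.
  rewrite (pred_ext (pin one t z) (fun x => desc (last z t) (inv (cls (t :: z) ** gen (last z t)) ** x) = true)).
  - apply (limit_halfspace_connected adj d act U GS x0 insep).
  - intros x. unfold pin. rewrite mul1g, invM, inv_gen, <- (mulA adj), desc_flip.
    destruct (desc (last z t) (inv (cls (t :: z)) ** x)); simpl; split; congruence.
Qed.

Lemma hub_to_pin k i del p q : 0 < del -> limit (hub k []) p -> limit (pin one (u i) (tail i)) q ->
  reach (limit (hub_pin_set k i)) del p q.
Proof.
  intros Hd Hp Hq. set (w := u i :: tail i).
  assert (Sub : forall n, (n <= length w)%nat -> forall x, limit (hub k (firstn n w)) x -> limit (hub_pin_set k i) x).
  { intros n Hn x. apply limit_mono. intros y Hy. left. exists (firstn n w). split; [apply in_prefixes, Hn | exact Hy]. }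
  assert (S1 : forall n, (n <= length w)%nat -> exists m, limit (hub k (firstn n w)) m /\ reach (limit (hub_pin_set k i)) del p m).
  { induction n as [|n IH]; intros Hn; [exists p; split; [exact Hp | apply rt_refl]|].
    destruct (IH ltac:(lia)) as [m [L1 L2]]. destruct (firstn_snoc w n Hn) as [t [Ht E]].
    destruct (hub_step k (firstn n w) t) as [m' [K1 K2]]; [apply (proj1 (tail_word i)), Ht|]. exists m'. rewrite E. split; [exact K2|].
    apply rt_trans with m; [exact L2|]. apply (reach_mono d x0 f (limit (hub k (firstn n w)))); [apply Sub; lia | apply hub_reach; assumption]. }
  destruct (S1 (length w) (le_n _)) as [m [L1 L2]]. rewrite firstn_all in L1.
  destruct (hub_pin k (u i) (tail i) (tail_word i)) as [m' [K1 K2]].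
  apply rt_trans with m; [exact L2|]. apply rt_trans with m'.
  - apply (reach_mono d x0 f (limit (hub k w))); [|apply hub_reach; assumption].
    intros x Hx. apply (Sub (length w) (le_n _)). rewrite firstn_all. exact Hx.
  - apply (reach_mono d x0 f (limit (pin one (u i) (tail i)))); [intros x; apply limit_mono; intros y Hy; right; exact Hy|].
    apply connected_reach; try assumption. apply pin_connected.
Qed.

Lemma hub_pin_cases k i xi : limit (hub_pin_set k i) xi ->
  (exists h h', u i :: tail i = h ++ h' /\ (forall v, In v h -> T v) /\ limit (hub k h) xi) \/ limit (pin one (u i) (tail i)) xi.
Proof.
  intros L. destruct (limit_or _ _ _ _ GS _ _ _ _ L) as [K | K]; [left | right; exact K].
  destruct (limit_ex _ _ _ _ GS x0 _ _ _ K) as [h [Hh Lh]]. destruct (prefixes_spec _ _ Hh) as [h' E]. exists h, h'.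
  split; [exact E | split; [|exact Lh]]. intros v Hv. apply (proj1 (tail_word i)). rewrite E. apply in_app_iff. auto.
Qed.
Lemma tail_covers i : covers (u i :: tail i).
Proof. intros t Ht. apply (l_T i) in Ht. destruct Ht as [H | H]; [left; exact H | right; unfold tail; apply in_app_iff; auto]. Qed.

Lemma hub_pin_disjoint k k' i j xi : k <> k' -> i <> j -> limit (hub_pin_set k i) xi -> limit (hub_pin_set k' j) xi -> False.
Proof.
  intros Nk Ni L L'. assert (Nu : u i <> u j) by auto.
  destruct (hub_pin_cases _ _ _ L) as [[h [h1 [E [Hh K]]]] | K], (hub_pin_cases _ _ _ L') as [[h' [h1' [E' [Hh' K']]]] | K'].
  - exact (hubs_disjoint k k' h h' xi Nk Hh Hh' K K').
  - apply (hub_misses_pin k h h1 (u i) (tail i) (u j) (l j) xi); try assumption; try apply tail_word. intros t Ht. apply l_T, Ht.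
  - apply (hub_misses_pin k' h' h1' (u j) (tail j) (u i) (l i) xi); try assumption; try apply tail_word; [congruence|]. intros t Ht. apply l_T, Ht.
  - exact (pins_disjoint _ _ _ _ xi (tail_word i) (tail_covers i) (tail_word j) (tail_covers j) Nu K K').
Qed.

Definition tris : list tri := [T0; T1; T2].
Lemma in_tris k : In k tris.
Proof. destruct k; simpl; auto. Qed.

Lemma bad_star_not_planar : False.
Proof.
  assert (Ho : forall k, exists xi, limit (hub k []) xi).
  { intros k. destruct (hub_step k [] (u T0)) as [xi [L _]]; [apply (l_T T0); left; reflexivity | eauto]. }
  assert (Hq : forall i, exists xi, limit (pin one (u i) (tail i)) xi).
  { intros i. destruct (hub_pin T0 (u i) (tail i) (tail_word i)) as [xi [_ L]]. eauto. }
  destruct (choice _ Ho) as [o Lo]. destruct (choice _ Hq) as [q Lq]. clear Ho Hq.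
  destruct (common_positive (list_prod (list_prod tris tris) (list_prod tris tris))
    (fun x eta => fst (fst x) <> fst (snd x) -> snd (fst x) <> snd (snd x) -> forall a b,
      limit (hub_pin_set (fst (fst x)) (snd (fst x))) a -> limit (hub_pin_set (fst (snd x)) (snd (snd x))) b -> eta <= dist3 (f a) (f b))) as [eta [He Sep]].
  { intros [[k i] [k' j]]. simpl. destruct (classic (k <> k' /\ i <> j)) as [[N1 N2] | N].
    - destruct (separation d met (gs_proper _ _ _ _ GS) U ult x0 f f_inj f_cont (limit (hub_pin_set k i)) (limit (hub_pin_set k' j))) as [e [He Hs]].
      + intros xs xi Hx Hr. exact (limit_rlim _ _ _ _ GS _ _ _ _ Hx Hr).
      + intros xs xi Hx Hr. exact (limit_rlim _ _ _ _ GS _ _ _ _ Hx Hr).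
      + intros x. apply hub_pin_disjoint; assumption.
      + exists e. split; [assumption|]. intros _ _. exact Hs.
    - exists 1%R. split; [lra|]. intros N1 N2. tauto. }
  { intros [[k i] [k' j]] a b Hab H N1 N2 x y Hx Hy. specialize (H N1 N2 x y Hx Hy). lra. }
  set (del := Rmin (1/10) (eta / 8)).
  assert (Hd : (0 < del <= 1/10)%R) by (split; [apply Rmin_glb_lt; lra | apply Rmin_l]).
  assert (Hd8 : (8 * del <= eta)%R) by (pose proof (Rmin_r (1/10) (eta / 8)); fold del in H; lra).
  destruct (choice (fun (ki : tri * tri) (lc : list bd) => chain del (f (o (fst ki))) (map f lc) /\
    last lc (o (fst ki)) = q (snd ki) /\ forall x, In x (o (fst ki) :: lc) -> limit (hub_pin_set (fst ki) (snd ki)) x)) as [ch Hch].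
  { intros [k i]. simpl. apply reach_chain; [assumption | apply hub_to_pin; auto; lra|].
    refine (limit_mono _ _ _ _ _ _ _ _ (Lo k)). intros x Hx. left. exists []. split; [|exact Hx].
    apply (in_prefixes (u i :: tail i) 0). lia. }
  apply (K33_not_in_sphere (fun k => f (o k)) (fun i => f (q i)) (fun k i => map f (ch (k, i))) del Hd).
  - intros k i. apply (Hch (k, i)).
  - intros k i. rewrite last_map. f_equal. apply (Hch (k, i)).
  - intros k k' i j a b Nk Ni Ha Hb. apply Rle_trans with eta; [exact Hd8|].
    change (f (o k) :: map f (ch (k, i))) with (map f (o k :: ch (k, i))) in Ha.
    change (f (o k') :: map f (ch (k', j))) with (map f (o k' :: ch (k', j))) in Hb.
    apply in_map_iff in Ha. destruct Ha as [a' [<- Ha]]. apply in_map_iff in Hb. destruct Hb as [b' [<- Hb]].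
    assert (I0 : In ((k, i), (k', j)) (list_prod (list_prod tris tris) (list_prod tris tris)))
      by (apply in_prod; apply in_prod; apply in_tris).
    apply (Sep _ I0 Nk Ni); [apply (Hch (k, i)), Ha | apply (Hch (k', j)), Hb].
Qed.
End BadStar.

Lemma linked_within {V : Type} (adj : V -> V -> Prop) P u v : linked_in adj P u v -> linked_in adj (linked_in adj P u) u v.
Proof.
  intros H. apply clos_rt_rtn1 in H. induction H as [|v w [Pv [Pw Hvw]] H IH]; [apply rt_refl|].
  apply clos_rtn1_rt in H. eapply rt_trans; [exact IH|]. apply rt_step.
  split; [exact H | split; [|exact Hvw]]. eapply rt_trans; [exact H | apply rt_step; auto].
Qed.
Lemma component_connected {V : Type} (adj : V -> V -> Prop) P u : (forall u v, adj u v -> adj v u) ->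
  connected_in adj (linked_in adj P u).
Proof.
  intros S v w Hv Hw. eapply rt_trans; [apply linked_sym; [exact S|] |]; apply linked_within; assumption.
Qed.
Lemma component_closed {V : Type} (adj : V -> V -> Prop) P u v w : P u -> linked_in adj P u v -> adj v w -> P w -> linked_in adj P u w.
Proof.
  intros Pu Hv A Pw. eapply rt_trans; [exact Hv | apply rt_step]. split; [exact (linked_in_set adj P u v Hv Pu) | auto].
Qed.
Lemma enumerate_from {V : Type} (T : V -> Prop) t : finite_type V -> T t -> exists l, NoDup (t :: l) /\ forall v, In v (t :: l) <-> T v.
Proof.
  intros [lV HlV] Ht.
  pose (dec := fun v => if excluded_middle_informative (T v) then true else false).
  pose (lT := nodup (fun x y : V => excluded_middle_informative (x = y)) (filter dec lV)).
  assert (H : forall v, In v lT <-> T v).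
  { intros v. unfold lT. rewrite nodup_In, filter_In. unfold dec. destruct (excluded_middle_informative (T v)) as [K | K].
    - specialize (HlV v). tauto.
    - split; [intros [_ Q]; discriminate | contradiction]. }
  destruct (in_split t lT) as [l1 [l2 E]]; [apply H, Ht|]. exists (l1 ++ l2). split.
  - apply (Permutation_NoDup (l := lT)); [rewrite E; symmetry; apply Permutation_middle | apply NoDup_nodup].
  - intros v. rewrite <- H, E. simpl. rewrite !in_app_iff. simpl. tauto.
Qed.

(** * Connectedness of star complements *)

Section StarGraph.
Context {V X : Type} (adj : V -> V -> Prop) (d : X -> X -> R) (act : V -> X -> X) (U : (nat -> Prop) -> Prop).
Hypothesis GS : geometric_setting adj d act U.
Variable x0 : X.
Hypothesis LC : locally_connected (cone_open d x0).
Hypothesis insep : inseparable adj.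
Hypothesis two_nbrs : forall s t, adj s t -> exists a, a <> s /\ adj t a.
Variable f : boundary d x0 -> pt3.
Hypothesis f_S2 : forall x, on_S2 (f x).
Hypothesis f_inj : forall x y, f x = f y -> x = y.
Hypothesis f_cont : forall W, open3 W -> cone_open d x0 (fun x => W (f x)).
Local Notation sym := (gs_sym _ _ _ _ GS).
Local Notation irr := (gs_irr _ _ _ _ GS).
Local Notation tri_free := (gs_tri _ _ _ _ GS).

Lemma star_complement_connected c : connected_in adj (fun v => v <> c /\ ~ adj c v).
Proof.
  set (P := fun v => v <> c /\ ~ adj c v). apply NNPP. intros NC.
  assert (E : exists u w, P u /\ P w /\ ~ linked_in adj P u w).
  { apply NNPP. intros K. apply NC. intros u w Hu Hw. apply NNPP. intros N. apply K. exists u, w. auto. }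
  destruct E as [a0 [w [Pa [Pw NL]]]].
  set (A := linked_in adj P a0).
  assert (AP : forall v, A v -> P v) by (intros v Hv; exact (linked_in_set adj P a0 v Hv Pa)).
  assert (A_nbr : forall v x, A v -> adj v x -> A x \/ adj c x).
  { intros v x Hv Hvx. destruct (classic (adj c x)) as [|N]; [auto | left]. apply (component_closed adj P a0 v x Pa Hv Hvx).
    split; [|exact N]. intros ->. apply (AP v Hv), sym, Hvx. }
  (* Neighbours of [c] that are not adjacent to [A] remain available, so unlike [A] the component
     [R] may meet the link of [c]; [T] is then the common frontier of the two. *)
  set (T' := fun v => adj c v /\ exists a, A a /\ adj a v).
  set (Q := fun v => v <> c /\ ~ A v /\ ~ T' v).
  assert (Qw : Q w). { split; [apply Pw | split; [exact NL|]]. intros [K _]. destruct Pw. auto. }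
  set (R := linked_in adj Q w).
  assert (RQ : forall v, R v -> Q v) by (intros v Hv; exact (linked_in_set adj Q w v Hv Qw)).
  set (T := fun v => T' v /\ exists r, R r /\ adj r v).
  assert (AR : forall a r, A a -> R r -> a <> r /\ ~ adj a r).
  { intros a r Ha Hr. destruct (RQ r Hr) as [_ [NA NT]]. split; [congruence|]. intros K.
    destruct (A_nbr a r Ha K) as [|K2]; [contradiction|]. apply NT. split; [exact K2 | eauto]. }
  assert (R_nbr : forall r v, R r -> adj r v -> R v \/ v = c \/ T v).
  { intros r v Hr Hrv. destruct (classic (v = c)) as [|Nc]; [auto|]. destruct (classic (T' v)) as [Tv | NT].
    - right. right. split; [exact Tv | eauto].
    - left. apply (component_closed adj Q w r v Qw Hr Hrv). split; [exact Nc | split; [|exact NT]].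
      intros Av. apply (proj2 (AR v r Av Hr)), sym, Hrv. }
  assert (Sep : ~ connected_in adj (fun v => v <> c /\ ~ T v)).
  { intros C. assert (K : R a0).
    { assert (L : linked_in adj (fun v => v <> c /\ ~ T v) w a0).
      - apply C; [split; [apply Pw | intros [[K _] _]; destruct Pw; auto] | split; [apply Pa | intros [[K _] _]; destruct Pa; auto]].
      - assert (G : forall y, clos_refl_trans_n1 V (fun a b => (a <> c /\ ~ T a) /\ (b <> c /\ ~ T b) /\ adj a b) w y -> R y).
        { induction 1 as [|x y [_ [[Ny NTy] Hxy]] _ IH]; [apply rt_refl|].
          destruct (R_nbr x y IH Hxy) as [|[|]]; [assumption | contradiction | contradiction]. }
        apply G, clos_rt_rtn1, L. }
    destruct (RQ a0 K) as [_ [N _]]. apply N, rt_refl. }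
  assert (Tc : forall t, T t -> adj c t) by (intros t [[H _] _]; exact H).
  (* A vertex [v] adjacent to all of [T] either is a neighbour of [c], and then [T] is empty by
     triangle-freeness, or makes [c] and [T] a virtual factor separator. *)
  assert (Escape : forall v, v <> c -> exists t, T t /\ ~ adj t v).
  { intros v Nv. apply NNPP. intros N.
    assert (All : forall t, T t -> adj v t). { intros t Ht. apply sym. apply NNPP. intros K. apply N. eauto. }
    apply Sep. destruct (classic (adj c v)) as [Acv | NA].
    - apply (connected_in_ext adj (fun x => x <> c)); [|apply (minus_vertex adj insep)].
      intros x. split; [|tauto]. intros Nx. split; [exact Nx|]. intros Tx.
      apply (no_triangle adj sym tri_free c v x); auto.
    - apply (no_virtual_factor_separator adj d act U GS x0 LC c v T); auto. }
  (* With fewer elements, [c] and [T] would be a separating vertex, edge or vertex suspension. *)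
  assert (Three : exists t1 t2 t3, T t1 /\ T t2 /\ T t3 /\ t1 <> t2 /\ t1 <> t3 /\ t2 <> t3).
  { apply NNPP. intros N.
    destruct (classic (exists t, T t)) as [[t1 T1] | N1].
    2: { apply Sep. apply (connected_in_ext adj (fun x => x <> c)); [|apply (minus_vertex adj insep)].
         intros x. split; [|tauto]. intros Nx. split; [exact Nx|]. intros Tx. eauto. }
    destruct (classic (exists t, T t /\ t <> t1)) as [[t2 [T2 N2]] | N1].
    2: { apply Sep. apply (connected_in_ext adj (fun x => ~ (x = c \/ x = t1))); [|apply (minus_edge adj insep), Tc, T1].
         intros x. split.
         - intros K. split; [tauto|]. intros Tx. apply N1. exists x. tauto.
         - intros [K1 K2] [-> | ->]; tauto. }
    apply Sep. apply (connected_in_ext adj (fun x => ~ (x = c \/ x = t1 \/ x = t2))).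
    - intros x. split.
      + intros K. split; [tauto|]. intros Tx. apply N. exists t1, t2, x. split; [exact T1 | split; [exact T2 | split; [exact Tx|]]].
        split; [congruence | split; intros ->; tauto].
      + intros [K1 K2] [-> | [-> | ->]]; tauto.
    - apply NNPP. apply (proj2 (proj2 (proj2 (proj2 insep))) c t1 t2); auto.
      intros K. exact (no_triangle adj sym tri_free c t1 t2 (Tc _ T1) K (Tc _ T2)). }
  destruct Three as [t1 [t2 [t3 [H1 [H2 [H3 [N12 [N13 N23]]]]]]]].
  set (u := fun k => match k with T0 => t1 | T1 => t2 | T2 => t3 end).
  assert (Hu : forall k, T (u k)) by (intros []; assumption).
  destruct (choice (fun k l => NoDup (u k :: l) /\ forall v, In v (u k :: l) <-> T v)) as [l Hl].
  { intros k. apply enumerate_from; [exact (gs_finite _ _ _ _ GS) | apply Hu]. }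
  apply (bad_star_not_planar adj d act U GS x0 LC insep c A R T) with (f := f) (u := u) (l := l); try assumption.
  - apply component_connected, sym.
  - apply component_connected, sym.
  - intros r Hr. apply RQ, Hr.
  - intros t [[_ H] _]. exact H.
  - intros t [_ H]. exact H.
  - intros r Hr [Ht _]. apply (RQ r Hr), Ht.
  - exists w. apply rt_refl.
  - intros [] []; simpl; congruence.
  - intros i E. destruct (Hl i) as [_ K]. rewrite E in K.
    assert (S : forall v, T v -> u i = v) by (intros v Hv; apply K in Hv; destruct Hv as [|[]]; assumption).
    destruct i; simpl in S; [apply N12 | apply N12; symmetry | apply N13; symmetry]; apply S; assumption.
  - intros i. apply Hl.
  - intros i. apply Hl.
Qed.
End StarGraph.

(** * A model of the graph in the sphere *)

Lemma chain_prefix del p l1 l2 : chain del p (l1 ++ l2) -> chain del p l1.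
Proof. revert p; induction l1 as [|a l1 IH]; intros p; [destruct l2; simpl; tauto|]. intros [H [H1 H2]]. split; [exact H | split; [exact H1 | apply IH, H2]]. Qed.
Lemma chain_infix del l1 : forall p l p' l' l2, chain del p l -> p :: l = l1 ++ p' :: l' ++ l2 -> chain del p' l'.
Proof.
  induction l1 as [|a l1 IH]; intros p l p' l' l2 H E; injection E as -> ->; [exact (chain_prefix _ _ _ _ H)|].
  destruct (l1 ++ p' :: l' ++ l2) as [|b l] eqn:E'; [destruct l1; discriminate|].
  apply (IH b l p' l' l2); [apply H | symmetry; exact E'].
Qed.
Lemma chain_snoc del p l q : chain del p l -> dist3 (last l p) q <= del -> on_S2 q -> chain del p (l ++ [q]).
Proof.
  revert p. induction l as [|a l IH]; intros p H D Hq; [simpl in *; tauto|]. rewrite last_cons in D.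
  destruct H as [H1 [H2 H3]]. split; [exact H1 | split; [exact H2 | apply IH; assumption]].
Qed.

(** Scanning the chain, the start is renewed at each visit to [P], and the scan stops at the first
    visit to [Q]; [m] holds the points passed since the current start. *)
Lemma trim {A : Type} (P Q : A -> Prop) (PQ : forall x, P x -> Q x -> False) l : forall p m,
  P p -> (forall x, In x m -> ~ P x /\ ~ Q x) -> Q (last l (last m p)) ->
  exists l1 p' m' q' l2, p :: m ++ l = l1 ++ p' :: (m' ++ [q']) ++ l2 /\ P p' /\ Q q' /\ forall x, In x m' -> ~ P x /\ ~ Q x.
Proof.
  induction l as [|a l IH]; intros p m Hp Hm HQ.
  - exfalso. destruct m as [|b m]; [exact (PQ _ Hp HQ)|]. change (Q (last (b :: m) p)) in HQ. rewrite last_cons in HQ.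
    assert (I : In (last m b) (b :: m)).
    { clear. revert b. induction m as [|c m IH]; intros b; [left; reflexivity|]. rewrite last_cons. right. apply IH. }
    destruct (Hm _ I). contradiction.
  - rewrite last_cons in HQ. destruct (classic (P a)) as [Pa | Na].
    + destruct (IH a [] Pa) as [l1 [p' [m' [q' [l2 [E H]]]]]]; [intros ? [] | exact HQ|].
      exists (p :: m ++ l1), p', m', q', l2. split; [|exact H]. simpl in E. rewrite E. simpl. rewrite <- !app_assoc. reflexivity.
    + destruct (classic (Q a)) as [Qa | NQ].
      * exists [], p, m, a, l. rewrite <- app_assoc. auto.
      * destruct (IH p (m ++ [a]) Hp) as [l1 [p' [m' [q' [l2 [E H]]]]]].
        -- intros x Hx. apply in_app_iff in Hx. destruct Hx as [Hx | [<- | []]]; auto.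
        -- rewrite last_last. exact HQ.
        -- exists l1, p', m', q', l2. split; [|exact H]. rewrite <- E, <- app_assoc. reflexivity.
Qed.

Lemma verts_prefix p w w' v : In v (verts p w) -> In v (verts p (w ++ w')).
Proof.
  revert p; induction w as [|a w IH]; intros p; simpl.
  - intros [<- | []]. destruct w'; left; reflexivity.
  - intros [H | H]; [left; exact H | right; apply IH, H].
Qed.
Lemma walk_end_in p w : In (walk_end p w) (verts p w).
Proof. revert p; induction w as [|a w IH]; intros p; [left; reflexivity | right; apply IH]. Qed.
Lemma verts_head p w : In p (verts p w).
Proof. destruct w; left; reflexivity. Qed.
Lemma first_hit (Q : Z * Z -> Prop) w : forall p, ~ Q p -> Q (walk_end p w) ->
  exists w1 a w2, w = w1 ++ a :: w2 /\ (forall v, In v (verts p w1) -> ~ Q v) /\ Q (move (walk_end p w1) a).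
Proof.
  induction w as [|a w IH]; intros p N H; [contradiction|].
  destruct (classic (Q (move p a))) as [K | K].
  - exists [], a, w. split; [reflexivity | split; [|exact K]]. intros v [<- | []]. exact N.
  - destruct (IH (move p a) K H) as [w1 [b [w2 [-> [H1 H2]]]]]. exists (a :: w1), b, w2.
    split; [reflexivity | split; [|exact H2]]. intros v [<- | Hv]; auto.
Qed.
Definition opp (a : dir) : dir := match a with Rt => Lt | Lt => Rt | Up => Dn | Dn => Up end.
Lemma move_opp p a : move (move p a) (opp a) = p.
Proof. destruct p as [x y], a; simpl; f_equal; lia. Qed.

Lemma finite_index {V : Type} : finite_type V -> exists idx : V -> nat, forall u v, idx u = idx v -> u = v.
Proof.
  intros [l Hl]. destruct (choice (fun v n => nth_error l n = Some v)) as [idx H].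
  - intros v. apply In_nth_error, Hl.
  - exists idx. intros u v E. pose proof (H u) as Hu. rewrite E, H in Hu. congruence.
Qed.

Section Model.
Context {X : Type} (d : X -> X -> R).
Hypothesis d_metric : is_metric d.
Hypothesis d_proper : proper_metric d.
Variable U : (nat -> Prop) -> Prop.
Hypothesis HU : ultra U.
Variable x0 : X.
Local Notation bd := (boundary d x0).
Variable f : bd -> pt3.
Hypothesis f_S2 : forall x, on_S2 (f x).
Hypothesis f_inj : forall x y, f x = f y -> x = y.
Hypothesis f_cont : forall W, open3 W -> cone_open d x0 (fun x => W (f x)).
Local Notation reach := (reach d x0 f).
Local Notation rclosed := (rclosed d U x0).

Lemma uniform_separation {I : Type} (l : list I) (cond : I -> Prop) (K K' : I -> bd -> Prop) :
  (forall i, cond i -> rclosed (K i) /\ rclosed (K' i) /\ forall x, K i x -> K' i x -> False) ->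
  exists eta, 0 < eta /\ forall i, In i l -> cond i -> forall x y, K i x -> K' i y -> eta <= dist3 (f x) (f y).
Proof.
  intros H. apply (common_positive l (fun i eta => cond i -> forall x y, K i x -> K' i y -> eta <= dist3 (f x) (f y))).
  - intros i. destruct (classic (cond i)) as [C | C].
    + destruct (H i C) as [H1 [H2 H3]]. destruct (separation d d_metric d_proper U HU x0 f f_inj f_cont _ _ H1 H2 H3) as [eta [He Hs]].
      exists eta. auto.
    + exists 1. split; [lra | contradiction].
  - intros i a b Hab Hi C x y Hx Hy. specialize (Hi C x y Hx Hy). lra.
Qed.

Context {V : Type} (adj : V -> V -> Prop).
Hypothesis V_finite : finite_type V.
Hypothesis adj_irr : forall v, ~ adj v v.
Hypothesis adj_sym : forall u v, adj u v -> adj v u.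
Variables (C : V -> bd -> Prop) (E : V -> V -> bd -> Prop).
Hypothesis C_closed : forall s, rclosed (C s).
Hypothesis E_closed : forall s t, rclosed (E s t).
Hypothesis C_reach : forall s del p q, 0 < del -> C s p -> C s q -> reach (C s) del p q.
Hypothesis E_reach : forall s t del p q, adj s t -> 0 < del -> E s t p -> E s t q -> reach (E s t) del p q.
Hypothesis E_sym : forall s t x, E s t x -> E t s x.
Hypothesis C_ne : forall s, exists p, C s p.
Hypothesis CC : forall s t x, C s x -> C t x -> s = t.
Hypothesis EC : forall s t u x, adj s t -> E s t x -> C u x -> u = s \/ u = t.
Hypothesis EE : forall s t s' t' x, adj s t -> adj s' t' -> E s t x -> E s' t' x -> s = s' \/ s = t' \/ t = s' \/ t = t'.
Hypothesis EEC : forall s t t' x, adj s t -> adj s t' -> t <> t' -> E s t x -> E s t' x -> C s x.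
Hypothesis touch : forall s t, adj s t -> exists x, C s x /\ E s t x.

(* The sets [E s t] may meet each other next to [C s], so that only their parts outside a neighbourhood of the
   sets [C s] serve as edges. *)
Definition close (rho : R) (s : V) (z : pt3) : Prop := exists y, C s y /\ dist3 z (f y) < rho.

(** The trimmed piece of a chain in [E s t]. Each of its ends is within [del] of a point that is not
    close to the same vertex set, hence at distance at least [rho - del >= rho / 2] from that
    set. *)
Lemma edge_chain rho del s t : 0 < rho -> 0 < del <= rho / 2 -> adj s t ->
  (forall a b, C s a -> C t b -> 10 * rho <= dist3 (f a) (f b)) ->
  exists p l, chain del (f p) (map f l) /\ close rho s (f p) /\ close rho t (f (last l p)) /\
    forall x, In x (p :: l) -> E s t x /\ (forall y, C s y -> rho / 2 <= dist3 (f x) (f y)) /\ (forall y, C t y -> rho / 2 <= dist3 (f x) (f y)).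
Proof.
  intros Hr Hd A Far. destruct (touch s t A) as [p [Cp Ep]]. destruct (touch t s (adj_sym _ _ A)) as [q [Cq Eq]].
  destruct (reach_chain d x0 f f_S2 (E s t) del p q) as [l [H1 [H2 H3]]]; [apply E_reach; auto; lra | assumption|].
  assert (Dis : forall x, close rho s (f x) -> close rho t (f x) -> False).
  { intros x [y [Cy Dy]] [y' [Cy' Dy']]. specialize (Far y y' Cy Cy').
    pose proof (dist3_triangle (f y) (f x) (f y')). rewrite (dist3_sym (f y) (f x)) in *. lra. }
  destruct (trim (fun x => close rho s (f x)) (fun x => close rho t (f x)) Dis l p []) as [l1 [p' [m [q' [l2 [Eq1 [Pp [Qq Hm]]]]]]]].
  - exists p. rewrite dist3_refl. auto.
  - intros ? [].
  - simpl. rewrite H2. exists q. rewrite dist3_refl. auto.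
  - simpl in Eq1. exists p', (m ++ [q']). split; [|split; [exact Pp | split; [rewrite last_last; exact Qq|]]].
    + apply (chain_infix del (map f l1) (f p) (map f l) (f p') (map f (m ++ [q'])) (map f l2) H1).
      change (f p :: map f l) with (map f (p :: l)). rewrite Eq1, !map_app. simpl. rewrite !map_app. reflexivity.
    + assert (HC : chain del (f p') (map f (m ++ [q']))).
      { apply (chain_infix del (map f l1) (f p) (map f l) (f p') (map f (m ++ [q'])) (map f l2) H1).
        change (f p :: map f l) with (map f (p :: l)). rewrite Eq1, !map_app. simpl. rewrite !map_app. reflexivity. }
      assert (NC : forall v x, ~ close rho v (f x) -> forall y, C v y -> rho <= dist3 (f x) (f y)).
      { intros v x N y Cy. apply Rnot_lt_le. intros L. apply N. exists y. auto. }
      assert (Step : forall x y, dist3 (f x) (f y) <= del -> forall v, ~ close rho v (f y) -> forall z, C v z -> rho / 2 <= dist3 (f x) (f z)).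
      { intros x y Hxy v N z Cz. pose proof (NC v y N z Cz). pose proof (dist3_triangle (f y) (f x) (f z)).
        rewrite (dist3_sym (f y) (f x)) in *. lra. }
      assert (Ps : forall y, C s y -> rho / 2 <= dist3 (f p') (f y)).
      { destruct m as [|b m]; simpl in HC.
        - apply (Step p' q'); [apply HC|]. intros K. exact (Dis _ K Qq).
        - apply (Step p' b); [apply HC|]. apply Hm. left; reflexivity. }
      assert (Qt : forall y, C t y -> rho / 2 <= dist3 (f q') (f y)).
      { assert (K : dist3 (f (last m p')) (f q') <= del).
        { clear - HC. revert p' HC. induction m as [|b m IH]; intros p' HC; [apply HC|]. rewrite last_cons. apply IH, HC. }
        apply (Step q' (last m p')); [rewrite dist3_sym; exact K|]. destruct (exists_last (l := p' :: m)) as [m' [b Em]]; [discriminate|].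
        assert (Eb : last m p' = b) by (rewrite <- (last_cons _ m p' p'), Em; apply last_last). rewrite Eb.
        assert (Ib : In b (p' :: m)) by (rewrite Em; apply in_app_iff; right; left; reflexivity).
        destruct Ib as [<- | Ib]; [intros K2; exact (Dis _ Pp K2) | apply Hm, Ib]. }
      intros x Hx. split; [apply H3; rewrite Eq1; apply in_app_iff; right; simpl in *; rewrite !in_app_iff in *; tauto|].
      destruct Hx as [<- | Hx].
      * split; [exact Ps|]. intros y Cy. pose proof (NC t p' (fun K => Dis _ Pp K) y Cy). lra.
      * apply in_app_iff in Hx. destruct Hx as [Hx | [<- | []]].
        -- destruct (Hm x Hx) as [N1 N2]. split; intros y Cy; [pose proof (NC s x N1 y Cy) | pose proof (NC t x N2 y Cy)]; lra.
        -- split; [|exact Qt]. intros y Cy. pose proof (NC s q' (fun K => Dis _ K Qq) y Cy). lra.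
Qed.

Lemma close_far rho s t x z : close rho s x -> (forall a b, C s a -> C t b -> 10 * rho <= dist3 (f a) (f b)) ->
  close rho t z -> 8 * rho <= dist3 x z.
Proof.
  intros [a [Ca Da]] Far [b [Cb Db]]. specialize (Far a b Ca Cb).
  pose proof (dist3_triangle (f a) x (f b)). pose proof (dist3_triangle x z (f b)). rewrite (dist3_sym (f a) x) in *. lra.
Qed.

(** The region of [s] consists of walks near [C s] to all edge ends, together with the walk of each
    edge to a vertex [t] of larger index, cut just before it first enters the walks near [C t]. *)
Theorem sphere_model_planar : planar_graph adj.
Proof.
  destruct V_finite as [lV HlV]. destruct (finite_index V_finite) as [idx idx_inj].
  assert (P2 : forall p : V * V, In p (list_prod lV lV)) by (intros [a b]; apply in_prod; apply HlV).
  assert (P3 : forall p : V * V * V, In p (list_prod (list_prod lV lV) lV)) by (intros [a b]; apply in_prod; [apply P2 | apply HlV]).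
  assert (P4 : forall p : V * V * (V * V), In p (list_prod (list_prod lV lV) (list_prod lV lV))) by (intros [a b]; apply in_prod; apply P2).
  destruct (uniform_separation (list_prod lV lV) (fun p => fst p <> snd p) (fun p => C (fst p)) (fun p => C (snd p))) as [r1 [Hr1 S1]].
  { intros [s t] N. simpl in *. split; [auto | split; [auto|]]. intros x H H'. exact (N (CC s t x H H')). }
  destruct (uniform_separation (list_prod (list_prod lV lV) lV) (fun p => adj (fst (fst p)) (snd (fst p)) /\ snd p <> fst (fst p) /\ snd p <> snd (fst p))
    (fun p => E (fst (fst p)) (snd (fst p))) (fun p => C (snd p))) as [r2 [Hr2 S2]].
  { intros [[s t] u] [A [N N']]. simpl in *. split; [auto | split; [auto|]]. intros x H H'. destruct (EC s t u x A H H'); contradiction. }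
  destruct (uniform_separation (list_prod (list_prod lV lV) (list_prod lV lV)) (fun p => adj (fst (fst p)) (snd (fst p)) /\ adj (fst (snd p)) (snd (snd p)) /\
      fst (fst p) <> fst (snd p) /\ fst (fst p) <> snd (snd p) /\ snd (fst p) <> fst (snd p) /\ snd (fst p) <> snd (snd p))
    (fun p => E (fst (fst p)) (snd (fst p))) (fun p => E (fst (snd p)) (snd (snd p)))) as [r3 [Hr3 S3]].
  { intros [[s t] [s' t']] [A [A' N]]. simpl in *. split; [auto | split; [auto|]]. intros x H H'. pose proof (EE s t s' t' x A A' H H'). tauto. }
  (* Points within [rho] of sets that are [10 * rho] apart keep the distance [8 * rho] required for
     two chains of step [rho]. *)
  assert (Hrho : exists rho, 0 < rho <= 1/10 /\ 10 * rho <= r1 /\ 10 * rho <= r2 /\ 10 * rho <= r3).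
  { exists (Rmin (1/10) (Rmin r1 (Rmin r2 r3) / 10)). pose proof (Rmin_l (1/10) (Rmin r1 (Rmin r2 r3) / 10)).
    pose proof (Rmin_r (1/10) (Rmin r1 (Rmin r2 r3) / 10)). pose proof (Rmin_l r1 (Rmin r2 r3)). pose proof (Rmin_r r1 (Rmin r2 r3)).
    pose proof (Rmin_l r2 r3). pose proof (Rmin_r r2 r3).
    assert (0 < Rmin r1 (Rmin r2 r3)) by (repeat apply Rmin_glb_lt; assumption).
    split; [split; [apply Rmin_glb_lt; lra | lra] | lra]. }
  destruct Hrho as [rho [[Hrho Hrho1] [Q1 [Q2 Q3]]]].
  assert (FC : forall s t, s <> t -> forall a b, C s a -> C t b -> 10 * rho <= dist3 (f a) (f b)).
  { intros s t N a b Ca Cb. pose proof (S1 (s, t) (P2 _) N a b Ca Cb). lra. }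
  destruct (uniform_separation (list_prod (list_prod lV lV) lV) (fun p => adj (fst (fst p)) (snd (fst p)) /\ adj (fst (fst p)) (snd p) /\ snd (fst p) <> snd p)
    (fun p x => E (fst (fst p)) (snd (fst p)) x /\ forall y, C (fst (fst p)) y -> rho / 2 <= dist3 (f x) (f y))
    (fun p x => E (fst (fst p)) (snd p) x /\ forall y, C (fst (fst p)) y -> rho / 2 <= dist3 (f x) (f y))) as [eta [Heta S4]].
  { intros [[s t] t'] [A [A' N]]. simpl in *. split; [apply (rclosed_away d d_metric U HU x0 f f_cont), E_closed|].
    split; [apply (rclosed_away d d_metric U HU x0 f f_cont), E_closed|]. intros x [H1 H2] [H3 _].
    specialize (H2 x (EEC s t t' x A A' N H1 H3)). rewrite dist3_refl in H2. lra. }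
  assert (Hdel : exists del, 0 < del /\ del <= rho / 2 /\ 8 * del <= eta).
  { exists (Rmin (rho / 2) (eta / 8)). pose proof (Rmin_l (rho / 2) (eta / 8)). pose proof (Rmin_r (rho / 2) (eta / 8)).
    split; [apply Rmin_glb_lt; lra | lra]. }
  destruct Hdel as [del [Hdel [D1 D2]]].
  destruct (choice _ C_ne) as [o Ho].
  pose (ordered := fun p : V * V => adj (fst p) (snd p) /\ (idx (fst p) < idx (snd p))%nat).
  destruct (choice (fun (p : V * V) (c : bd * list bd) => ordered p -> chain del (f (fst c)) (map f (snd c)) /\
     close rho (fst p) (f (fst c)) /\ close rho (snd p) (f (last (snd c) (fst c))) /\
     forall x, In x (fst c :: snd c) -> E (fst p) (snd p) x /\ (forall y, C (fst p) y -> rho / 2 <= dist3 (f x) (f y)) /\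
       (forall y, C (snd p) y -> rho / 2 <= dist3 (f x) (f y)))) as [ec Hec].
  { intros [s t]. destruct (classic (ordered (s, t))) as [Or | N]; [|exists (o s, []); intros K; contradiction].
    destruct Or as [A L]. simpl in *. destruct (edge_chain rho del s t) as [p [l H]]; try assumption; [lra | apply FC; intros ->; lia|].
    exists (p, l). intros _. exact H. }
  (* One chain serves both orientations of an edge: its first point belongs to the vertex of smaller
     index and its last point to the other. *)
  pose (ep := fun s t : V => if excluded_middle_informative (ordered (s, t)) then fst (ec (s, t)) else last (snd (ec (t, s))) (fst (ec (t, s)))).
  assert (Hep : forall s t, adj s t -> close rho s (f (ep s t))).
  { intros s t A. unfold ep. destruct (excluded_middle_informative (ordered (s, t))) as [Or | N]; [apply (Hec (s, t) Or)|].
    assert (Or : ordered (t, s)).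
    { split; [apply adj_sym, A|]. simpl. destruct (Nat.lt_trichotomy (idx s) (idx t)) as [L | [L | L]]; [|apply idx_inj in L; subst; destruct (adj_irr _ A) | exact L].
      destruct N. split; assumption. }
    apply (Hec (t, s) Or). }
  destruct (choice (fun (p : V * V) (l : list pt3) => chain rho (f (o (fst p))) l /\ (forall z, In z (f (o (fst p)) :: l) -> close rho (fst p) z) /\
     (adj (fst p) (snd p) -> last l (f (o (fst p))) = f (ep (fst p) (snd p))))) as [rc Hrc].
  { intros [s t]. simpl. assert (Co : close rho s (f (o s))) by (exists (o s); rewrite dist3_refl; auto).
    destruct (classic (adj s t)) as [A | N].
    - destruct (Hep s t A) as [y [Cy Dy]].
      destruct (reach_chain d x0 f f_S2 (C s) rho (o s) y) as [l [H1 [H2 H3]]]; [apply C_reach; auto | apply Ho|].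
      exists (map f l ++ [f (ep s t)]). split; [|split].
      + apply chain_snoc; [exact H1 | | apply f_S2]. rewrite last_map, H2, dist3_sym. lra.
      + intros z [<- | Hz]; [exact Co|]. apply in_app_iff in Hz. destruct Hz as [Hz | [<- | []]].
        * apply in_map_iff in Hz. destruct Hz as [x [<- Hx]]. exists x. rewrite dist3_refl.
          split; [apply H3; right; exact Hx | assumption].
        * exists y. auto.
      + intros _. apply last_last.
    - exists []. split; [split; [apply f_S2 | exact I]|]. split; [intros z [<- | []]; exact Co | contradiction]. }
  pose (hd := fun i : V * V + V * V => match i with inl p => f (o (fst p)) | inr p => if excluded_middle_informative (ordered p) then f (fst (ec p)) else f (o (fst p)) end).
  pose (tl := fun i : V * V + V * V => match i with inl p => rc p | inr p => if excluded_middle_informative (ordered p) then map f (snd (ec p)) else [] end).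
  pose (dl := fun i : V * V + V * V => match i with inl p => rho | inr p => del end).
  destruct (sphere_chains_to_grid (V * V + V * V) (map inl (list_prod lV lV) ++ map inr (list_prod lV lV)) hd tl dl) as [phi [w [W1 W2]]].
  { intros [p | p]; apply in_app_iff; [left | right]; apply in_map, P2. }
  { intros [p | p]; simpl; lra. }
  { intros [p | p]; simpl; [apply Hrc|]. destruct (excluded_middle_informative (ordered p)) as [Or | N]; [apply (Hec p Or) | split; [apply f_S2 | exact I]]. }
  pose (root := fun s => phi (f (o s))).
  pose (region0 := fun s b => exists t, In b (verts (root s) (w (inl (s, t))))).
  assert (R0root : forall s, region0 s (root s)) by (intros s; exists s; apply verts_head).
  assert (R0end : forall s t, adj s t -> region0 s (phi (f (ep s t)))).
  { intros s t A. exists t. pose proof (W1 (inl (s, t))) as K. simpl in K. destruct (Hrc (s, t)) as [_ [_ L]]. simpl in L.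
    rewrite (L A) in K. rewrite <- K. apply walk_end_in. }
  assert (R0dis : forall s t b, s <> t -> region0 s b -> region0 t b -> False).
  { intros s t b N [s' Hs] [t' Ht]. apply (W2 (inl (s, s')) (inl (t, t'))) with b; [|exact Hs | exact Ht].
    simpl. intros p q Hp Hq. replace (4 * (rho + rho)) with (8 * rho) by ring.
    destruct (Hrc (s, s')) as [_ [Cs _]]. destruct (Hrc (t, t')) as [_ [Ct _]].
    apply (close_far rho s t); [apply Cs, Hp | apply FC, N | apply Ct, Hq]. }
  pose (ew := fun s t => verts (phi (f (ep s t))) (w (inr (s, t)))).
  assert (Ehd : forall s t, ordered (s, t) -> hd (inr (s, t)) = f (ep s t) /\ tl (inr (s, t)) = map f (snd (ec (s, t))) /\ fst (ec (s, t)) = ep s t).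
  { intros s t Or. unfold hd, tl, ep. destruct (excluded_middle_informative (ordered (s, t))); [auto | contradiction]. }
  assert (Epts : forall s t z, ordered (s, t) -> In z (hd (inr (s, t)) :: tl (inr (s, t))) -> exists x, z = f x /\ E s t x /\
     (forall y, C s y -> rho / 2 <= dist3 (f x) (f y)) /\ (forall y, C t y -> rho / 2 <= dist3 (f x) (f y))).
  { intros s t z Or Hz. destruct (Ehd s t Or) as [E1 [E2 E3]]. rewrite E1, E2, <- E3 in Hz.
    change (f (fst (ec (s, t))) :: map f (snd (ec (s, t)))) with (map f (fst (ec (s, t)) :: snd (ec (s, t)))) in Hz.
    apply in_map_iff in Hz. destruct Hz as [x [<- Hx]]. exists x. split; [reflexivity|]. apply (Hec (s, t) Or), Hx. }
  assert (ER0 : forall s t u b, ordered (s, t) -> u <> s -> u <> t -> In b (ew s t) -> region0 u b -> False).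
  { intros s t u b Or N N' Hb [v Hv]. unfold ew in Hb. destruct (Ehd s t Or) as [E1 _]. rewrite <- E1 in Hb.
    apply (W2 (inr (s, t)) (inl (u, v))) with b; [|exact Hb | exact Hv].
    intros p q Hp Hq. destruct (Epts s t p Or Hp) as [x [-> [Ex _]]]. destruct (Hrc (u, v)) as [_ [Cu _]]. destruct (Cu q Hq) as [y [Cy Dy]]. simpl in Cy.
    pose proof (S2 ((s, t), u) (P3 _) (conj (proj1 Or) (conj N N')) x y Ex Cy).
    pose proof (dist3_triangle (f x) q (f y)). simpl. lra. }
  assert (EE0 : forall s t s' t' b, ordered (s, t) -> ordered (s', t') -> (s, t) <> (s', t') -> In b (ew s t) -> In b (ew s' t') -> False).
  { intros s t s' t' b Or Or' N Hb Hb'. unfold ew in *. destruct (Ehd s t Or) as [E1 _]. destruct (Ehd s' t' Or') as [E2 _]. rewrite <- E1 in Hb. rewrite <- E2 in Hb'.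
    apply (W2 (inr (s, t)) (inr (s', t'))) with b; [|exact Hb | exact Hb'].
    intros p q Hp Hq. destruct (Epts s t p Or Hp) as [x [-> [Ex [Xs Xt]]]]. destruct (Epts s' t' q Or' Hq) as [y [-> [Ey [Ys Yt]]]].
    simpl. replace (4 * (del + del)) with (8 * del) by ring.
    destruct Or as [A L], Or' as [A' L']. simpl in A, L, A', L'.
    assert (Sh : forall v a b', adj v a -> adj v b' -> a <> b' -> E v a x -> E v b' y -> (forall z, C v z -> rho / 2 <= dist3 (f x) (f z)) ->
       (forall z, C v z -> rho / 2 <= dist3 (f y) (f z)) -> 8 * del <= dist3 (f x) (f y)).
    { intros v a b' Aa Ab Nab Ea Eb Xv Yv. pose proof (S4 ((v, a), b') (P3 _) (conj Aa (conj Ab Nab)) x y (conj Ea Xv) (conj Eb Yv)). lra. }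
    destruct (classic (s = s')) as [<- | N1]; [apply (Sh s t t'); auto; congruence|].
    destruct (classic (t = t')) as [<- | N2]; [apply (Sh t s s'); auto|].
    destruct (classic (s = t')) as [<- | N3]; [apply (Sh s t s'); auto; intros <-; lia|].
    destruct (classic (t = s')) as [<- | N4]; [apply (Sh t s t'); auto|].
    pose proof (S3 ((s, t), (s', t')) (P4 _) (conj A (conj A' (conj N1 (conj N3 (conj N4 N2))))) x y Ex Ey). lra. }
  destruct (choice (fun (p : V * V) (c : list dir * dir) => ordered p ->
     (exists w2, w (inr p) = fst c ++ snd c :: w2) /\ (forall v, In v (verts (phi (f (ep (fst p) (snd p)))) (fst c)) -> ~ region0 (snd p) v) /\
     region0 (snd p) (move (walk_end (phi (f (ep (fst p) (snd p)))) (fst c)) (snd c)))) as [fh Hfh].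
  { intros [s t]. simpl. destruct (classic (ordered (s, t))) as [Or | N]; [|exists ([], Up); intros K; contradiction].
    destruct (first_hit (region0 t) (w (inr (s, t))) (phi (f (ep s t)))) as [w1 [a [w2 [K1 [K2 K3]]]]].
    - intros K. apply (R0dis s t (phi (f (ep s t)))); [|apply R0end, Or | exact K]. intros ->. exact (adj_irr _ (proj1 Or)).
    - pose proof (W1 (inr (s, t))) as K. destruct (Ehd s t Or) as [E1 [E2 E3]]. rewrite E1, E2, <- E3, last_map in K. rewrite <- E3, K.
      assert (Et : ep t s = last (snd (ec (s, t))) (fst (ec (s, t)))).
      { unfold ep. destruct (excluded_middle_informative (ordered (t, s))) as [[_ L] | _]; [|reflexivity].
        destruct Or as [_ L']. simpl in *. lia. }
      rewrite <- Et. apply R0end, adj_sym, Or.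
    - exists (w1, a). intros _. split; [exists w2; exact K1 | split; assumption]. }
  pose (wk := fun s t => if excluded_middle_informative (ordered (s, t)) then w (inl (s, t)) ++ fst (fh (s, t)) else w (inl (s, t))).
  assert (Wend : forall s t, adj s t -> walk_end (root s) (w (inl (s, t))) = phi (f (ep s t))).
  { intros s t A. pose proof (W1 (inl (s, t))) as K. simpl in K. destruct (Hrc (s, t)) as [_ [_ L]]. simpl in L. rewrite (L A) in K. exact K. }
  assert (Reg : forall s b, region V root (fun s => map (wk s) lV) s b ->
    region0 s b \/ exists t, ordered (s, t) /\ In b (ew s t) /\ ~ region0 t b).
  { intros s b [-> | [w' [Hw Hb]]]; [left; apply R0root|]. apply in_map_iff in Hw. destruct Hw as [t [<- _]]. unfold wk in Hb.
    destruct (excluded_middle_informative (ordered (s, t))) as [Or | N]; [|left; exists t; exact Hb].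
    apply verts_app in Hb. destruct Hb as [Hb | Hb]; [left; exists t; exact Hb | right].
    rewrite (Wend s t (proj1 Or)) in Hb. destruct (Hfh (s, t) Or) as [[w2 K1] [K2 K3]]. exists t. split; [exact Or|]. split; [|apply K2, Hb].
    unfold ew. rewrite K1. apply verts_prefix, Hb. }
  assert (Reg0 : forall s b, region0 s b -> region V root (fun s => map (wk s) lV) s b).
  { intros s b [t Hb]. right. exists (wk s t). split; [apply in_map, HlV|]. unfold wk.
    destruct (excluded_middle_informative (ordered (s, t))); [apply verts_prefix|]; exact Hb. }
  apply (grid_minor_planar V adj adj_irr root (fun s => map (wk s) lV) lV HlV).
  - intros s t b Hs Ht. apply NNPP. intros N.
    destruct (Reg s b Hs) as [K | [s' [Or [K K0]]]], (Reg t b Ht) as [K' | [t' [Or' [K' K0']]]].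
    + exact (R0dis s t b N K K').
    + destruct (classic (s = t')) as [<- | N']; [contradiction|]. exact (ER0 t t' s b Or' N N' K' K).
    + destruct (classic (t = s')) as [<- | N']; [contradiction|]. exact (ER0 s s' t b Or (not_eq_sym N) N' K K').
    + apply (EE0 s s' t t' b Or Or'); [congruence | exact K | exact K'].
  - assert (Con : forall s t, ordered (s, t) -> exists a dr, region V root (fun s => map (wk s) lV) s a /\ region V root (fun s => map (wk s) lV) t (move a dr)).
    { intros s t Or. destruct (Hfh (s, t) Or) as [_ [_ K3]]. simpl in K3.
      exists (walk_end (phi (f (ep s t))) (fst (fh (s, t)))), (snd (fh (s, t))). split; [|apply Reg0, K3].
      right. exists (wk s t). split; [apply in_map, HlV|]. unfold wk. destruct (excluded_middle_informative (ordered (s, t))) as [Or' | N]; [|contradiction].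
      rewrite <- (Wend s t (proj1 Or)), <- walk_end_app. apply walk_end_in. }
    intros s t A. destruct (Nat.lt_trichotomy (idx s) (idx t)) as [L | [L | L]].
    + apply Con. split; assumption.
    + apply idx_inj in L. subst. destruct (adj_irr _ A).
    + destruct (Con t s (conj (adj_sym _ _ A) L)) as [a [dr [K1 K2]]]. exists (move a dr), (opp dr). rewrite move_opp. auto.
Qed.
End Model.

(** * Small graphs, and the limit sets as a model of the graph *)

Lemma two_vertices_planar {V : Type} (adj : V -> V -> Prop) (s t : V) :
  (forall v, ~ adj v v) -> (forall v : V, v = s \/ v = t) -> planar_graph adj.
Proof.
  intros irr H. pose (root := fun v : V => if excluded_middle_informative (v = s) then (0, 0)%Z else (1, 0)%Z).
  assert (Rg : forall v b, region V root (fun _ => []) v b -> b = root v) by (intros v b [E | [w [[] _]]]; exact E).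
  apply (grid_minor_planar V adj irr root (fun _ => []) [s; t]).
  - intros v. destruct (H v) as [-> | ->]; simpl; auto.
  - intros u v b Hu Hv. apply Rg in Hu, Hv. rewrite Hu in Hv. unfold root in Hv. destruct (H u), (H v);
    destruct (excluded_middle_informative (u = s)), (excluded_middle_informative (v = s)); congruence.
  - intros u v A. assert (N : u <> v) by (intros ->; exact (irr _ A)).
    exists (root u), (if excluded_middle_informative (u = s) then Rt else Lt). split; [left; reflexivity | left].
    unfold root. destruct (excluded_middle_informative (u = s)), (excluded_middle_informative (v = s)); try reflexivity; [congruence|].
    destruct (H u), (H v); congruence.
Qed.

Lemma linked_first_step {V : Type} (adj : V -> V -> Prop) P u v : linked_in adj P u v -> u <> v -> exists w, P w /\ adj u w.
Proof.
  intros L N. apply clos_rt_rt1n in L. destruct L as [|w v [_ [Pw A]] _]; [congruence | eauto].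
Qed.

Theorem mainTheorem2 (V : Type) (adj : V -> V -> Prop)
    (X : Type) (d : X -> X -> R) (act : V -> X -> X) (x0 : X) :
  finite_simplicial_graph adj -> triangle_free adj -> inseparable adj ->
  proper_CAT0 d -> geometric_racg_action adj d act ->
  ~ planar_graph adj ->
  locally_connected (cone_open d x0) ->
  (forall p : boundary d x0, ~ local_cut_point (cone_open d x0) p) ->
  ~ planar_space (cone_open d x0).
Proof.
  intros [fin [sym irr]] tri_free insep [met [prop [geods cat0]]] [iso [disc coc]] NP LC _ [f [f_S2 [f_inj [f_cont _]]]].
  destruct ultra_exists as [U HU].
  assert (GS : geometric_setting adj d act U) by (constructor; assumption).
  (* With a third vertex, absence of separating vertices lets every edge be continued at its end;
     [touch] needs this, so smaller graphs are drawn directly. *)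
  apply NP. destruct (classic (exists s t, forall v : V, v = s \/ v = t)) as [[s [t H]] | Big].
  { exact (two_vertices_planar adj s t irr H). }
  assert (third : forall s t : V, exists v, v <> s /\ v <> t).
  { intros s t. apply NNPP. intros N. apply Big. exists s, t. intros v. apply NNPP. intros K. apply N. exists v. tauto. }
  assert (two_nbrs : forall s t, adj s t -> exists a, a <> s /\ adj t a).
  { intros s t A. destruct (third s t) as [v [N1 N2]].
    apply (linked_first_step adj (fun x => x <> s) t v); [|congruence].
    apply (minus_vertex adj insep s); [intros ->; exact (irr _ A) | exact N1]. }
  assert (nbr : forall s, exists t, adj s t).
  { intros s. destruct (third s s) as [v [N _]].
    destruct (linked_first_step adj (fun _ => True) s v) as [t [_ A]]; [apply insep; exact I | congruence | eauto]. }
  pose (C := fun s => limit adj d act x0 (fun x => forall u, desc adj u x = true <-> u = s)).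
  pose (E := fun s t => limit adj d act x0 (fun x => desc adj s x = true /\ desc adj t x = true)).
  assert (touch : forall s t, adj s t -> exists xi, C s xi /\ E s t xi).
  { intros s t A. destruct (two_nbrs s t A) as [a [N B]].
    destruct (vertex_edge_limit adj d act U GS x0 (one adj) s t a A B N) as [xi [L1 L2]]. exists xi.
    split; [refine (limit_mono _ _ _ _ _ _ _ _ L1) | refine (limit_mono _ _ _ _ _ _ _ _ L2)]; intros x; rewrite inv1, mul1g; auto. }
  (* All incidences are read off from the letter [w] that [halfspace_at] provides at the base point
     [one]. *)
  assert (CW : forall s xi w, C s xi -> eventually_at adj d act x0 xi (fun x => desc adj w (mul adj (inv adj (one adj)) x) = true) -> w = s).
  { intros s xi w L Ew. destruct (limit_meets _ _ _ _ GS _ _ _ _ L Ew) as [x [H1 H2]]. rewrite inv1, mul1g in H2. apply H1, H2. }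
  assert (EW : forall s t xi w, adj s t -> E s t xi -> eventually_at adj d act x0 xi (fun x => desc adj w (mul adj (inv adj (one adj)) x) = true) -> w = s \/ w = t).
  { intros s t xi w A L Ew. destruct (limit_meets _ _ _ _ GS _ _ _ _ L Ew) as [x [[H1 H2] H3]]. rewrite inv1, mul1g in H3.
    destruct (desc_adj adj sym w s x H3 H1) as [|B1]; [auto|]. destruct (desc_adj adj sym w t x H3 H2) as [|B2]; [auto|].
    destruct (no_triangle adj sym tri_free w s t B1 A B2). }
  apply (sphere_model_planar d met prop U HU x0 f f_S2 f_inj f_cont adj fin irr sym C E).
  - intros s xs xi H Hr. exact (limit_rlim _ _ _ _ GS _ _ _ _ H Hr).
  - intros s t xs xi H Hr. exact (limit_rlim _ _ _ _ GS _ _ _ _ H Hr).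
  - intros s del p q Hd Hp Hq. apply connected_reach; try assumption.
    apply (limit_vertex_connected adj d act U GS x0 LC insep).
    apply (star_complement_connected adj d act U GS x0 LC insep two_nbrs f f_S2 f_inj f_cont).
  - intros s t del p q A Hd Hp Hq. apply connected_reach; try assumption.
    apply (limit_edge_connected adj d act U GS x0 insep s t A).
  - intros s t x. apply limit_mono. tauto.
  - intros s. destruct (nbr s) as [t A]. destruct (touch s t A) as [p [H _]]. eauto.
  - intros s t x Hs Ht. destruct (halfspace_at _ _ _ _ GS x0 (one adj) x) as [w Hw].
    rewrite <- (CW s x w Hs Hw). exact (CW t x w Ht Hw).
  - intros s t u x A He Hu. destruct (halfspace_at _ _ _ _ GS x0 (one adj) x) as [w Hw].
    rewrite <- (CW u x w Hu Hw). exact (EW s t x w A He Hw).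
  - intros s t s' t' x A A' H H'. destruct (halfspace_at _ _ _ _ GS x0 (one adj) x) as [w Hw].
    destruct (EW s t x w A H Hw) as [-> | ->], (EW s' t' x _ A' H' Hw) as [-> | ->]; auto.
  - intros s t t' x A A' N H H'. destruct (halfspace_at _ _ _ _ GS x0 (one adj) x) as [w Hw].
    assert (w = s) as ->.
    { destruct (EW s t x w A H Hw) as [-> | ->]; [reflexivity|]. destruct (EW s t' x t A' H' Hw) as [E1 | E1]; congruence. }
    (* The letter [t] is a descent along [E s t] but not along [E s t'], so [x] lies on the wall of
       [t]. Next to this wall every descent is adjacent to [t]; as [s] is one of them, a second
       would complete a triangle. *)
    assert (L1 : limit adj d act x0 (fun y => desc adj t y = true) x) by (refine (limit_mono _ _ _ _ _ _ _ _ H); tauto).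
    assert (L2 : limit adj d act x0 (fun y => ~ desc adj t y = true) x).
    { refine (limit_mono _ _ _ _ _ _ _ _ H'). intros y [D1 D2] D3. destruct (desc_adj adj sym t t' y D3 D2) as [|B]; [contradiction|].
      exact (no_triangle adj sym tri_free s t t' A B A'). }
    assert (L3 : limit adj d act x0 (fun y => desc adj t y = false /\ mul adj (gen adj t) y = mul adj y (gen adj t)) x).
    { apply (limit_gen _ _ _ _ GS _ _ _ _ (crossing _ _ _ _ GS _ _ _ L1 L2)). intros y [D1 [v D2]]. exists v.
      apply not_true_is_false in D2. split; [exact D2|].
      assert (Cy : mul adj (gen adj t) y = mul adj y (gen adj v)) by (apply desc_change; congruence).
      pose proof (wall_letter adj _ _ _ Cy). subst v. rewrite (mulA adj), Cy. reflexivity. }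
    refine (limit_mono _ _ _ _ _ _ _ _ (limit_eventually _ _ _ _ GS _ _ _ _ L3 Hw)). intros y [[D1 Cy] D2] u.
    rewrite inv1, mul1g in D2. split; [|intros ->; exact D2]. intros Du.
    destruct (desc_adj adj sym u s y Du D2) as [|B]; [assumption|].
    destruct (no_triangle adj sym tri_free u s t B A (wall_desc adj sym t y u Cy D1 Du)).
  - exact touch.
Qed.
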